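(* Consider either the simply supported case or the Cahn--Hilliard case, with the corresponding spaces, forms and projections defined in the context. Let $T>0$, $J:=(0,T]$, $\gamma>0$, $g(u):=u^3-u$, $f\in L^2(J;L^2(\Omega))$, $\ell(v):=(f(t),v)_{0,\Omega}$, and let $u_0$ be the initial datum. Let $((u(t),\boldsymbol{\sigma}(t)),\boldsymbol{\phi}(t))\in\mathbb{V}\times\mathbf{M}$ be the solution, with $u(\cdot,0)=u_0$, of: for every $t\in J$, $$(\partial_t u,v)_{0,\Omega}+\gamma\big(a((u,\boldsymbol{\sigma}),(v,\boldsymbol{\tau}))+b((v,\boldsymbol{\tau}),\boldsymbol{\phi})\big)+c(\boldsymbol{\sigma},\boldsymbol{\tau})+(g(u),v)_{0,\Omega}=\ell(v)\quad\forall (v,\boldsymbol{\tau})\in\mathbb{V},$$ $$b((u,\boldsymbol{\sigma}),\boldsymbol{\psi})=0\quad\forall\boldsymbol{\psi}\in\mathbf{M},$$ and let $((u_h(t),\boldsymbol{\sigma}_h(t)),\boldsymbol{\phi}_h(t))\in\mathbb{V}_h\times\mathbf{M}_h$ be the solution, with $u_h(\cdot,0)=P_hu_0$, of the semi-discrete problem: for every $t\in J$, $$(\partial_t u_h,v_h)_{0,\Omega}+\gamma\big(a((u_h,\boldsymbol{\sigma}_h),(v_h,\boldsymbol{\tau}_h))+b((v_h,\boldsymbol{\tau}_h),\boldsymbol{\phi}_h)\big)+c(\boldsymbol{\sigma}_h,\boldsymbol{\tau}_h)+(g(u_h),v_h)_{0,\Omega}=\ell(v_h)\quad\forall (v_h,\boldsymbol{\tau}_h)\in\mathbb{V}_h,$$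 $$b((u_h,\boldsymbol{\sigma}_h),\boldsymbol{\psi}_h)=0\quad\forall\boldsymbol{\psi}_h\in\mathbf{M}_h.$$ Define $\rho_u:=u-P_hu$, $\theta_u:=P_hu-u_h$, $\rho_{\boldsymbol{\sigma}}:=\boldsymbol{\sigma}-\boldsymbol{P}_h\boldsymbol{\sigma}$, $\theta_{\boldsymbol{\sigma}}:=\boldsymbol{P}_h\boldsymbol{\sigma}-\boldsymbol{\sigma}_h$, $\rho_{\boldsymbol{\phi}}:=\boldsymbol{\phi}-\boldsymbol{F}_h\boldsymbol{\phi}$. Then the following error estimate holds: $$\|\theta_u\|_{L^\infty(\overline{J};L^2(\Omega))}^2+\gamma\|\mathrm{div}\,\theta_{\boldsymbol{\sigma}}\|_{L^2(J;L^2(\Omega))}^2+\|\theta_{\boldsymbol{\sigma}}\|_{L^2(J;L^2(\Omega))}^2$$ $$\lesssim\ \|\partial_t\rho_u\|_{L^2(J;L^2(\Omega))}^2+\|\rho_u\|_{L^2(J;L^2(\Omega))}^2+\gamma\|\mathrm{div}\,\rho_{\boldsymbol{\sigma}}\|_{L^2(J;L^2(\Omega))}^2+\|\rho_{\boldsymbol{\sigma}}\|_{L^2(J;L^2(\Omega))}^2+\|\rho_{\boldsymbol{\phi}}\|_{L^2(J;L^2(\Omega))}^2.$$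
   Context: $\Omega\subset\mathbb{R}^d$, $d\in\{2,3\}$, is a bounded convex domain with polygonal or polyhedral boundary $\Gamma=\partial\Omega$ and outward unit normal $\boldsymbol{n}$. $(\cdot,\cdot)_{0,\Omega}$ and $\|\cdot\|_{0,\Omega}$ are the $L^2(\Omega)$ inner product and norm (for scalar or vector fields). Let $H_0(\mathrm{div},\Omega):=\{\boldsymbol{\tau}\in H(\mathrm{div},\Omega):\boldsymbol{\tau}\cdot\boldsymbol{n}=0\text{ on }\Gamma\}$. Spaces: in the simply supported case, $U:=L^2(\Omega)$ and $\mathbf{M}:=H(\mathrm{div},\Omega)$; in the Cahn--Hilliard case, $U:=\{v\in L^2(\Omega):\int_\Omega v\,dx=0\}$ and $\mathbf{M}:=H_0(\mathrm{div},\Omega)$. In both cases $\mathbb{V}:=U\times\mathbf{M}$. Bilinear forms: $a((u,\boldsymbol{\sigma}),(v,\boldsymbol{\tau})):=\int_\Omega \mathrm{div}\,\boldsymbol{\sigma}\;\mathrm{div}\,\boldsymbol{\tau}\,dx$, $b((v,\boldsymbol{\tau}),\boldsymbol{\psi}):=\int_\Omega(\boldsymbol{\tau}\cdot\boldsymbol{\psi}+v\,\mathrm{div}\,\boldsymbol{\psi})\,dx$, $c(\boldsymbol{\sigma},\boldsymbol{\tau}):=\int_\Omega\boldsymbol{\sigma}\cdot\boldsymbol{\tau}\,dx$. Discretisation: $\mathcal{T}_h$ is a shape-regular partition of $\Omega$ into simplices with mesh-size $h$; $\mathcal{P}_k(T)$ is the space of polynomials of degree $k\ge 0$ on the simplex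 $T$, and $\boldsymbol{x}\in\mathbb{R}^d$ is the coordinate vector. Set $U_h:=\{u_h\in U: u_h|_T\in\mathcal{P}_k(T)\ \forall T\in\mathcal{T}_h\}$, $\mathbf{M}_h:=\{\boldsymbol{\phi}_h\in\mathbf{M}:\boldsymbol{\phi}_h|_T\in[\mathcal{P}_k(T)]^d+\boldsymbol{x}\,\mathcal{P}_k(T)\ \forall T\in\mathcal{T}_h\}$ (Raviart--Thomas space of order $k$), and $\mathbb{V}_h:=U_h\times\mathbf{M}_h$. Projections: $P_h$ is the $L^2$-projection onto $U_h$, i.e. $(v-P_hv,v_h)_{0,\Omega}=0$ for all $v_h\in U_h$; $\boldsymbol{P}_h:\mathbf{M}\to\mathbf{M}_h$ is the vector-valued $L^2$-projection onto $\mathbf{M}_h$; $\boldsymbol{F}_h:\mathbf{M}\to\mathbf{M}_h$ is the classical Fortin interpolation operator, which satisfies $\mathrm{div}\,\boldsymbol{F}_h\boldsymbol{\psi}=P_h(\mathrm{div}\,\boldsymbol{\psi})$ for all $\boldsymbol{\psi}\in\mathbf{M}$ and, for all $\boldsymbol{\tau}\in[H^{k+1}(\Omega)]^d$ with $\mathrm{div}\,\boldsymbol{\tau}\in H^{k+1}(\Omega)$, $\|\boldsymbol{\tau}-\boldsymbol{F}_h\boldsymbol{\tau}\|_{0,\Omega}\lesssim h^{k+1}|\boldsymbol{\tau}|_{[H^{k+1}(\Omega)]^d}$ and $\|\mathrm{div}(\boldsymbol{\tau}-\boldsymbol{F}_h\boldsymbol{\tau})\|_{0,\Omega}\lesssim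 h^{k+1}|\mathrm{div}\,\boldsymbol{\tau}|_{H^{k+1}(\Omega)}$. Time norms: $\|w\|_{L^p(J;* )}^p:=\int_J\|w(s)\|_*^p\,ds$ for $p\in[1,\infty)$ and $\|w\|_{L^\infty(\overline{J};* )}:=\sup_{s\in\overline{J}}\|w(s)\|_*$. $A\lesssim B$ means $A\le C B$ with a generic constant $C>0$ independent of the mesh-size $h$. *)

(* Defs.v *)
From HB Require Import structures.
From mathcomp Require Import all_boot all_order all_algebra.
From mathcomp Require Import all_classical all_reals all_analysis.


Set Implicit Arguments.
Unset Strict Implicit.
Unset Printing Implicit Defensive.
Import Order.TTheory GRing.Theory Num.Theory.
Import numFieldNormedType.Exports.
Local Open Scope classical_set_scope.
Local Open Scope ring_scope.

(* Product sigma-algebra and Lebesgue measure on row vectors. *)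
Fact rV_display : measure_display. Proof. exact. Qed.

Section rV_measurable.
Context {R : realType} (n : nat).

Definition rV_coords (i : 'I_n) (x : 'rV[R]_n) : measurableTypeR R := x ord0 i.

Let rV_set0 : g_sigma_preimage rV_coords set0.
Proof. exact: sigma_algebra0. Qed.

Let rV_setC A : g_sigma_preimage rV_coords A -> g_sigma_preimage rV_coords (~` A).
Proof. exact: sigma_algebraC. Qed.

Let rV_bigcup (F : _^nat) : (forall i, g_sigma_preimage rV_coords (F i)) ->
  g_sigma_preimage rV_coords (\bigcup_i (F i)).
Proof. exact: sigma_algebra_bigcup. Qed.

HB.instance Definition _ := @isMeasurable.Build rV_display 'rV[R]_n
  (g_sigma_preimage rV_coords) rV_set0 rV_setC rV_bigcup.

Lemma measurable_coord (i : 'I_n) :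
  measurable_fun [set: 'rV[R]_n] (fun x : 'rV[R]_n => x ord0 i).
Proof.
move=> _ Y mY; rewrite setTI; apply: sub_sigma_algebra => /=.
rewrite -bigcup_seq/=; exists i => /=; first by rewrite mem_index_enum.
by exists Y => //; rewrite setTI.
Qed.

Lemma measurable_fun_rV d (T : measurableType d) (f : T -> 'rV[R]_n) :
  (forall i, measurable_fun [set: T] (fun t => f t ord0 i)) ->
  measurable_fun [set: T] f.
Proof.
move=> mf _ A mA.
suff : g_sigma_preimage (fun i => rV_coords i \o f) `<=` measurable.
  rewrite g_sigma_preimage_comp => /(_ (setT `&` f @^-1` A)); apply.
  by exists A.
apply: smallest_sub; first exact: sigma_algebra_measurable.
rewrite -bigcup_seq; apply: bigcup_sub => i _ /= B [C mC <-].
exact: (mf i).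
Qed.
End rV_measurable.

Section lebesgue_rV.
Context {R : realType}.

Definition rV_cons n (p : measurableTypeR R * 'rV[R]_n) : 'rV[R]_n.+1 :=
  row_mx (p.1)%:M p.2.

Definition rV_uncons n (x : 'rV[R]_n.+1) : measurableTypeR R * 'rV[R]_n :=
  (x ord0 ord0, \row_i x ord0 (lift ord0 i)).

Lemma rV_consK n : cancel (@rV_cons n) (@rV_uncons n).
Proof.
case=> a x; rewrite /rV_cons /rV_uncons /=; congr pair.
  have -> : ord0 = lshift n (ord0 : 'I_1) by apply/val_inj.
  by rewrite [LHS]row_mxEl mxE eqxx mulr1n.
apply/rowP => i; rewrite mxE.
have -> : lift ord0 i = rshift 1 i by apply/val_inj.
by rewrite [LHS]row_mxEr.
Qed.

Lemma measurable_rV_cons n : measurable_fun setT (@rV_cons n).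
Proof.
apply: measurable_fun_rV => i; case: (split_ordP (i : 'I_(1 + n))) => j ->.
  rewrite (_ : (fun _ => _) = fst) //; apply/funext => p.
  by rewrite [LHS]row_mxEl mxE (ord1 j) mulr1n.
rewrite (_ : (fun _ => _) = (fun x : 'rV[R]_n => x ord0 j) \o snd).
  exact: (measurableT_comp (measurable_coord j) measurable_snd).
by apply/funext => p; rewrite [LHS]row_mxEr.
Qed.

Lemma measurable_rV_uncons n : measurable_fun setT (@rV_uncons n).
Proof.
apply/measurable_fun_pairP; split; first exact: measurable_coord.
apply: measurable_fun_rV => i.
rewrite (_ : (fun _ => _) = (fun x : 'rV[R]_n.+1 => x ord0 (lift ord0 i))).
  exact: measurable_coord.
by apply/funext => x /=; rewrite mxE.
Qed.


Section step.
Context n (mu : {sigma_finite_measure set 'rV[R]_n -> \bar R}).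
Local Open Scope ereal_scope.

Let m := pushforward (lebesgue_measure \x mu) (@rV_cons n).

Let m0 : m set0 = 0.
Proof. by rewrite /m /pushforward preimage_set0 measure0. Qed.

Let m_ge0 A : 0 <= m A. Proof. by rewrite /m /pushforward measure_ge0. Qed.

Let mcons (A : set 'rV[R]_n.+1) :
  measurable A -> measurable (@rV_cons n @^-1` A).
Proof. by move=> mA; rewrite -[X in measurable X]setTI; exact: measurable_rV_cons. Qed.

Let m_sigma_additive : semi_sigma_additive m.
Proof.
move=> F mF tF mUF; rewrite /m /pushforward preimage_bigcup.
apply: measure_semi_sigma_additive.
- by move=> k; exact: mcons.
- apply/trivIsetP => /= i j _ _ ij; rewrite -preimage_setI.
  by move/trivIsetP : tF => /(_ _ _ _ _ ij) ->//; rewrite preimage_set0.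
- by rewrite -preimage_bigcup; exact: mcons.
Qed.

HB.instance Definition _ := isMeasure.Build _ _ _ m m0 m_ge0 m_sigma_additive.

Let m_sigma_finite : sigma_finite setT m.
Proof.
pose l : {sigma_finite_measure set (measurableTypeR R) -> \bar R} := lebesgue_measure.
have /sigma_finiteP[F [TF ndF Foo]] := sigma_finiteT l.
have /sigma_finiteP[G [TG ndG Goo]] := sigma_finiteT mu.
have UFG : [set: measurableTypeR R * 'rV[R]_n] = \bigcup_k (F k `*` G k).
  rewrite -setXTT TF TG predeqE => -[x y]; split.
    move=> [/= [i _ Fx] [k _ Gy]]; exists (maxn i k) => //; split.
    - by move: x Fx; exact/subsetPset/ndF/leq_maxl.
    - by move: y Gy; exact/subsetPset/ndG/leq_maxr.
  by move=> [k _ []/= ? ?]; split; exists k.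
exists (fun k => @rV_uncons n @^-1` (F k `*` G k)).
  by rewrite -preimage_bigcup -UFG preimage_setT.
move=> k; have [mFk Fkoo] := Foo k; have [mGk Gkoo] := Goo k; split.
  rewrite -[X in measurable X]setTI.
  by apply: measurable_rV_uncons => //; exact: measurableX.
rewrite /m /pushforward -comp_preimage (_ : _ \o _ = id) ?preimage_id.
  rewrite (product_measure1E l mu)//.
  by rewrite lte_mul_pinfty// ge0_fin_numE.
by apply/funext => p; exact: rV_consK.
Qed.

HB.instance Definition _ := Measure_isSigmaFinite.Build _ _ _ m m_sigma_finite.

Definition leb_step : {sigma_finite_measure set 'rV[R]_n.+1 -> \bar R} := m.
End step.

Fixpoint leb n : {sigma_finite_measure set 'rV[R]_n -> \bar R} :=
  if n is n'.+1 then leb_step (leb n') else \d_(0 : 'rV[R]_0).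

Lemma leb_box n (a b : 'rV[R]_n) : (forall i, a ord0 i <= b ord0 i) ->
  leb n [set x | forall i, x ord0 i \in `[a ord0 i, b ord0 i]] =
  (\prod_(i < n) (b ord0 i - a ord0 i))%:E.
Proof.
elim: n a b => [|n IHn] a b ab.
  rewrite big_ord0 /= diracE mem_set// => -[] //.
rewrite big_ord_recl EFinM /=.
set a' : 'rV[R]_n := \row_i a ord0 (lift ord0 i).
set b' : 'rV[R]_n := \row_i b ord0 (lift ord0 i).
rewrite [X in (_ * X)%E](_ : _ = leb n [set x : 'rV[R]_n |
    forall i, x ord0 i \in `[a' ord0 i, b' ord0 i]]); last first.
  rewrite IHn; last by move=> i; rewrite !mxE.
  by congr EFin; apply: eq_bigr => i _; rewrite !mxE.
rewrite /leb_step /= /pushforward.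
rewrite (_ : _ @^-1` _ = `[a ord0 ord0, b ord0 ord0] `*`
    [set x : 'rV[R]_n | forall i, x ord0 i \in `[a' ord0 i, b' ord0 i]]).
  rewrite product_measure1E//.
    congr (_ * _)%E; have := lebesgue_measure_itv `[a ord0 ord0, b ord0 ord0].
    rewrite /= lte_fin; case: ltP => [_ -> //|h ->].
    by rewrite (le_anti (introT andP (conj h (ab ord0)))) subrr.
  rewrite (_ : [set _ | _] = \bigcap_(i in [set: 'I_n]) ((fun x : 'rV[R]_n => x ord0 i) @^-1` `[a' ord0 i, b' ord0 i])).
    by apply: fin_bigcap_measurable => // i _; rewrite -[X in measurable X]setTI; exact: (measurable_coord i).
  by apply/seteqP; split => x h i; [move=> _; exact: h|exact: (h i I)].
have c0 (p : measurableTypeR R * 'rV[R]_n) : rV_cons p ord0 ord0 = p.1.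
  have -> : ord0 = lshift n (ord0 : 'I_1) by apply/val_inj.
  by rewrite [LHS]row_mxEl mxE eqxx mulr1n.
have cS (p : measurableTypeR R * 'rV[R]_n) i : rV_cons p ord0 (lift ord0 i) = p.2 ord0 i.
  have -> : lift ord0 i = rshift 1 i by apply/val_inj.
  by rewrite [LHS]row_mxEr.
apply/seteqP; split => p /=.
  move=> h; split; first by have := h ord0; rewrite c0.
  by move=> i; have := h (lift ord0 i); rewrite cS !mxE.
case=> h0 hS i; case: (unliftP ord0 i) => [j|] ->; last by rewrite c0.
by rewrite cS; have := hS j; rewrite !mxE.
Qed.
End lebesgue_rV.

Inductive boundary_case := SimplySupported | CahnHilliard.

Section geometry.
Context {R : realType} {d : nat}.
Implicit Types (Om : set 'rV[R]_d) (x y : 'rV[R]_d).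

Definition dot x y : R := \sum_i x ord0 i * y ord0 i.

(* The library norm of 'rV[R]_d is the maximum norm. *)
Definition enorm x : R := Num.sqrt (dot x x).

Definition polyhedral_domain Om :=
  [/\ open Om, Om !=set0, bounded_set Om,
      convex_set (Om : set (convex_lmodType 'rV[R]_d)) &
      exists (m : nat) (a : 'I_m -> 'rV[R]_d) (b : 'I_m -> R),
        (forall j, a j != 0) /\
        (forall x, (closure Om `\` Om) x -> exists j, dot (a j) x = b j)].

(* The rows of V are the d.+1 vertices. *)
Definition simplex (V : 'M[R]_(d.+1, d)) : set 'rV[R]_d :=
  [set w *m V | w in [set w : 'rV[R]_d.+1 |
    (forall i, 0 <= w ord0 i) /\ \sum_i w ord0 i = 1]].

Definition nondegenerate (V : 'M[R]_(d.+1, d)) :=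
  \matrix_(i < d) (row (lift ord0 i) V - row ord0 V) \in unitmx.

Record mesh := Mesh {
  mesh_card : nat;
  mesh_vertices : 'I_mesh_card -> 'M[R]_(d.+1, d) }.
Arguments mesh_vertices : clear implicits.

Definition elt (Th : mesh) i : set 'rV[R]_d := simplex (mesh_vertices Th i).
Arguments elt : clear implicits.

Definition is_partition Om (Th : mesh) :=
  [/\ forall i, nondegenerate (mesh_vertices Th i),
      \bigcup_i elt Th i = closure Om &
      forall i j, i != j -> interior (elt Th i) `&` interior (elt Th j) = set0].

Definition diam (A : set 'rV[R]_d) : R :=
  sup [set enorm (p.1 - p.2) | p in A `*` A].

Definition inradius (A : set 'rV[R]_d) : R :=
  sup [set r : R | exists c, [set x | enorm (x - c) <= r] `<=` A /\ 0 <= r].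

Definition shape_regular (kappa : R) (Th : mesh) :=
  forall i, diam (elt Th i) <= kappa * inradius (elt Th i).

Definition meshsize (Th : mesh) : R :=
  \big[Num.max/0]_(i < mesh_card Th) diam (elt Th i).

End geometry.
Arguments mesh : clear implicits.
Arguments mesh_vertices {R d} m _.
Arguments elt {R d} Th i.

(* Elements of L2(Om) and of the spaces below are represented by functions on
   the whole of R^d; only their values a.e. in Om matter. *)
Section spaces.
Context {R : realType} {d : nat} (Om : set 'rV[R]_d).
Local Notation mu := (leb d : {sigma_finite_measure set 'rV[R]_d -> \bar R}).
Implicit Types (v w : 'rV[R]_d -> R) (tau psi : 'rV[R]_d -> 'rV[R]_d).

Definition coordf tau (i : 'I_d) : 'rV[R]_d -> R := fun x => tau x ord0 i.

Definition L2 v := v \_ Om \in Lfun mu 2%:E.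
Definition L2v tau := forall i, L2 (coordf tau i).

Definition normL2 v : \bar R := 'N[mu]_2%:E[EFin \o (v \_ Om)]%E.
Definition normL2v tau : \bar R := normL2 (fun x => enorm (tau x)).

Definition ip v w : R := \int[mu]_(x in Om) (v x * w x).
Definition ipv tau psi : R := \int[mu]_(x in Om) dot (tau x) (psi x).

Definition pd (i : 'I_d) v : 'rV[R]_d -> R := fun x => 'D_(delta_mx ord0 i) v x.
Definition pds (s : seq 'I_d) v := foldr pd v s.

Definition smooth v := forall s : seq 'I_d,
  continuous (pds s v) /\
  forall i x, derivable (pds s v) x (delta_mx ord0 i).

Definition test_function v :=
  smooth v /\ exists2 K, compact K & K `<=` Om /\ forall x, ~ K x -> v x = 0.

Definition is_wderiv (s : seq 'I_d) v w :=
  L2 w /\ forall phi, test_function phi ->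
    ip v (pds s phi) = (-1) ^+ size s * ip w phi.
Definition wderiv s v := get [set w | is_wderiv s v w].

Definition Hsob (m : nat) v :=
  L2 v /\ forall s, (size s <= m)%N -> exists w, is_wderiv s v w.

Definition mindex (alpha : 'I_d -> nat) : seq 'I_d :=
  flatten [seq nseq (alpha i) i | i <- enum 'I_d].
(* Square of the H^m seminorm, summed over the multi-indices of length m. *)
Definition sqHsemi (m : nat) v : \bar R :=
  (\sum_(alpha : {ffun 'I_d -> 'I_m.+1} |
      (\sum_i (alpha i : nat) == m)%N)
     normL2 (wderiv (mindex (fun i => alpha i)) v) ^+ 2)%E.
Definition Hsemi m v : \bar R := (sqHsemi m v `^ 2^-1)%E.
Definition Hsemiv m tau : \bar R := ((\sum_i sqHsemi m (coordf tau i)) `^ 2^-1)%E.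

Definition grad v : 'rV[R]_d -> 'rV[R]_d :=
  fun x => \row_i wderiv [:: i] v x.

Definition is_div tau w :=
  L2 w /\ forall phi, test_function phi ->
    ipv tau (fun x => \row_i pd i phi x) = - ip w phi.
Definition div tau := get [set w | is_div tau w].

Definition Hdiv tau := L2v tau /\ exists w, is_div tau w.

(* tau . n = 0 on the boundary, where the normal trace is the functional
   v |-> (tau, grad v) + (div tau, v) on H1(Om). *)
Definition Hdiv0 tau := Hdiv tau /\
  forall v, Hsob 1 v -> ipv tau (grad v) + ip (div tau) v = 0.

Variable bc : boundary_case.

Definition spaceU v := L2 v /\
  if bc is CahnHilliard then \int[mu]_(x in Om) v x = 0 else True.
Definition spaceM := if bc is CahnHilliard then Hdiv0 else Hdiv.

Definition form_a (p q : ('rV[R]_d -> R) * ('rV[R]_d -> 'rV[R]_d)) : R :=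
  \int[mu]_(x in Om) (div p.2 x * div q.2 x).
Definition form_b (p : ('rV[R]_d -> R) * ('rV[R]_d -> 'rV[R]_d)) psi : R :=
  \int[mu]_(x in Om) (dot (p.2 x) (psi x) + p.1 x * div psi x).
Definition form_c tau psi : R := \int[mu]_(x in Om) dot (tau x) (psi x).

Variables (k : nat) (Th : mesh R d).

Definition Pk v := exists c : {ffun 'I_d -> 'I_k.+1} -> R,
  forall x, v x = \sum_(alpha : {ffun 'I_d -> 'I_k.+1} |
                           (\sum_i (alpha i : nat) <= k)%N)
                      c alpha * \prod_i x ord0 i ^+ alpha i.

Definition Uh v := spaceU v /\ forall i, exists2 p, Pk p &
  {ae mu, forall x, elt Th i x -> v x = p x}.

Definition Mh tau := spaceM tau /\ forall i,
  exists (q : 'I_d -> 'rV[R]_d -> R) (r : 'rV[R]_d -> R),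
    [/\ forall j, Pk (q j), Pk r &
        {ae mu, forall x, elt Th i x ->
          tau x = (\row_j q j x) + r x *: x}].

Definition is_projU (P : ('rV[R]_d -> R) -> ('rV[R]_d -> R)) :=
  forall v, L2 v -> Uh (P v) /\ forall vh, Uh vh -> ip (v \- P v) vh = 0.

Definition is_projM (P : ('rV[R]_d -> 'rV[R]_d) -> ('rV[R]_d -> 'rV[R]_d)) :=
  forall tau, spaceM tau ->
    Mh (P tau) /\ forall tauh, Mh tauh -> ipv (tau \- P tau) tauh = 0.

(* F is constrained only by the properties of the Fortin interpolation that do
   not involve its degrees of freedom: range, commuting property and
   approximation properties, with a constant CF that does not depend on Th. *)
Definition is_fortin (Ph : ('rV[R]_d -> R) -> ('rV[R]_d -> R)) (CF : R)
    (F : ('rV[R]_d -> 'rV[R]_d) -> ('rV[R]_d -> 'rV[R]_d)) :=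
  [/\ forall psi, spaceM psi -> Mh (F psi),
      forall psi, spaceM psi -> div (F psi) = Ph (div psi) %[ae mu in Om] &
      forall tau, spaceM tau -> (forall i, Hsob k.+1 (coordf tau i)) ->
        Hsob k.+1 (div tau) ->
        (normL2v (tau \- F tau)%R <=
           (CF * meshsize Th ^+ k.+1)%:E * Hsemiv k.+1 tau)%E /\
        (normL2 (div (tau \- F tau)%R) <=
           (CF * meshsize Th ^+ k.+1)%:E * Hsemi k.+1 (div tau))%E].

End spaces.

Section evolution.
Context {R : realType} {d : nat} (Om : set 'rV[R]_d) (T : R).
Implicit Types w : R -> 'rV[R]_d -> R.

(* Derivative with respect to the L2(Om) norm, one-sided at T. *)
Definition is_dt w t z :=
  L2 Om z /\
  normL2 Om (fun x => (s - t)^-1 * (w s x - w t x) - z x)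
    @[s --> within `[0, T] (dnbhs t)] --> 0%E.
Definition dt w : R -> 'rV[R]_d -> R := fun t => get [set z | is_dt w t z].

Definition L2_continuous w := forall t, 0 <= t <= T ->
  normL2 Om (w s \- w t) @[s --> within `[0, T] (nbhs t)] --> 0%E.

(* Strong (Bochner) measurability on J as a map into L2(Om). *)
Definition strongly_measurable w :=
  (forall t, 0 < t <= T -> L2 Om (w t)) /\
  exists (N : nat -> nat) (A : nat -> nat -> set (measurableTypeR R))
         (v : nat -> nat -> 'rV[R]_d -> R),
    (forall n i, measurable (A n i) /\ L2 Om (v n i)) /\
    forall t, 0 < t <= T ->
      normL2 Om (fun x => w t x - \sum_(i < N n) \1_(A n i) t * v n i x)
        @[n --> \oo] --> 0%E.

(* The square of the norm in L2(J), given the norms at each time. *)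
Definition sqnormJ (n : R -> \bar R) : \bar R :=
  (\int[lebesgue_measure]_(t in `]0%R, T]) n t ^+ 2)%E.

Definition supnormJ (n : R -> \bar R) : \bar R :=
  ereal_sup [set n t | t in `[0, T]].

Definition L2J w :=
  strongly_measurable w /\ (sqnormJ (fun t => normL2 Om (w t)) < +oo)%E.

Definition L2J_Hdiv (tau : R -> 'rV[R]_d -> 'rV[R]_d) :=
  (forall i, L2J (fun t => coordf (tau t) i)) /\ L2J (fun t => div Om (tau t)).

Definition reaction (v : 'rV[R]_d -> R) : 'rV[R]_d -> R := fun x => v x ^+ 3 - v x.

(* Common form of the continuous (U, M the full spaces) and semi-discrete
   (U, M the discrete spaces) problems, for functions u in C([0, T]; L2) and
   in H1(J; L2), sigma and phi in L2(J; H(div)). *)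
Record is_solution (gamma : R) (f : R -> 'rV[R]_d -> R)
    (U : ('rV[R]_d -> R) -> Prop) (M : ('rV[R]_d -> 'rV[R]_d) -> Prop)
    (u0 : 'rV[R]_d -> R) (u : R -> 'rV[R]_d -> R)
    (sigma phi : R -> 'rV[R]_d -> 'rV[R]_d) : Prop := {
  sol_U : forall t, 0 <= t <= T -> U (u t);
  sol_M : forall t, 0 < t <= T -> M (sigma t) /\ M (phi t);
  sol_g : forall t, 0 < t <= T -> L2 Om (reaction (u t));
  sol_cont : L2_continuous u;
  sol_dt : forall t, 0 < t <= T -> exists z, is_dt u t z;
  sol_L2J : [/\ L2J (dt u), L2J_Hdiv sigma & L2J_Hdiv phi];
  sol_init : u 0 = u0 %[ae leb d in Om];
  sol_eq1 : forall t, 0 < t <= T -> forall v tau, U v -> M tau ->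
    ip Om (dt u t) v +
    gamma * (form_a Om (u t, sigma t) (v, tau) + form_b Om (v, tau) (phi t)) +
    form_c Om (sigma t) tau + ip Om (reaction (u t)) v = ip Om (f t) v;
  sol_eq2 : forall t, 0 < t <= T -> forall psi, M psi ->
    form_b Om (u t, sigma t) psi = 0 }.

End evolution.

(* Main.v *)
From HB Require Import structures.
From mathcomp Require Import all_boot all_order all_algebra.
From mathcomp Require Import all_classical all_reals all_analysis.
From mathcomp Require Import measurable_realfun ring lra.
Require Import Defs.

Set Implicit Arguments.
Unset Strict Implicit.
Unset Printing Implicit Defensive.
Import Order.TTheory GRing.Theory Num.Theory.
Import numFieldNormedType.Exports.
Local Open Scope classical_set_scope.
Local Open Scope ring_scope.

(** The estimate follows from an energy argument for the discrete errors. Writing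
    [rho = u - P u] and [theta = P u - uh], the pair [(theta, theta_sigma)] is
    tested in both problems at each time, and the coupling terms disappear
    because the divergence maps [Mh] into [Uh], and by the orthogonality of the
    projections and the commuting property of the Fortin operator
    ([energy_estimate]). What is left besides the projection errors is
    [(u^3 - uh^3, theta)]. The monotone part of this term absorbs all
    products that contain [theta], up to [100 ((P u)^2 + rho^2) rho^2]
    ([cubic_lower]). This remainder is at most a multiple of
    [M(t)^2 ||rho||^2] as soon as [|u(t)|] and [|P u(t)|] are bounded by
    [M(t)], up to constants that do not depend on the mesh.

    The bound on [u(t)] comes from elliptic regularity. The second equation says
    that [sigma(t)] is the gradient of [u(t)], so that [u(t)] solves Poisson's
    equation with right-hand side [div sigma(t)] in [L^2], with homogeneous
    Dirichlet or Neumann boundary values. In dimension at most 3 this bounds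
    [u(t)] in the maximum norm by [||div sigma(t)||] and [||u(t)||]
    ([solution_bounded]), and the former is square integrable in time. The proof
    is De Giorgi's: a Faber-Krahn inequality on convex domains ([faber_krahn])
    makes the measure of the level sets of [u(t)] decay ([level_decay],
    [level_iteration]). The truncations of [u(t)] are tested through smooth
    functions that approximate [u(t)] together with its gradient, and vanish
    near the boundary in the Dirichlet case; they are mollifications of dilates
    of [u(t)], which exist because [Om] is convex ([smooth_approximation]).

    The bound on [P u(t)] is the stability of the projection in the maximum norm
    ([projection_bounded]): the projection acts on each element separately, up
    to a constant in the space of functions of mean value zero, and the maximum
    of a polynomial on a convex set is controlled by its mean square with a
    constant that only depends on the degree ([polynomial_sup_le]).

    In time, [||rho(t)||] is bounded uniformly by the norms of [rho] and of its
    time derivative ([sup_le_time]), so that [M^2 ||rho||^2] is integrable with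
    the right bound, and Gronwall's lemma concludes ([gronwall_dissipation],
    [error_bound]). The equations hold at every time and the time derivative is
    merely square integrable, so the differential inequalities are integrated
    with the help of a Vitali-Caratheodory majorant ([vitali_caratheodory]);
    the squared norms of [div rho_sigma] and of the time derivative of [rho]
    need not be known to be measurable for this ([growth_by_derivative]). *)

(** * Lebesgue measure on row vectors *)

Section euclidean_measure.
Context {R : realType} {n : nat}.
Implicit Types (A U : set 'rV[R]_n) (x y a b : 'rV[R]_n).
Local Notation mu := (leb n : {sigma_finite_measure set 'rV[R]_n -> \bar R}).

Definition box a b : set 'rV[R]_n :=
  [set x | forall i, x ord0 i \in `[a ord0 i, b ord0 i]].

Lemma measurable_box a b : measurable (box a b).
Proof.
rewrite (_ : box a b = \bigcap_(i in [set: 'I_n])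
    ((fun x : 'rV[R]_n => x ord0 i) @^-1` `[a ord0 i, b ord0 i])).
  by apply: fin_bigcap_measurable => // i _; rewrite -[X in measurable X]setTI;
     exact: (measurable_coord i).
by apply/seteqP; split => x h i; [move=> _; exact: h|exact: (h i I)].
Qed.

Lemma boxI a b a' b' : box a b `&` box a' b' =
  box (\row_i Num.max (a ord0 i) (a' ord0 i)) (\row_i Num.min (b ord0 i) (b' ord0 i)).
Proof.
apply/seteqP; split => x /=.
  by move=> [h h'] i; move: (h i) (h' i); rewrite !in_itv/= !mxE ge_max le_min => /andP[-> ->] /andP[-> ->].
by move=> h; split => i; have := h i;
  rewrite !in_itv/= !mxE ge_max le_min => /andP[/andP[h1 h2] /andP[h3 h4]]; apply/andP.
Qed.

Lemma norm_coord_le x i : `|x ord0 i| <= `|x|.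
Proof.
rewrite [leRHS]/Num.norm/= mx_normrE.
by apply/bigmax_geP; right => /=; exists (ord0, i).
Qed.

Lemma norm_le_coord x (c : R) : 0 <= c -> (forall i, `|x ord0 i| <= c) -> `|x| <= c.
Proof.
move=> c0 h; rewrite [leLHS]/Num.norm/= mx_normrE; apply/bigmax_leP; split => //=.
by move=> [i j] _ /=; rewrite (ord1 i).
Qed.

Definition rat_lo (p : 'rV[rat]_n * nat) : 'rV[R]_n := \row_i (ratr (p.1 ord0 i) - p.2.+1%:R^-1).
Definition rat_hi (p : 'rV[rat]_n * nat) : 'rV[R]_n := \row_i (ratr (p.1 ord0 i) + p.2.+1%:R^-1).

(** Boxes with rational centres are countably many, so statements about boxes
    pass to open sets. *)
Lemma rat_box_nbhs U x : open U -> U x ->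
  exists2 p, (forall i, rat_lo p ord0 i < x ord0 i < rat_hi p ord0 i) & box (rat_lo p) (rat_hi p) `<=` U.
Proof.
move=> oU Ux; have /nbhs_ballP[e/= e0 eU] : nbhs x U by exact: open_nbhs_nbhs.
have [m me] : exists m : nat, m.+1%:R^-1 < e / 2.
  have e2 : 0 < e / 2 by rewrite divr_gt0.
  by have [m _ /(_ m (leqnn m))/= h] := near_infty_natSinv_lt (PosNum e2); exists m.
have hq i : exists q : rat, x ord0 i - m.+1%:R^-1 < ratr q < x ord0 i + m.+1%:R^-1.
  have : x ord0 i - m.+1%:R^-1 < x ord0 i + m.+1%:R^-1.
    by rewrite ltrD2l gtrN// invr_gt0 ltr0n.
  by move=> /rat_in_itvoo[q]; rewrite in_itv/= => hq; exists q.
have [q hq'] := choice hq.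
exists (\row_i q i, m).
  move=> i; rewrite !mxE; have /andP[h1 h2] := hq' i.
  by rewrite ltrBlDr h2/= -ltrBlDr h1.
move=> y yb; apply: eU; rewrite mx_norm_ball /ball_/=.
apply: (@le_lt_trans _ _ (m.+1%:R^-1 + m.+1%:R^-1)).
  apply: norm_le_coord => [|i]; first by rewrite addr_ge0// invr_ge0.
  rewrite !mxE; have := yb i; rewrite in_itv/= !mxE => /andP[h1 h2].
  have /andP[h3 h4] := hq' i; rewrite ler_norml.
  by set r : R := m.+1%:R^-1 in h1 h2 h3 h4 *; apply/andP; split; lra.
by set r : R := m.+1%:R^-1 in me *; lra.
Qed.

Lemma open_bigcup_rat_box U : open U ->
  U = \bigcup_(p in [set p | box (rat_lo p) (rat_hi p) `<=` U]) box (rat_lo p) (rat_hi p).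
Proof.
move=> oU; apply/seteqP; split => [x Ux|x [p pU /pU//]].
have [p px pU] := rat_box_nbhs oU Ux; exists p => // i.
by have /andP[h1 h2] := px i; rewrite in_itv/= !ltW.
Qed.

Lemma open_measurable_rV U : open U -> measurable U.
Proof.
move=> oU; rewrite (open_bigcup_rat_box oU) bigcup_mkcond.
by apply: countable_bigcupT_measurable => // p; case: ifP => // _; exact: measurable_box.
Qed.

Lemma closed_measurable_rV A : closed A -> measurable A.
Proof. by rewrite -openC => /open_measurable_rV mA; rewrite -[A]setCK; exact: measurableC. Qed.

Lemma continuous_measurable_rV (f : 'rV[R]_n -> R) : continuous f -> measurable_fun setT f.
Proof.
move=> cf; apply: (measurability _ (RGenOInfty.measurableE R)) => // _ [_ [x ->] <-].
rewrite setTI; apply: open_measurable_rV; apply: open_comp; [by move=> *; exact: cf|exact: interval_open].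
Qed.

Lemma leb_bounded_lty A : measurable A -> bounded_set A -> (mu A < +oo)%E.
Proof.
move=> mA [M [_ AM]].
have AB : A `<=` box (\row_i - (`|M| + 1)) (\row_i (`|M| + 1)).
  move=> x /(AM (`|M| + 1)) h i; rewrite in_itv/= !mxE -ler_norml.
  by apply: le_trans (h _); [exact: norm_coord_le|rewrite (le_lt_trans (ler_norm _))// ltrDl].
apply: (@le_lt_trans _ _ (mu (box (\row_i - (`|M| + 1)) (\row_i (`|M| + 1))))).
  by apply: le_measure => //; rewrite inE//; exact: measurable_box.
rewrite /box leb_box ?ltry// => i; rewrite !mxE.
have : 0 <= `|M| by []. lra.
Qed.

Definition boxes : set (set 'rV[R]_n) := [set A | A = set0 \/ exists a b, A = box a b].

Lemma boxes_setI_closed : setI_closed boxes.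
Proof.
move=> A B [->|[a [b ->]]]; first by rewrite set0I; left.
move=> [->|[a' [b' ->]]]; first by rewrite setI0; left.
by right; rewrite boxI; eexists; eexists.
Qed.

Lemma measurable_boxesE : (measurable : set (set 'rV[R]_n)) = <<s boxes >>.
Proof.
apply/seteqP; split; last first.
  apply: smallest_sub; first exact: sigma_algebra_measurable.
  by move=> _ [->|[a [b ->]]]//; exact: measurable_box.
apply: smallest_sub; first exact: smallest_sigma_algebra.
rewrite -bigcup_seq; apply: bigcup_sub => i _ /= B [C mC <-].
suff : measurable_fun setT (rV_coords i : g_sigma_algebraType boxes -> R) by move=> /(_ measurableT C mC).
apply: (measurability _ (RGenCInfty.measurableE R)) => // _ [_ [x ->] <-].
rewrite setTI.
rewrite (_ : _ @^-1` _ = \bigcup_(m : nat) box (\row_j if j == i then x else - m%:R) (\row_j m%:R)).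
  by apply: bigcupT_measurable => m; apply: sub_sigma_algebra; right; eexists; eexists.
apply/seteqP; split => y /=; rewrite in_itv/= andbT /rV_coords.
  move=> xy; exists (Num.truncn `|y|).+1 => // j; rewrite in_itv/= !mxE.
  have h : `|y ord0 j| <= (Num.truncn `|y|).+1%:R.
    by apply: le_trans (norm_coord_le _ _) _; apply/ltW/truncnS_gt.
  move: h; rewrite ler_norml => /andP[h1 ->]; rewrite andbT.
  by case: eqP => [->|].
by move=> [m _ /(_ i)]; rewrite in_itv/= !mxE eqxx => /andP[].
Qed.

Lemma boxes_cover : \bigcup_(m : nat) box (\row_j (- m%:R)) (\row_j m%:R) = [set: 'rV[R]_n].
Proof.
apply/seteqP; split => // y _; exists (Num.truncn `|y|).+1 => // j; rewrite in_itv/= !mxE -ler_norml.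
by apply: le_trans (norm_coord_le _ _) _; apply/ltW/truncnS_gt.
Qed.

Lemma leb_boxE a b : (forall i, a ord0 i <= b ord0 i) ->
  mu (box a b) = (\prod_(i < n) (b ord0 i - a ord0 i))%:E.
Proof. exact: leb_box. Qed.

(** Boxes with finite measure form a pi-system that generates the Borel sets, so
    a measure is determined by its values on them. *)
Lemma eq_measure_boxes (m1 m2 : {measure set 'rV[R]_n -> \bar R}) :
  (forall a b, (forall i, a ord0 i <= b ord0 i) -> m1 (box a b) = m2 (box a b)) ->
  (forall k : nat, (m1 (box (\row_j (- (k%:R))%R) (\row_j (k%:R)%R)) < +oo)%E) ->
  forall A, measurable A -> m1 A = m2 A.
Proof.
move=> m12 m1oo A mA.
apply: (measure_unique boxes (fun m : nat => box (\row_j (- m%:R)) (\row_j m%:R))) => //.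
- exact: measurable_boxesE.
- exact: boxes_setI_closed.
- by move=> i; right; eexists; eexists.
- exact: boxes_cover.
- move=> _ [->|[a [b ->]]]; first by rewrite !measure0.
  have [ab|/existsNP[i /negP abi]] := pselect (forall i, a ord0 i <= b ord0 i); first exact: m12.
  rewrite (_ : box a b = set0) ?measure0//; apply/seteqP; split => // x /(_ i).
  by rewrite in_itv/= => /andP[h1 h2]; move: abi; rewrite (le_trans h1 h2).
Qed.

Definition aff (l : R) (z x : 'rV[R]_n) := l *: x + z.

Lemma measurable_aff l z : measurable_fun setT (aff l z).
Proof.
apply: measurable_fun_rV => i.
rewrite (_ : (fun _ => _) = (fun x : 'rV[R]_n => l * x ord0 i + z ord0 i)).
  apply: measurable_funD => //; apply: measurable_funM => //; exact: measurable_coord.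
by apply/funext => x; rewrite !mxE.
Qed.

Lemma measurable_preimage_aff l z A : measurable A -> measurable (aff l z @^-1` A).
Proof. by move=> mA; rewrite -[X in measurable X]setTI; exact: measurable_aff. Qed.

(** Preimages of boxes are boxes, so [eq_measure_boxes] applies after rescaling.
    *)
Lemma leb_aff (l : R) z A : 0 < l -> measurable A ->
  mu (aff l z @^-1` A) = ((l^-1 ^+ n)%:E * mu A)%E.
Proof.
move=> l0 mA.
have k0 : 0 <= l^-1 ^+ n by rewrite exprn_ge0// invr_ge0 ltW.
pose m1 : {measure set 'rV[R]_n -> \bar R} :=
  measure_function_pushforward__canonical__measure_function_Measure mu (measurable_aff l z).
pose m2 : {measure set 'rV[R]_n -> \bar R} := mscale (NngNum k0) mu.
rewrite -[LHS]/(m1 A) -[RHS]/(m2 A).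
have box_pre a b : aff l z @^-1` box a b = box (l^-1 *: (a - z)) (l^-1 *: (b - z)).
  apply/seteqP; split => x h i; have := h i; rewrite !in_itv/= !mxE;
  by rewrite !(mulrC l^-1) ler_pdivrMr// ler_pdivlMr// lerBlDr lerBrDr (mulrC l).
have m1box a b : (forall i, a ord0 i <= b ord0 i) -> m1 (box a b) = m2 (box a b).
  move=> ab; rewrite /m1 /m2 /mscale/= /pushforward (box_pre a b) leb_boxE//; last first.
    by move=> i; rewrite !mxE ler_pM2l ?invr_gt0// lerD2r.
  rewrite -[RHS]/((l^-1 ^+ n)%:E * mu (box a b))%E leb_boxE// -EFinM; congr EFin.
  have -> : l^-1 ^+ n = \prod_(i < n) l^-1 by rewrite prodr_const card_ord.
  rewrite -big_split/=.
  by apply: eq_bigr => i _; rewrite !mxE -mulrBr opprB addrA subrK.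
apply: eq_measure_boxes => // k.
have hk : forall i : 'I_n, (\row_j - (k%:R : R)) ord0 i <= (\row_j (k%:R : R)) ord0 i.
  by move=> i; rewrite !mxE; have : 0 <= k%:R :> R by []; lra.
rewrite m1box//.
set B := box _ _; rewrite -[X in (X < _)%E]/((l^-1 ^+ n)%:E * mu B)%E.
by rewrite leb_boxE// -EFinM ltry.
Qed.

Lemma ge0_integral_aff (l : R) (z : 'rV[R]_n) (f : 'rV[R]_n -> \bar R) : 0 < l ->
  measurable_fun setT f -> (forall x, 0 <= f x)%E ->
  (\int[mu]_x f (aff l z x) = (l^-1 ^+ n)%:E * \int[mu]_x f x)%E.
Proof.
move=> l0 mf f0.
have k0 : 0 <= l^-1 ^+ n by rewrite exprn_ge0// invr_ge0 ltW.
have := @ge0_integral_pushforward _ _ _ _ _ (aff l z) (measurable_aff l z) mu setT f measurableT mf (fun y _ => f0 y).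
rewrite preimage_setT => <-.
transitivity (\int[mscale (NngNum k0) mu]_x f x)%E; last first.
  by rewrite ge0_integral_mscale//.
apply: eq_measure_integral; first exact: measurable_aff.
move=> m A mA _.
by rewrite -[LHS]/(mu (aff l z @^-1` A)) -[RHS]/((l^-1 ^+ n)%:E * mu A)%E; exact: leb_aff.
Qed.

Lemma integral_translate (z : 'rV[R]_n) (f : 'rV[R]_n -> \bar R) : measurable_fun setT f ->
  (\int[mu]_x f (x + z)%R = \int[mu]_x f x)%E.
Proof.
move=> mf.
rewrite integralE [RHS]integralE; congr (_ - _)%E.
  have := @ge0_integral_aff 1 z (f^\+)%E ltr01 (measurable_funepos mf) (fun x => funepos_ge0 f x).
  rewrite invr1 expr1n mul1e => <-; apply: eq_integral => x _.
  by rewrite !funeposE /aff scale1r.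
have := @ge0_integral_aff 1 z (f^\-)%E ltr01 (measurable_funeneg mf) (fun x => funeneg_ge0 f x).
rewrite invr1 expr1n mul1e => <-; apply: eq_integral => x _.
by rewrite !funenegE /aff scale1r.
Qed.

End euclidean_measure.

(** * Square integrable functions on a measurable domain *)

Section L2_calculus.
Context {R : realType} {d : nat} (Om : set 'rV[R]_d) (mOm : measurable Om).
Local Notation mu := (leb d : {sigma_finite_measure set 'rV[R]_d -> \bar R}).
Implicit Types (u v w : 'rV[R]_d -> R) (tau psi : 'rV[R]_d -> 'rV[R]_d).

Lemma integrable_sqrE v : measurable_fun Om v ->
  mu.-integrable Om (EFin \o (fun x => v x ^+ 2)) <-> (\int[mu]_(x in Om) (v x ^+ 2)%:E < +oo)%E.
Proof.
move=> mv; have mv2 : measurable_fun Om (EFin \o (fun x => v x ^+ 2)).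
  by apply/measurable_EFinP; exact: measurable_funX.
have E : (\int[mu]_(x in Om) `|(v x ^+ 2)%:E| = \int[mu]_(x in Om) (v x ^+ 2)%:E)%E.
  by apply: eq_integral => x _; rewrite gee0_abs// lee_fin sqr_ge0.
split; first by move=> /integrableP[_]/=; rewrite E.
by move=> h; apply/integrableP; split => //=; rewrite E.
Qed.

Lemma poweR2 (x : \bar R) : (0 <= x)%E -> (x `^ 2 = x ^+ 2)%E.
Proof.
case: x => [r| |]//= r0; first by rewrite powR_mulrn.
by rewrite (_ : (2 == 0 :> R) = false) ?mulyy// pnatr_eq0.
Qed.

Lemma normL2_sqrE v : (normL2 Om v ^+ 2 = \int[mu]_(x in Om) (v x ^+ 2)%:E)%E.
Proof.
rewrite -poweR2 ?Lnorm_ge0// /normL2 powR_Lnorm// integral_mkcond [RHS]integral_mkcond.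
rewrite patch_setT; apply: eq_integral => x _; rewrite /patch/=.
case: ifPn => _ /=; first by rewrite powR_mulrn// -normrX ger0_norm ?sqr_ge0.
by rewrite [X in (`|X| `^ _)%:E](_ : _ = 0)// normr0 powR0.
Qed.

Lemma L2E v : L2 Om v <->
  measurable_fun Om v /\ mu.-integrable Om (EFin \o (fun x => v x ^+ 2)).
Proof.
rewrite /L2 inE; split.
  move=> /andP[/[!inE]/= mv fv].
  have mv' : measurable_fun Om v by apply/(measurable_restrictT _ mOm).
  split => //; apply/integrable_sqrE => //.
  rewrite -normL2_sqrE -poweR2 ?Lnorm_ge0//.
  by apply: poweR_lty; exact: fv.
move=> [mv /integrable_sqrE iv]; apply/andP; rewrite !inE/=; split.
  by apply/(measurable_restrictT _ mOm).
have := iv mv; rewrite -normL2_sqrE -poweR2 ?Lnorm_ge0// => h.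
exact: lty_poweRy h.
Qed.

Lemma L2_measurable v : L2 Om v -> measurable_fun Om v.
Proof. by move=> /L2E[]. Qed.

Lemma L2_integrableM v w : L2 Om v -> L2 Om w -> mu.-integrable Om (EFin \o (fun x => v x * w x)).
Proof.
move=> /L2E[mv iv] /L2E[mw iw].
apply: (@le_integrable _ _ _ mu Om mOm _ (EFin \o (fun x => v x ^+ 2 + w x ^+ 2))).
- by apply/measurable_EFinP; exact: measurable_funM.
- move=> x _ /=; rewrite lee_fin normrM [leRHS]ger0_norm ?addr_ge0 ?sqr_ge0//.
  rewrite -[v x ^+ 2]real_normK ?num_real// -[w x ^+ 2]real_normK ?num_real//.
  rewrite -subr_ge0 (_ : _ - _ = (`|v x| - `|w x|) ^+ 2 + `|v x| * `|w x|); last by ring.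
  by rewrite addr_ge0 ?sqr_ge0// mulr_ge0.
- rewrite (_ : EFin \o _ = ((EFin \o (fun x => (v x ^+ 2)%R)) \+ (EFin \o (fun x => (w x ^+ 2)%R)))%E)//.
  exact: integrableD.
Qed.

Lemma L2_le v w : measurable_fun Om v -> (forall x, Om x -> `|v x| <= `|w x|) ->
  L2 Om w -> L2 Om v.
Proof.
move=> mv vw /L2E[mw iw]; apply/L2E; split => //.
apply: (@le_integrable _ _ _ mu Om mOm _ _ _ _ iw).
  by apply/measurable_EFinP; exact: measurable_funX.
move=> x Ox /=; rewrite lee_fin !normrX.
by rewrite lerXn2r// ?nnegrE// vw.
Qed.

Lemma L2D v w : L2 Om v -> L2 Om w -> L2 Om (fun x => v x + w x).
Proof.
move=> lv lw; have /L2E[mv iv] := lv; have /L2E[mw iw] := lw; apply/L2E; split.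
  exact: measurable_funD.
have ivw := L2_integrableM lv lw.
have := integrableD mOm (integrableD mOm iv iw) (integrableZl mOm 2 ivw).
apply: eq_integrable => // x _ /=; rewrite -!EFinD; congr EFin; ring.
Qed.

Lemma L2Z (c : R) v : L2 Om v -> L2 Om (fun x => c * v x).
Proof.
move=> /L2E[mv iv]; apply/L2E; split; first exact: measurable_funM.
have := integrableZl mOm (c ^+ 2) iv.
by apply: eq_integrable => // x _ /=; rewrite -EFinM exprMn.
Qed.

Lemma L2N v : L2 Om v -> L2 Om (fun x => - v x).
Proof. by move=> /(L2Z (-1)); congr (L2 _ _); apply/funext => x; rewrite mulN1r. Qed.

Lemma L2B v w : L2 Om v -> L2 Om w -> L2 Om (fun x => v x - w x).
Proof. by move=> lv /L2N; exact: L2D. Qed.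

Lemma L20 : L2 Om (fun=> 0).
Proof.
apply/L2E; split; first exact: measurable_cst.
rewrite (_ : _ \o _ = cst 0%E); last by apply/funext => x /=; rewrite expr0n.
exact: integrable0.
Qed.

Lemma L2_sum (I : Type) (r : seq I) (P : pred I) (F : I -> 'rV[R]_d -> R) :
  (forall i, P i -> L2 Om (F i)) -> L2 Om (fun x => \sum_(i <- r | P i) F i x).
Proof.
move=> h; elim: r => [|i r IH].
  by rewrite (_ : (fun _ => _) = fun=> 0); [exact: L20|apply/funext => x; rewrite big_nil].
rewrite (_ : (fun _ => _) = fun x => (if P i then F i x else 0) + \sum_(i <- r | P i) F i x); last first.
  by apply/funext => x; rewrite big_cons; case: ifP; rewrite ?add0r.
apply: (@L2D (fun x => if P i then F i x else 0) _ _ IH).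
by case: (P i) (h i) => [hi|_]; [exact: hi|exact: L20].
Qed.

Lemma L2_bounded v (M : R) : (mu Om < +oo)%E -> measurable_fun Om v ->
  (forall x, Om x -> `|v x| <= M) -> L2 Om v.
Proof.
move=> Oy mv vM; apply: (@L2_le _ (cst M)) => //.
  by move=> x Ox; apply: le_trans (vM _ Ox) _; exact: ler_norm.
apply/L2E; split; first exact: measurable_cst.
apply: measurable_bounded_integrable => //; first by apply: measurable_funX; exact: measurable_cst.
rewrite /bounded_near.
near=> y => x _ /=; rewrite ger0_norm ?sqr_ge0//; near: y; exact: nbhs_pinfty_ge.
Unshelve. all: by end_near. Qed.

(** * The inner product *)

Lemma ipE v w : ip Om v w = fine (\int[mu]_(x in Om) (v x * w x)%:E).
Proof. by []. Qed.

Lemma ip_EFin v w : L2 Om v -> L2 Om w ->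
  (\int[mu]_(x in Om) (v x * w x)%:E = (ip Om v w)%:E)%E.
Proof. by move=> lv lw; rewrite ipE fineK//; apply: integrable_fin_num => //; exact: L2_integrableM. Qed.

Lemma ipC v w : ip Om v w = ip Om w v.
Proof. by apply: eq_Rintegral => x _; rewrite mulrC. Qed.

Lemma ipDl u v w : L2 Om u -> L2 Om v -> L2 Om w ->
  ip Om (fun x => u x + v x) w = ip Om u w + ip Om v w.
Proof.
move=> lu lv lw; rewrite /ip -RintegralD//; [|exact: L2_integrableM..].
by apply: eq_Rintegral => x _; rewrite mulrDl.
Qed.

Lemma ipZl c v w : L2 Om v -> L2 Om w -> ip Om (fun x => c * v x) w = c * ip Om v w.
Proof.
move=> lv lw; rewrite /ip -RintegralZl//; [|exact: L2_integrableM].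
by apply: eq_Rintegral => x _; rewrite mulrA.
Qed.

Lemma ipNl v w : L2 Om v -> L2 Om w -> ip Om (fun x => - v x) w = - ip Om v w.
Proof.
move=> lv lw; rewrite -mulN1r -ipZl//.
by congr ip; apply/funext => x; rewrite mulN1r.
Qed.

Lemma ipBl u v w : L2 Om u -> L2 Om v -> L2 Om w ->
  ip Om (fun x => u x - v x) w = ip Om u w - ip Om v w.
Proof. by move=> lu lv lw; rewrite ipDl ?ipNl//; exact: L2N. Qed.

Lemma ipDr u v w : L2 Om u -> L2 Om v -> L2 Om w ->
  ip Om w (fun x => u x + v x) = ip Om w u + ip Om w v.
Proof. by move=> lu lv lw; rewrite ipC ipDl// ![ip Om _ w]ipC. Qed.

Lemma ipZr c v w : L2 Om v -> L2 Om w -> ip Om w (fun x => c * v x) = c * ip Om w v.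
Proof. by move=> lv lw; rewrite ipC ipZl// ipC. Qed.

Lemma ipBr u v w : L2 Om u -> L2 Om v -> L2 Om w ->
  ip Om w (fun x => u x - v x) = ip Om w u - ip Om w v.
Proof. by move=> lu lv lw; rewrite ipC ipBl// ![ip Om _ w]ipC. Qed.

Lemma ip0l w : ip Om (fun=> 0) w = 0.
Proof.
rewrite /ip (_ : (fun _ => _) = cst 0); last by apply/funext => x; rewrite mul0r.
by rewrite /Rintegral integral0.
Qed.

Lemma ip_suml (I : Type) (r : seq I) (P : pred I) (F : I -> 'rV[R]_d -> R) w :
  (forall i, P i -> L2 Om (F i)) -> L2 Om w ->
  ip Om (fun x => \sum_(i <- r | P i) F i x) w = \sum_(i <- r | P i) ip Om (F i) w.
Proof.
move=> h lw; elim: r => [|i r IH].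
  rewrite big_nil -[RHS](ip0l w); congr ip; apply/funext => x; by rewrite big_nil.
rewrite big_cons -IH; case: ifPn => Pi; last first.
  by congr ip; apply/funext => x; rewrite big_cons (negbTE Pi).
rewrite -ipDl//; [|exact: h|exact: L2_sum].
by congr ip; apply/funext => x; rewrite big_cons Pi.
Qed.

Lemma ip_ge0 v : 0 <= ip Om v v.
Proof. by apply: Rintegral_ge0 => x _; rewrite -expr2 sqr_ge0. Qed.

Lemma ip_ae v v' w : measurable_fun Om v -> measurable_fun Om v' -> measurable_fun Om w ->
  v = v' %[ae mu in Om] -> ip Om v w = ip Om v' w.
Proof.
move=> mv mv' mw vv'; rewrite !ipE; congr fine; apply: ae_eq_integral => //;
  [by apply/measurable_EFinP; exact: measurable_funM..|].
by apply: filterS vv' => x /[apply] ->.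
Qed.

Lemma normL2_sqr v : L2 Om v -> (normL2 Om v ^+ 2 = (ip Om v v)%:E)%E.
Proof.
by move=> lv; rewrite normL2_sqrE -ip_EFin.
Qed.

Lemma normL2E v : L2 Om v -> normL2 Om v = (Num.sqrt (ip Om v v))%:E.
Proof.
move=> lv; have := normL2_sqr lv; have : (0 <= normL2 Om v)%E by exact: Lnorm_ge0.
case: (normL2 Om v) => [r| |]//=.
- by rewrite lee_fin => r0 [<-]; rewrite -expr2 sqrtr_sqr ger0_norm.
Qed.

Lemma ipDD v w : L2 Om v -> L2 Om w ->
  ip Om (fun x => v x + w x) (fun x => v x + w x) = ip Om v v + 2 * ip Om v w + ip Om w w.
Proof.
move=> lv lw; have lvw := L2D lv lw.
rewrite ipDl// !ipDr// (ipC w v); ring.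
Qed.

Lemma ipBB v w : L2 Om v -> L2 Om w ->
  ip Om (fun x => v x - w x) (fun x => v x - w x) = ip Om v v - 2 * ip Om v w + ip Om w w.
Proof.
move=> lv lw; have lvw := L2B lv lw.
rewrite ipBl// !ipBr// (ipC w v); ring.
Qed.

Lemma ip_young (e : R) v w : 0 < e -> L2 Om v -> L2 Om w ->
  2 * ip Om v w <= e * ip Om v v + e^-1 * ip Om w w.
Proof.
move=> e0 lv lw; have := ip_ge0 (fun x => e * v x - w x).
rewrite ipBB//; last exact: L2Z.
rewrite !ipZl// ?ipZr//; last exact: L2Z.
set a := ip Om v v; set b := ip Om v w; set c := ip Om w w => h.
have e1 : 0 < e^-1 by rewrite invr_gt0.
have ee : e * e^-1 = 1 by rewrite divff// gt_eqF.
have : 0 <= e^-1 * (e * (e * a) - 2 * (e * b) + c) by rewrite mulr_ge0// ltW.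
have -> : e^-1 * (e * (e * a) - 2 * (e * b) + c) = (e * e^-1) * e * a - 2 * (e * e^-1) * b + e^-1 * c by ring.
rewrite ee; set e' := e^-1; lra.
Qed.

Lemma ip_cauchy_schwarz v w : L2 Om v -> L2 Om w -> ip Om v w ^+ 2 <= ip Om v v * ip Om w w.
Proof.
move=> lv lw.
have H (t : R) : 0 <= ip Om v v - 2 * (t * ip Om v w) + t ^+ 2 * ip Om w w.
  have := ip_ge0 (fun x => v x - t * w x); rewrite ipBB//; last exact: L2Z.
  by rewrite ipZl ?ipZr//; [rewrite expr2 !mulrA|exact: L2Z].
have := ip_ge0 v; have := ip_ge0 w; move: H.
set a := ip Om v v; set b := ip Om v w; set c := ip Om w w => H c0 a0.
have [c0'|cp] := eqVneq c 0.
  rewrite c0' mulr0 (_ : b = 0) ?expr0n//; apply/eqP/negPn/negP => b0.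
  have := H ((a + 1) / b / 2); rewrite c0' mulr0 addr0.
  rewrite (_ : 2 * _ = a + 1); last by field.
  lra.
have cp' : 0 < c by rewrite lt_neqAle eq_sym cp.
have := H (b / c); have : 0 < c^-1 by rewrite invr_gt0.
rewrite (_ : a - _ + _ = (a * c - b ^+ 2) / c); last by field.
by move=> ci; rewrite pmulr_lge0// subr_ge0.
Qed.

(** * Vector fields *)

Lemma L2vZ (c : R) tau : L2v Om tau -> L2v Om (fun x => c *: tau x).
Proof.
move=> h i; rewrite (_ : coordf _ i = fun x => c * coordf tau i x).
  exact: L2Z.
by apply/funext => x; rewrite /coordf mxE.
Qed.

Lemma L2vB tau psi : L2v Om tau -> L2v Om psi -> L2v Om (fun x => tau x - psi x).
Proof.
move=> h h' i; rewrite (_ : coordf _ i = fun x => coordf tau i x - coordf psi i x).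
  exact: L2B.
by apply/funext => x; rewrite /coordf !mxE.
Qed.

Lemma ipvE tau psi : L2v Om tau -> L2v Om psi ->
  ipv Om tau psi = \sum_i ip Om (coordf tau i) (coordf psi i).
Proof.
move=> lt lp; rewrite /ipv /Rintegral.
have -> : (\int[mu]_(x in Om) (dot (tau x) (psi x))%:E =
   \sum_i \int[mu]_(x in Om) (coordf tau i x * coordf psi i x)%:E)%E.
  rewrite -(@integral_sum _ _ _ mu _ mOm _ (fun i x => (coordf tau i x * coordf psi i x)%:E)); last first.
    by move=> i; exact: L2_integrableM.
  by apply: eq_integral => x _; rewrite sumEFin.
rewrite (eq_bigr (fun i => (ip Om (coordf tau i) (coordf psi i))%:E)); last by move=> i _; rewrite ip_EFin.
by rewrite sumEFin.
Qed.

Lemma L2v_integrable_dot tau psi : L2v Om tau -> L2v Om psi ->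
  mu.-integrable Om (EFin \o (fun x => dot (tau x) (psi x))).
Proof.
move=> lt lp.
rewrite (_ : _ \o _ = (fun x => \sum_i (coordf tau i x * coordf psi i x)%:E)%E).
  by apply: integrable_sum => // i _; exact: L2_integrableM.
by apply/funext => x /=; rewrite sumEFin.
Qed.

Lemma ipvC tau psi : ipv Om tau psi = ipv Om psi tau.
Proof. by apply: eq_Rintegral => x _; apply: eq_bigr => i _; rewrite mulrC. Qed.

Lemma ipvZl c tau psi : L2v Om tau -> L2v Om psi ->
  ipv Om (fun x => c *: tau x) psi = c * ipv Om tau psi.
Proof.
move=> l lp; rewrite !ipvE//; last exact: L2vZ.
rewrite mulr_sumr; apply: eq_bigr => i _; rewrite -ipZl//.
by congr ip; apply/funext => x; rewrite /coordf mxE.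
Qed.

Lemma ipvBl tau tau' psi : L2v Om tau -> L2v Om tau' -> L2v Om psi ->
  ipv Om (fun x => tau x - tau' x) psi = ipv Om tau psi - ipv Om tau' psi.
Proof.
move=> l l' lp; rewrite !ipvE//; last exact: L2vB.
rewrite -sumrB; apply: eq_bigr => i _; rewrite -ipBl//.
by congr ip; apply/funext => x; rewrite /coordf !mxE.
Qed.

Lemma ipvBr tau tau' psi : L2v Om tau -> L2v Om tau' -> L2v Om psi ->
  ipv Om psi (fun x => tau x - tau' x) = ipv Om psi tau - ipv Om psi tau'.
Proof. by move=> l l' lp; rewrite ipvC ipvBl// ![ipv Om _ psi]ipvC. Qed.

Lemma ipv_ge0 tau : 0 <= ipv Om tau tau.
Proof.
apply: Rintegral_ge0 => x _; apply: sumr_ge0 => i _.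
by rewrite -expr2 sqr_ge0.
Qed.

Lemma ipv_young (e : R) tau psi : 0 < e -> L2v Om tau -> L2v Om psi ->
  2 * ipv Om tau psi <= e * ipv Om tau tau + e^-1 * ipv Om psi psi.
Proof.
move=> e0 lv lw; rewrite !ipvE// !mulr_sumr -big_split/=; apply: ler_sum => i _.
exact: ip_young.
Qed.

Lemma normL2v_sqr tau : L2v Om tau -> (normL2v Om tau ^+ 2 = (ipv Om tau tau)%:E)%E.
Proof.
move=> lt; rewrite /normL2v normL2_sqrE /ipv /Rintegral fineK; last first.
  by apply: integrable_fin_num => //; exact: L2v_integrable_dot.
apply: eq_integral => x _; rewrite /enorm sqr_sqrtr//.
by apply: sumr_ge0 => i _; rewrite -expr2 sqr_ge0.
Qed.

End L2_calculus.

(** * Integrating differential inequalities that hold at every time *)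

Section growth.
Context {R : realType}.
Local Notation mu := (@lebesgue_measure R).

(** A nonnegative integrable function lies below an integrable function that
    near each point [t] stays above the value at [t]: its level sets, of small
    height, are enlarged to open sets. *)
Lemma vitali_caratheodory (a b : R) (K : R -> R) (eps : R) : a < b -> 0 < eps ->
  measurable_fun `]a, b] K -> (forall t, `]a, b]%classic t -> 0 <= K t) ->
  exists G : R -> \bar R,
  [/\ measurable_fun setT G, forall s, (0 <= G s)%E,
      (\int[mu]_(s in `]a, b]) G s <= \int[mu]_(s in `]a, b]) (K s)%:E + eps%:E)%E &
      forall t, `]a, b]%classic t -> \forall s \near t, ((K t)%:E <= G s)%E].
Proof.
move=> ab eps0 mK K0.
set D := `]a, b]%classic in mK K0 *.
have mD : measurable D by exact: measurable_itv.
have ba1 : 0 < b - a + 1 by rewrite addr_gt0// subr_gt0.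
pose dl := eps / (b - a + 1).
have dl0 : 0 < dl by rewrite divr_gt0.
pose c n : R := n.+1%:R * dl.
have c0 n : 0 < c n by rewrite mulr_gt0.
pose E n := D `&` K @^-1` `[n%:R * dl, c n[%classic.
have mE n : measurable (E n) by apply: mK => //; exact: measurable_itv.
have muD : (mu D = (b - a)%:E)%E by rewrite lebesgue_measure_itv/= lte_fin ab.
have Ey n : (mu (E n) < +oo)%E.
  apply: (@le_lt_trans _ _ (mu D)); last by rewrite muD ltry.
  by apply: le_measure; [rewrite inE; exact: mE|rewrite inE|exact: subIsetl].
pose e n := dl / (2 ^ n.+1)%:R / c n.
have e0 n : 0 < e n by rewrite !divr_gt0// ltr0n expn_gt0.
have hV n : exists U : set R, [/\ open U, E n `<=` U & (mu (U `\` E n) < (e n)%:E)%E].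
  exact: (lebesgue_regularity_outer (mE n) (Ey n) (e0 n)).
have [V hV'] := choice hV.
have mV n : measurable (V n) by apply: open_measurable; case: (hV' n).
pose G (s : R) : \bar R := (\sum_(n <oo) (c n * \1_(V n) s)%:E)%E.
have mG n : measurable_fun setT (fun s => (c n * \1_(V n) s)%:E).
  by apply/measurable_EFinP; apply: measurable_funM => //; exact: measurable_indic.
have G0 n s : (0 <= (c n * \1_(V n) s)%:E)%E by rewrite lee_fin mulr_ge0// ltW.
have Em t : D t -> E (Num.truncn (K t / dl)) t.
  move=> Dt; split => //=; rewrite in_itv/=.
  have : 0 <= K t / dl by rewrite divr_ge0 ?K0// ltW.
  move=> /truncn_itv/andP[h1 h2].
  by rewrite -ler_pdivlMr// h1 -ltr_pdivrMr.
exists G; split.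
- by apply: ge0_emeasurable_sum => // *; exact: G0.
- by move=> s; apply: nneseries_ge0 => *; exact: G0.
- have -> : (\int[mu]_(s in D) G s = \sum_(n <oo) \int[mu]_(s in D) (c n * \1_(V n) s)%:E)%E.
    by apply: integral_nneseries => [//|n|n s _]; [apply: measurable_funTS; exact: mG|exact: G0].
  have h1 n : (\int[mu]_(s in D) (c n * \1_(V n) s)%:E <= \int[mu]_(s in D) (c n * \1_(E n) s)%:E + (dl / (2 ^ n.+1)%:R)%:E)%E.
    have I A : measurable A -> (\int[mu]_(s in D) (c n * \1_A s)%:E = (c n)%:E * mu (A `&` D))%E.
      move=> mA; under eq_integral do rewrite EFinM.
      rewrite ge0_integralZl_EFin//; last 2 first.
        by apply/measurable_EFinP; apply: measurable_funTS; exact: measurable_indic.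
        exact: ltW.
      by rewrite integral_indic.
    have de : dl / (2 ^ n.+1)%:R = c n * e n by rewrite /e [RHS]mulrC divfK// gt_eqF.
    rewrite (I _ (mV n)) (I _ (mE n)) de (EFinM (c n) (e n)) -ge0_muleDr//; last by rewrite lee_fin ltW.
    rewrite lee_pmul2l ?lte_fin//.
    have [_ EV hmu] := hV' n.
    apply: (@le_trans _ _ (mu (E n `&` D) + mu (V n `\` E n))%E); last by rewrite leeD2l// ltW.
    apply: (@le_trans _ _ (mu ((E n `&` D) `|` (V n `\` E n)))); last first.
      by apply: measureU2 => //; [exact: (measurableI _ _ (mE n) mD)|exact: (measurableD (mV n) (mE n))].
    apply: le_measure; rewrite ?inE.
    + exact: (measurableI _ _ (mV n) mD).
    + by apply: measurableU; [exact: (measurableI _ _ (mE n) mD)|exact: (measurableD (mV n) (mE n))].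
    + by move=> s [Vs Ds]; have [Es|nEs] := pselect (E n s); [left|right].
  apply: le_trans; first by apply: lee_nneseries => [i _ _|i _]; [apply: integral_ge0 => s _; exact: G0|exact: h1].
  apply: le_trans.
    apply: epsilon_trick; last exact: ltW.
    by move=> n; apply: integral_ge0 => s _; rewrite lee_fin mulr_ge0// ltW.
  rewrite -integral_nneseries//; last 2 first.
    move=> n; apply/measurable_EFinP; apply: measurable_funM => //.
    by apply: measurable_indic; exact: mE.
    by move=> n s _; rewrite lee_fin mulr_ge0// ltW.
  apply: (@le_trans _ _ (\int[mu]_(s in D) ((K s)%:E + dl%:E) + dl%:E)%E).
    rewrite leeD2r//; apply: ge0_le_integral => //.
    + by move=> s _; apply: nneseries_ge0 => n _ _; rewrite lee_fin mulr_ge0// ltW.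
    + apply: ge0_emeasurable_sum => [n s _ _|n _]; first by rewrite lee_fin mulr_ge0// ltW.
      apply/measurable_EFinP; apply: measurable_funM => //.
      by apply: measurable_indic; exact: mE.
    + by apply/measurable_EFinP; apply: measurable_funD.
    + move=> t Dt.
      set m := Num.truncn (K t / dl).
      have uniqE n : E n t -> n = m.
        move=> [_ /=]; rewrite in_itv/= => /andP[h h'].
        by apply/esym/truncn_def; rewrite ler_pdivlMr// h ltr_pdivrMr.
      apply: lime_le.
        by apply: is_cvg_nneseries => n _ _; rewrite lee_fin mulr_ge0// ltW.
      apply: nearW => N; rewrite sumEFin -EFinD lee_fin.
      have hm : c m <= K t + dl.
        have [_ /=] := Em _ Dt; rewrite -/m in_itv/= => /andP[h _].
        by rewrite /c -natr1 mulrDl mul1r lerD2r.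
      apply: le_trans hm.
      have [mN|Nm] := ltnP m N.
        rewrite (bigD1_seq m) ?iota_uniq ?mem_index_iota//= big1_seq ?addr0.
          by apply: ler_piMr; [exact: ltW|rewrite indicE; case: (_ \in _)].
        move=> n /andP[nm _]; rewrite indicE memNset ?mulr0// => /uniqE nE.
        by rewrite nE eqxx in nm.
      rewrite big1_seq; first exact: ltW.
      move=> n /andP[_]; rewrite mem_index_iota => /andP[_ nN].
      rewrite indicE memNset ?mulr0// => /uniqE nE.
      by move: nN; rewrite nE ltnNge Nm.
  rewrite ge0_integralD//; last 2 first.
    exact/measurable_EFinP.
    by move=> s _; rewrite lee_fin ltW.
  have -> : (\int[mu]_(x in D) dl%:E = dl%:E * mu D)%E by exact: integral_cst.
  rewrite muD -addeA leeD2l// -EFinM -EFinD lee_fin.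
  by rewrite /dl -[X in _ + X <= _]mulr1 -mulrDr divfK// gt_eqF.
- move=> t Dt; set m := Num.truncn (K t / dl).
  have [oV EV _] := hV' m.
  have : \forall s \near t, V m s by apply: open_nbhs_nbhs; split => //; apply: EV; exact: Em.
  apply: filterS => s Vs.
  apply: le_trans (nneseries_lim_ge m.+1 _); last by move=> n _ _; exact: G0.
  rewrite big_nat_recr//= indicE mem_set// mulr1.
  apply: (@le_trans _ _ (c m)%:E).
    have [_ /=] := Em _ Dt; rewrite -/m in_itv/= => /andP[_ /ltW h].
    by rewrite lee_fin.
  by rewrite leeDr//; apply: sume_ge0 => n _; exact: G0.
Qed.

(** No integrability of the derivative is assumed, so this does not follow from
    the fundamental theorem of calculus; the supremum of the times up to which
    the inequality holds, with [K] replaced by the majorant of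
    [vitali_caratheodory], is [b]. *)
Lemma growth_le_integral (a b : R) (f K : R -> R) : a < b ->
  measurable_fun `]a, b] K -> (forall t, `]a, b]%classic t -> 0 <= K t) ->
  (forall t, a < t <= b -> f x @[x --> t^'-] --> f t) ->
  f x @[x --> a^'+] --> f a ->
  (forall t e, a < t < b -> 0 < e -> \forall s \near t^'+, f s - f t <= (s - t) * (K t + e)) ->
  ((f b - f a)%:E <= \int[mu]_(t in `]a, b]) (K t)%:E)%E.
Proof.
move=> ab mK K0 fl fr fD; apply/lee_addgt0Pr => eps eps0.
have ba1 : 0 < b - a + 2 by rewrite addr_gt0// subr_gt0.
pose e := eps / (b - a + 2).
have e0 : 0 < e by rewrite divr_gt0.
have [G [mG G0 GK GE]] := vitali_caratheodory ab e0 mK K0.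
pose Phi t := (\int[mu]_(s in `]a, t]) G s)%E.
have Phi0 t : (0 <= Phi t)%E by apply: integral_ge0.
have PhiD s t : a <= s -> s <= t -> (Phi t = Phi s + \int[mu]_(x in `]s, t]) G x)%E.
  move=> as_ st; rewrite /Phi -ge0_integral_setU//=.
  - by congr (integral _ _ _); rewrite -itv_bndbnd_setU//= bnd_simp.
  - by apply: measurable_funTS.
  - by apply/disj_setPS => x /= [] /=; rewrite !in_itv/= => /andP[_ xs] /andP[sx _]; move: (lt_le_trans sx xs); rewrite ltxx.
have PhiM s t : a <= s -> s <= t -> (Phi s <= Phi t)%E.
  by move=> as_ st; rewrite (PhiD s t)// leeDl// integral_ge0.
pose P t := ((f t - f a - e - e * (t - a))%:E <= Phi t)%E.
suff : P b.
  rewrite /P => Pb; apply: le_trans (_ : ((e + e * (b - a))%:E + Phi b <= _)%E).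
    rewrite -leeBlDl// -EFinB; apply: le_trans Pb.
    by rewrite lee_fin; lra.
  apply: le_trans (leeD (lexx _) GK) _.
  rewrite addeCA leeD2l// -EFinD lee_fin /e.
  have -> : eps / (b - a + 2) + eps / (b - a + 2) * (b - a) + eps / (b - a + 2) = eps / (b - a + 2) * (b - a + 2) by ring.
  by rewrite divfK// gt_eqF.
pose S := [set t | a <= t <= b /\ forall s, a <= s <= t -> P s].
have Pa : P a by rewrite /P; apply: le_trans (Phi0 a); rewrite lee_fin; nra.
have Sa : S a.
  by split=> [|s /andP[h1 h2]]; [rewrite lexx ltW|rewrite (_ : s = a)//; apply/le_anti; rewrite h1 h2].
have Sub : ubound S b by move=> t [/andP[]].
have hS : has_sup S by split; [exists a|exists b].
pose c := sup S.
have ac : a <= c by apply: ub_le_sup => //; exists b.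
have cb : c <= b by apply: ge_sup => //; exists a.
have ltc s : a <= s < c -> P s.
  move=> /andP[as_ sc].
  have [t St st] : exists2 t, S t & s < t.
    have := @sup_adherent _ S (c - s); rewrite subr_gt0 => /(_ sc hS)[t St].
    by rewrite opprB addrC subrK => st; exists t.
  by case: St => _; apply; rewrite as_ ltW.
have Pc : P c.
  have [->//|ca] := eqVneq c a.
  have ac' : a < c by rewrite lt_neqAle eq_sym ca ac.
  have h : (fun t => f t - f a - e - e * (t - a)) x @[x --> c^'-] --> f c - f a - e - e * (c - a).
    apply: cvgB; first by apply: cvgB; [apply: cvgB; [by apply: fl; rewrite ac' cb|exact: cvg_cst]|exact: cvg_cst].
    apply: cvgM; first exact: cvg_cst.
    apply: cvgB; [|exact: cvg_cst].
    by apply: cvg_within_filter; exact: cvg_id.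
  case Phic : (Phi c) => [r| |]; last 2 first.
  - by rewrite /P Phic leey.
  - by have := Phi0 c; rewrite Phic.
  rewrite /P Phic lee_fin.
  apply: (cvgr_to_le h).
  near=> s; rewrite -lee_fin -Phic; apply: le_trans (PhiM s c _ _).
  - apply: ltc; apply/andP; split; near: s; last exact: nbhs_left_lt.
    exact: nbhs_left_ge.
  - by near: s; exact: nbhs_left_ge.
  - by near: s; exact: nbhs_left_le.
have [<-//|cneb] := eqVneq c b.
have cb' : c < b by rewrite lt_neqAle cneb cb.
have Sc : S c.
  split=> [|s /andP[as_]]; first by rewrite ac cb.
  by rewrite le_eqVlt => /orP[/eqP->//|sc]; apply: ltc; rewrite as_ sc.
have ext : \forall s \near c^'+, P s.
  have [ca|ca] := eqVneq c a.
    have : \forall s \near a^'+, f s < f a + e.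
      by apply: (cvgr_lt _ fr); rewrite ltrDl.
    rewrite ca => h; near=> s; rewrite /P; apply: le_trans (Phi0 s).
    have h1 : f s < f a + e by near: s.
    have : a <= s by near: s; exact: nbhs_right_ge.
    by rewrite lee_fin; nra.
  have ac' : a < c by rewrite lt_neqAle eq_sym ca ac.
  have Dc : `]a, b]%classic c by rewrite /= in_itv/= ac' cb.
  have /nbhs_ballP[r/= r0 rG] := GE _ Dc.
  have hD : \forall s \near c^'+, f s - f c <= (s - c) * (K c + e) by apply: fD => //; rewrite ac' cb'.
  near=> s.
  have cs : c < s by near: s; exact: nbhs_right_gt.
  have sr : s < c + r by near: s; apply: nbhs_right_lt; rewrite ltrDl.
  have h : f s - f c <= (s - c) * (K c + e) by near: s.
  rewrite /P (PhiD c s ac (ltW cs)).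
  apply: (@le_trans _ _ ((f c - f a - e - e * (c - a)) + K c * (s - c))%:E).
    by rewrite lee_fin; nra.
  rewrite EFinD leeD//.
  have -> : ((K c * (s - c))%:E = \int[mu]_(x in `]c, s]) (cst (K c)%:E x))%E.
    by rewrite integral_cst//= lebesgue_measure_itv/= lte_fin cs.
  apply: ge0_le_integral => //=.
  - by move=> x _; rewrite lee_fin K0.
  - exact: measurable_funTS.
  - move=> x; rewrite in_itv/= => /andP[cx xs]; apply: rG => /=.
    by rewrite /ball/= ltr_norml; apply/andP; split; lra.
have [r r0 hr] : exists2 r, 0 < r & forall s, c < s < c + r -> P s.
  have /nbhs_ballP[r/= r0 hr] : nbhs c (fun s => c < s -> P s) by exact: ext.
  exists r => // s /andP[cs sr]; apply: hr => //.
  by rewrite /ball/= ltr_norml; apply/andP; split; lra.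
have [s [cs sr sb]] : exists s, [/\ c < s, s < c + r & s <= b].
  exists (c + Num.min (r / 2) (b - c)); split.
  - by rewrite ltrDl lt_min divr_gt0//= subr_gt0.
  - by rewrite ltrD2l gt_min ltr_pdivrMr// mulr2n mulrDr mulr1 ltrDl r0.
  - by rewrite -lerBrDl ge_min lexx orbT.
suff : s <= c by rewrite leNgt cs.
apply: ub_le_sup; first by exists b.
split=> [|t /andP[at_ ts]]; first by rewrite sb (le_trans ac) ?ltW.
have [tc|ct] := leP t c; first by case: Sc => _; apply; rewrite at_ tc.
by apply: hr; rewrite ct (le_lt_trans ts).
Unshelve. all: by end_near. Qed.

(** Adding [c * t] to [f] makes the right-hand side nonnegative. *)
Lemma growth_dissipation (a b c : R) (f K h : R -> R) : a < b ->
  measurable_fun `]a, b] K -> (forall t, `]a, b]%classic t -> 0 <= K t) ->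
  measurable_fun `]a, b] h -> (forall t, 0 <= h t <= c) ->
  (forall t, a < t <= b -> f x @[x --> t^'-] --> f t) ->
  f x @[x --> a^'+] --> f a ->
  (forall t e, a < t < b -> 0 < e ->
     \forall s \near t^'+, f s - f t <= (s - t) * (K t - h t + e)) ->
  ((f b - f a)%:E + \int[mu]_(t in `]a, b]) (h t)%:E <=
   \int[mu]_(t in `]a, b]) (K t)%:E)%E.
Proof.
move=> ab mK K0 mh hB fl fr fD.
set D := `]a, b]%classic in mK K0 mh *.
have mD : measurable D by exact: measurable_itv.
have muD : (mu D = (b - a)%:E)%E by rewrite lebesgue_measure_itv/= lte_fin ab.
have Dy : (mu D < +oo)%E by rewrite muD ltry.
have h0 t : 0 <= h t by case/andP: (hB t).
have hc t : h t <= c by case/andP: (hB t).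
have IK0 : (0 <= \int[mu]_(t in D) (K t)%:E)%E by apply: integral_ge0 => t Dt; rewrite lee_fin K0.
case IKE : (\int[mu]_(t in D) (K t)%:E)%E => [k| |]; last 2 first.
- by rewrite leey.
- by move: IK0; rewrite IKE.
rewrite addeC -leeBrDr// -EFinB.
have ih : mu.-integrable D (EFin \o h).
  apply: measurable_bounded_integrable; [exact: mD|exact: Dy|exact: mh|].
  rewrite /bounded_near; near=> M => x _ /=; rewrite ger0_norm//.
  by apply: le_trans (hc x) _; near: M; apply: nbhs_pinfty_ge; exact: num_real.
have iK : mu.-integrable D (EFin \o K).
  apply/integrableP; split; first exact/measurable_EFinP.
  rewrite (_ : (\int[mu]_(x in D) `|(EFin \o K) x|)%E = k%:E) ?ltry// -IKE.
  by apply: eq_integral => x /set_mem Dx; rewrite gee0_abs// lee_fin K0.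
pose f' t := f t + c * t; pose K' t := Num.max 0 (K t - h t + c).
have K'E t : D t -> K' t = K t - h t + c.
  move=> Dt; rewrite /K' max_r//.
  by have := K0 _ Dt; have := hc t; lra.
have := @growth_le_integral a b f' K' ab.
rewrite -/D (_ : (\int[mu]_(t in D) (K' t)%:E = k%:E - \int[mu]_(x in D) (h x)%:E + (c * (b - a))%:E)%E); last first.
  transitivity (\int[mu]_(t in D) ((K t)%:E - (h t)%:E + c%:E))%E.
    by apply: eq_integral => x /set_mem /K'E ->.
  have ic : mu.-integrable D (cst c%:E).
    apply: measurable_bounded_integrable; [exact: mD|exact: Dy|exact: measurable_cst|].
    rewrite /bounded_near; near=> M => x _ /=.
    near: M; apply: nbhs_pinfty_ge; exact: num_real.
  rewrite integralD//; last exact: integrableB.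
  congr (_ + _)%E; first by rewrite integralB// IKE.
  by transitivity (c%:E * mu D)%E; [exact: integral_cst|rewrite muD].
have ihf : (\int[mu]_(x in D) (h x)%:E)%E \is a fin_num by exact: integrable_fin_num.
rewrite -(fineK ihf) -EFinB -EFinD !lee_fin => H.
have {}H := H _ _ _ _ _.
suff : f' b - f' a <= k - fine (\int[mu]_(x in D) (h x)%:E)%E + c * (b - a).
  by rewrite /f'; lra.
apply: H.
- apply: (eq_measurable_fun (fun t => K t - h t + c)); first by move=> t /set_mem /K'E ->.
  by apply: measurable_funD => //; apply: measurable_funB.
- by move=> t _; rewrite /K' le_max lexx.
- move=> t tab; apply: cvgD; first exact: fl.
  by apply: cvgM; [exact: cvg_cst|apply: cvg_within_filter; exact: cvg_id].
- by apply: cvgD => //; apply: cvgM; [exact: cvg_cst|apply: cvg_within_filter; exact: cvg_id].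
- move=> t e tab e0; have := fD t e tab e0; apply: filterS2; last exact: (nbhs_right_gt t).
  move=> s ts fst.
  have Dt : D t by rewrite /D/= in_itv/=; case/andP: tab => -> /ltW.
  rewrite K'E// /f'.
  by lra.
Unshelve. all: by end_near. Qed.

End growth.

(** * Smooth functions *)

Section smooth_line.
Context {R : realType}.

(** The profile of all cut-off functions below; multiplying [exp (- 1 / r)] by
    polynomials in [1 / r] gives a family closed under derivation. *)
Definition flat_exp (p : {poly R}) (r : R) : R :=
  if 0 < r then p.[r^-1] * expR (- r^-1) else 0.

Lemma horner_bound (p : {poly R}) : exists2 B : R, 0 <= B &
  forall t : R, 1 <= t -> `|p.[t]| <= B * t ^+ size p.
Proof.
exists (\sum_(i < size p) `|p`_i|); first exact: sumr_ge0.
move=> t t1; rewrite horner_coef mulr_suml; apply: le_trans (ler_norm_sum _ _ _) _.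
apply: ler_sum => i _; rewrite normrM ler_wpM2l// normrX ger0_norm ?(le_trans ler01)//.
by apply: ler_weXn2l => //; exact: ltnW.
Qed.

Lemma expRN_le (t : R) (N : nat) : 0 < t -> (0 < N)%N -> expR (- t) <= (N%:R / t) ^+ N.
Proof.
move=> t0 N0; have N0' : 0 < N%:R :> R by rewrite ltr0n.
rewrite expRN -invf_div exprVn lef_pV2 ?posrE ?expR_gt0 ?exprn_gt0 ?divr_gt0//.
have {2}-> : t = (t / N%:R) * N%:R by rewrite divfK// gt_eqF.
rewrite expRM_natr; apply: lerXn2r; rewrite ?nnegrE ?expR_ge0//.
  by rewrite divr_ge0 ?(ltW t0).
by apply: le_trans (expR_ge1Dx _); rewrite lerDr.
Qed.

(** Applied to [p] multiplied by the variable, this shows that the difference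
    quotients at 0 tend to 0. *)
Lemma flat_exp_linear_bound (p : {poly R}) : exists2 C : R, 0 <= C &
  forall h : R, h <= 1 -> `|flat_exp p h| <= C * `|h|.
Proof.
have [B B0 hB] := horner_bound p.
pose N := (size p).+1.
exists (B * N%:R ^+ N) => [|h h1]; first by rewrite mulr_ge0// exprn_ge0.
rewrite /flat_exp; case: ifPn => [h0|_]; last by rewrite normr0 mulr_ge0// mulr_ge0// exprn_ge0.
have hV : 0 < h^-1 by rewrite invr_gt0.
rewrite normrM [`|expR _|]ger0_norm ?expR_ge0// [`|h|]gtr0_norm//.
apply: (@le_trans _ _ ((B * h^-1 ^+ size p) * (N%:R / h^-1) ^+ N)).
  apply: ler_pM => //.
  - by apply: hB; rewrite -invr1 lef_pV2 ?posrE.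
  - exact: expRN_le.
rewrite invrK exprMn /N exprS exprVn.
set k := size p.
rewrite (_ : _ * _ = B * (k.+1%:R * k.+1%:R ^+ k) * (h ^+ k)^-1 * (h ^+ k.+1)); last by ring.
rewrite exprSr mulrA mulfVK// expf_neq0// gt_eqF//.
Qed.

(** The derivative of [p s * exp (- s)], [s = 1 / r], with respect to [r], is
    [flat_deriv p s * exp (- s)]. *)
Definition flat_deriv (p : {poly R}) : {poly R} := 'X^2 * (p - p^`()).

Lemma is_derive_horner (p : {poly R}) (x : R) : is_derive x 1 (horner p) p^`().[x].
Proof.
elim/poly_ind: p => [|p c IH].
  rewrite deriv0 horner0 (_ : horner 0 = cst 0); last by apply/funext => y; rewrite horner0.
  exact: is_derive_cst.
rewrite derivMXaddC hornerD hornerMX.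
rewrite (_ : horner _ = (fun y => p.[y] * y + c)); last by apply/funext => y; rewrite !hornerE.
have H := is_deriveD (is_deriveM IH (is_derive_id x 1)) (is_derive_cst c x 1).
apply: (is_derive_eq H).
by rewrite addr0 [p.[x]%:A]mulr1 [x *: _]mulrC.
Qed.

Lemma is_derive_of_cvg (f : R -> R) (r l : R) :
  h^-1 * (f (h + r) - f r) @[h --> 0^'] --> l -> is_derive r 1 f l.
Proof.
move=> H.
have {}H : h^-1 *: (f (h *: 1 + r) - f r) @[h --> 0^'] --> l.
  by rewrite (_ : (fun _ => _) = (fun h => h^-1 * (f (h + r) - f r)))//; apply/funext => h; rewrite [h *: 1]mulr1.
by apply: DeriveDef; [exact: (cvgP _ H)|exact: (cvg_lim _ H)].
Qed.

Lemma is_derive_flat_exp (p : {poly R}) (r : R) :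
  is_derive r 1 (flat_exp p) (flat_exp (flat_deriv p) r).
Proof.
have [r0|r0|r0] := ltrgtP 0 r.
- have H1 : is_derive r 1 (fun x : R => x^-1) (- r ^- 2).
    have H := @is_deriveV _ id r 1 1 (lt0r_neq0 r0) (is_derive_id r 1).
    by apply: (is_derive_eq H); rewrite [LHS]mulr1.
  have H2 : is_derive r 1 (fun x => p.[x^-1]) (p^`().[r^-1] * - r ^- 2).
    have H := @is_derive1_comp _ (horner p) (fun x : R => x^-1) r _ _ (is_derive_horner p r^-1) H1.
    exact: H.
  have H3 : is_derive r 1 (fun x : R => expR (- x^-1)) (expR (- r^-1) * r ^- 2).
    have H := @is_derive1_comp _ expR (fun x : R => - x^-1) r _ _ (is_derive_expR (- r^-1)) (is_deriveN H1).
    by apply: (is_derive_eq H); rewrite opprK.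
  have H4 := is_deriveM H2 H3.
  apply: (@near_eq_is_derive _ _ _ (fun x : R => p.[x^-1] * expR (- x^-1)) (flat_exp p)).
    by near=> x; rewrite /flat_exp ifT//; near: x; exact: lt_nbhsr.
  apply: (is_derive_eq H4); rewrite /flat_exp r0 /flat_deriv !hornerE.
  rewrite /GRing.scale/= exprVn; ring.
- apply: (@near_eq_is_derive _ _ _ (cst 0) (flat_exp p)).
    near=> x; rewrite /flat_exp ifF//; apply/negbTE; rewrite -leNgt ltW//.
    by near: x; exact: lt_nbhsl.
  rewrite /flat_exp ifF; first exact: is_derive_cst.
  by apply/negbTE; rewrite -leNgt ltW.
- rewrite -r0 {2}/flat_exp ltxx; apply: is_derive_of_cvg.
  rewrite {2}/flat_exp ltxx.
  have [C C0 hC] := flat_exp_linear_bound ('X * p).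
  apply/cvgr0Pnorm_lt => e e0; near=> h.
  have E : h^-1 * (flat_exp p (h + 0) - 0) = flat_exp ('X * p) h.
    rewrite addr0 subr0 /flat_exp; case: ifPn => _; last by rewrite mulr0.
    by rewrite hornerM hornerX mulrA.
  rewrite E; apply: (@le_lt_trans _ _ (C * `|h|)).
    apply: hC; apply: le_trans (ler_norm _) _; near: h; exact: dnbhs0_le.
  apply: (@le_lt_trans _ _ ((C + 1) * `|h|)); first by rewrite ler_wpM2r// lerDl.
  rewrite mulrC -ltr_pdivlMr ?ltr_wpDl//; near: h; apply: dnbhs0_lt.
  by rewrite divr_gt0// ltr_wpDl.
Unshelve. all: by end_near. Qed.

End smooth_line.

(** * Functions of several variables all of whose derivatives exist *)

Section smooth.
Context {R : realType} {d : nat}.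
Implicit Types (v w : 'rV[R]_d -> R) (x y z : 'rV[R]_d) (s : seq 'I_d).

(** Differentiability in every direction, which is what restriction to segments
    needs, is built in. *)
Definition full_derivative v := continuous v /\
  forall x z, is_derive x z v (\sum_i z ord0 i * pd i v x).

Definition strongly_smooth v := forall s, full_derivative (pds s v).

(** Smoothness is always proved by exhibiting a family of functions that is
    stable under partial derivatives. *)
Lemma strongly_smooth_stable (S : set ('rV[R]_d -> R)) :
  (forall v, S v -> full_derivative v) -> (forall v i, S v -> S (pd i v)) ->
  S `<=` strongly_smooth.
Proof.
move=> h1 h2 v Sv s; apply: h1.
by elim: s => // i s IH /=; exact: h2.
Qed.

Lemma strongly_smooth_pd v i : strongly_smooth v -> strongly_smooth (pd i v).
Proof.
move=> sv s; have := sv (rcons s i).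
by rewrite /pds foldr_rcons.
Qed.

Lemma strongly_smooth_full v : strongly_smooth v -> full_derivative v.
Proof. by move=> /(_ [::]). Qed.

Lemma sum_delta (F : 'I_d -> R) i :
  \sum_j (delta_mx ord0 i : 'rV[R]_d) ord0 j * F j = F i.
Proof.
rewrite (bigD1 i)//= mxE !eqxx mul1r big1 ?addr0// => j ji.
by rewrite mxE (negbTE ji) andbF mul0r.
Qed.

Lemma strongly_smooth_smooth v : strongly_smooth v -> smooth v.
Proof. by move=> sv s; have [c h] := sv s; split => // i x; have [] := h x (delta_mx ord0 i). Qed.

Lemma is_derive_pd v i x (l : R) : is_derive x (delta_mx ord0 i) v l -> pd i v x = l.
Proof. by move=> h; rewrite /pd; exact: derive_val. Qed.

Lemma full_derivativeD v w : full_derivative v -> full_derivative w ->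
  (forall i, pd i (fun x => v x + w x) = fun x => pd i v x + pd i w x) /\
  full_derivative (fun x => v x + w x).
Proof.
move=> [cv hv] [cw hw].
have E i : pd i (fun x => v x + w x) = fun x => pd i v x + pd i w x.
  apply/funext => x; apply: is_derive_pd.
  have H := is_deriveD (hv x (delta_mx ord0 i)) (hw x (delta_mx ord0 i)).
  by apply: (is_derive_eq H); rewrite !sum_delta.
split=> //; split; first by move=> x; exact: (continuousD (cv x) (cw x)).
move=> x z; have H := is_deriveD (hv x z) (hw x z).
apply: (is_derive_eq H); rewrite -big_split/=; apply: eq_bigr => i _.
by rewrite E mulrDr.
Qed.

Lemma full_derivativeM v w : full_derivative v -> full_derivative w ->
  (forall i, pd i (fun x => v x * w x) = fun x => v x * pd i w x + w x * pd i v x) /\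
  full_derivative (fun x => v x * w x).
Proof.
move=> [cv hv] [cw hw].
have E i : pd i (fun x => v x * w x) = fun x => v x * pd i w x + w x * pd i v x.
  apply/funext => x; apply: is_derive_pd.
  have H := is_deriveM (hv x (delta_mx ord0 i)) (hw x (delta_mx ord0 i)).
  by apply: (is_derive_eq H); rewrite !sum_delta.
split=> //; split; first by move=> x; exact: (continuousM (cv x) (cw x)).
move=> x z; have H := is_deriveM (hv x z) (hw x z).
apply: (is_derive_eq H); rewrite ![_ *: _]mulr_sumr -big_split/=; apply: eq_bigr => i _.
rewrite E; ring.
Qed.

Lemma full_derivative_cst (c : R) :
  (forall i, pd i (fun=> c : R) = (fun=> 0) :> ('rV[R]_d -> R)) /\ full_derivative (fun=> c).
Proof.
have E i : pd i (fun=> c : R) = (fun=> 0) :> ('rV[R]_d -> R).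
  by apply/funext => x; apply: is_derive_pd; exact: is_derive_cst.
split=> //; split; first exact: cst_continuous.
move=> x z; rewrite big1; first exact: is_derive_cst.
by move=> i _; rewrite E mulr0.
Qed.

Lemma is_derive_line v x z (l : R) :
  is_derive (0 : R) 1 (fun h : R => v (h *: z + x)) l -> is_derive x z v l.
Proof.
move=> [h1 h2].
have E : (fun h : R => h^-1 *: ((v \o shift x) (h *: z) - v x)) =
         (fun h : R => h^-1 *: (((fun h : R => v (h *: z + x)) \o shift 0) (h *: (1:R)) - (fun h : R => v (h *: z + x)) 0)).
  by apply/funext => h /=; rewrite [h *: 1]mulr1 addr0 scale0r add0r.
by apply: DeriveDef; [rewrite /derivable E|rewrite /derive E].
Qed.

Lemma is_derive_on_line v x z (l : R) :
  is_derive x z v l -> is_derive (0 : R) 1 (fun h : R => v (h *: z + x)) l.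
Proof.
move=> [h1 h2].
have E : (fun h : R => h^-1 *: ((v \o shift x) (h *: z) - v x)) =
         (fun h : R => h^-1 *: (((fun h : R => v (h *: z + x)) \o shift 0) (h *: (1:R)) - (fun h : R => v (h *: z + x)) 0)).
  by apply/funext => h /=; rewrite [h *: 1]mulr1 addr0 scale0r add0r.
by apply: DeriveDef; [rewrite /derivable -E|rewrite /derive -E].
Qed.

Lemma full_derivative_coord j :
  (forall i, pd i (fun x => x ord0 j) = fun=> (i == j)%:R) /\ full_derivative (fun x => x ord0 j).
Proof.
have D x z : is_derive x z (fun x => x ord0 j) (z ord0 j).
  apply: is_derive_line.
  have H := is_deriveD (is_deriveM (@is_derive_id R R^o 0 1) (@is_derive_cst R R^o R^o (z ord0 j) 0 1)) (@is_derive_cst R R^o R^o (x ord0 j) 0 1).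
  rewrite (_ : (fun _ => _) = (fun h : R => h * z ord0 j + x ord0 j)); last by apply/funext => h; rewrite !mxE.
  by apply: (is_derive_eq H); rewrite addr0 scaler0 add0r [LHS]mulr1.
have E i : pd i (fun x => x ord0 j) = fun=> (i == j)%:R.
  by apply/funext => x; apply: is_derive_pd; apply: (is_derive_eq (D _ _)); rewrite mxE eqxx eq_sym.
split=> //; split; first by move=> x; exact: coord_continuous.
move=> x z; apply: (is_derive_eq (D _ _)).
rewrite (bigD1 j)//= E eqxx mulr1 big1 ?addr0// => i ij.
by rewrite E (negbTE ij) mulr0.
Qed.

Lemma full_derivative_comp (G G' : R -> R) v :
  (forall r : R, is_derive r 1 G (G' r)) -> full_derivative v ->
  (forall i, pd i (G \o v) = fun x => G' (v x) * pd i v x) /\ full_derivative (G \o v).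
Proof.
move=> hG [cv hv].
have D x z : is_derive x z (G \o v) (G' (v x) * \sum_i z ord0 i * pd i v x).
  apply: is_derive_line.
  have hG0 : is_derive (v (0 *: z + x)) 1 G (G' (v x)) by rewrite scale0r add0r.
  have H := @is_derive1_comp _ G (fun h : R => v (h *: z + x)) 0 _ _ hG0 (is_derive_on_line (hv x z)).
  exact: H.
have E i : pd i (G \o v) = fun x => G' (v x) * pd i v x.
  by apply/funext => x; apply: is_derive_pd; apply: (is_derive_eq (D _ _)); rewrite sum_delta.
split=> //; split.
  move=> x; apply: continuous_comp; first exact: cv.
  by apply: differentiable_continuous; apply/derivable1_diffP; have [] := hG (v x).
move=> x z; apply: (is_derive_eq (D _ _)); rewrite mulr_sumr; apply: eq_bigr => i _.
by rewrite E mulrCA.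
Qed.

(** Such a family, closed under the operations by which all test functions and
    mollifiers are built. *)
Inductive smooth_expr : ('rV[R]_d -> R) -> Prop :=
| SmoothBase v : strongly_smooth v -> smooth_expr v
| SmoothCst c : smooth_expr (fun=> c)
| SmoothCoord j : smooth_expr (fun x => x ord0 j)
| SmoothAdd v w : smooth_expr v -> smooth_expr w -> smooth_expr (fun x => v x + w x)
| SmoothMul v w : smooth_expr v -> smooth_expr w -> smooth_expr (fun x => v x * w x)
| SmoothFlat p v : smooth_expr v -> smooth_expr (flat_exp p \o v).

Lemma smooth_expr_strongly_smooth v : smooth_expr v -> strongly_smooth v.
Proof.
apply: strongly_smooth_stable => {}v.
  elim=> {v}.
  - by move=> v; exact: strongly_smooth_full.
  - by move=> c; have [] := full_derivative_cst c.
  - by move=> j; have [] := full_derivative_coord j.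
  - by move=> v w _ hv _ hw; have [] := full_derivativeD hv hw.
  - by move=> v w _ hv _ hw; have [] := full_derivativeM hv hw.
  - by move=> p v _ hv; have [] := full_derivative_comp (is_derive_flat_exp p) hv.
move=> i; suff : smooth_expr v -> full_derivative v /\ smooth_expr (pd i v) by move=> h /h[].
elim=> {v}.
- move=> v sv; split; first exact: strongly_smooth_full.
  by apply: SmoothBase; exact: strongly_smooth_pd.
- by move=> c; have [E h] := full_derivative_cst c; split => //; rewrite E; exact: SmoothCst.
- by move=> j; have [E h] := full_derivative_coord j; split => //; rewrite E; exact: SmoothCst.
- move=> v w sv [hv pv] sw [hw pw]; have [E h] := full_derivativeD hv hw; split => //.
  by rewrite E; exact: SmoothAdd.
- move=> v w sv [hv pv] sw [hw pw]; have [E h] := full_derivativeM hv hw; split => //.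
  by rewrite E; apply: SmoothAdd; exact: SmoothMul.
- move=> p v sv [hv pv]; have [E h] := full_derivative_comp (is_derive_flat_exp p) hv; split => //.
  by rewrite E; apply: SmoothMul => //; exact: (SmoothFlat (flat_deriv p)).
Qed.

End smooth.

(** * Integration by parts and the uniqueness of weak derivatives *)

Section integration_by_parts.
Context {R : realType} {d : nat}.
Local Notation mu := (leb d : {sigma_finite_measure set 'rV[R]_d -> \bar R}).
Implicit Types (v w : 'rV[R]_d -> R) (x y z : 'rV[R]_d) (K Om : set 'rV[R]_d).

Lemma continuous_translate (z : 'rV[R]_d) : continuous (fun x : 'rV[R]_d => x + z).
Proof.
move=> x; exact: (@cvgD R 'rV[R]_d _ (nbhs x) (nbhs_filter x) id (cst z) x z (@cvg_id _ _) (@cvg_cst _ _ _ _ _)).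
Qed.

Lemma compact_support_bounded v K : continuous v -> compact K ->
  (forall x, ~ K x -> v x = 0) -> exists2 M : R, 0 <= M & forall x, `|v x| <= M.
Proof.
move=> cv cK vK.
have /compact_bounded[M [_ hM]] : compact (v @` K).
  by apply: continuous_compact => //; exact: continuous_subspaceT.
exists (`|M| + 1) => [|x]; first by rewrite addr_ge0.
have [Kx|/vK ->] := pselect (K x); last by rewrite normr0 addr_ge0.
by apply: (hM (`|M| + 1)); [rewrite (le_lt_trans (ler_norm _))// ltrDl|exists x].
Qed.

Lemma compact_in_box K : compact K -> exists2 N : R, 0 <= N & K `<=` box (\row_i - N) (\row_i N).
Proof.
move=> /compact_bounded[M [_ hM]]; exists (`|M| + 1); first by rewrite addr_ge0.
move=> x Kx i; rewrite in_itv/= !mxE -ler_norml.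
apply: le_trans (norm_coord_le _ _) _.
by apply: (hM (`|M| + 1)) => //; rewrite (le_lt_trans (ler_norm _))// ltrDl.
Qed.

Lemma integrable_cst_indicator A (c : R) : measurable A -> (mu A < +oo)%E ->
  mu.-integrable setT (EFin \o (fun x => c * \1_A x)).
Proof.
move=> mA Ay.
have : mu.-integrable A (EFin \o cst c).
  apply: measurable_bounded_integrable => //.
  rewrite /bounded_near; near=> M => x _ /=.
  by near: M; apply: nbhs_pinfty_ge; exact: num_real.
move/(integrable_mkcond _ mA); apply: eq_integrable => // x _.
by rewrite /patch /= indicE; case: (x \in A); rewrite ?mulr1 ?mulr0.
Unshelve. all: by end_near.
Qed.

Lemma leb_box_lty (a b : 'rV[R]_d) : (mu (box a b) < +oo)%E.
Proof.
have [ab|/existsNP[i /negP abi]] := pselect (forall i, a ord0 i <= b ord0 i).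
  by rewrite leb_boxE// ltry.
rewrite (_ : box a b = set0) ?measure0//; apply/seteqP; split => // x /(_ i).
by rewrite in_itv/= => /andP[h1 h2]; move: abi; rewrite (le_trans h1 h2).
Qed.

Lemma integrable_compact_support v K : continuous v -> compact K ->
  (forall x, ~ K x -> v x = 0) -> mu.-integrable setT (EFin \o v).
Proof.
move=> cv cK vK; have [M M0 hM] := compact_support_bounded cv cK vK.
have [N N0 hN] := compact_in_box cK.
apply: (@le_integrable _ _ _ mu setT measurableT _ (EFin \o (fun x => M * \1_(box (\row_i - N) (\row_i N)) x))).
- by apply/measurable_EFinP; exact: continuous_measurable_rV.
- move=> x _ /=; rewrite lee_fin indicE.
  have [/hN Kx|/vK ->] := pselect (K x); first by rewrite mem_set// mulr1 (le_trans (hM x))// ler_norm.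
  by rewrite normr0.
- by apply: integrable_cst_indicator; [exact: measurable_box|exact: leb_box_lty].
Qed.

Lemma pd_support v K i : closed K -> (forall x, ~ K x -> v x = 0) ->
  forall x, ~ K x -> pd i v x = 0.
Proof.
move=> cK vK x Kx; apply: is_derive_pd.
apply: (@near_eq_is_derive _ _ _ (cst 0) v).
have : \forall y \near x, (~` K) y by apply: open_nbhs_nbhs; split => //; exact: closed_openC.
by apply: filterS => y /vK ->.
Qed.

(** Translating [v] does not change its integral; the derivative of this constant
    function of the translation is the integral of the partial derivative. *)
Lemma integral_pd0 v K i : compact K -> (forall x, ~ K x -> v x = 0) ->
  continuous v -> continuous (pd i v) ->
  (forall x, derivable v x (delta_mx ord0 i)) ->
  \int[mu]_x pd i v x = 0.
Proof.
move=> cK vK cv cdv dv.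
have clK : closed K by apply: compact_closed => //; exact: norm_hausdorff.
have dvK := pd_support i clK vK.
have [L L0 hL] := compact_support_bounded cdv cK dvK.
have [N N0 hN] := compact_in_box cK.
pose e : 'rV[R]_d := delta_mx ord0 i.
pose B := box (\row_(_ < d) - (N + 1)) (\row_(_ < d) (N + 1)).
have mB : measurable B by exact: measurable_box.
pose f (h : R) x := v (x + h *: e).
have mT (g : 'rV[R]_d -> R) : continuous g -> measurable_fun setT (EFin \o g).
  by move=> cg; apply/measurable_EFinP; exact: continuous_measurable_rV.
have F_cst h : (\int[mu]_x f h x)%R = (\int[mu]_x v x)%R.
  congr fine; exact: (@integral_translate _ _ (h *: e) (EFin \o v) (mT _ cv)).
have line (h : R) x : is_derive h (1 : R) (f ^~ x) (pd i v (x + h *: e)).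
  have [d1 d2] : is_derive (x + h *: e) e v (pd i v (x + h *: e)) by apply: DeriveDef => //; exact: dv.
  have E : (fun t : R => t^-1 *: ((v \o shift (x + h *: e)) (t *: e) - v (x + h *: e))) =
      (fun t : R => t^-1 *: (((f ^~ x) \o shift h) (t *: (1:R)) - f h x)).
    by apply/funext => t /=; rewrite /f [t *: 1]mulr1 scalerDl addrCA.
  by apply: DeriveDef; [rewrite /derivable -E|rewrite /derive -E].
have intf h : `]-1, 1[%classic h -> mu.-integrable setT (EFin \o f h).
  move=> _; apply: (@integrable_compact_support _ ((fun x => x - h *: e) @` K)).
  - move=> x; apply: continuous_comp; last exact: cv.
    exact: continuous_translate.
  - apply: continuous_compact => //; apply: continuous_subspaceT.
    exact: continuous_translate.
  - move=> x nx; rewrite /f vK// => Kx; apply: nx; exists (x + h *: e) => //.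
    by rewrite addrK.
have H := @differentiation_under_integral R _ _ mu f setT measurableT 0 (-1) 1 _ intf _ (fun x => L * \1_B x) _ _ _.
have {}H : (fun h => \int[mu]_x f h x)^`()%classic 0 = \int[mu]_x ((partial1of2 f) ^~ x) 0.
  apply: H.
  - by rewrite /= in_itv/= ltrN10 ltr01.
  - by move=> x y _ _; have [] := line x y.
  - by move=> y; rewrite mulr_ge0.
  - apply: integrable_cst_indicator => //; exact: leb_box_lty.
  - move=> h y; rewrite /= in_itv/= => /andP[h1 h2] _.
    rewrite partial1of2E (derive_val (is_derive := line h y)) indicE.
    have [Bx|nBx] := pselect (B y); first by rewrite mem_set// mulr1.
    rewrite memNset// mulr0 dvK ?normr0// => /hN Kb; apply: nBx => j.
    have := Kb j; rewrite !in_itv/= !mxE/=.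
    have : -1 <= h * (j == i)%:R <= 1 by case: (j == i); rewrite ?mulr1 ?mulr0; lra.
    move: (h * _) => t /andP[a1 a2] /andP[a3 a4]; apply/andP; split; lra.
have : (fun h => \int[mu]_x f h x)^`()%classic 0 = 0.
  rewrite (_ : (fun h => _) = cst (\int[mu]_x v x)); last by apply/funext => h; rewrite F_cst.
  by rewrite derive1_cst.
rewrite H => <-; apply: eq_Rintegral => x _.
by rewrite partial1of2E (derive_val (is_derive := line 0 x)) scale0r addr0.
Qed.

Definition C1 v := continuous v /\
  forall i, continuous (pd i v) /\ forall x, derivable v x (delta_mx ord0 i).

Lemma strongly_smooth_C1 v : strongly_smooth v -> C1 v.
Proof.
move=> sv; have [cv dv] := strongly_smooth_full sv; split => // i; split.
  by have [] := strongly_smooth_full (strongly_smooth_pd i sv).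
by move=> x; have [] := dv x (delta_mx ord0 i).
Qed.

Lemma smooth_C1 v : smooth v -> C1 v.
Proof.
move=> sv; have [cv dv] := sv [::]; split=> // i; split; last exact: dv.
by have [] := sv [:: i].
Qed.

Lemma C1M v w : C1 v -> C1 w ->
  (forall i, pd i (fun x => v x * w x) = fun x => v x * pd i w x + w x * pd i v x) /\
  C1 (fun x => v x * w x).
Proof.
move=> [cv hv] [cw hw].
have D i x : is_derive x (delta_mx ord0 i) (fun x => v x * w x) (v x * pd i w x + w x * pd i v x).
  have [_ /(_ x) dv] := hv i; have [_ /(_ x) dw] := hw i.
  have H := is_deriveM (DeriveDef dv erefl) (DeriveDef dw erefl).
  exact: H.
have E i : pd i (fun x => v x * w x) = fun x => v x * pd i w x + w x * pd i v x.
  by apply/funext => x; apply: is_derive_pd.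
split; first exact: E.
split; first by move=> x; exact: (continuousM (cv x) (cw x)).
move=> i; split; last by move=> x; have [] := D i x.
rewrite E => x; have [cdv _] := hv i; have [cdw _] := hw i.
exact: (continuousD (continuousM (cv x) (cdw x)) (continuousM (cw x) (cdv x))).
Qed.

Lemma test_function_pd phi i Om : test_function Om phi -> test_function Om (pd i phi).
Proof.
move=> [sp [K cK [KO hK]]]; split.
  by move=> s; have := sp (rcons s i); rewrite /pds foldr_rcons.
exists K => //; split => //; apply: pd_support => //.
by apply: compact_closed => //; exact: norm_hausdorff.
Qed.

Lemma ip_test_T v phi Om : (forall x, ~ Om x -> phi x = 0) ->
  ip Om v phi = \int[mu]_x (v x * phi x).
Proof.
move=> h; rewrite /ip Rintegral_mkcond; congr (fine (integral _ _ _)).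
apply/funext => x; rewrite /= /patch; case: ifPn => //.
by rewrite notin_setE => /h ->; rewrite mulr0.
Qed.

Lemma test_function_zero phi Om : test_function Om phi -> forall x, ~ Om x -> phi x = 0.
Proof. by move=> [_ [K _ [KO hK]]] x nOx; apply: hK => /KO. Qed.

Lemma ip_by_parts v phi i Om : C1 v -> test_function Om phi ->
  ip Om v (pd i phi) = - ip Om (pd i v) phi.
Proof.
move=> Cv tp; have [sp [K cK [KO hK]]] := tp.
rewrite !ip_test_T; [|exact: test_function_zero|apply: test_function_zero; exact: test_function_pd].
have Cp := smooth_C1 sp.
have [E [cvp dvp]] := C1M Cv Cp.
have clK : closed K by apply: compact_closed => //; exact: norm_hausdorff.
have := @integral_pd0 (fun x => v x * phi x) K i cK.
rewrite E => /(_ _ cvp) H.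
have {}H : \int[mu]_x (v x * pd i phi x + phi x * pd i v x) = 0.
  apply: H; [by move=> x /hK ->; rewrite mulr0| |].
  - by have [] := dvp i; rewrite E.
  - by have [] := dvp i.
have [cv /(_ i)[cdv _]] := Cv; have [cp /(_ i)[cdp _]] := Cp.
apply/eqP; rewrite -addr_eq0 -RintegralD//.
- apply/eqP; rewrite -[RHS]H; apply: eq_Rintegral => x _; congr (_ + _); exact: mulrC.
- apply: (@integrable_compact_support _ K) => //; first by move=> x; exact: (continuousM (cv x) (cdp x)).
  by move=> x nK; rewrite (pd_support i clK hK)// mulr0.
- apply: (@integrable_compact_support _ K) => //; first by move=> x; exact: (continuousM (cdv x) (cp x)).
  by move=> x /hK ->; rewrite mulr0.
Qed.

End integration_by_parts.

(** * The fundamental lemma of the calculus of variations *)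

Section fundamental_lemma.
Context {R : realType} {d : nat}.
Local Notation mu := (leb d : {sigma_finite_measure set 'rV[R]_d -> \bar R}).
Implicit Types (v w : 'rV[R]_d -> R) (x y z a b : 'rV[R]_d) (K Om : set 'rV[R]_d).

Definition obox a b : set 'rV[R]_d :=
  [set x | forall i, x ord0 i \in `]a ord0 i, b ord0 i[].

Lemma measurable_obox a b : measurable (obox a b).
Proof.
rewrite (_ : obox a b = \bigcap_(i in [set: 'I_d])
    ((fun x : 'rV[R]_d => x ord0 i) @^-1` `]a ord0 i, b ord0 i[)).
  by apply: fin_bigcap_measurable => // i _; rewrite -[X in measurable X]setTI;
     exact: (measurable_coord i).
by apply/seteqP; split => x h i; [move=> _; exact: h|exact: (h i I)].
Qed.

Lemma obox_sub_box a b : obox a b `<=` box a b.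
Proof. by move=> x h i; have := h i; rewrite !in_itv/= => /andP[/ltW -> /ltW ->]. Qed.

Lemma oboxI a b a' b' : obox a b `&` obox a' b' =
  obox (\row_i Num.max (a ord0 i) (a' ord0 i)) (\row_i Num.min (b ord0 i) (b' ord0 i)).
Proof.
apply/seteqP; split => x /=.
  by move=> [h h'] i; move: (h i) (h' i); rewrite !in_itv/= !mxE gt_max lt_min => /andP[-> ->] /andP[-> ->].
by move=> h; split => i; have := h i;
  rewrite !in_itv/= !mxE gt_max lt_min => /andP[/andP[h1 h2] /andP[h3 h4]]; apply/andP.
Qed.

Lemma compact_box a b : compact (box a b).
Proof.
apply: (@rV_compact R d (fun i => `[a ord0 i, b ord0 i]%classic)) => i.
exact: segment_compact.
Qed.

Definition oboxes : set (set 'rV[R]_d) := [set A | exists a b, A = obox a b].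

Lemma oboxes_setI_closed : setI_closed oboxes.
Proof. by move=> A B [a [b ->]] [a' [b' ->]]; rewrite oboxI; eexists; eexists. Qed.

Lemma measurable_oboxesE : (measurable : set (set 'rV[R]_d)) = <<s oboxes >>.
Proof.
apply/seteqP; split; last first.
  apply: smallest_sub; first exact: sigma_algebra_measurable.
  by move=> _ [a [b ->]]; exact: measurable_obox.
rewrite measurable_boxesE; apply: smallest_sub; first exact: smallest_sigma_algebra.
move=> _ [->|[a [b ->]]]; first exact: (@measurable0 _ (g_sigma_algebraType oboxes)).
pose t (n : nat) : R := n.+1%:R^-1.
rewrite (_ : box a b = \bigcap_(n : nat) obox (\row_i (a ord0 i - t n)) (\row_i (b ord0 i + t n))).
  apply: (@bigcapT_measurable _ (g_sigma_algebraType oboxes)) => n.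
  by apply: sub_sigma_algebra; eexists; eexists.
have t0 n : 0 < t n by rewrite invr_gt0.
apply/seteqP; split => x h.
  move=> n _ i; have := h i; have := t0 n; rewrite !in_itv/= !mxE => tn /andP[h1 h2].
  by apply/andP; split; lra.
move=> i; rewrite in_itv/=; apply/andP; split; apply/ler_addgt0Pr => e e0;
  have [n _ /(_ n (leqnn n))/= hn] := near_infty_natSinv_lt (PosNum e0);
  have := h n I i; rewrite in_itv/= !mxE /t => /andP[h1 h2].
  by set r : R := n.+1%:R^-1 in hn h1 h2; lra.
by set r : R := n.+1%:R^-1 in hn h1 h2; lra.
Qed.

(** Smooth, supported in the box, and increasing to its indicator as [n] grows. *)
Definition box_bump a b (n : nat) x : R :=
  \prod_i (flat_exp 1 (n.+1%:R * (x ord0 i - a ord0 i)) * flat_exp 1 (n.+1%:R * (b ord0 i - x ord0 i))).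

Lemma flat_exp1_ge0 (r : R) : 0 <= flat_exp 1 r.
Proof. by rewrite /flat_exp; case: ifP => // _; rewrite hornerE mul1r expR_ge0. Qed.

Lemma flat_exp1_le1 (r : R) : flat_exp 1 r <= 1.
Proof.
rewrite /flat_exp; case: ifP => // r0; rewrite hornerE mul1r -expR0 ler_expR.
by rewrite oppr_le0 invr_ge0 ltW.
Qed.

Lemma flat_exp_le0 (p : {poly R}) (r : R) : r <= 0 -> flat_exp p r = 0.
Proof. by rewrite /flat_exp; case: ltP. Qed.

Lemma SmoothProd (I : Type) (r : seq I) (F : I -> 'rV[R]_d -> R) :
  (forall i, smooth_expr (F i)) -> smooth_expr (fun x => \prod_(i <- r) F i x).
Proof.
move=> h; elim: r => [|i r IH].
  by rewrite (_ : (fun _ => _) = fun=> 1); [exact: SmoothCst|apply/funext => x; rewrite big_nil].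
rewrite (_ : (fun _ => _) = fun x => F i x * \prod_(j <- r) F j x); first exact: SmoothMul.
by apply/funext => x; rewrite big_cons.
Qed.

Lemma SmoothAffine (l c : R) i : smooth_expr (fun x => l * x ord0 i + c).
Proof. by apply: SmoothAdd; [apply: SmoothMul; [exact: SmoothCst|exact: SmoothCoord]|exact: SmoothCst]. Qed.

Lemma smooth_expr_box_bump a b n : smooth_expr (box_bump a b n).
Proof.
apply: SmoothProd => i; apply: SmoothMul.
  rewrite (_ : (fun _ => _) = flat_exp 1 \o (fun x => n.+1%:R * x ord0 i + - (n.+1%:R * a ord0 i))).
    by apply: SmoothFlat; exact: SmoothAffine.
  by apply/funext => x /=; rewrite mulrBr.
rewrite (_ : (fun _ => _) = flat_exp 1 \o (fun x => (- n.+1%:R) * x ord0 i + n.+1%:R * b ord0 i)).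
  by apply: SmoothFlat; exact: SmoothAffine.
by apply/funext => x /=; rewrite mulrBr mulNr addrC.
Qed.

Lemma box_bump_ge0 a b n x : 0 <= box_bump a b n x.
Proof. by apply: prodr_ge0 => i _; rewrite mulr_ge0 ?flat_exp1_ge0. Qed.

Lemma box_bump_le1 a b n x : box_bump a b n x <= 1.
Proof.
apply: prodr_ile1 => i; rewrite mulr_ge0 ?flat_exp1_ge0//=.
by rewrite mulr_ile1 ?flat_exp1_ge0 ?flat_exp1_le1.
Qed.

Lemma box_bump_out a b n x : ~ obox a b x -> box_bump a b n x = 0.
Proof.
move=> /existsNP[i /negP]; rewrite in_itv/= negb_and -!leNgt => h.
rewrite /box_bump (bigD1 i)//=; case/orP: h => h.
  by rewrite flat_exp_le0 ?mul0r// mulr_ge0_le0// subr_le0.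
by rewrite [X in _ * X * _]flat_exp_le0 ?mulr0 ?mul0r// mulr_ge0_le0// subr_le0.
Qed.

Lemma test_function_box_bump a b n Om : box a b `<=` Om -> test_function Om (box_bump a b n).
Proof.
move=> abO; split.
  by apply/strongly_smooth_smooth/smooth_expr_strongly_smooth; exact: smooth_expr_box_bump.
exists (box a b); first exact: compact_box.
by split => // x nx; apply: box_bump_out => /obox_sub_box.
Qed.

Lemma cvg_flat_exp1 (r : R) : 0 < r -> flat_exp 1 (n.+1%:R * r) @[n --> \oo] --> (1 : R).
Proof.
move=> r0.
rewrite (_ : (fun _ => _) = (fun n => expR (- (n.+1%:R^-1 * r^-1)))); last first.
  by apply/funext => n; rewrite /flat_exp mulr_gt0// hornerE mul1r invfM.
rewrite -[X in _ --> X]expR0.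
apply: (@cvg_comp _ _ _ (fun n : nat => - (n.+1%:R^-1 * r^-1)) expR _ (nbhs 0)); last exact: continuous_expR.
rewrite -oppr0 -[X in - X](mul0r r^-1).
apply: cvgN; apply: cvgM; last exact: cvg_cst.
exact: cvg_harmonic.
Qed.

Lemma cvg_big_prod (I : Type) (r : seq I) (F : I -> nat -> R) (l : I -> R) :
  (forall i, F i n @[n --> \oo] --> l i) ->
  (\prod_(i <- r) F i n) @[n --> \oo] --> \prod_(i <- r) l i.
Proof.
move=> h; elim: r => [|i r IH].
  by rewrite big_nil (_ : (fun _ => _) = cst 1); [exact: cvg_cst|apply/funext => n; rewrite big_nil].
rewrite big_cons (_ : (fun _ => _) = (fun n => F i n * \prod_(j <- r) F j n)); last first.
  by apply/funext => n; rewrite big_cons.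
exact: cvgM.
Qed.

Lemma cvg_box_bump a b x : box_bump a b n x @[n --> \oo] --> (\1_(obox a b) x : R).
Proof.
rewrite indicE; have [h|h] := pselect (obox a b x); last first.
  rewrite memNset// (_ : (fun n => _) = cst 0); first exact: cvg_cst.
  by apply/funext => n; rewrite box_bump_out.
rewrite mem_set//= (_ : 1%:R = \prod_(i < d) (1 : R)); last by rewrite big1.
apply: cvg_big_prod => i; rewrite -[X in _ --> X](mulr1 (1:R)).
by have := h i; rewrite in_itv/= => /andP[h1 h2]; apply: cvgM; apply: cvg_flat_exp1; rewrite subr_gt0.
Qed.

Variables (Om : set 'rV[R]_d) (mOm : measurable Om) (Omy : (mu Om < +oo)%E).

Lemma L2_integrable w : L2 Om w -> mu.-integrable Om (EFin \o w).
Proof.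
move=> lw.
have l1 : L2 Om (cst 1).
  apply: (@L2_bounded _ _ _ mOm _ 1) => //.
  by move=> x _; rewrite normr1.
have := L2_integrableM mOm lw l1.
by apply: eq_integrable => // x _ /=; rewrite mulr1.
Qed.

(** The indicator of the box is a bounded pointwise limit of test functions. *)
Lemma integral_obox0 w a b : L2 Om w ->
  (forall phi, test_function Om phi -> ip Om w phi = 0) ->
  box a b `<=` Om -> (\int[mu]_(x in obox a b) (w x)%:E = 0)%E.
Proof.
move=> lw hw abO.
have iw := L2_integrable lw.
have mw := L2_measurable mOm lw.
have mb n : measurable_fun setT (box_bump a b n).
  by apply: continuous_measurable_rV; have [] := strongly_smooth_full (smooth_expr_strongly_smooth (smooth_expr_box_bump a b n)).
have mf n : measurable_fun Om (fun x => (w x * box_bump a b n x)%:E).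
  by apply/measurable_EFinP; apply: measurable_funM => //; exact: measurable_funTS.
have mfl : measurable_fun Om (fun x => (w x * \1_(obox a b) x)%:E).
  apply/measurable_EFinP; apply: measurable_funM => //.
  by apply: measurable_funTS; apply: measurable_indic; exact: measurable_obox.
have ib : mu.-integrable Om (fun x => `|w x|%:E).
  by have := integrable_abse iw; apply: eq_integrable.
have dom_cvg x : ((w x * box_bump a b n x)%:E @[n --> \oo] --> (w x * \1_(obox a b) x)%:E)%E.
  apply/fine_cvgP; split; first exact: nearW.
  by apply: cvgM; [exact: cvg_cst|exact: cvg_box_bump].
have dom_le x n : (`|(w x * box_bump a b n x)%:E| <= `|w x|%:E)%E.
  rewrite lee_fin normrM ler_piMr// ger0_norm ?box_bump_ge0//.
  exact: box_bump_le1.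
have [_ _ H] := @dominated_convergence _ _ _ mu Om mOm (fun n x => (w x * box_bump a b n x)%:E)
  (fun x => (w x * \1_(obox a b) x)%:E) (fun x => `|w x|%:E) mf mfl
  (aeW _ (fun x _ => dom_cvg x)) ib (aeW _ (fun x n _ => dom_le x n)).
have E0 n : (\int[mu]_(x in Om) (w x * box_bump a b n x)%:E = 0)%E.
  rewrite -[RHS]/(0%:E) -(hw _ (test_function_box_bump n abO)) /ip /Rintegral fineK//.
  apply: integrable_fin_num => //; apply: (@le_integrable _ _ _ mu Om mOm _ _ (mf n) _ iw).
  move=> x _; rewrite lee_fin normrM ler_piMr// ger0_norm ?box_bump_ge0//.
  exact: box_bump_le1.
have {}H : (\int[mu]_(x in Om) (w x * \1_(obox a b) x)%:E = 0)%E.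
  rewrite -(cvg_lim _ H)// (_ : (fun n => _) = cst 0%E) ?lim_cst//.
  by apply/funext => n; exact: E0.
rewrite -[RHS]H [LHS]integral_mkcond [RHS]integral_mkcond; apply: eq_integral => x _.
rewrite /patch indicE; have [xb|xb] := pselect (obox a b x).
  by rewrite !mem_set ?mulr1//; exact/abO/obox_sub_box.
by rewrite memNset// mulr0; case: ifP.
Qed.

(** The integrals of [w] vanish on smaller boxes, hence on all measurable
    subsets by Dynkin's theorem. *)
Lemma zero_ae_obox w a b : L2 Om w ->
  (forall phi, test_function Om phi -> ip Om w phi = 0) ->
  box a b `<=` Om -> w = (fun=> 0) %[ae mu in obox a b].
Proof.
move=> lw hw abO; set D := obox a b.
have mD : measurable D by exact: measurable_obox.
have DO : D `<=` Om by move=> x /obox_sub_box /abO.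
have iw : mu.-integrable D (EFin \o w) by apply: integrableS (L2_integrable lw).
have key A : measurable A -> (\int[mu]_(x in A `&` D) (w x)%:E = 0)%E.
  rewrite {1}measurable_oboxesE; move: A; apply: (dynkin_induction measurable_oboxesE oboxes_setI_closed).
  - by rewrite setTI; exact: integral_obox0.
  - move=> _ [a' [b' ->]]; rewrite oboxI; apply: integral_obox0 => //.
    rewrite -boxI; exact: subIset (or_intror abO).
  - move=> S mS h.
    have : (\int[mu]_(x in D) (w x)%:E = 0)%E by exact: integral_obox0.
    rewrite {1}(_ : D = (S `&` D) `|` (~` S `&` D)); last by rewrite -setIUl setUv setTI.
    rewrite integral_setU; first by rewrite h add0e.
    + exact: measurableI.
    + by apply: measurableI => //; exact: measurableC.
    + by rewrite -setIUl setUv setTI; exact: (measurable_int _ iw).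
    + by apply/disj_setPS => x [[Sx _] []].
  - move=> F mF tF h; rewrite setI_bigcupl integral_bigcup//.
    + by rewrite eseries0.
    + by apply: trivIset_setIr.
    + by move=> k; exact: measurableI.
    + apply: integrableS iw => //; last by move=> x [k _ []].
      by apply: bigcupT_measurable => k; exact: measurableI.
have H : ae_eq mu D (EFin \o w) (cst 0%E).
  apply: integral_ae_eq => // E ED mE.
  by rewrite integral0 -(key E mE) setIidl.
by apply: filterS H => x /[apply] -[].
Qed.

(** Countably many boxes cover [Om], by [rat_box_nbhs]. *)
Lemma fundamental_lemma w : open Om -> L2 Om w ->
  (forall phi, test_function Om phi -> ip Om w phi = 0) -> w = (fun=> 0) %[ae mu in Om].
Proof.
move=> oO lw hw.
pose F (k : nat) : set 'rV[R]_d := if unpickle k is Some p then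
  (if `[< box (rat_lo p) (rat_hi p) `<=` Om >] then
     ~` [set x | obox (rat_lo p) (rat_hi p) x -> w x = 0] else set0) else set0.
have nF k : mu.-negligible (F k).
  rewrite /F; case: unpickle => [p|]; last exact: negligible_set0.
  case: asboolP => [pO|_]; last exact: negligible_set0.
  exact: zero_ae_obox.
apply: negligibleS (negligible_bigcup nF) => x /= /not_implyP[Ox wx].
have [p px pO] := rat_box_nbhs oO Ox.
exists (pickle p) => //; rewrite /F pickleK; case: asboolP => // _ /= h.
by apply: wx; apply: h => i; rewrite in_itv/=.
Qed.

End fundamental_lemma.

(** * Weak derivatives *)

Section weak_derivatives.
Context {R : realType} {d : nat} (Om : set 'rV[R]_d).
Hypotheses (oOm : open Om) (bOm : bounded_set Om).
Local Notation mu := (leb d : {sigma_finite_measure set 'rV[R]_d -> \bar R}).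
Implicit Types (v w : 'rV[R]_d -> R) (tau psi : 'rV[R]_d -> 'rV[R]_d).

Let mOm : measurable Om. Proof. exact: open_measurable_rV. Qed.
Let Omy : (mu Om < +oo)%E. Proof. exact: leb_bounded_lty. Qed.

Lemma continuous_bounded_on v : continuous v -> exists2 M : R, 0 <= M & forall x, Om x -> `|v x| <= M.
Proof.
move=> cv; have [M [_ hM]] := bOm.
pose N := `|M| + 1.
have OB : Om `<=` box (\row_i - N) (\row_i N).
  move=> x /(hM N) h i; rewrite in_itv/= !mxE -ler_norml.
  by apply: le_trans (h _); [exact: norm_coord_le|rewrite /N (le_lt_trans (ler_norm _))// ltrDl].
have /compact_bounded[L [_ hL]] : compact (v @` box (\row_i - N) (\row_i N)).
  by apply: continuous_compact; [exact: continuous_subspaceT|exact: compact_box].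
exists (`|L| + 1) => [|x /OB Bx]; first by rewrite addr_ge0.
by apply: (hL (`|L| + 1)); [rewrite (le_lt_trans (ler_norm _))// ltrDl|exists x].
Qed.

Lemma L2_continuous_fun v : continuous v -> L2 Om v.
Proof.
move=> cv; have [M M0 hM] := continuous_bounded_on cv.
apply: (@L2_bounded _ _ _ mOm v M) => //.
by apply: measurable_funTS; exact: continuous_measurable_rV.
Qed.

Lemma L2_test phi : test_function Om phi -> L2 Om phi.
Proof. by move=> [/(_ [::])[cp _] _]; exact: L2_continuous_fun. Qed.

Lemma L2v_grad_test phi : test_function Om phi -> L2v Om (fun x => \row_i pd i phi x).
Proof.
move=> tp i; rewrite (_ : coordf _ i = pd i phi); last by apply/funext => x; rewrite /coordf mxE.
exact: L2_test (test_function_pd i tp).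
Qed.

Lemma ipv_grad_test tau phi : L2v Om tau -> test_function Om phi ->
  ipv Om tau (fun x => \row_i pd i phi x) = \sum_i ip Om (coordf tau i) (pd i phi).
Proof.
move=> lt tp; rewrite ipvE//; last exact: L2v_grad_test.
by apply: eq_bigr => i _; congr ip; apply/funext => x; rewrite /coordf mxE.
Qed.

Lemma L2_eq_ae v w : L2 Om v -> L2 Om w ->
  (forall phi, test_function Om phi -> ip Om v phi = ip Om w phi) -> v = w %[ae mu in Om].
Proof.
move=> lv lw h.
have : (fun x => v x - w x) = (fun=> 0) %[ae mu in Om].
  apply: fundamental_lemma => //; first exact: L2B.
  by move=> phi tp; rewrite ipBl ?h ?subrr//; exact: L2_test.
by apply: filterS => x /[apply] /eqP; rewrite subr_eq0 => /eqP.
Qed.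

Lemma is_div_unique tau w w' : is_div Om tau w -> is_div Om tau w' -> w = w' %[ae mu in Om].
Proof.
move=> [lw hw] [lw' hw']; apply: L2_eq_ae => // phi tp.
by apply: oppr_inj; rewrite -hw// -hw'.
Qed.

Lemma divP tau : Hdiv Om tau -> is_div Om tau (div Om tau).
Proof. by move=> [_ [w hw]]; rewrite /div; apply: (@getPex _ [set w | is_div Om tau w]); exists w. Qed.

Lemma L2_div tau : Hdiv Om tau -> L2 Om (div Om tau).
Proof. by move=> /divP[]. Qed.

Lemma is_div_div tau w : L2v Om tau -> is_div Om tau w -> Hdiv Om tau /\ div Om tau = w %[ae mu in Om].
Proof.
move=> lt hw; have ht : Hdiv Om tau by split => //; exists w.
by split=> //; apply: is_div_unique hw; exact: divP.
Qed.

Lemma is_divB tau psi w w' : L2v Om tau -> L2v Om psi -> is_div Om tau w -> is_div Om psi w' ->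
  is_div Om (fun x => tau x - psi x) (fun x => w x - w' x).
Proof.
move=> lt lp [lw hw] [lw' hw']; split; first exact: L2B.
move=> phi tp; rewrite ipvBl//; last exact: L2v_grad_test.
by rewrite hw// hw'// ipBl//; [ring|exact: L2_test].
Qed.

Lemma HdivB tau psi : Hdiv Om tau -> Hdiv Om psi ->
  Hdiv Om (fun x => tau x - psi x) /\
  div Om (fun x => tau x - psi x) = (fun x => div Om tau x - div Om psi x) %[ae mu in Om].
Proof.
move=> ht hp; have [lt _] := ht; have [lp _] := hp.
by apply: is_div_div; [exact: L2vB|apply: is_divB => //; exact: divP].
Qed.

Lemma ip_ae_L2 v v' w : L2 Om v -> L2 Om v' -> L2 Om w -> v = v' %[ae mu in Om] -> ip Om v w = ip Om v' w.
Proof. by move=> lv lv' lw; apply: ip_ae => //; exact: L2_measurable. Qed.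

Lemma ip_divB tau psi v : Hdiv Om tau -> Hdiv Om psi -> L2 Om v ->
  ip Om (div Om (fun x => tau x - psi x)) v = ip Om (div Om tau) v - ip Om (div Om psi) v.
Proof.
move=> ht hp lv; have [h e] := HdivB ht hp.
have lt := L2_div ht; have lp := L2_div hp.
by rewrite (ip_ae_L2 (L2_div h) (L2B mOm lt lp) lv e) ipBl.
Qed.

Lemma is_wderiv_unique s v w w' : is_wderiv Om s v w -> is_wderiv Om s v w' -> w = w' %[ae mu in Om].
Proof.
move=> [lw hw] [lw' hw']; apply: L2_eq_ae => // phi tp.
by have := hw _ tp; rewrite hw'// => /(mulfI (negbT (signr_eq0 R (size s)))) ->.
Qed.

Lemma wderivP s v : (exists w, is_wderiv Om s v w) -> is_wderiv Om s v (wderiv Om s v).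
Proof. by move=> [w hw]; rewrite /wderiv; apply: (@getPex _ [set w | is_wderiv Om s v w]); exists w. Qed.

Lemma Hsob1_L2v_grad v : Hsob Om 1 v -> L2v Om (grad Om v).
Proof.
move=> [lv hv] i; rewrite (_ : coordf _ i = wderiv Om [:: i] v); last by apply/funext => x; rewrite /coordf mxE.
by have [] := wderivP (hv [:: i] isT).
Qed.

Lemma C1_wderiv v i : C1 v -> is_wderiv Om [:: i] v (pd i v).
Proof.
move=> Cv; split; first by apply: L2_continuous_fun; have [_ /(_ i)[]] := Cv.
by move=> phi tp /=; rewrite ip_by_parts// expr1 mulN1r.
Qed.

Lemma C1_Hsob1 v : C1 v -> Hsob Om 1 v.
Proof.
move=> Cv; have lv : L2 Om v by apply: L2_continuous_fun; case: Cv.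
split=> // -[_|i [_|//]].
- by exists v; split => // phi tp; rewrite expr0 mul1r.
- by exists (pd i v); exact: C1_wderiv.
Qed.

Lemma ipv_grad_C1 tau v : L2v Om tau -> C1 v ->
  ipv Om tau (grad Om v) = \sum_i ip Om (coordf tau i) (pd i v).
Proof.
move=> lt Cv; have lg := Hsob1_L2v_grad (C1_Hsob1 Cv).
rewrite ipvE//; apply: eq_bigr => i _; rewrite ipC [RHS]ipC.
have lp : L2 Om (pd i v) by apply: L2_continuous_fun; have [_ /(_ i)[]] := Cv.
apply: ip_ae_L2 => //.
rewrite (_ : coordf _ i = wderiv Om [:: i] v); last by apply/funext => x; rewrite /coordf mxE.
by apply: (@is_wderiv_unique [:: i] v); [apply: wderivP; exists (pd i v)|]; exact: C1_wderiv.
Qed.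

Variable bc : boundary_case.

Lemma spaceM_Hdiv tau : spaceM Om bc tau -> Hdiv Om tau.
Proof. by rewrite /spaceM; case: bc => // -[]. Qed.

Lemma spaceM_B tau psi : spaceM Om bc tau -> spaceM Om bc psi -> spaceM Om bc (fun x => tau x - psi x).
Proof.
rewrite /spaceM; case: bc => [ht hp|[ht h0] [hp h0']]; first by have [] := HdivB ht hp.
have [hB eB] := HdivB ht hp; split; [exact: hB|move=> v hv].
have lv : L2 Om v by case: hv.
have lg := Hsob1_L2v_grad hv.
have [lt _] := ht; have [lp _] := hp.
rewrite ipvBl// ip_divB//.
have := h0 v hv; have := h0' v hv.
by move: (ipv _ _ _) (ipv _ _ _) (ip _ _ _) (ip _ _ _) => a1 a2 a3 a4; lra.
Qed.

End weak_derivatives.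

(** * Continuity of dilations and translations in the mean *)

Section affine_continuity.
Context {R : realType} {d : nat}.
Local Notation mu := (leb d : {sigma_finite_measure set 'rV[R]_d -> \bar R}).
Implicit Types (f g v w : 'rV[R]_d -> R) (x y z a b : 'rV[R]_d).
Local Notation L2T := (@L2 R d setT).
Local Notation mT := (@measurableT _ 'rV[R]_d).

Definition sqn f : R := ip setT f f.

Lemma sqn_ge0 f : 0 <= sqn f.
Proof. exact: ip_ge0. Qed.

Lemma sqnD_le f g : L2T f -> L2T g -> sqn (fun x => f x + g x) <= 2 * sqn f + 2 * sqn g.
Proof.
move=> lf lg; rewrite /sqn (ipDD mT lf lg).
have := @ip_young _ _ _ mT 1 f g ltr01 lf lg.
by rewrite invr1 !mul1r; move: (ip setT f f) (ip setT f g) (ip setT g g) => p q r; lra.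
Qed.

Lemma sqnZ (c : R) f : L2T f -> sqn (fun x => c * f x) = c ^+ 2 * sqn f.
Proof. by move=> lf; rewrite /sqn (ipZl mT) ?(ipZr mT)//; [rewrite expr2 mulrA|exact: L2Z]. Qed.

Lemma sqn_EFin f : L2T f -> (\int[mu]_x (f x ^+ 2)%:E)%E = (sqn f)%:E.
Proof. by move=> lf; rewrite -(ip_EFin mT lf lf); apply: eq_integral => x _; rewrite expr2. Qed.

Lemma measurable_comp_aff (l : R) z f : measurable_fun setT f -> measurable_fun setT (f \o aff l z).
Proof. by move=> mf; apply: measurableT_comp => //; exact: measurable_aff. Qed.

Lemma L2_comp_aff (l : R) z f : 0 < l -> L2T f ->
  L2T (f \o aff l z) /\ sqn (f \o aff l z) = l^-1 ^+ d * sqn f.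
Proof.
move=> l0 lf; have [mf _] := (L2E mT f).1 lf.
have E : (\int[mu]_x ((f \o aff l z) x ^+ 2)%:E = (l^-1 ^+ d * sqn f)%:E)%E.
  rewrite (@ge0_integral_aff _ _ l z (fun x => (f x ^+ 2)%:E))//.
  - by rewrite sqn_EFin.
  - by apply/measurable_EFinP; exact: measurable_funX.
  - by move=> x; rewrite lee_fin sqr_ge0.
have lc : L2T (f \o aff l z).
  apply/(L2E mT); split; first exact: measurable_comp_aff.
  by apply/(integrable_sqrE (measurable_comp_aff l z mf)); rewrite E ltry.
by split => //; apply: EFin_inj; rewrite -sqn_EFin.
Qed.

Definition shift_continuous f := forall e : R, 0 < e -> exists2 dl : R, 0 < dl &
  forall (l : R) z, `|l - 1| < dl -> `|z| < dl -> 0 < l ->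
    sqn (fun x => f (aff l z x) - f x) <= e.

Lemma shift_continuousD f g : L2T f -> L2T g ->
  shift_continuous f -> shift_continuous g -> shift_continuous (fun x => f x + g x).
Proof.
move=> lf lg hf hg e e0.
have e4 : 0 < e / 4 by rewrite divr_gt0.
have [d1 d10 h1] := hf _ e4; have [d2 d20 h2] := hg _ e4.
exists (Num.min d1 d2); first by rewrite lt_min d10.
move=> l z; rewrite !lt_min => /andP[l1 l2] /andP[z1 z2] l0.
have [lfa _] := L2_comp_aff z l0 lf; have [lga _] := L2_comp_aff z l0 lg.
rewrite (_ : (fun x => _) = (fun x => (f (aff l z x) - f x) + (g (aff l z x) - g x))); last first.
  by apply/funext => x; rewrite opprD addrACA.
apply: le_trans (sqnD_le (L2B mT lfa lf) (L2B mT lga lg)) _.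
have := h1 l z l1 z1 l0; have := h2 l z l2 z2 l0.
by rewrite /=; move: (sqn _) (sqn _) => p q; lra.
Qed.

Lemma shift_continuousZ (c : R) f : L2T f -> shift_continuous f -> shift_continuous (fun x => c * f x).
Proof.
move=> lf hf e e0.
have c1 : 0 < c ^+ 2 + 1 by rewrite ltr_wpDl// sqr_ge0.
have [dl dl0 h] := hf (e / (c ^+ 2 + 1)) (divr_gt0 e0 c1).
exists dl => // l z hl hz l0; have := h l z hl hz l0.
have [lfa _] := L2_comp_aff z l0 lf.
rewrite (_ : (fun x => c * _ - _) = (fun x => c * (f (aff l z x) - f x))); last by apply/funext => x; rewrite mulrBr.
rewrite sqnZ; last exact: (L2B mT lfa lf).
rewrite ler_pdivlMr// mulrC => H; apply: le_trans H.
by rewrite ler_wpM2r ?sqn_ge0// lerDl.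
Qed.

Lemma shift_continuous_approx f : L2T f ->
  (forall e : R, 0 < e -> exists g, [/\ L2T g, shift_continuous g & sqn (fun x => f x - g x) <= e]) ->
  shift_continuous f.
Proof.
move=> lf H e e0.
pose C : R := 4 * 2 ^+ d + 4.
have C0 : 0 < C by rewrite ltr_wpDl// mulr_ge0// exprn_ge0.
have e2 : 0 < e / 2 by rewrite divr_gt0.
have e4 : 0 < e / 4 by rewrite divr_gt0.
have [g [lg hg fg]] := H (e / 2 / C) (divr_gt0 e2 C0).
have [dl dl0 h] := hg (e / 4) e4.
exists (Num.min dl 2^-1); first by rewrite lt_min dl0 invr_gt0 ltr0n.
move=> l z; rewrite !lt_min => /andP[l1 l2] /andP[z1 _] l0.
have {h} := h l z l1 z1 l0.
have lfg := L2B mT lf lg.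
have [lfga Efga] := L2_comp_aff z l0 lfg.
have [lfa _] := L2_comp_aff z l0 lf; have [lga _] := L2_comp_aff z l0 lg.
rewrite (_ : (fun x => f _ - _) = (fun x => ((f \o aff l z) x - (g \o aff l z) x - (f x - g x)) + ((g \o aff l z) x - g x))); last first.
  by apply/funext => x /=; ring.
move=> h.
apply: le_trans (sqnD_le (L2B mT lfga lfg) (L2B mT lga lg)) _.
have h2 : sqn (fun x => (f \o aff l z) x - (g \o aff l z) x - (f x - g x)) <= 2 * (2 ^+ d * sqn (fun x => f x - g x)) + 2 * sqn (fun x => f x - g x).
  apply: le_trans (_ : _ <= 2 * sqn ((fun x => f x - g x) \o aff l z) + 2 * sqn (fun x => -1 * (f x - g x))) _.
    apply: le_trans (sqnD_le lfga (L2Z mT (-1) lfg)).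
    rewrite le_eqVlt; apply/orP; left; apply/eqP; congr sqn; apply/funext => x /=.
    by rewrite mulN1r.
  rewrite sqnZ// sqrrN expr1n mul1r lerD2r ler_pM2l// Efga ler_wpM2r ?sqn_ge0//.
  rewrite lerXn2r ?nnegrE ?invr_ge0 ?(ltW l0)//.
  rewrite -[leRHS]invrK lef_pV2 ?posrE ?invr_gt0//.
  by move: l2; rewrite ltr_norml => /andP[]; lra.
have h3 : C * sqn (fun x => f x - g x) <= e / 2 by rewrite -ler_pdivlMl// mulrC.
move: h h2 h3; rewrite /C.
move: (sqn _) (sqn _) (sqn _) => p q r.
move: (2 ^+ d) => t; rewrite /=; nra.
Qed.

(** The convergence also holds in the mean, by domination, and
    [shift_continuous_approx] applies. *)
Lemma shift_continuous_dominated (f_ : nat -> 'rV[R]_d -> R) f g :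
  (forall n, L2T (f_ n)) -> L2T f -> L2T g ->
  (forall n, shift_continuous (f_ n)) ->
  (forall n x, `|f_ n x| <= g x) ->
  (forall x, f_ n x @[n --> \oo] --> f x) -> shift_continuous f.
Proof.
move=> lf_ lf lg hf_ f_g cf; apply: shift_continuous_approx => // e e0.
have g0 x : 0 <= g x by exact: le_trans (f_g 0%N x).
have fg x : `|f x| <= g x.
  have h : `|f_ n x| @[n --> \oo] --> `|f x| by apply: cvg_norm; exact: cf.
  apply: (cvgr_to_le h).
  by apply: nearW => n; exact: f_g.
have [mf _] := (L2E mT f).1 lf.
have lfB n := L2B mT (lf_ n) lf.
have mfB n : measurable_fun setT (fun x => ((f_ n x - f x) ^+ 2)%:E).
  by apply/measurable_EFinP; apply: measurable_funX; have [] := (L2E mT _).1 (lfB n).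
have dom_cvg x : (((f_ n x - f x) ^+ 2)%:E @[n --> \oo] --> (0 : R)%:E)%E.
  apply/fine_cvgP; split; first exact: nearW.
  have h : (f_ n x - f x) @[n --> \oo] --> f x - f x by apply: cvgB; [exact: cf|exact: cvg_cst].
  rewrite [X in _ --> X](_ : 0 = (f x - f x) * (f x - f x)); last by rewrite subrr mulr0.
  exact: (cvgM h h).
have dom_le x n : (`|((f_ n x - f x) ^+ 2)%:E| <= ((2 * g x) ^+ 2)%:E)%E.
  rewrite lee_fin normrX lerXn2r ?nnegrE ?mulr_ge0//.
  apply: le_trans (ler_normB _ _) _.
  by have := f_g n x; have := fg x; lra.
have ig : mu.-integrable setT (fun x => ((2 * g x) ^+ 2)%:E).
  by have [_] := (L2E mT _).1 (L2Z mT 2 lg).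
have [_ _ H] := @dominated_convergence _ _ _ mu setT mT (fun n x => ((f_ n x - f x) ^+ 2)%:E)
  (fun x => (0:R)%:E) (fun x => ((2 * g x) ^+ 2)%:E) mfB (measurable_cst _)
  (aeW _ (fun x _ => dom_cvg x)) ig (aeW _ (fun x n _ => dom_le x n)).
rewrite integral0 in H.
have {}H : sqn (fun x => f_ n x - f x) @[n --> \oo] --> (0 : R).
  have H' : ((sqn (fun x => f_ n x - f x))%:E @[n --> \oo] --> (0:R)%:E)%E.
    rewrite (_ : (fun n => _) = (fun n => (\int[mu]_x ((f_ n x - f x) ^+ 2)%:E)%E))//.
    by apply/funext => n; rewrite sqn_EFin.
  by move/fine_cvgP : H' => [_].
have [n _ hn] : \forall n \near \oo, sqn (fun x => f_ n x - f x) <= e by have := @cvgr_le _ _ _ _ _ _ H e e0; apply.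
exists (f_ n); split => //.
have := hn n (leqnn n); congr (_ <= _).
by rewrite /sqn; apply: eq_Rintegral => x _; ring.
Qed.

(** * Lipschitz functions *)

Lemma is_derive_segment v x z (h : R) : full_derivative v ->
  is_derive h 1 (fun h : R => v (h *: z + x)) (\sum_i z ord0 i * pd i v (h *: z + x)).
Proof.
move=> [_ hv]; have := is_derive_on_line (hv (h *: z + x) z).
move=> [h1 h2].
have E : (fun t : R => t^-1 *: (((fun s : R => v (s *: z + x)) \o shift h) (t *: (1:R)) - v (h *: z + x))) =
   (fun t : R => t^-1 *: (((fun s : R => v (s *: z + (h *: z + x))) \o shift 0) (t *: (1:R)) - (fun s : R => v (s *: z + (h *: z + x))) 0)).
  by apply/funext => t /=; rewrite [t *: 1]mulr1 addr0 scale0r add0r scalerDl addrA.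
by apply: DeriveDef; [rewrite /derivable E|rewrite /derive E].
Qed.

Lemma lipschitz_of_partials v (L : R) : full_derivative v -> 0 <= L ->
  (forall i x, `|pd i v x| <= L) -> forall x y, `|v y - v x| <= L * d%:R * `|y - x|.
Proof.
move=> fv L0 hL x y.
pose g (h : R) := v (h *: (y - x) + x).
have Dg (h : R) : is_derive h 1 g (\sum_i (y - x) ord0 i * pd i v (h *: (y - x) + x)).
  exact: is_derive_segment.
have [c _ hc] := @MVT_segment R g (fun h => \sum_i (y - x) ord0 i * pd i v (h *: (y - x) + x)) 0 1 ler01 (fun h _ => Dg h)
   (derivable_within_continuous (fun h _ => @ex_derive _ _ _ _ _ _ _ (Dg h))).
have -> : v y - v x = g 1 - g 0 by rewrite /g scale1r scale0r add0r subrK.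
rewrite hc subr0 mulr1; apply: le_trans (ler_norm_sum _ _ _) _.
apply: (@le_trans _ _ (\sum_(i < d) `|y - x| * L)).
  by apply: ler_sum => i _; rewrite normrM ler_pM// norm_coord_le.
by rewrite sumr_const card_ord -mulr_natr le_eqVlt; apply/orP; left; apply/eqP; ring.
Qed.

Lemma sqn_le_box f a b (c : R) : measurable_fun setT f -> 0 <= c ->
  (forall x, `|f x| <= c * \1_(box a b) x) ->
  L2T f /\ sqn f <= c ^+ 2 * fine (mu (box a b)).
Proof.
move=> mf c0 hf.
have Bf : mu (box a b) \is a fin_num by rewrite ge0_fin_numE//; exact: leb_box_lty.
have E : (\int[mu]_x (f x ^+ 2)%:E <= (c ^+ 2 * fine (mu (box a b)))%:E)%E.
  rewrite EFinM fineK// -(setIT (box a b)) -integral_indic//; last exact: measurable_box.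
  rewrite -ge0_integralZl_EFin//; last 2 first.
  - by apply/measurable_EFinP; apply: measurable_indic; exact: measurable_box.
  - by rewrite exprn_ge0.
  apply: ge0_le_integral => //.
  - by move=> x _; rewrite lee_fin sqr_ge0.
  - by apply/measurable_EFinP; exact: measurable_funX.
  - apply: measurable_funeM; apply/measurable_EFinP; apply: measurable_indic; exact: measurable_box.
  - move=> x _; rewrite -EFinM lee_fin -real_normK ?num_real//.
    have := hf x; rewrite indicE; case: (x \in box a b); rewrite ?mulr1 ?mulr0 => h.
      by rewrite lerXn2r// nnegrE.
    by rewrite (_ : `|f x| = 0) ?expr0n//; apply/le_anti; rewrite h normr_ge0.
have lf : L2T f.
  apply/(L2E mT); split => //; apply/(integrable_sqrE mf).
  by apply: le_lt_trans E _; rewrite ltry.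
by split => //; rewrite -lee_fin -sqn_EFin.
Qed.

Lemma partials_bounded v a b : strongly_smooth v -> (forall x, ~ box a b x -> v x = 0) ->
  exists2 L : R, 0 <= L & forall i x, `|pd i v x| <= L.
Proof.
move=> sv v0.
have clB : closed (box a b) by apply: compact_closed; [exact: norm_hausdorff|exact: compact_box].
have h i : exists M : R, 0 <= M /\ forall x, `|pd i v x| <= M.
  have [cp _] := strongly_smooth_full (strongly_smooth_pd i sv).
  have [M M0 hM] := compact_support_bounded cp (@compact_box _ _ a b) (pd_support i clB v0).
  by exists M.
have [M hM] := choice h.
exists (\sum_i M i); first by apply: sumr_ge0 => i _; have [] := hM i.
move=> i x; have [_ hi] := hM i; apply: le_trans (hi x) _.
by rewrite (bigD1 i)//= lerDl; apply: sumr_ge0 => j _; have [] := hM j.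
Qed.

Lemma shift_continuous_smooth v a b : strongly_smooth v -> (forall x, ~ box a b x -> v x = 0) ->
  shift_continuous v.
Proof.
move=> sv v0 e e0.
have [L L0 hL] := partials_bounded sv v0.
have [N N0 hN] := compact_in_box (@compact_box _ _ a b).
have fv := strongly_smooth_full sv.
have lip := lipschitz_of_partials fv L0 hL.
pose B : R := 2 * (N + 1).
have B0 : 0 <= B by rewrite mulr_ge0// addr_ge0.
pose BB := box (\row_(_ < d) - B) (\row_(_ < d) B).
pose X : R := (L * d%:R * (B + 1)) ^+ 2 * fine (mu BB).
have X0 : 0 <= X by rewrite mulr_ge0 ?sqr_ge0// fine_ge0.
pose dl : R := Num.min 2^-1 (e / (X + 1)).
have dl0 : 0 < dl by rewrite lt_min invr_gt0 ltr0n/= divr_gt0// ltr_wpDl.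
exists dl => // l z hl hz l0.
have [dl2 dlX] : dl <= 2^-1 /\ dl <= e / (X + 1) by split; rewrite ge_min lexx ?orbT.
have mv : measurable_fun setT v by apply: continuous_measurable_rV; case: fv.
have outB x : ~ BB x -> v (aff l z x) - v x = 0.
  move=> nB.
  have v1 : v x = 0.
    apply: v0 => /hN h; apply: nB => i; have := h i; rewrite !in_itv/= !mxE => /andP[h1 h2].
    by rewrite /B; apply/andP; split; lra.
  have v2 : v (aff l z x) = 0.
    apply: v0 => /hN h; apply: nB => i; have := h i; rewrite !in_itv/= !mxE => /andP[h1 h2].
    have hz' : `|z ord0 i| < dl by apply: le_lt_trans hz; exact: norm_coord_le.
    move: hz' hl; rewrite !ltr_norml => /andP[h3 h4] /andP[h5 h6].
    by rewrite /B; move: (x ord0 i) (z ord0 i) h1 h2 h3 h4 => p q *; apply/andP; split; nra.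
  by rewrite v1 v2 subrr.
have hc x : `|v (aff l z x) - v x| <= (L * d%:R * (dl * (B + 1))) * \1_BB x.
  have [Bx|/outB ->] := pselect (BB x); last by rewrite normr0 mulr_ge0// !mulr_ge0// ?(ltW dl0)// addr_ge0.
  rewrite indicE mem_set// mulr1; apply: le_trans (lip _ _) _.
  rewrite ler_wpM2l ?mulr_ge0//.
  rewrite (_ : aff l z x - x = (l - 1) *: x + z); last by rewrite /aff scalerBl scale1r addrAC.
  apply: le_trans (ler_normD _ _) _; rewrite normrZ mulrDr mulr1 lerD ?(ltW hz)//.
  rewrite ler_pM ?(ltW hl)//.
  by apply: norm_le_coord => // i; have := Bx i; rewrite in_itv/= !mxE -ler_norml.
have c0 : 0 <= L * d%:R * (dl * (B + 1)) by rewrite !mulr_ge0// ?(ltW dl0)// addr_ge0.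
have mD : measurable_fun setT (fun x => v (aff l z x) - v x).
  by apply: measurable_funB => //; exact: measurable_comp_aff.
have [_ h] := sqn_le_box mD c0 hc; apply: le_trans h _.
rewrite -/BB (_ : _ * _ = dl ^+ 2 * X); last by rewrite /X; ring.
apply: (@le_trans _ _ (dl * (X + 1))).
  by rewrite expr2 -mulrA ler_wpM2l ?(ltW dl0)//; nra.
by rewrite -ler_pdivlMr// ltr_wpDl.
Qed.

Lemma L2_indic_box a b A : measurable A -> A `<=` box a b -> L2T (\1_A : 'rV[R]_d -> R).
Proof.
move=> mA AB.
have mI : measurable_fun setT (\1_A : 'rV[R]_d -> R) by exact: measurable_indic.
suff h : forall x, `|\1_A x| <= 1 * \1_(box a b) x :> R.
  by have [] := @sqn_le_box (\1_A) a b 1 mI ler01 h.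
move=> x; rewrite mul1r !indicE; have [Ax|nAx] := pselect (A x); last by rewrite [x \in A]memNset// normr0.
by rewrite !mem_set// ?normr1//; exact: AB.
Qed.

Lemma shift_continuous_obox a b : shift_continuous (\1_(obox a b) : 'rV[R]_d -> R).
Proof.
have hL n : L2T (box_bump a b n).
  have [cb _] := strongly_smooth_full (smooth_expr_strongly_smooth (smooth_expr_box_bump a b n)).
  suff h : forall x, `|box_bump a b n x| <= 1 * \1_(box a b) x.
    by have [] := @sqn_le_box (box_bump a b n) a b 1 (continuous_measurable_rV cb) ler01 h.
  move=> x; rewrite mul1r indicE ger0_norm ?box_bump_ge0//.
  have [Ax|nAx] := pselect (box a b x); first by rewrite mem_set//; exact: box_bump_le1.
  by rewrite box_bump_out// => /obox_sub_box.
apply: (@shift_continuous_dominated (box_bump a b) _ (\1_(box a b))) => //.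
- by apply: (@L2_indic_box a b); [exact: measurable_obox|exact: obox_sub_box].
- by apply: (@L2_indic_box a b) => //; exact: measurable_box.
- move=> n; apply: (@shift_continuous_smooth _ a b).
    exact: smooth_expr_strongly_smooth (smooth_expr_box_bump a b n).
  by move=> x nx; apply: box_bump_out => /obox_sub_box.
- move=> n x; rewrite indicE ger0_norm ?box_bump_ge0//.
  have [Ax|nAx] := pselect (box a b x); first by rewrite mem_set//; exact: box_bump_le1.
  by rewrite box_bump_out// => /obox_sub_box.
- by move=> x; exact: cvg_box_bump.
Qed.

Lemma shift_continuous_cst0 : shift_continuous (fun=> 0 : R).
Proof.
move=> e e0; exists 1 => // l z _ _ _.
rewrite (_ : (fun x => _) = fun=> 0); last by apply/funext => x; rewrite subrr.
by rewrite /sqn ip0l ltW.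
Qed.

Lemma shift_continuous_sum (I : Type) (r : seq I) (F : I -> 'rV[R]_d -> R) :
  (forall i, L2T (F i)) -> (forall i, shift_continuous (F i)) ->
  shift_continuous (fun x => \sum_(i <- r) F i x).
Proof.
move=> lF hF; elim: r => [|i r IH].
  rewrite (_ : (fun x => _) = fun=> 0); first exact: shift_continuous_cst0.
  by apply/funext => x; rewrite big_nil.
rewrite (_ : (fun x => _) = (fun x => F i x + \sum_(j <- r) F j x)); last by apply/funext => x; rewrite big_cons.
by apply: shift_continuousD => //; exact: (L2_sum mT).
Qed.

Lemma shift_continuous_indic a b A : measurable A ->
  shift_continuous (\1_(A `&` obox a b) : 'rV[R]_d -> R).
Proof.
rewrite {1}measurable_oboxesE; move: A.
have mI A : measurable A -> measurable (A `&` obox a b) by move=> mA; apply: measurableI => //; exact: measurable_obox.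
have L2I A : measurable A -> L2T (\1_(A `&` obox a b) : 'rV[R]_d -> R).
  by move=> mA; apply: (@L2_indic_box a b); [exact: mI|move=> x [_ /obox_sub_box]].
apply: (dynkin_induction measurable_oboxesE oboxes_setI_closed).
- by rewrite setTI; exact: shift_continuous_obox.
- by move=> _ [a' [b' ->]]; rewrite oboxI; exact: shift_continuous_obox.
- move=> A mA hA.
  rewrite (_ : \1_(~` A `&` obox a b) = (fun x => \1_(obox a b) x + (-1) * \1_(A `&` obox a b) x) :> ('rV[R]_d -> R)).
    have LA := L2I _ mA; apply: shift_continuousD => //.
    + by have := L2I _ mT; rewrite setTI.
    + exact: (L2Z mT).
    + exact: shift_continuous_obox.
    + exact: shift_continuousZ.
  apply/funext => x; rewrite !indicE.
  have [xb|xb] := pselect (obox a b x); last first.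
    by rewrite [x \in ~` A `&` _]memNset ?[x \in obox a b]memNset ?[x \in A `&` _]memNset ?mulr0 ?addr0// => -[].
  rewrite [x \in obox a b]mem_set//; have [xA|xA] := pselect (A x).
    by rewrite memNset ?mem_set//= ?mulr1 ?subrr// => -[].
  by rewrite mem_set// memNset ?mulr0 ?addr0// => -[].
- move=> F mF tF hF.
  pose S n x : R := \sum_(0 <= k < n) \1_(F k `&` obox a b) x.
  have S_indic n x : S n x = \1_((\bigcup_(k < n) F k) `&` obox a b) x.
    rewrite /S indicE; have [[[k /= kn Fk] xb]|nx] := pselect (((\bigcup_(k < n) F k) `&` obox a b) x).
      rewrite mem_set; last by split => //; exists k.
      rewrite (bigD1_seq k) ?iota_uniq ?mem_index_iota//= big1 ?addr0 ?indicE ?mem_set//.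
      move=> j jk; rewrite indicE memNset// => -[Fj _].
      by move/trivIsetP : tF => /(_ j k I I jk); rewrite -subset0 => /(_ x); apply.
    rewrite memNset// big1_seq// => k /andP[_]; rewrite mem_index_iota => /andP[_ kn].
    by rewrite indicE memNset// => -[Fk xb]; apply: nx; split => //; exists k.
  apply: (@shift_continuous_dominated S _ (\1_(obox a b))).
  + by move=> n; apply: (L2_sum mT) => k _; exact: L2I.
  + by apply: L2I; exact: bigcupT_measurable.
  + by have := L2I _ mT; rewrite setTI.
  + by move=> n; apply: shift_continuous_sum => // k; exact: L2I.
  + move=> n x; rewrite S_indic !indicE; case: (boolP (x \in _ `&` _)) => [/set_mem[_ xb]|_].
      by rewrite mem_set// normr1.
    by rewrite normr0.
  + move=> x; rewrite indicE; have [[[k _ Fk] xb]|nx] := pselect ((\bigcup_k F k `&` obox a b) x).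
      rewrite mem_set; last by split => //; exists k.
      apply: (@cvg_near_cst _ _ _ _ _ _); exists k.+1 => // n /= kn; rewrite S_indic indicE mem_set//.
      by split => //; exists k.
    rewrite memNset//; apply: (@cvg_near_cst _ _ _ _ _ _); apply: nearW => n.
    by rewrite S_indic indicE memNset// => -[[k _ Fk] xb]; apply: nx; split => //; exists k.
Qed.

Import HBNNSimple.

Lemma shift_continuous_nnsfun (h : {nnsfun 'rV[R]_d >-> R}) a b :
  (forall x, ~ obox a b x -> h x = 0) -> shift_continuous h.
Proof.
move=> h0.
pose F (r : R) x : R := r * \1_((h @^-1` [set r]) `&` obox a b) x.
have mp r : measurable (h @^-1` [set r]) by exact: measurable_sfunP.
have LI r : L2T (\1_((h @^-1` [set r]) `&` obox a b) : 'rV[R]_d -> R).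
  apply: (@L2_indic_box a b); last by move=> x [_ /obox_sub_box].
  by apply: measurableI => //; exact: measurable_obox.
have -> : (h : 'rV[R]_d -> R) = (fun x => \sum_(r <- finmap.enum_fset (fset_set (range h))) F r x).
  apply/funext => x; rewrite fimfunE fsbig_finite//=; apply: eq_bigr => r _.
  rewrite /F !indicE; have [xb|xb] := pselect (obox a b x).
    by congr (_ * (_ : bool)%:R); apply/idP/idP => /set_mem/= hx; apply/mem_set => //; case: hx.
  rewrite [x \in _ `&` _]memNset; last by case.
  rewrite mulr0; case: (boolP (x \in h @^-1` [set r])) => [/set_mem/= <-|_]; last by rewrite mulr0.
  by rewrite h0// mul0r.
apply: shift_continuous_sum => r; first exact: (L2Z mT).
apply: shift_continuousZ => //.
by apply: shift_continuous_indic.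
Qed.

Lemma shift_continuous_ge0 f a b : L2T f -> (forall x, 0 <= f x) ->
  (forall x, ~ obox a b x -> f x = 0) -> shift_continuous f.
Proof.
move=> lf f0 fo; have [mf _] := (L2E mT f).1 lf.
have mEf : measurable_fun setT (EFin \o f) by exact/measurable_EFinP.
pose f_ := nnsfun_approx mT mEf.
have f_f n x : f_ n x <= f x.
  rewrite -lee_fin /f_ nnsfun_approxE.
  have f0' (t : 'rV[R]_d) : setT t -> (0 <= (EFin \o f) t)%E by move=> _; rewrite lee_fin.
  have H := @le_approx _ _ _ _ _ n x f0' I; exact: H.
have f_0 n x : 0 <= f_ n x by exact: fun_ge0.
have mf_ n : measurable_fun setT (f_ n) by exact: measurable_funP.
apply: (@shift_continuous_dominated f_ _ f) => //.
- move=> n; apply: (L2_le mT (mf_ n) _ lf) => x _.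
  by rewrite !ger0_norm.
- move=> n; apply: (@shift_continuous_nnsfun _ a b) => x /fo fx.
  by apply/le_anti; rewrite f_0 andbT -fx.
- by move=> n x; rewrite ger0_norm.
- move=> x; have h : (EFin \o f_^~ x) n @[n --> \oo] --> (f x)%:E.
    by apply: (@cvg_nnsfun_approx _ _ _ _ mT _ mEf) => // t _; rewrite lee_fin.
  by move/fine_cvgP : h => [_].
Qed.

(** Translations and dilations act continuously on square integrable functions
    of bounded support: the property holds for smooth functions, and passes to
    indicators of boxes, of measurable sets, and to simple functions by
    dominated limits. *)
Lemma shift_continuous_L2 f a b : L2T f ->
  (forall x, ~ obox a b x -> f x = 0) -> shift_continuous f.
Proof.
move=> lf fo; have [mf _] := (L2E mT f).1 lf.
pose p x := Num.max (f x) 0; pose q x := Num.max (- f x) 0.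
have -> : f = (fun x => p x + (-1) * q x).
  by apply/funext => x; rewrite /p /q; case: (leP (f x) 0) => h; case: (leP (- f x) 0) => h'; lra.
have mp : measurable_fun setT p by apply: measurable_maxr => //; exact: measurable_cst.
have mq : measurable_fun setT q.
  by apply: measurable_maxr; [exact: measurable_funN|exact: measurable_cst].
have lp : L2T p.
  apply: (L2_le mT mp _ lf) => x _; rewrite ger0_norm ?le_max ?lexx ?orbT//.
  by rewrite ge_max ler_norm normr_ge0.
have lq : L2T q.
  apply: (L2_le mT mq _ lf) => x _; rewrite ger0_norm ?le_max ?lexx ?orbT//.
  by rewrite ge_max -normrN ler_norm normr_ge0.
apply: shift_continuousD => //; first exact: (L2Z mT).
  apply: (@shift_continuous_ge0 p a b) => // x; first by rewrite le_max lexx orbT.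
  by move=> /fo fx; rewrite /p fx maxxx.
apply: shift_continuousZ => //.
apply: (@shift_continuous_ge0 q a b) => // x; first by rewrite le_max lexx orbT.
by move=> /fo fx; rewrite /q fx oppr0 maxxx.
Qed.

End affine_continuity.

(** * Mollification *)

Section mollification.
Context {R : realType} {d : nat} (Om : set 'rV[R]_d).
Hypotheses (mOm : measurable Om) (bOm : bounded_set Om).
Local Notation mu := (leb d : {sigma_finite_measure set 'rV[R]_d -> \bar R}).
Implicit Types (f g v w kappa : 'rV[R]_d -> R) (x y z a b c : 'rV[R]_d).
Local Notation mT := (@measurableT _ 'rV[R]_d).

Let Omy : (mu Om < +oo)%E. Proof. exact: leb_bounded_lty. Qed.

(** An average of [f] near the image of [x] by a dilation. As [x] only occurs in
    the kernel, so do the derivatives. *)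
Definition mollify kappa (l : R) c f x : R := ip Om f (fun y => kappa (y - aff l c x)).

Definition kernel a b kappa := strongly_smooth kappa /\ forall x, ~ box a b x -> kappa x = 0.

Lemma kernel_pd a b kappa i : kernel a b kappa -> kernel a b (pd i kappa).
Proof.
move=> [sk k0]; split; first exact: strongly_smooth_pd.
apply: pd_support => //; apply: compact_closed; [exact: norm_hausdorff|exact: compact_box].
Qed.

Lemma kernel_continuous a b kappa : kernel a b kappa -> continuous kappa.
Proof. by move=> [/strongly_smooth_full[]]. Qed.

Lemma kernel_bounded a b kappa : kernel a b kappa ->
  exists2 M : R, 0 <= M & forall x, `|kappa x| <= M.
Proof.
move=> hk; have [_ k0] := hk.
exact: (compact_support_bounded (kernel_continuous hk) (@compact_box _ _ a b)).
Qed.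

Lemma measurable_shift f z : measurable_fun setT f -> measurable_fun setT (fun y => f (y - z)).
Proof.
move=> mf; rewrite (_ : (fun _ => _) = f \o aff 1 (- z)); first exact: measurable_comp_aff.
by apply/funext => y; rewrite /aff /= scale1r.
Qed.

Lemma L2_kernel a b kappa z : kernel a b kappa -> L2 Om (fun y => kappa (y - z)).
Proof.
move=> hk; have [M _ hM] := kernel_bounded hk.
apply: (@L2_bounded _ _ _ mOm _ M) => //; apply: measurable_funTS; apply: measurable_shift.
exact: continuous_measurable_rV (kernel_continuous hk).
Qed.

Lemma L2_integrable_norm f : L2 Om f -> mu.-integrable Om (EFin \o (fun x => `|f x|)).
Proof. by move=> lf; apply: integrable_norm; exact: (L2_integrable mOm Omy). Qed.

Lemma L2_integrable_normZ f (M : R) : L2 Om f -> mu.-integrable Om (EFin \o (fun x => M * `|f x|)).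
Proof.
move=> lf; rewrite (_ : EFin \o _ = (fun x => M%:E * (`|f x|)%:E)%E); last first.
  by apply/funext => x /=; rewrite EFinM.
by apply: integrableZl => //; exact: L2_integrable_norm.
Qed.

Lemma ip_bounded_le f w (M : R) : L2 Om f -> L2 Om w -> (forall x, Om x -> `|w x| <= M) ->
  `|ip Om f w| <= M * \int[mu]_(x in Om) `|f x|.
Proof.
move=> lf lw hM; have fw := L2_integrableM mOm lf lw.
apply: le_trans (le_normr_Rintegral mOm fw) _.
rewrite -RintegralZl//; last exact: L2_integrable_norm.
apply: le_Rintegral => //.
- exact: (integrable_norm fw).
- exact: L2_integrable_normZ.
- by move=> x Ox; rewrite normrM mulrC ler_wpM2r//; exact: hM.
Qed.

Lemma mollify_continuous a b kappa l c f : kernel a b kappa -> L2 Om f ->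
  continuous (mollify kappa l c f).
Proof.
move=> hk lf.
have [sk k0] := hk; have [L L0 hL] := partials_bounded sk k0.
have lip := lipschitz_of_partials (strongly_smooth_full sk) L0 hL.
pose I := \int[mu]_(x in Om) `|f x|.
have I0 : 0 <= I by apply: Rintegral_ge0.
pose C : R := L * d%:R * `|l| * I.
have C0 : 0 <= C by rewrite /C !mulr_ge0.
have h x x' : `|mollify kappa l c f x' - mollify kappa l c f x| <= C * `|x' - x|.
  have lx := L2_kernel (aff l c x) hk; have lx' := L2_kernel (aff l c x') hk.
  rewrite /mollify -ipBr//.
  have -> : C * `|x' - x| = (L * d%:R * (`|l| * `|x' - x|)) * I by rewrite /C; ring.
  apply: ip_bounded_le => //; first exact: L2B.
  move=> y _; apply: le_trans (lip _ _) _; rewrite ler_wpM2l ?mulr_ge0//.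
  rewrite -normrZ -normrN le_eqVlt; apply/orP; left; apply/eqP; congr `|_|.
  by rewrite /aff scalerBr !opprB !addrA !opprD; apply/rowP => i; rewrite !mxE; ring.
move=> x; apply/(@cvgrPdist_le _ _ _ (nbhs x)) => e e0.
have r0 : 0 < e / (C + 1) by rewrite divr_gt0// ltr_wpDl.
apply: (@filterS _ _ (nbhs_filter x) (ball x (e / (C + 1)))); last exact: nbhsx_ballx.
move=> x'; rewrite -ball_normE/= distrC ltr_pdivlMr ?ltr_wpDl// => hx.
rewrite distrC; apply: le_trans (h _ _) _.
by apply: le_trans (ltW hx); rewrite mulrDr mulr1 mulrC lerDl.
Qed.

Lemma is_derive_mollify a b kappa l c f x z : kernel a b kappa -> L2 Om f ->
  is_derive x z (mollify kappa l c f) (\sum_i z ord0 i * (- l * mollify (pd i kappa) l c f x)).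
Proof.
move=> hk lf; apply: is_derive_line.
have [sk k0] := hk; have [L L0 hL] := partials_bounded sk k0.
have fk := strongly_smooth_full sk.
pose w := (- l) *: z.
pose q y := y - aff l c x.
pose F (h : R) (y : 'rV[R]_d) : R := f y * kappa (h *: w + q y).
have -> : (fun h : R => mollify kappa l c f (h *: z + x)) = (fun h => \int[mu]_(y in Om) F h y).
  apply/funext => h; rewrite /mollify /ip; apply: eq_Rintegral => y _; congr (_ * kappa _).
  by rewrite /q /w /aff; apply/rowP => i; rewrite !mxE; ring.
have dF (h : R) y : is_derive h 1 (F ^~ y) (f y * \sum_i w ord0 i * pd i kappa (h *: w + q y)).
  have H := is_deriveM (@is_derive_cst R R^o R^o (f y) h 1) (@is_derive_segment _ _ kappa (q y) w h fk).
  by apply: (is_derive_eq H); rewrite scaler0 addr0.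
have d1 (h : R) y : partial1of2 F h y = f y * \sum_i w ord0 i * pd i kappa (h *: w + q y).
  by rewrite partial1of2E; exact: (@derive_val _ _ _ _ _ _ _ (dF h y)).
pose D := \sum_i `|w ord0 i| * L.
have D0 : 0 <= D by apply: sumr_ge0 => i _; rewrite mulr_ge0.
have lq (h : R) kap : kernel a b kap -> L2 Om (fun y => kap (h *: w + q y)).
  move=> hk'; rewrite (_ : (fun _ => _) = fun y => kap (y - (aff l c x - h *: w))).
    exact: L2_kernel hk'.
  by apply/funext => y; congr kap; rewrite /q; apply/rowP => i; rewrite !mxE; ring.
have I0 : `](-1 : R), 1[%classic 0 by rewrite /= in_itv/= ltr01 ltrN10.
have iF (h : R) : `](-1 : R), 1[%classic h -> mu.-integrable Om (EFin \o F h).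
  by move=> _; apply: (L2_integrableM mOm) => //; exact: lq.
have derF (h : R) y : `](-1 : R), 1[%classic h -> Om y -> derivable (F ^~ y) h 1.
  by move=> _ _; have [] := dF h y.
have iG : mu.-integrable Om (EFin \o (fun y => D * `|f y|)).
  exact: L2_integrable_normZ.
have G0 y : 0 <= D * `|f y| by rewrite mulr_ge0.
have Gub (h : R) y : `](-1 : R), 1[%classic h -> Om y -> `|partial1of2 F h y| <= D * `|f y|.
  move=> _ _; rewrite d1 normrM mulrC ler_wpM2r//.
  by apply: le_trans (ler_norm_sum _ _ _) _; apply: ler_sum => i _; rewrite normrM ler_wpM2l.
have H1 := derivable_under_integral mOm I0 iF derF G0 iG Gub.
have H2 := differentiation_under_integral mOm I0 iF derF G0 iG Gub.
rewrite derive1E in H2.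
have H := derivableP H1; apply: (is_derive_eq H); rewrite H2.
transitivity (ip Om (fun y => \sum_i w ord0 i * pd i kappa (q y)) f).
  by rewrite /ip; apply: eq_Rintegral => y _; rewrite d1 scale0r add0r mulrC.
have lqi i : L2 Om (fun y => pd i kappa (q y)) by exact: L2_kernel (kernel_pd i hk).
rewrite (ip_suml mOm)//; last by move=> i _; exact: (L2Z mOm).
apply: eq_bigr => i _; rewrite (ipZl mOm)// /mollify ipC /w mxE; ring.
Qed.

Lemma pd_mollify a b kappa l c f i : kernel a b kappa -> L2 Om f ->
  pd i (mollify kappa l c f) = fun x => - l * mollify (pd i kappa) l c f x.
Proof.
move=> hk lf; apply/funext => x; apply: is_derive_pd.
by apply: (is_derive_eq (is_derive_mollify l c x _ hk lf)); rewrite sum_delta.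
Qed.

Lemma mollify_smooth a b kappa l c f : kernel a b kappa -> L2 Om f ->
  strongly_smooth (mollify kappa l c f).
Proof.
move=> hk lf; rewrite -[mollify _ _ _ _](_ : (fun x => 1 * mollify kappa l c f x) = _); last first.
  by apply/funext => x; rewrite mul1r.
pose S := [set v | exists (m : R) kappa, kernel a b kappa /\ v = (fun x => m * mollify kappa l c f x)].
apply: (@strongly_smooth_stable _ _ S); last by exists 1, kappa.
  move=> _ [m [kap [hkap ->]]].
  have fm : full_derivative (mollify kap l c f).
    split; first exact: mollify_continuous hkap lf.
    move=> x z; rewrite (eq_bigr (fun i => z ord0 i * (- l * mollify (pd i kap) l c f x))).
      exact: is_derive_mollify hkap lf.
    by move=> i _; rewrite (pd_mollify _ _ _ hkap lf).
  by have [_] := full_derivativeM (full_derivative_cst m).2 fm.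
move=> _ i [m [kap [hkap ->]]]; exists (- (m * l)), (pd i kap); split; first exact: kernel_pd.
have fm : full_derivative (mollify kap l c f).
  split; first exact: mollify_continuous hkap lf.
  move=> x z; rewrite (eq_bigr (fun i => z ord0 i * (- l * mollify (pd i kap) l c f x))).
    exact: is_derive_mollify hkap lf.
  by move=> j _; rewrite (pd_mollify _ _ _ hkap lf).
have [-> _] := full_derivativeM (full_derivative_cst m).2 fm.
apply/funext => x; rewrite (pd_mollify _ _ _ hkap lf) (full_derivative_cst m).1; ring.
Qed.

End mollification.

Section averages.
Context {R : realType} {d : nat} (Om : set 'rV[R]_d).
Hypotheses (oOm : open Om) (bOm : bounded_set Om).
Local Notation mu := (leb d : {sigma_finite_measure set 'rV[R]_d -> \bar R}).
Implicit Types (f g v w u kappa : 'rV[R]_d -> R) (x y z a b c p : 'rV[R]_d)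
  (tau psi sigma : 'rV[R]_d -> 'rV[R]_d).
Local Notation mT := (@measurableT _ 'rV[R]_d).

Let mOm : measurable Om. Proof. exact: open_measurable_rV. Qed.
Let Omy : (mu Om < +oo)%E. Proof. exact: leb_bounded_lty. Qed.

Lemma patchT f : f \_ setT = f.
Proof. by apply/funext => x; rewrite /patch mem_set. Qed.

Lemma L2_extend f : L2 Om f -> L2 setT (f \_ Om).
Proof. by rewrite /L2 patchT. Qed.

Lemma mollify_extend a b kappa l c f x : kernel a b kappa -> L2 Om f ->
  mollify Om kappa l c f x = ip setT (fun z => (f \_ Om) (z + aff l c x)) kappa.
Proof.
move=> hk lf; rewrite /mollify /ip Rintegral_mkcond.
have -> : (fun y => f y * kappa (y - aff l c x)) \_ Om = fun y => (f \_ Om) y * kappa (y - aff l c x).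
  by apply/funext => y; rewrite /patch; case: ifP => //; rewrite mul0r.
rewrite /Rintegral; congr fine.
rewrite -(@integral_translate _ _ (aff l c x) (fun y => ((f \_ Om) y * kappa (y - aff l c x))%:E)).
  by apply: eq_integral => z _; rewrite addrK.
apply/measurable_EFinP; apply: measurable_funM.
  exact: (L2_measurable mT (L2_extend lf)).
by apply: measurable_shift; exact: continuous_measurable_rV (kernel_continuous hk).
Qed.

(** Jensen's inequality for the averages against a probability kernel. *)
Lemma mollify_jensen a b kappa l c f x : kernel a b kappa -> (forall z, 0 <= kappa z) ->
  \int[mu]_z kappa z = 1 -> L2 Om f -> Om x ->
  (((mollify Om kappa l c f x - f x) ^+ 2)%:E <=
   \int[mu]_z (((f \_ Om) (z + aff l c x) - (f \_ Om) x) ^+ 2 * kappa z)%:E)%E.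
Proof.
move=> hk k0 k1 lf Ox; rewrite (mollify_extend _ _ _ hk lf).
have [M M0 hM] := kernel_bounded hk.
have ck := kernel_continuous hk.
pose q z := Num.sqrt (kappa z).
have qq z : q z * q z = kappa z by rewrite -expr2 sqr_sqrtr.
have mq : measurable_fun setT q.
  by apply: continuous_measurable_rV => z; apply: continuous_comp; [exact: ck|exact: sqrt_continuous].
have ik : mu.-integrable setT (EFin \o kappa).
  by have [_ kz] := hk; apply: integrable_compact_support kz => //; exact: compact_box.
have lq : L2 setT q.
  apply/(L2E mT); split => //; rewrite (_ : (fun _ => _) = kappa)//.
  by apply/funext => z; rewrite sqr_sqrtr.
pose F z := (f \_ Om) (z + aff l c x).
have EF : F = (f \_ Om) \o aff 1 (aff l c x) by apply/funext => z; rewrite /F /= /aff scale1r.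
have lF : L2 setT F by rewrite EF; have [] := L2_comp_aff (aff l c x) ltr01 (L2_extend lf).
have mF := L2_measurable mT lF.
have lFq : L2 setT (fun z => F z * q z).
  apply: (L2_le mT (measurable_funM mF mq) _ (L2Z mT (Num.sqrt M) lF)) => z _.
  rewrite !normrM mulrC ler_wpM2r// !ger0_norm ?sqrtr_ge0// ler_wsqrtr//.
  by apply: le_trans (hM z); exact: ler_norm.
pose m := (f \_ Om) x.
have lG : L2 setT (fun z => F z * q z - m * q z) by apply: (L2B mT) => //; exact: (L2Z mT).
have E1 : ip setT (fun z => F z * q z - m * q z) q = ip setT F kappa - f x.
  rewrite (ipBl mT)//; last exact: (L2Z mT).
  rewrite (ipZl mT)//; congr (_ - _).
    by rewrite /ip; apply: eq_Rintegral => z _; rewrite -mulrA qq.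
  rewrite /m /patch mem_set// /ip (_ : (fun _ => _) = kappa) ?k1 ?mulr1//.
  by apply/funext => z; exact: qq.
have E2 : ip setT q q = 1.
  by rewrite /ip -[RHS]k1; apply: eq_Rintegral => z _; exact: qq.
have := ip_cauchy_schwarz mT lG lq; rewrite E1 E2 mulr1 => h.
apply: (@le_trans _ _ (ip setT (fun z => F z * q z - m * q z) (fun z => F z * q z - m * q z))%:E).
  by rewrite lee_fin.
rewrite -ip_EFin//; apply: ge0_le_integral => //.
- by move=> z _; rewrite lee_fin -expr2 sqr_ge0.
- by apply/measurable_EFinP; apply: measurable_funM; exact: (L2_measurable mT lG).
- apply/measurable_EFinP; apply: measurable_funM; last exact: continuous_measurable_rV.
  by apply: measurable_funX; apply: measurable_funB.
- move=> z _; rewrite lee_fin -qq -/(F z) -/m le_eqVlt; apply/orP; left; apply/eqP; ring.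
Qed.

(** Integrated over [x], Jensen's inequality bounds the error by an average of
    the shift errors of [f]. *)
Lemma mollify_error a b kappa l c f (e : R) : kernel a b kappa -> (forall z, 0 <= kappa z) ->
  \int[mu]_z kappa z = 1 -> L2 Om f -> 0 < l ->
  (forall z, box a b z -> sqn (fun x => (f \_ Om) (aff l (c + z) x) - (f \_ Om) x) <= e) ->
  ip Om (fun x => mollify Om kappa l c f x - f x) (fun x => mollify Om kappa l c f x - f x) <= e.
Proof.
move=> hk k0 k1 lf l0 hs.
have cm : continuous (mollify Om kappa l c f) by exact: mollify_continuous hk lf.
have lD : L2 Om (fun x => mollify Om kappa l c f x - f x).
  by apply: L2B => //; exact: L2_continuous_fun.
rewrite -lee_fin -ip_EFin//.
have mfe := L2_measurable mT (L2_extend lf).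
pose H (p : 'rV[R]_d * 'rV[R]_d) : \bar R :=
  (((f \_ Om) (p.2 + aff l c p.1) - (f \_ Om) p.1) ^+ 2 * kappa p.2)%:E.
have mk : measurable_fun setT kappa by exact: continuous_measurable_rV (kernel_continuous hk).
have mH : measurable_fun setT H.
  apply/measurable_EFinP; apply: measurable_funM; last exact: (measurableT_comp mk measurable_snd).
  apply: measurable_funX; apply: measurable_funB; last exact: (measurableT_comp mfe measurable_fst).
  apply: (measurableT_comp mfe); apply: measurable_fun_rV => i.
  rewrite (_ : (fun _ => _) = fun p : 'rV[R]_d * 'rV[R]_d => p.2 ord0 i + (l * p.1 ord0 i + c ord0 i)); last first.
    by apply/funext => p; rewrite /aff !mxE.
  apply: measurable_funD; first exact: (measurableT_comp (measurable_coord i) measurable_snd).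
  apply: measurable_funD => //; apply: measurable_funM => //.
  exact: (measurableT_comp (measurable_coord i) measurable_fst).
have H0 pp : (0 <= H pp)%E by rewrite lee_fin mulr_ge0// sqr_ge0.
apply: (@le_trans _ _ (\int[mu]_(x in Om) \int[mu]_z H (x, z))%E).
  apply: ge0_le_integral => //.
  - by move=> x _; rewrite lee_fin -expr2 sqr_ge0.
  - by apply/measurable_EFinP; apply: measurable_funM; exact: (L2_measurable mOm lD).
  - by apply: measurable_funTS; exact: measurable_fun_fubini_tonelli_F.
  - by move=> x Ox; rewrite -expr2; exact: mollify_jensen hk k0 k1 lf Ox.
apply: (@le_trans _ _ (\int[mu]_x \int[mu]_z H (x, z))%E).
  apply: ge0_subset_integral => //.
    exact: measurable_fun_fubini_tonelli_F.
  by move=> x _; exact: integral_ge0.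
rewrite fubini_tonelli//.
have i1 : (\int[mu]_z (kappa z)%:E = 1)%E.
  have ik : mu.-integrable setT (EFin \o kappa).
    have [_ kz] := hk; apply: integrable_compact_support kz; first exact: kernel_continuous hk.
    exact: compact_box.
  by rewrite -(fineK (integrable_fin_num mT ik)) -[X in _ = X]/((1:R)%:E) -k1.
have e0 : 0 <= e.
  have [z kz] : exists z, kappa z != 0.
    apply: contrapT => /forallNP h; have : \int[mu]_z kappa z = 0.
      rewrite (_ : kappa = cst 0) ?Rintegral_cst ?mul0r//.
      by apply/funext => z; apply/eqP; apply: contrapT => /negP; exact: h.
    by move/eqP; rewrite k1 oner_eq0.
  apply: le_trans (hs z _); first exact: sqn_ge0.
  by apply: contrapT; have [_ kz0] := hk; move=> /kz0 /eqP; rewrite (negbTE kz).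
apply: (@le_trans _ _ (\int[mu]_z (e%:E * (kappa z)%:E))%E); last first.
  rewrite ge0_integralZl//; first by rewrite i1 mule1.
    by apply/measurable_EFinP.
  by move=> x _; rewrite lee_fin.
apply: ge0_le_integral => //.
- by move=> z _; exact: integral_ge0.
- exact: measurable_fun_fubini_tonelli_G.
- by apply: measurable_funeM; apply/measurable_EFinP.
move=> z _; have [Bz|nBz] := pselect (box a b z); last first.
  have kz : kappa z = 0 by have [_ ->] := hk.
  rewrite integral0_eq ?mule_ge0 ?lee_fin// => x _.
  by rewrite /H /= kz mulr0.
have lS : L2 setT (fun x => (f \_ Om) (aff l (c + z) x) - (f \_ Om) x).
  apply: (L2B mT); last exact: L2_extend.
  by have [] := L2_comp_aff (c + z) l0 (L2_extend lf).
have EH x : H (x, z) = ((kappa z)%:E * ((((f \_ Om) (aff l (c + z) x) - (f \_ Om) x)) ^+ 2)%:E)%E.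
  rewrite /H /= -EFinM mulrC (_ : z + aff l c x = aff l (c + z) x)//.
  by rewrite /aff addrCA [z + _]addrC.
under eq_integral do rewrite EH.
rewrite ge0_integralZl//; last 3 first.
- by apply/measurable_EFinP; apply: measurable_funX; exact: (L2_measurable mT lS).
- by move=> x _; rewrite lee_fin sqr_ge0.
- by rewrite lee_fin.
by rewrite sqn_EFin// -EFinM -EFinM lee_fin mulrC ler_wpM2r//; exact: hs.
Qed.


Lemma convex_comb x y (t : R) : convex_set (Om : set (convex_lmodType 'rV[R]_d)) ->
  0 <= t -> t <= 1 -> Om x -> Om y -> Om (t *: x + (1 - t) *: y).
Proof.
move=> cO t0 t1 Ox Oy.
by have := cO x y (Itv01 t0 t1) (mem_set Ox) (mem_set Oy); rewrite inE.
Qed.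

(** * Smooth approximation with the gradient *)

Definition vec v (i : 'I_d) : 'rV[R]_d -> 'rV[R]_d := fun x => \row_j (if j == i then v x else 0).

Lemma coordf_vec v i j : coordf (vec v i) j = if j == i then v else fun=> 0.
Proof. by apply/funext => x; rewrite /coordf mxE; case: eqP. Qed.

Lemma L2v_vec v i : L2 Om v -> L2v Om (vec v i).
Proof. by move=> lv j; rewrite coordf_vec; case: eqP => // _; exact: L20. Qed.

Lemma ipv_vec tau v i : L2v Om tau -> L2 Om v -> ipv Om tau (vec v i) = ip Om (coordf tau i) v.
Proof.
move=> lt lv; rewrite ipvE//; last exact: L2v_vec.
rewrite (bigD1 i)//= big1 ?addr0 => [|j ji].
  by rewrite coordf_vec eqxx.
by rewrite coordf_vec (negbTE ji) ipC ip0l.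
Qed.

Lemma is_div_vec v i : C1 v -> is_div Om (vec v i) (pd i v).
Proof.
move=> Cv; have lv : L2 Om v by apply: L2_continuous_fun; case: Cv.
have lpv : L2 Om (pd i v) by apply: L2_continuous_fun; have [_ /(_ i)[]] := Cv.
split=> // phi tp; rewrite ipvC ipv_vec//; last exact: L2v_grad_test.
rewrite (_ : coordf _ i = pd i phi); last by apply/funext => x; rewrite /coordf mxE.
by rewrite ipC ip_by_parts.
Qed.

Variable bc : boundary_case.

Lemma spaceM_vec v i : C1 v -> (bc = CahnHilliard -> test_function Om v) -> spaceM Om bc (vec v i).
Proof.
move=> Cv tv; have lv : L2 Om v by apply: L2_continuous_fun; case: Cv.
have [hd ed] := is_div_div oOm bOm (L2v_vec i lv) (is_div_vec i Cv).
rewrite /spaceM; case: bc tv => [_|/(_ erefl) tv]; first exact: hd.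
split=> // w hw; have [lw hw'] := hw.
rewrite ipvC ipv_vec//; last exact: Hsob1_L2v_grad.
rewrite (ip_ae_L2 oOm (L2_div hd) _ lw ed); last first.
  by apply: L2_continuous_fun => //; have [_ /(_ i)[]] := Cv.
rewrite (_ : coordf _ i = wderiv Om [:: i] w); last by apply/funext => x; rewrite /coordf mxE.
have [_ /(_ v tv)/=] := wderivP (hw' [:: i] isT).
by rewrite expr1 mulN1r [ip _ (pd _ _) _]ipC => ->; rewrite addrN.
Qed.

Lemma form_bE tau v psi : L2v Om tau -> L2 Om v -> Hdiv Om psi ->
  form_b Om (v, tau) psi = ipv Om tau psi + ip Om v (div Om psi).
Proof.
move=> lt lv hp; have [lp _] := hp.
rewrite /form_b /= RintegralD//; first exact: L2v_integrable_dot.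
exact: (L2_integrableM mOm lv (L2_div hp)).
Qed.

(** [sigma] is the gradient of [u], in the sense of the second equation of the
    mixed problem; this also encodes the boundary condition. *)
Definition mixed_gradient u sigma := [/\ L2 Om u, L2v Om sigma &
  forall psi, spaceM Om bc psi -> ipv Om sigma psi + ip Om u (div Om psi) = 0].

Lemma mixed_gradient_by_parts u sigma v i : mixed_gradient u sigma ->
  C1 v -> (bc = CahnHilliard -> test_function Om v) ->
  ip Om u (pd i v) = - ip Om (coordf sigma i) v.
Proof.
move=> [lu ls h] Cv tv; have lv : L2 Om v by apply: L2_continuous_fun; case: Cv.
have hM := spaceM_vec i Cv tv.
have hd := spaceM_Hdiv hM.
have := h _ hM; rewrite ipv_vec//.
have [_ ed] := is_div_div oOm bOm (L2v_vec i lv) (is_div_vec i Cv).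
rewrite [ip Om u (div _ _)]ipC (ip_ae_L2 oOm (L2_div hd) _ lu ed); last first.
  by apply: L2_continuous_fun => //; have [_ /(_ i)[]] := Cv.
by rewrite [ip Om (pd _ _) _]ipC => /eqP; rewrite addrC addr_eq0 => /eqP.
Qed.

Lemma pd_translate v p i : pd i (fun y => v (y - p)) = fun y => pd i v (y - p).
Proof.
apply/funext => x; rewrite /pd /derive.
have -> : (fun h : R => h^-1 *: (((fun y => v (y - p)) \o shift x) (h *: delta_mx ord0 i) - v (x - p))) =
    (fun h : R => h^-1 *: ((v \o shift (x - p)) (h *: delta_mx ord0 i) - v (x - p))).
  by apply/funext => h /=; rewrite addrA.
by [].
Qed.

Lemma box_bump_translate a b p n x : box_bump a b n (x - p) = box_bump (a + p) (b + p) n x.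
Proof.
apply: eq_bigr => i _; congr (flat_exp 1 (_ * _) * flat_exp 1 (_ * _)); rewrite !mxE; ring.
Qed.

Lemma integral_box_bump_gt0 (r : R) : 0 < r ->
  0 < \int[mu]_x box_bump (\row_i - r) (\row_i r) 0 x.
Proof.
move=> r0; pose a : 'rV[R]_d := \row_i - r; pose b : 'rV[R]_d := \row_i r.
pose a' : 'rV[R]_d := \row_i (- (r / 2)); pose b' : 'rV[R]_d := \row_i (r / 2).
pose q : R := expR (- (2 / r)).
have q0 : 0 < q by exact: expR_gt0.
have fq (s : R) : r / 2 <= s -> q <= flat_exp 1 s.
  move=> rs; have r2 : 0 < r / 2 by rewrite divr_gt0.
  rewrite /flat_exp (lt_le_trans r2 rs) hornerC mul1r ler_expR lerN2.
  by rewrite -invf_div lef_pV2// posrE// (lt_le_trans r2 rs).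
have bq x : (q * q) ^+ d * \1_(box a' b') x <= box_bump a b 0 x.
  rewrite indicE; have [Bx|nBx] := pselect (box a' b' x); last by rewrite memNset// mulr0 box_bump_ge0.
  rewrite mem_set// mulr1 -{1}(card_ord d) -prodr_const; apply: ler_prod => i _.
  rewrite mulr_ge0 ?(ltW q0)//=; have := Bx i; rewrite in_itv/= !mxE => /andP[h1 h2].
  by rewrite mulr1n !mul1r ler_pM ?(ltW q0)//; apply: fq; lra.
have ck : continuous (box_bump a b 0).
  by have [] := strongly_smooth_full (smooth_expr_strongly_smooth (smooth_expr_box_bump a b 0)).
have ik : mu.-integrable setT (EFin \o box_bump a b 0).
  apply: (@integrable_compact_support _ _ _ (box a b)) => //; first exact: compact_box.
  by move=> x nx; apply: box_bump_out => /obox_sub_box.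
have qd : 0 < (q * q) ^+ d by rewrite exprn_gt0// mulr_gt0.
have ab' i : a' ord0 i <= b' ord0 i by rewrite !mxE; lra.
rewrite -lte_fin /Rintegral fineK ?integrable_fin_num//.
apply: (@lt_le_trans _ _ (\int[mu]_x ((q * q) ^+ d * \1_(box a' b') x)%:E)%E).
  under eq_integral do rewrite EFinM.
  rewrite ge0_integralZl_EFin ?(ltW qd)//; last first.
    by apply/measurable_EFinP; apply: measurable_indic; exact: measurable_box.
  rewrite integral_indic//; last exact: measurable_box.
  rewrite setIT -[X in (_ * X)%E]/(mu (box a' b')) leb_boxE// -EFinM lte_fin mulr_gt0// prodr_gt0// => i _.
  by rewrite !mxE; lra.
apply: ge0_le_integral => //.
- by move=> x _; rewrite lee_fin mulr_ge0// ?(ltW qd)// indicE.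
- apply/measurable_EFinP; apply: measurable_funM => //; apply: measurable_indic; exact: measurable_box.
- by apply/measurable_EFinP; exact: continuous_measurable_rV.
- by move=> x _; rewrite lee_fin.
Qed.

End averages.

Section gradient_approximation.
Context {R : realType} {d : nat} (Om : set 'rV[R]_d).
Hypotheses (oOm : open Om) (bOm : bounded_set Om) (neOm : Om !=set0)
  (cOm : convex_set (Om : set (convex_lmodType 'rV[R]_d))).
Local Notation mu := (leb d : {sigma_finite_measure set 'rV[R]_d -> \bar R}).
Implicit Types (f g v w u kappa : 'rV[R]_d -> R) (x y z a b c p : 'rV[R]_d)
  (tau psi sigma : 'rV[R]_d -> 'rV[R]_d).
Variable bc : boundary_case.

Let mOm : measurable Om. Proof. exact: open_measurable_rV. Qed.
Let Omy : (mu Om < +oo)%E. Proof. exact: leb_bounded_lty. Qed.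

Lemma bounded_sub_obox : exists a b : 'rV[R]_d, Om `<=` obox a b.
Proof.
have [M [_ hM]] := bOm; pose N := `|M| + 1.
exists (\row_i - (N + 1)), (\row_i (N + 1)) => x /(hM N) h i; rewrite in_itv/= !mxE -ltr_norml.
apply: le_lt_trans (norm_coord_le x i) _; apply: le_lt_trans (h _) _; last by rewrite ltrDl.
by rewrite /N (le_lt_trans (ler_norm _))// ltrDl.
Qed.

Lemma interior_ball x0 : Om x0 -> exists2 rho : R, 0 < rho & forall q, `|q| <= rho -> Om (x0 + q).
Proof.
move=> Ox0; have /nbhs_ballP[e/= e0 he] : nbhs x0 Om by exact: open_nbhs_nbhs.
exists (e / 2) => [|q hq]; first by rewrite divr_gt0.
by apply: he; rewrite -ball_normE /= opprD addNKr normrN (le_lt_trans hq)// gtr_pMr// invf_lt1// ltr1n.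
Qed.

Lemma common_shift (e : R) (g : option 'I_d -> 'rV[R]_d -> R) : 0 < e -> (forall o, L2 Om (g o)) ->
  exists2 dl : R, 0 < dl & forall o (l : R) z, `|l - 1| < dl -> `|z| < dl -> 0 < l ->
    sqn (fun x => (g o \_ Om) (aff l z x) - (g o \_ Om) x) <= e.
Proof.
move=> e0 lg; have [a [b Oab]] := bounded_sub_obox.
have h o : exists dl : R, 0 < dl /\ forall (l : R) z, `|l - 1| < dl -> `|z| < dl -> 0 < l ->
    sqn (fun x => (g o \_ Om) (aff l z x) - (g o \_ Om) x) <= e.
  have [|dl dl0 hdl] := @shift_continuous_L2 _ _ (g o \_ Om) a b (L2_extend (lg o)) _ e e0.
    by move=> x nx; rewrite /patch memNset// => /Oab.
  by exists dl.
have [dl hdl] := choice h.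
pose s := 1 + \sum_o (dl o)^-1.
have s0 : 0 < s by rewrite ltr_pwDl// sumr_ge0// => o _; rewrite invr_ge0; have [/ltW] := hdl o.
exists s^-1; first by rewrite invr_gt0.
move=> o l z hl hz l0; have [d0 hd] := hdl o.
have sd : s^-1 <= dl o.
  rewrite -[leRHS]invrK lef_pV2 ?posrE ?invr_gt0// /s (bigD1 o)//=.
  rewrite addrCA lerDl addr_ge0// sumr_ge0// => o' _; rewrite invr_ge0; have [/ltW] := hdl o'; by [].
by apply: hd => //; [exact: lt_le_trans hl sd|exact: lt_le_trans hz sd].
Qed.

Lemma ipDD_le v w : L2 Om v -> L2 Om w ->
  ip Om (fun x => v x + w x) (fun x => v x + w x) <= 2 * ip Om v v + 2 * ip Om w w.
Proof.
move=> lv lw; rewrite (ipDD mOm lv lw).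
have := @ip_young _ _ _ mOm 1 v w ltr01 lv lw.
by rewrite invr1 !mul1r; move: (ip _ _ _) (ip _ _ _) (ip _ _ _) => p q r; lra.
Qed.

Lemma eq_ip v v' w w' : (forall x, Om x -> v x = v' x) -> (forall x, Om x -> w x = w' x) ->
  ip Om v w = ip Om v' w'.
Proof.
by move=> hv hw; apply: eq_Rintegral => x /set_mem Ox; rewrite hv// hw.
Qed.

(** Dilations about an interior point move a convex set into its interior or
    its complement by a fixed proportion, which leaves room for a mollifier:
    in the simply supported case the approximations vanish near the boundary,
    in the other case they use the values inside only. *)
Lemma smooth_approximation u sigma (e : R) : mixed_gradient Om bc u sigma -> 0 < e ->
  exists v, [/\ strongly_smooth v, bc = SimplySupported -> test_function Om v,
    ip Om (fun x => v x - u x) (fun x => v x - u x) <= e &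
    forall i, ip Om (fun x => pd i v x - coordf sigma i x) (fun x => pd i v x - coordf sigma i x) <= e].
Proof.
move=> hg e0; have [lu ls _] := hg.
have [x0 Ox0] := neOm; have [rho rho0 hrho] := interior_ball Ox0.
pose g (o : option 'I_d) := if o is Some i then coordf sigma i else u.
have lg o : L2 Om (g o) by case: o => [i|]; [exact: ls|exact: lu].
pose e1 := e / 16; have e10 : 0 < e1 by rewrite divr_gt0.
have [dl dl0 hdl] := common_shift e10 lg.
pose S := \sum_i ip Om (coordf sigma i) (coordf sigma i).
have S0 : 0 <= S by apply: sumr_ge0 => i _; exact: ip_ge0.
(* The inverse of [t] dominates each of the three quantities that [t] has to
   compensate below. *)
pose K := 1 + (`|x0| + rho + 1) / dl + 4 * (S + 1) / e.
pose t : R := K^-1 / 2.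
have x00 : 0 <= `|x0| by [].
have K1 : 0 < (`|x0| + rho + 1) / dl by rewrite divr_gt0//; lra.
have K2 : 0 < 4 * (S + 1) / e by rewrite divr_gt0// mulr_gt0// ltr_wpDl.
have K0 : 0 < K by rewrite /K; lra.
have t0 : 0 < t by rewrite divr_gt0// invr_gt0.
have tK : t * K = 2^-1 by rewrite /t mulrAC mulVf ?mul1r// gt_eqF.
have tle (k : R) : k <= K -> t * k <= 2^-1 by move=> h; rewrite -tK ler_wpM2l ?(ltW t0).
have t12 : t <= 2^-1 by rewrite -[leLHS]mulr1; apply: tle; rewrite /K; lra.
have tx0 : t * (`|x0| + rho + 1) <= dl * 2^-1.
  rewrite -[leLHS](@mulfVK _ dl) ?gt_eqF// [leLHS]mulrC ler_wpM2l ?(ltW dl0)// -mulrA.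
  by apply: tle; rewrite /K; lra.
have tS : t * (4 * (S + 1)) <= e * 2^-1.
  rewrite -[leLHS](@mulfVK _ e) ?gt_eqF// [leLHS]mulrC ler_wpM2l ?(ltW e0)// -mulrA.
  by apply: tle; rewrite /K; lra.
pose r := t * rho / 2.
have r0 : 0 < r by rewrite divr_gt0// mulr_gt0.
pose lo : 'rV[R]_d := \row_i - r; pose hi : 'rV[R]_d := \row_i r.
have m0 : 0 < \int[mu]_x box_bump lo hi 0 x by exact: integral_box_bump_gt0.
set m := \int[mu]_x _ in m0.
pose kappa x := m^-1 * box_bump lo hi 0 x.
have sphi p : strongly_smooth (fun y => kappa (y - p)).
  apply: smooth_expr_strongly_smooth.
  rewrite (_ : (fun _ => _) = fun y => m^-1 * box_bump (lo + p) (hi + p) 0 y).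
    by apply: SmoothMul; [exact: SmoothCst|exact: smooth_expr_box_bump].
  by apply/funext => y; rewrite /kappa box_bump_translate.
have hk : kernel lo hi kappa.
  split; first by have := sphi 0; under eq_fun do rewrite subr0.
  by move=> x nx; rewrite /kappa box_bump_out ?mulr0// => /obox_sub_box.
have k0 z : 0 <= kappa z by rewrite mulr_ge0 ?box_bump_ge0// invr_ge0 (ltW m0).
have k1 : \int[mu]_z kappa z = 1.
  have ik : mu.-integrable setT (EFin \o box_bump lo hi 0).
    apply: (@integrable_compact_support _ _ _ (box lo hi)); [|exact: compact_box|].
      by have [] := strongly_smooth_full (smooth_expr_strongly_smooth (smooth_expr_box_bump lo hi 0)).
    by move=> x nx; apply: box_bump_out => /obox_sub_box.
  by rewrite RintegralZl// -/m mulVf// gt_eqF.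
have boxr z : box lo hi z -> `|z| <= r.
  move=> Bz; apply: norm_le_coord; first exact: ltW.
  by move=> i; have := Bz i; rewrite in_itv/= !mxE -ler_norml.
(* The values of [u] are read at the image of [x] by the dilation of factor [l]
   about [x0]: near the boundary this is outside [Om] when [l] exceeds 1, and
   always well inside when [l] is less than 1. *)
pose l : R := if bc is SimplySupported then 1 + t else 1 - t.
have l1 : `|l - 1| = t.
  by rewrite /l; case: bc; rewrite addrAC subrr add0r ?normrN gtr0_norm.
have [l0 l2] : 0 < l /\ l <= 2 by rewrite /l; case: bc; split; lra.
pose c : 'rV[R]_d := (1 - l) *: x0.
have affE x : aff l c x = x0 + l *: (x - x0).
  by rewrite /aff /c; apply/rowP => i; rewrite !mxE; ring.
have hs o z : box lo hi z ->
    sqn (fun x => (g o \_ Om) (aff l (c + z) x) - (g o \_ Om) x) <= e1.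
  move=> /boxr hz; apply: hdl => //; first by rewrite l1; nra.
  apply: le_lt_trans (ler_normD _ _) _.
  rewrite /c normrZ distrC l1; have : r < t * (rho + 1) by rewrite /r; nra.
  nra.
have hgrad i x : (bc = CahnHilliard -> test_function Om (fun y => kappa (y - aff l c x))) ->
    pd i (mollify Om kappa l c u) x = l * mollify Om kappa l c (coordf sigma i) x.
  move=> tphi; rewrite (pd_mollify mOm bOm _ _ _ hk lu) /mollify -pd_translate.
  rewrite (mixed_gradient_by_parts oOm bOm i hg) ?mulrNN//.
  exact: strongly_smooth_C1 (sphi _).
have hgradO i x : Om x -> pd i (mollify Om kappa l c u) x = l * mollify Om kappa l c (coordf sigma i) x.
  move=> Ox; apply: hgrad => bcE.
  set p := aff l c x.
  have -> : (fun y => kappa (y - p)) = fun y => m^-1 * box_bump (lo + p) (hi + p) 0 y.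
    by apply/funext => y; rewrite /kappa box_bump_translate.
  have BO : box (lo + p) (hi + p) `<=` Om.
    move=> y By; have hq : `|y - p| <= r.
      apply: norm_le_coord; first exact: ltW.
      move=> i'; have := By i'; rewrite in_itv/= !mxE ler_norml => /andP[h1 h2].
      by apply/andP; split; lra.
    have lE : l = 1 - t by rewrite /l bcE.
    have -> : y = (1 - t) *: x + (1 - (1 - t)) *: (x0 + t^-1 *: (y - p)).
      rewrite subKr scalerDr scalerA mulfV ?gt_eqF// scale1r /p affE lE.
      by apply/rowP => i'; rewrite !mxE; ring.
    apply: convex_comb => //; [lra|lra|apply: hrho].
    rewrite normrZ gtr0_norm ?invr_gt0// ler_pdivrMl//; apply: le_trans hq _.
    by rewrite /r; nra.
  have [sb [K' cK' [KO hK']]] := test_function_box_bump 0 BO.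
  split; last by exists K' => //; split => // z /hK' ->; rewrite mulr0.
  apply: strongly_smooth_smooth; apply: smooth_expr_strongly_smooth.
  by apply: SmoothMul; [exact: SmoothCst|exact: smooth_expr_box_bump].
have err o := mollify_error oOm bOm hk k0 k1 (lg o) l0 (hs o).
have lme o : L2 Om (fun x => mollify Om kappa l c (g o) x - g o x).
  by apply: L2B => //; apply: L2_continuous_fun => //; exact: mollify_continuous hk (lg o).
exists (mollify Om kappa l c u); split.
- exact: mollify_smooth hk lu.
- move=> bcE; split; first exact: strongly_smooth_smooth (mollify_smooth mOm bOm _ _ hk lu).
  have lE : l = 1 + t by rewrite /l bcE.
  pose S' := [set x | exists2 y, Om y & `|y - aff l c x| <= r].
  have clO : closure S' `<=` Om.
    move=> x /(_ (ball x (r / 2))) []; first by apply: nbhsx_ballx; rewrite divr_gt0.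
    move=> x' [[y Oy hy]]; rewrite -ball_normE/= => hx.
    pose q := aff l c x - y.
    have hq : `|q| <= t * rho.
      have -> : q = l *: (x - x') - (y - aff l c x') by apply/rowP => i; rewrite !mxE; ring.
      apply: le_trans (ler_normB _ _) _; rewrite normrZ gtr0_norm//.
      have -> : t * rho = r + r by rewrite /r; lra.
      by apply: lerD => //; nra.
    have -> : x = l^-1 *: y + (1 - l^-1) *: (x0 + t^-1 *: q).
      apply/rowP => i; rewrite !mxE lE; field.
      by rewrite !gt_eqF//; lra.
    apply: convex_comb => //; [by rewrite invr_ge0 ltW|by rewrite invf_le1// lE; lra|apply: hrho].
    by rewrite normrZ gtr0_norm ?invr_gt0// ler_pdivrMl.
  exists (closure S').
    have [a [b Oab]] := bounded_sub_obox.
    apply: (subclosed_compact (@closed_closure _ _) (@compact_box _ _ a b)).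
    by move=> x /clO /Oab /obox_sub_box.
  split=> // x nx; rewrite /mollify (@eq_ip _ u _ (fun=> 0)) 1?ipC ?ip0l// => y Oy.
  have [_ ->] := hk => // /boxr hy; apply: nx; apply: subset_closure.
  by exists y.
- by apply: le_trans (err None) _; rewrite /e1; lra.
- move=> i.
  pose A x := l * (mollify Om kappa l c (coordf sigma i) x - coordf sigma i x).
  pose B x := (l - 1) * coordf sigma i x.
  rewrite (@eq_ip _ (fun x => A x + B x) _ (fun x => A x + B x)); last 2 first.
  + by move=> x Ox; rewrite hgradO// /A /B; ring.
  + by move=> x Ox; rewrite hgradO// /A /B; ring.
  have lA : L2 Om A by apply: (L2Z mOm); exact: lme (Some i).
  have lB : L2 Om B by apply: (L2Z mOm); exact: ls.
  apply: le_trans (ipDD_le lA lB) _.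
  have -> : ip Om A A = l ^+ 2 * ip Om (fun x => mollify Om kappa l c (coordf sigma i) x - coordf sigma i x)
      (fun x => mollify Om kappa l c (coordf sigma i) x - coordf sigma i x).
    by rewrite ipZl ?ipZr ?mulrA -?expr2//; exact: lme (Some i).
  have -> : ip Om B B = t ^+ 2 * ip Om (coordf sigma i) (coordf sigma i).
    by rewrite ipZl ?ipZr ?mulrA -?expr2//; rewrite -l1 real_normK ?num_real.
  have := err (Some i); rewrite -/(g _) /=; set E := ip _ _ _ => hE.
  have Si : ip Om (coordf sigma i) (coordf sigma i) <= S.
    by rewrite /S (bigD1 i)//= lerDl sumr_ge0// => j _; exact: ip_ge0.
  have E0 : 0 <= E by exact: ip_ge0.
  set s := ip _ _ _ in Si *.
  have s0 : 0 <= s by exact: ip_ge0.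
  have h1 : l ^+ 2 * E <= 4 * e1 by rewrite ler_pM// ?sqr_ge0//; nra.
  have h2 : t ^+ 2 * s <= t * S by rewrite expr2 -mulrA ler_wpM2l ?(ltW t0)//; nra.
  have h3 : 16 * e1 = e by rewrite /e1; lra.
  nra.
Qed.

End gradient_approximation.

(** * A Faber-Krahn type inequality on convex domains *)

Section weighted_increment.
Context {R : realType}.
Local Notation lmu := (@lebesgue_measure R).

Lemma growth_of_derive (a b : R) (F f K : R -> R) : a < b ->
  measurable_fun `]a, b] K -> (forall t, `]a, b]%classic t -> 0 <= K t) ->
  (forall t, a <= t <= b -> is_derive t 1 F (f t)) ->
  (forall t, a < t < b -> f t <= K t) ->
  ((F b - F a)%:E <= \int[lmu]_(t in `]a, b]) (K t)%:E)%E.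
Proof.
move=> ab mK K0 dF fK.
have cF t : a <= t <= b -> {for t, continuous F}.
  by move=> /dF[h _]; apply: differentiable_continuous; exact/derivable1_diffP.
apply: growth_le_integral => //.
- by move=> t /andP[at_ tb]; apply: cvg_at_left_filter; apply: cF; rewrite (ltW at_).
- by apply: cvg_at_right_filter; apply: cF; rewrite lexx (ltW ab).
move=> t e /andP[at_ tb] e0.
have [h1 h2] : is_derive t 1 F (f t) by apply: dF; rewrite (ltW at_) (ltW tb).
have : (fun h => h^-1 *: ((F \o shift t) (h *: (1:R)) - F t)) h @[h --> 0^'] --> f t.
  by rewrite -h2; exact: h1.
move=> /cvgrPdist_le/(_ e e0) [r /= r0 hr].
exists r => //= s ts ts'.
have st : 0 < s - t by rewrite subr_gt0.
have := hr (s - t); rewrite /= sub0r normrN -[X in X < r]distrC => /(_ ts); rewrite gt_eqF// => /(_ isT).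
rewrite [(s - t) *: 1]mulr1 subrK [_ *: _]mulrC -(ler_pM2r st).
rewrite -{2}(gtr0_norm st) -normrM mulrBl divfK ?gt_eqF// => h.
have ft : f t <= K t by apply: fK; rewrite at_ tb.
move: h; rewrite ler_norml => /andP[h _].
have : f t * (s - t) <= K t * (s - t) by rewrite ler_wpM2r// (ltW st).
by move: h; rewrite [(s - t) * _]mulrC mulrDl; move: (f t * _) (K t * _) (e * _) => p1 p2 p3; lra.
Qed.

(** Cauchy-Schwarz on an interval, with the weight [W'] on one side; it is
    obtained from [2 m phi' <= m ^ 2 W' + phi' ^ 2 / W'], integrated, by choice
    of [m]. *)
Lemma weighted_increment (a b w : R) (phi W phi' p K : R -> R) : a < b -> 0 < w ->
  measurable_fun `]a, b] K -> (forall t, `]a, b]%classic t -> 0 <= K t) ->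
  (forall t, a <= t <= b -> is_derive t 1 phi (phi' t)) ->
  (forall t, a <= t <= b -> is_derive t 1 W (p t)) ->
  W b - W a <= w ->
  (forall t, a < t < b -> 0 < p t /\ phi' t ^+ 2 <= p t * K t) ->
  (((phi b - phi a) ^+ 2 / w)%:E <= \int[lmu]_(t in `]a, b]) (K t)%:E)%E.
Proof.
move=> ab w0 mK K0 dphi dW Ww hK.
pose D := phi b - phi a; pose m := D / w.
pose F t := 2 * m * phi t - m ^+ 2 * W t.
have dF t : a <= t <= b -> is_derive t 1 F (2 * m * phi' t - m ^+ 2 * p t).
  move=> tab.
  have H := is_deriveB (is_deriveZ (2 * m) (dphi t tab)) (is_deriveZ (m ^+ 2) (dW t tab)).
  exact: H.
apply: (@le_trans _ _ (F b - F a)%:E); last first.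
  apply: (@growth_of_derive a b F (fun t => 2 * m * phi' t - m ^+ 2 * p t)) => //.
  move=> t tab; have [p0 h] := hK t tab.
  move: h; move: (p t) (phi' t) (K t) p0 => P f k P0 h; rewrite -(ler_pM2l P0).
  have -> : P * (2 * m * f - m ^+ 2 * P) = f ^+ 2 - (m * P - f) ^+ 2 by ring.
  by apply: le_trans h; rewrite lerBlDr lerDl sqr_ge0.
rewrite lee_fin.
have -> : F b - F a = 2 * m * D - m ^+ 2 * (W b - W a) by rewrite /F /D; ring.
have -> : D ^+ 2 / w = 2 * m * D - m ^+ 2 * w by rewrite /m; field; rewrite gt_eqF.
by rewrite lerD2l lerN2 ler_wpM2l ?sqr_ge0.
Qed.

End weighted_increment.

Lemma sqr_sum_le (R : realType) (d : nat) (a : 'I_d -> R) :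
  (\sum_i a i) ^+ 2 <= d%:R * \sum_i a i ^+ 2.
Proof.
have -> : (\sum_i a i) ^+ 2 = \sum_i \sum_j a i * a j.
  by rewrite expr2 mulr_suml; apply: eq_bigr => i _; rewrite mulr_sumr.
apply: (@le_trans _ _ (\sum_i \sum_j (2^-1 * a i ^+ 2 + 2^-1 * a j ^+ 2))).
  apply: ler_sum => i _; apply: ler_sum => j _.
  by have := sqr_ge0 (a i - a j); rewrite sqrrB; move: (a i * a j) => q; rewrite -mulr_natr; lra.
pose S := \sum_j a j ^+ 2.
rewrite (eq_bigr (fun i => 2^-1 * d%:R * a i ^+ 2 + 2^-1 * S)); last first.
  move=> i _; rewrite big_split/= sumr_const card_ord -mulr_sumr -/S -mulr_natr; ring.
rewrite big_split/= -mulr_sumr -/S sumr_const card_ord -mulr_natr.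
by rewrite le_eqVlt; apply/orP; left; apply/eqP; field.
Qed.

Section powers.
Context {R : realType}.

Lemma is_derive_sqr (t : R) : is_derive t 1 (fun t : R => t ^+ 2) (2 * t).
Proof.
have H := is_deriveM (@is_derive_id R R^o t 1) (@is_derive_id R R^o t 1).
by apply: (is_derive_eq H); rewrite ![_ *: _]mulr1 mulr_natl mulr2n.
Qed.

Lemma is_derive_cube (t : R) : is_derive t 1 (fun t : R => t ^+ 3) (3 * t ^+ 2).
Proof.
have H := is_deriveM (@is_derive_id R R^o t 1) (is_derive_sqr t).
apply: (is_derive_eq H); change (t * (2 * t) + t ^+ 2 * 1 = 3 * t ^+ 2); ring.
Qed.

Lemma is_derive_cubeV (t : R) : 0 < t ->
  is_derive t 1 (fun t : R => - 3^-1 * (t ^+ 3)^-1) ((t ^+ 4)^-1).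
Proof.
move=> t0; have t3 : (fun t : R => t ^+ 3) t != 0 by rewrite expf_neq0// gt_eqF.
have H1 := @is_deriveV R (fun t : R => t ^+ 3) t _ 1 t3 (is_derive_cube t).
have H := is_deriveZ (- 3^-1) H1.
apply: (is_derive_eq H); change (- 3^-1 * (- (t ^+ 3) ^- 2 * (3 * t ^+ 2)) = (t ^+ 4)^-1).
by field; rewrite gt_eqF.
Qed.

End powers.

Section increments.
Context {R : realType} {d : nat} (Om : set 'rV[R]_d).
Hypotheses (oOm : open Om) (bOm : bounded_set Om)
  (cOm : convex_set (Om : set (convex_lmodType 'rV[R]_d))).
Local Notation mu := (leb d : {sigma_finite_measure set 'rV[R]_d -> \bar R}).
Local Notation lmu := (@lebesgue_measure R).
Implicit Types (v : 'rV[R]_d -> R) (x y z p : 'rV[R]_d).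

Let mOm : measurable Om. Proof. exact: open_measurable_rV. Qed.
Let Omy : (mu Om < +oo)%E. Proof. exact: leb_bounded_lty. Qed.

Lemma bounded_coord_diff : exists2 D : R, 0 < D & forall x y i, Om x -> Om y ->
  `|x ord0 i - y ord0 i| <= D.
Proof.
have [M [_ hM]] := bOm; pose N := `|M| + 1.
have N0 : 0 < N by rewrite ltr_wpDl.
have h x i : Om x -> `|x ord0 i| <= N.
  move=> /(hM N) hx; apply: le_trans (norm_coord_le x i) (hx _).
  by rewrite /N (le_lt_trans (ler_norm _))// ltrDl.
exists (N + N) => [|x y i Ox Oy]; first by rewrite addr_gt0.
by apply: le_trans (ler_normB _ _) _; rewrite lerD ?h.
Qed.

Definition sqgrad v x : R := \1_Om x * \sum_i pd i v x ^+ 2.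

Definition energy v : R := \sum_i ip Om (pd i v) (pd i v).

Lemma sqgrad_ge0 v x : 0 <= sqgrad v x.
Proof. by rewrite mulr_ge0 ?indicE// sumr_ge0// => i _; exact: sqr_ge0. Qed.

Lemma measurable_sqgrad v : strongly_smooth v -> measurable_fun setT (sqgrad v).
Proof.
move=> sv; apply: measurable_funM; first exact: measurable_indic.
apply: measurable_sum => i; apply: measurable_funX; apply: continuous_measurable_rV.
by have [] := strongly_smooth_full (strongly_smooth_pd i sv).
Qed.

Lemma L2_pd v i : strongly_smooth v -> L2 Om (pd i v).
Proof.
move=> sv; apply: L2_continuous_fun => //.
by have [] := strongly_smooth_full (strongly_smooth_pd i sv).
Qed.

Lemma energy_ge0 v : 0 <= energy v.
Proof. by apply: sumr_ge0 => i _; exact: ip_ge0. Qed.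

Lemma integral_sqgrad v : strongly_smooth v -> (\int[mu]_x (sqgrad v x)%:E = (energy v)%:E)%E.
Proof.
move=> sv; rewrite /energy -sumEFin.
transitivity (\int[mu]_(x in Om) \sum_i ((pd i v x * pd i v x)%:E))%E.
  rewrite [RHS]integral_mkcond; apply: eq_integral => x _.
  rewrite /sqgrad indicE /patch; case: (x \in Om); last by rewrite mul0r.
  by rewrite mul1r sumEFin; congr _%:E; apply: eq_bigr => i _; rewrite expr2.
rewrite ge0_integral_sum//.
- by apply: eq_bigr => i _; rewrite ip_EFin//; exact: L2_pd.
- move=> i; apply/measurable_EFinP; have lp := L2_pd i sv.
  by apply: measurable_funM; exact: (L2_measurable mOm lp).
- by move=> i x _; rewrite lee_fin -expr2 sqr_ge0.
Qed.

(** The increments of [v] along the points [l t z + (1 - l t) p] are controlled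
    in the mean over [z] by the change of variables [z |-> l t z + (1 - l t) p]. *)
Lemma increment_le v p (D a b w M : R) (l l' W wt k : R -> R) :
  strongly_smooth v -> Om p -> 0 <= D ->
  (forall x y i, Om x -> Om y -> `|x ord0 i - y ord0 i| <= D) ->
  a < b -> 0 < w -> continuous l ->
  (forall t, a <= t <= b -> is_derive t 1 l (l' t)) ->
  (forall t, a <= t <= b -> is_derive t 1 W (wt t)) -> W b - W a <= w ->
  (forall t, a <= t <= b -> 0 <= l t <= 1) ->
  measurable_fun setT k ->
  (forall t, a < t <= b -> [/\ 0 < l t, 0 < wt t, 0 <= k t, l' t ^+ 2 <= wt t * k t &
    k t * (l t)^-1 ^+ d <= M]) ->
  (\int[mu]_(z in Om) ((v (aff (l b) ((1 - l b) *: p) z) - v (aff (l a) ((1 - l a) *: p) z)) ^+ 2)%:E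
    <= (w * M * (b - a) * (d%:R * D ^+ 2) * energy v)%:E)%E.
Proof.
move=> sv Op D0 hD ab w0 cl dl dW Ww l01 mk hk.
have [cv hv] := strongly_smooth_full sv.
pose path z t := aff (l t) ((1 - l t) *: p) z.
have pathE z t : path z t = l t *: (z - p) + p.
  by apply/rowP => i; rewrite /path /aff !mxE; ring.
have C0 : 0 <= d%:R * D ^+ 2 by rewrite mulr_ge0// sqr_ge0.
pose K z t := (d%:R * D ^+ 2) * k t * sqgrad v (path z t).
have ml : measurable_fun setT l by exact: continuous_measurable_fun.
have mG := measurable_sqgrad sv.
have mpath : measurable_fun setT (fun q : 'rV[R]_d * measurableTypeR R => path q.1 q.2).
  apply: measurable_fun_rV => i.
  rewrite (_ : (fun _ => _) = fun q : 'rV[R]_d * measurableTypeR R => l q.2 * (q.1 ord0 i - p ord0 i) + p ord0 i); last first.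
    by apply/funext => q; rewrite pathE !mxE.
  apply: measurable_funD => //; apply: measurable_funM; first exact: (measurableT_comp ml measurable_snd).
  apply: measurable_funB => //; exact: (measurableT_comp (measurable_coord i) measurable_fst).
pose I : set (measurableTypeR R) := `]a, b]%classic.
pose H (q : 'rV[R]_d * measurableTypeR R) : \bar R := (\1_I q.2 * K q.1 q.2)%:E.
have mI : measurable I by exact: measurable_itv.
have mK : measurable_fun setT (fun q : 'rV[R]_d * measurableTypeR R => K q.1 q.2).
  apply: measurable_funM; last exact: (measurableT_comp mG mpath).
  by apply: measurable_funM => //; exact: (measurableT_comp mk measurable_snd).
have mH : measurable_fun setT H.
  apply/measurable_EFinP; apply: measurable_funM => //.
  by apply: (measurableT_comp _ measurable_snd); exact: measurable_indic.
have H0 q : (0 <= H q)%E.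
  rewrite lee_fin indicE; case: (boolP (_ \in _)) => [/set_mem/=|_]; last by rewrite mul0r.
  rewrite /I /= in_itv/= => /hk[_ _ k0 _ _].
  by rewrite mul1r /K mulr_ge0 ?sqgrad_ge0// mulr_ge0.
have step z : Om z -> (((v (path z b) - v (path z a)) ^+ 2)%:E <= w%:E * \int[lmu]_t H (z, t))%E.
  move=> Oz.
  pose s t := \sum_i (z - p) ord0 i * pd i v (path z t).
  have dphi t : a <= t <= b -> is_derive t 1 (fun t => v (path z t)) (l' t * s t).
    move=> tab; have D1 := @is_derive_segment _ _ v p (z - p) (l t) (strongly_smooth_full sv).
    have D2 := @is_derive1_comp _ (fun h : R => v (h *: (z - p) + p)) l t _ _ D1 (dl t tab).
    rewrite (_ : (fun t => v (path z t)) = (fun h : R => v (h *: (z - p) + p)) \o l).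
      by apply: (is_derive_eq D2); rewrite mulrC /s; congr (_ * _); apply: eq_bigr => i _; rewrite pathE.
    by apply/funext => t'; rewrite /= pathE.
  have mKz : measurable_fun `]a, b] (K z).
    have mz : measurable_fun setT (fun t : measurableTypeR R => (z, t)).
      by apply/measurable_fun_pairP; split; [exact: measurable_cst|exact: measurable_id].
    by apply: measurable_funTS; exact: (measurableT_comp mK mz).
  have Kz0 t : `]a, b]%classic t -> 0 <= K z t.
    by rewrite /= in_itv/= => /hk[_ _ k0 _ _]; rewrite /K mulr_ge0 ?sqgrad_ge0// mulr_ge0.
  have Opath t : a <= t <= b -> Om (path z t).
    by move=> /l01 /andP[l0 l1]; apply: convex_comb.
  have key t : a < t < b -> 0 < wt t /\ (l' t * s t) ^+ 2 <= wt t * K z t.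
    move=> /andP[ta tb]; have [] := hk t; first by rewrite ta ltW.
    move=> _ w0' k0 lw _; split => //.
    rewrite exprMn /K /sqgrad indicE mem_set ?mul1r; last by apply: Opath; rewrite !ltW.
    have hs : s t ^+ 2 <= d%:R * D ^+ 2 * \sum_i pd i v (path z t) ^+ 2.
      apply: le_trans (sqr_sum_le _) _; rewrite -mulrA ler_wpM2l// mulr_sumr.
      apply: ler_sum => i _; rewrite exprMn ler_wpM2r ?sqr_ge0//.
      rewrite -real_normK ?num_real// lerXn2r ?nnegrE// mxE [X in `|_ + X|]mxE.
      exact: hD.
    rewrite [leRHS](_ : _ = (wt t * k t) * (d%:R * D ^+ 2 * \sum_i pd i v (path z t) ^+ 2)); last by ring.
    by rewrite ler_pM ?sqr_ge0.
  have := @weighted_increment _ a b w (fun t => v (path z t)) W (fun t => l' t * s t) wt (K z) ab w0 mKz Kz0 dphi dW Ww key.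
  have -> : (\int[lmu]_(t in `]a, b]) (K z t)%:E = \int[lmu]_t H (z, t))%E.
    rewrite integral_mkcond; apply: eq_integral => t _; rewrite /H /= /patch indicE.
    by case: (_ \in _); rewrite ?mul1r ?mul0r.
  move=> h; rewrite -[leLHS](_ : (w%:E * ((v (path z b) - v (path z a)) ^+ 2 / w)%:E)%E = _).
    by rewrite lee_wpmul2l// lee_fin ltW.
  by rewrite -EFinM mulrC divfK// gt_eqF.
have mF : measurable_fun setT (fun z => \int[lmu]_t H (z, t))%E by exact: measurable_fun_fubini_tonelli_F.
have mpz t : measurable_fun setT (fun z => v (path z t)).
  by apply: measurableT_comp; [exact: continuous_measurable_rV|exact: measurable_aff].
apply: (@le_trans _ _ (\int[mu]_(z in Om) (w%:E * \int[lmu]_t H (z, t))%E)%E).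
  apply: ge0_le_integral => //.
  - by move=> z _; rewrite lee_fin sqr_ge0.
  - apply: measurable_funTS; apply/measurable_EFinP; apply: measurable_funX; apply: measurable_funB; exact: mpz.
  - by apply: measurable_funTS; exact: measurable_funeM.
apply: (@le_trans _ _ (\int[mu]_z (w%:E * \int[lmu]_t H (z, t))%E)%E).
  apply: ge0_subset_integral => //; first exact: measurable_funeM.
  by move=> z _; rewrite mule_ge0 ?lee_fin ?(ltW w0)//; exact: integral_ge0.
rewrite ge0_integralZl//; [|by move=> z _; exact: integral_ge0|by rewrite lee_fin ltW].
rewrite fubini_tonelli//.
have inner t : (\int[mu]_z H (z, t) <= (\1_I t * (M * (d%:R * D ^+ 2) * energy v))%:E)%E.
  rewrite /H /= indicE; case: (boolP (t \in I)) => [/set_mem/=|_]; last first.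
    by rewrite integral0_eq ?mul0r// => z _; rewrite mul0r.
  rewrite /I /= in_itv/= => /hk[l0 _ k0 _ kM]; rewrite !mul1r.
  under eq_integral do rewrite mul1r /K EFinM.
  have c0 : 0 <= d%:R * D ^+ 2 * k t by rewrite mulr_ge0.
  rewrite ge0_integralZl_EFin//; last 2 first.
  - by move=> z _; rewrite lee_fin sqgrad_ge0.
  - by apply/measurable_EFinP; apply: measurableT_comp => //; exact: measurable_aff.
  rewrite (@ge0_integral_aff _ _ (l t) _ (fun z => (sqgrad v z)%:E))//; last 2 first.
  - by apply/measurable_EFinP.
  - by move=> z; rewrite lee_fin sqgrad_ge0.
  rewrite integral_sqgrad// -!EFinM lee_fin.
  rewrite [leLHS](_ : _ = k t * (l t)^-1 ^+ d * (d%:R * D ^+ 2 * energy v)); last by ring.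
  by rewrite -[leRHS]mulrA ler_wpM2r// mulr_ge0// energy_ge0.
have cc : 0 <= M * (d%:R * D ^+ 2) * energy v.
  have [|l0 _ k0 _ kM] := hk b; first by rewrite ab lexx.
  rewrite mulr_ge0 ?energy_ge0// mulr_ge0// (le_trans _ kM)// mulr_ge0// exprn_ge0// invr_ge0.
  exact: ltW.
apply: (@le_trans _ _ (w%:E * \int[lmu]_t (\1_I t * (M * (d%:R * D ^+ 2) * energy v))%:E)%E).
  rewrite lee_wpmul2l ?lee_fin ?(ltW w0)//; apply: ge0_le_integral => //.
  - by move=> t _; exact: integral_ge0.
  - exact: measurable_fun_fubini_tonelli_G.
  - by apply/measurable_EFinP; apply: measurable_funM => //; exact: measurable_indic.
under eq_integral do rewrite mulrC EFinM.
rewrite ge0_integralZl_EFin//; last by apply/measurable_EFinP; exact: measurable_indic.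
have EI : (lmu I = (b - a)%:E)%E by rewrite /I lebesgue_measure_itv/= lte_fin ab.
rewrite integral_indic// setIT -[X in (_ * (_ * X))%E]/(lmu I) EI -!EFinM lee_fin.
by rewrite le_eqVlt; apply/orP; left; apply/eqP; ring.
Qed.


(** The beginning of the path [t |-> (1 - t^2) x + t^2 y], with [W t = t^2]. The
    dilation in [x] has factor at least 1/2, so the change of variables costs at
    most [2^d]. *)
Lemma increment_near v y (D r : R) : strongly_smooth v -> Om y -> 0 <= D ->
  (forall x y i, Om x -> Om y -> `|x ord0 i - y ord0 i| <= D) -> 0 < r -> r <= 2^-1 -> (d <= 3)%N ->
  (\int[mu]_(x in Om) ((v (aff (1 - r ^+ 2) (r ^+ 2 *: y) x) - v x) ^+ 2)%:E <=
    (16 * r ^+ 4 * (d%:R * D ^+ 2) * energy v)%:E)%E.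
Proof.
move=> sv Oy D0 hD r0 r12 d3.
have := @increment_le v y D 0 r (r ^+ 2) (16 * r) (fun t => 1 - t ^+ 2) (fun t => - (2 * t))
  (fun t => t ^+ 2) (fun t => 2 * t) (fun t => 2 * t) sv Oy D0 hD r0.
move=> H; apply: le_trans (le_trans _ (H _ _ _ _ _ _ _ _)) _.
- rewrite le_eqVlt; apply/orP; left; apply/eqP; apply: eq_integral => z _.
  by rewrite /aff expr0n /= subr0 subrr !scale0r addr0 scale1r subKr.
- by rewrite exprn_gt0.
- by move=> t; apply: cvgB; [exact: cvg_cst|exact: exprn_continuous].
- move=> t _; have H1 := is_deriveB (@is_derive_cst R R^o R^o 1 t 1) (is_derive_sqr t).
  by apply: (is_derive_eq H1); rewrite sub0r.
- by move=> t _; exact: is_derive_sqr.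
- by rewrite expr0n subr0.
- by move=> t /andP[t0 tr]; apply/andP; split; nra.
- exact: measurable_funM.
- move=> t /andP[t0 tr].
  have l1 : 2^-1 <= 1 - t ^+ 2 by nra.
  split => //; [by nra|by nra|by nra|by nra|].
  have h1 : (1 - t ^+ 2)^-1 <= 2 by rewrite -[leRHS]invrK lef_pV2 ?posrE//; nra.
  have h0 : 0 <= (1 - t ^+ 2)^-1 by rewrite invr_ge0; nra.
  have h2 : (1 - t ^+ 2)^-1 ^+ d <= 2 ^+ 3.
    apply: (@le_trans _ _ (2 ^+ d)); first by rewrite lerXn2r ?nnegrE.
    by rewrite ler_weXn2l// ler1n.
  have -> : 16 * r = 2 * r * 2 ^+ 3 by ring.
  by rewrite ler_pM ?exprn_ge0//; nra.
- rewrite lee_fin le_eqVlt; apply/orP; left; apply/eqP; ring.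
Qed.

(** The rest of the path, dilated in [y] with the factor [t^2]. The Jacobian
    [t^(- 2 d)] is compensated by [k t = 4 t^6] since [d <= 3]; the price is the
    weight [t^(- 4)], whose integral is at most [r^(- 3)]. *)
Lemma increment_far v x (D r : R) : strongly_smooth v -> Om x -> 0 <= D ->
  (forall x y i, Om x -> Om y -> `|x ord0 i - y ord0 i| <= D) -> 0 < r -> r < 1 -> (d <= 3)%N ->
  (\int[mu]_(y in Om) ((v y - v (aff (1 - r ^+ 2) (r ^+ 2 *: y) x)) ^+ 2)%:E <=
    (4 * r^-1 ^+ 3 * (d%:R * D ^+ 2) * energy v)%:E)%E.
Proof.
move=> sv Ox D0 hD r0 r1 d3.
have sE (p1 p2 : R) : p1 *: (p2 : R^o) = p1 * p2 by [].
pose W (t : R) := - 3^-1 * (t ^+ 3)^-1.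
have := @increment_le v x D r 1 (r^-1 ^+ 3) 4 (fun t => t ^+ 2) (fun t => 2 * t)
  W (fun t => (t ^+ 4)^-1) (fun t => 4 * t ^+ 6) sv Ox D0 hD r1.
move=> H; apply: le_trans (le_trans _ (H _ _ _ _ _ _ _ _)) _.
- rewrite le_eqVlt; apply/orP; left; apply/eqP; apply: eq_integral => y _.
  rewrite (_ : aff (1 ^+ 2) _ y = y); last by rewrite /aff expr1n subrr scale0r addr0 scale1r.
  by rewrite (_ : aff (r ^+ 2) _ y = aff (1 - r ^+ 2) (r ^+ 2 *: y) x)//; apply/rowP => i; rewrite /aff !mxE; ring.
- by rewrite exprn_gt0// invr_gt0.
- by move=> t; exact: exprn_continuous.
- by move=> t _; exact: is_derive_sqr.
- by move=> t /andP[rt _]; apply: is_derive_cubeV; exact: lt_le_trans rt.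
- rewrite /W expr1n invr1 exprVn; have : 0 < (r ^+ 3)^-1 by rewrite invr_gt0 exprn_gt0.
  move: (r ^+ 3)^-1 => z z0; lra.
- by move=> t /andP[rt t1]; have t0 : 0 < t by [exact: lt_le_trans rt]; rewrite exprn_ge0 ?(ltW t0)// exprn_ile1// (ltW t0).
- by apply: measurable_funM => //; exact: measurable_funX.
- move=> t /andP[rt t1]; have t0 : 0 < t by exact: lt_trans rt.
  split.
  + by rewrite exprn_gt0.
  + by rewrite invr_gt0 exprn_gt0.
  + by rewrite mulr_ge0// exprn_ge0// ltW.
  + rewrite le_eqVlt; apply/orP; left; apply/eqP; field; by rewrite gt_eqF.
  + have h1 : 1 <= (t ^+ 2)^-1 by rewrite invf_ge1 ?exprn_gt0// exprn_ile1// ltW.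
    apply: (@le_trans _ _ (4 * t ^+ 6 * (t ^+ 2)^-1 ^+ 3)).
      by rewrite ler_wpM2l ?mulr_ge0 ?exprn_ge0 ?(ltW t0)//; exact: ler_weXn2l.
    rewrite le_eqVlt; apply/orP; left; apply/eqP; field; by rewrite gt_eqF.
- rewrite lee_fin ler_wpM2r ?energy_ge0// ler_wpM2r//; first by rewrite mulr_ge0// sqr_ge0.
  have : 0 < r^-1 ^+ 3 by rewrite exprn_gt0// invr_gt0.
  by move: (r^-1 ^+ 3) => z z0; nra.
Qed.

End increments.

Section faber_krahn.
Context {R : realType} {d : nat} (Om : set 'rV[R]_d).
Hypotheses (oOm : open Om) (bOm : bounded_set Om)
  (cOm : convex_set (Om : set (convex_lmodType 'rV[R]_d))).
Local Notation mu := (leb d : {sigma_finite_measure set 'rV[R]_d -> \bar R}).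
Local Notation lmu := (@lebesgue_measure R).
Implicit Types (v : 'rV[R]_d -> R) (x y z p : 'rV[R]_d).

Let mOm : measurable Om. Proof. exact: open_measurable_rV. Qed.
Let Omy : (mu Om < +oo)%E. Proof. exact: leb_bounded_lty. Qed.


Lemma L2_subset A v : measurable A -> A `<=` Om -> L2 Om v -> L2 A v.
Proof.
move=> mA AO lv; have [mv iv] := (L2E mOm v).1 lv; apply/(L2E mA); split.
  exact: measurable_funS mv.
exact: integrableS iv.
Qed.

(** The value at a point of [A] is compared to the value at a point of [B] along
    a path that is cut at the parameter [r]; the increment on the first piece is
    integrated over [A], the one on the second piece over [B]. If [v] vanishes
    on [B] and [A] is small, then the energy controls [v] with a small constant.
    *)
Lemma faber_krahn : (d <= 3)%N -> exists2 C : R, 0 < C & forall v (A B : set 'rV[R]_d) (r : R),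
  strongly_smooth v -> measurable A -> measurable B -> A `<=` Om -> B `<=` Om -> 0 < r <= 2^-1 ->
  fine (mu B) * ip A v v <=
    2 * fine (mu A) * ip B v v + C * (r ^+ 4 + fine (mu A) * r^-1 ^+ 3) * energy Om v.
Proof.
move=> d3; have [D D0 hD] := bounded_coord_diff bOm.
pose mO := fine (mu Om); have mO0 : 0 <= mO by exact: fine_ge0.
pose q : R := d%:R * D ^+ 2.
have q0 : 0 <= q by rewrite mulr_ge0// sqr_ge0.
exists (64 * (q + 1) * (mO + 1)); first by rewrite !mulr_gt0// ltr_wpDl.
move=> v A B r sv mA mB AO BO /andP[r0 r12].
have N0 := energy_ge0 Om v; set N := energy Om v in N0 *.
have [cv _] := strongly_smooth_full sv.
have mv : measurable_fun setT v by exact: continuous_measurable_rV.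
have lv : L2 Om v by exact: L2_continuous_fun.
have lA := L2_subset mA AO lv; have lB := L2_subset mB BO lv.
have fin X : measurable X -> X `<=` Om -> mu X = (fine (mu X))%:E /\ 0 <= fine (mu X) <= mO.
  move=> mX XO; have Xy : (mu X <= mu Om)%E by apply: le_measure; rewrite ?inE.
  have fX : mu X \is a fin_num by rewrite ge0_fin_numE// (le_lt_trans Xy).
  by rewrite fineK// fine_ge0//= fine_le// ge0_fin_numE.
have [EA /andP[a0 aO]] := fin A mA AO; have [EB /andP[b0 bO]] := fin B mB BO.
pose Q x y := aff (1 - r ^+ 2) (r ^+ 2 *: y) x.
have K1 : 0 <= 16 * r ^+ 4 * q * N.
  by apply: mulr_ge0 N0; apply: mulr_ge0 q0; apply: mulr_ge0 => //; apply: exprn_ge0; exact: ltW.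
have r30 : 0 < r^-1 ^+ 3 by rewrite exprn_gt0// invr_gt0.
have K2 : 0 <= 16 * r^-1 ^+ 3 * q * N by apply: mulr_ge0 N0; apply: mulr_ge0 q0; apply: mulr_ge0 => //; exact: ltW.
have near_x y : Om y -> (\int[mu]_(x in Om) ((v (Q x y) - v x) ^+ 2)%:E <= (16 * r ^+ 4 * q * N)%:E)%E.
  by move=> Oy; apply: increment_near => //; exact: ltW.
have near_y x : Om x -> (\int[mu]_(y in Om) ((v y - v (Q x y)) ^+ 2)%:E <= (4 * r^-1 ^+ 3 * q * N)%:E)%E.
  by move=> Ox; apply: increment_far => //; [exact: ltW|lra].
pose H (p : 'rV[R]_d * 'rV[R]_d) : \bar R := (\1_A p.1 * \1_B p.2 * (v (Q p.1 p.2) - v p.1) ^+ 2)%:E.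
have mQ : measurable_fun setT (fun p : 'rV[R]_d * 'rV[R]_d => v (Q p.1 p.2)).
  apply: (measurableT_comp mv); apply: measurable_fun_rV => i.
  rewrite (_ : (fun _ => _) = fun p : 'rV[R]_d * 'rV[R]_d => (1 - r ^+ 2) * p.1 ord0 i + r ^+ 2 * p.2 ord0 i); last first.
    by apply/funext => p; rewrite /Q /aff !mxE.
  apply: measurable_funD; apply: measurable_funM => //.
    exact: (measurableT_comp (measurable_coord i) measurable_fst).
  exact: (measurableT_comp (measurable_coord i) measurable_snd).
have mH : measurable_fun setT H.
  apply/measurable_EFinP; apply: measurable_funM.
    apply: measurable_funM.
      by apply: (measurableT_comp _ measurable_fst); exact: measurable_indic.
    by apply: (measurableT_comp _ measurable_snd); exact: measurable_indic.
  by apply: measurable_funX; apply: measurable_funB => //; exact: (measurableT_comp mv measurable_fst).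
have H0 pp : (0 <= H pp)%E.
  by rewrite lee_fin; apply: mulr_ge0; [apply: mulr_ge0; rewrite indicE|exact: sqr_ge0].
have mQx x : measurable_fun setT (fun y => v (Q x y)).
  have mz : measurable_fun setT (fun y : 'rV[R]_d => (x, y)).
    by apply/measurable_fun_pairP; split; [exact: measurable_cst|exact: measurable_id].
  exact: (measurableT_comp mQ mz).
have mQy y : measurable_fun setT (fun x => v (Q x y)).
  have mz : measurable_fun setT (fun x : 'rV[R]_d => (x, y)).
    by apply/measurable_fun_pairP; split; [exact: measurable_id|exact: measurable_cst].
  exact: (measurableT_comp mQ mz).
have swap : (\int[mu]_(x in A) \int[mu]_y H (x, y) <= (fine (mu B) * (16 * r ^+ 4 * q * N))%:E)%E.
  apply: (@le_trans _ _ (\int[mu]_x \int[mu]_y H (x, y))%E).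
    apply: ge0_subset_integral => //; first exact: measurable_fun_fubini_tonelli_F.
    by move=> x _; exact: integral_ge0.
  rewrite fubini_tonelli// EFinM -EB -[in leRHS](setIT B) -integral_indic//.
  rewrite -ge0_integralZr//; last by apply/measurable_EFinP; exact: measurable_indic.
  apply: ge0_le_integral => //.
  - by move=> y _; exact: integral_ge0.
  - exact: measurable_fun_fubini_tonelli_G.
  - by apply: emeasurable_funM => //; apply/measurable_EFinP; exact: measurable_indic.
  move=> y _; rewrite /H /= !indicE; case: (boolP (y \in B)) => [/set_mem By|_]; last first.
    by rewrite mul0e integral0_eq// => x _; rewrite mulr0 mul0r.
  rewrite mul1e; apply: le_trans (near_x y (BO _ By)).
  have -> : (\int[mu]_x (\1_A x * 1 * (v (Q x y) - v x) ^+ 2)%:E =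
      \int[mu]_(x in A) ((v (Q x y) - v x) ^+ 2)%:E)%E.
    by rewrite [RHS]integral_mkcond; apply: eq_integral => x _; rewrite /patch indicE; case: (x \in A);
      rewrite mulr1 ?mul1r ?mul0r.
  apply: ge0_subset_integral => //; last by move=> x _; rewrite lee_fin sqr_ge0.
  by apply: measurable_funTS; apply/measurable_EFinP; apply: measurable_funX; exact: measurable_funB.
pose c : R := 2 * ip B v v + 16 * r^-1 ^+ 3 * q * N.
have iB0 : 0 <= ip B v v by exact: ip_ge0.
have c0 : 0 <= c by rewrite addr_ge0// mulr_ge0.
have inner x : A x -> (((v x) ^+ 2)%:E * mu B <= c%:E + 4%:E * \int[mu]_y H (x, y))%E.
  move=> Ax; rewrite -integral_cst//.
  have mE1 : measurable_fun B (fun y => ((v (Q x y) - v x) ^+ 2)%:E).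
    by apply: measurable_funTS; apply/measurable_EFinP; apply: measurable_funX; exact: measurable_funB.
  have mE2 : measurable_fun Om (fun y => ((v y - v (Q x y)) ^+ 2)%:E).
    by apply: measurable_funTS; apply/measurable_EFinP; apply: measurable_funX; exact: measurable_funB.
  have mE2B : measurable_fun B (fun y => ((v y - v (Q x y)) ^+ 2)%:E) by exact: measurable_funS mE2.
  have mv2 : measurable_fun B (fun y => (v y * v y)%:E).
    by apply: measurable_funTS; apply/measurable_EFinP; exact: measurable_funM.
  apply: (@le_trans _ _ (\int[mu]_(y in B) (2%:E * (v y * v y)%:E +
      (4%:E * ((v y - v (Q x y)) ^+ 2)%:E + 4%:E * ((v (Q x y) - v x) ^+ 2)%:E)))%E).
    apply: ge0_le_integral => //.
    - by move=> y _; rewrite lee_fin sqr_ge0.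
    - by apply: emeasurable_funD; [|apply: emeasurable_funD]; exact: measurable_funeM.
    - move=> y _; rewrite /= -!EFinM -!EFinD lee_fin.
      move: (v x) (v y) (v (Q x y)) => a1 a2 a3.
      have := sqr_ge0 (2 * a2 - a1); have := sqr_ge0 (a2 - 2 * a3 + a1); nra.
  rewrite ge0_integralD//; last 4 first.
  - by move=> y _; rewrite -EFinM lee_fin mulr_ge0// -expr2 sqr_ge0.
  - exact: measurable_funeM.
  - by move=> y _; rewrite -!EFinM -EFinD lee_fin addr_ge0// mulr_ge0// sqr_ge0.
  - by apply: emeasurable_funD; exact: measurable_funeM.
  rewrite ge0_integralD//; last 4 first.
  - by move=> y _; rewrite -EFinM lee_fin mulr_ge0// sqr_ge0.
  - exact: measurable_funeM.
  - by move=> y _; rewrite -EFinM lee_fin mulr_ge0// sqr_ge0.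
  - exact: measurable_funeM.
  rewrite !ge0_integralZl_EFin//; last 3 first.
  - by move=> y _; rewrite lee_fin sqr_ge0.
  - by move=> y _; rewrite lee_fin sqr_ge0.
  - by move=> y _; rewrite lee_fin -expr2 sqr_ge0.
  rewrite /c addeA; apply: leeD; last first.
    rewrite lee_wpmul2l// ?lee_fin// integral_mkcond.
    rewrite le_eqVlt; apply/orP; left; apply/eqP; apply: eq_integral => y _.
    by rewrite /H /patch /= !indicE (mem_set Ax); case: (y \in B); rewrite ?mul1r ?mulr0 ?mul0r.
  rewrite [leRHS]EFinD; apply: leeD; first by rewrite ip_EFin// -EFinM.
  apply: (@le_trans _ _ (4%:E * (4 * r^-1 ^+ 3 * q * N)%:E)%E).
    rewrite lee_wpmul2l ?lee_fin//; apply: le_trans (near_y x (AO _ Ax)).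
    by apply: ge0_subset_integral => // y _; rewrite lee_fin sqr_ge0.
  rewrite -EFinM lee_fin le_eqVlt; apply/orP; left; apply/eqP; ring.
have mF : measurable_fun setT (fun x => \int[mu]_y H (x, y))%E by exact: measurable_fun_fubini_tonelli_F.
have mv2 : measurable_fun A (fun y => (v y ^+ 2)%:E).
  by apply: measurable_funTS; apply/measurable_EFinP; exact: measurable_funX.
have total : (fine (mu B) * ip A v v <= c * fine (mu A) + 4 * (fine (mu B) * (16 * r ^+ 4 * q * N))).
  rewrite -lee_fin EFinM -EB -ip_EFin// muleC -ge0_integralZr//; last first.
    by move=> x _; rewrite lee_fin -expr2 sqr_ge0.
  apply: (@le_trans _ _ (\int[mu]_(x in A) (c%:E + 4%:E * \int[mu]_y H (x, y)))%E).
    apply: ge0_le_integral => //.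
    - by move=> x _; rewrite mule_ge0// lee_fin -expr2 sqr_ge0.
    - by apply: emeasurable_funM => //; under eq_fun do rewrite -expr2.
    - by apply: emeasurable_funD => //; apply: measurable_funTS; exact: measurable_funeM.
  rewrite ge0_integralD//; last 2 first.
  - by move=> x _; rewrite mule_ge0//; exact: integral_ge0.
  - by apply: measurable_funTS; exact: measurable_funeM.
  rewrite integral_cst// [leRHS]EFinD (EFinM c) -EA leeD2l//.
  rewrite ge0_integralZl_EFin//; last 2 first.
  - by move=> x _; exact: integral_ge0.
  - exact: measurable_funTS.
  by rewrite (EFinM 4) lee_wpmul2l// lee_fin.
apply: le_trans total _.
rewrite /c mulrDl -addrA lerD//; first by rewrite le_eqVlt; apply/orP; left; apply/eqP; ring.
rewrite mulrDr mulrDl [leRHS]addrC lerD//.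
  rewrite -[leRHS]mulrA.
  rewrite (_ : 16 * _ * q * N * _ = (16 * q) * (fine (mu A) * r^-1 ^+ 3 * N)); last by ring.
  rewrite ler_wpM2r//; first by apply: mulr_ge0 N0; apply: mulr_ge0 => //; exact: ltW.
  rewrite (_ : 64 * _ * _ = 64 * (q * mO + q + mO + 1)); last by ring.
  by have := mulr_ge0 q0 mO0; lra.
rewrite (_ : 4 * _ = 64 * (q * fine (mu B)) * (r ^+ 4 * N)); last by ring.
rewrite -[leRHS]mulrA ler_wpM2r//; first by apply: mulr_ge0 => //; apply: exprn_ge0; exact: ltW.
rewrite -mulrA ler_wpM2l//.
apply: (@le_trans _ _ (q * mO)); first by rewrite ler_wpM2l.
by have := mulr_ge0 q0 mO0; nra.
Qed.

End faber_krahn.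

(** * Boundedness of the solutions of the mixed problem *)

Section soft_truncation.
Context {R : realType}.
Implicit Types r s k dl : R.

(** A smooth substitute for the positive part. *)
Definition soft r : R := r * flat_exp 1 r.

Definition soft' r : R := flat_exp 1 r + r * flat_exp (flat_deriv 1) r.

Lemma is_derive_soft r : is_derive r 1 soft (soft' r).
Proof.
have H := is_deriveM (@is_derive_id R R^o r 1) (is_derive_flat_exp 1 r).
apply: (is_derive_eq H).
change (r * flat_exp (flat_deriv 1) r + flat_exp 1 r * 1 = soft' r).
by rewrite /soft' mulr1 addrC.
Qed.

Lemma soft'_itv r : 0 <= soft' r <= 1.
Proof.
rewrite /soft' /flat_exp; case: ifPn => r0; last by rewrite mulr0 addr0 lexx ler01.
have E : (flat_deriv 1).[r^-1] = r^-1 ^+ 2.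
  by rewrite /flat_deriv derivC !hornerE; ring.
rewrite E hornerC mul1r expr2 mulrA mulrA mulfV ?gt_eqF// mul1r -[X in X + _]mul1r -mulrDl.
have s0 : 0 < r^-1 by rewrite invr_gt0.
rewrite mulr_ge0 ?addr_ge0 ?expR_ge0 ?(ltW s0)//= expRN ler_pdivrMr ?expR_gt0// mul1r.
exact: expR_ge1Dx.
Qed.

Definition truncation dl k r : R := dl * soft ((r - k) / dl).

Lemma is_derive_truncation dl k r : 0 < dl ->
  is_derive r 1 (truncation dl k) (soft' ((r - k) / dl)).
Proof.
move=> dl0.
have H1 := is_deriveM (is_deriveB (@is_derive_id R R^o r 1) (@is_derive_cst R R^o R^o k r 1)) (@is_derive_cst R R^o R^o (dl^-1) r 1).
have H2 := @is_derive1_comp _ soft (fun r => (r - k) * dl^-1) r _ _ (is_derive_soft ((r - k) / dl)) H1.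
have H3 := is_deriveZ dl H2.
apply: (is_derive_eq H3).
change (dl * (soft' ((r - k) / dl) * ((r - k) * 0 + dl^-1 * (1 - 0))) = soft' ((r - k) / dl)).
by field; rewrite gt_eqF.
Qed.

Lemma truncation_le0 dl k r : 0 < dl -> r <= k -> truncation dl k r = 0.
Proof.
move=> dl0 rk; rewrite /truncation /soft flat_exp_le0 ?mulr0//.
by rewrite mulr_le0_ge0 ?subr_le0// invr_ge0 ltW.
Qed.

Lemma truncation_lipschitz dl k r s : 0 < dl -> `|truncation dl k r - truncation dl k s| <= `|r - s|.
Proof.
move=> dl0; wlog sr : r s / s <= r => [hw|].
  by case: (leP s r) => [|/ltW] h; [exact: hw|rewrite distrC [leRHS]distrC; exact: hw].
have D t := @is_derive_truncation dl k t dl0.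
have [c _ ->] := @MVT_segment R (truncation dl k) (fun t => soft' ((t - k) / dl)) s r sr (fun h _ => D h)
   (derivable_within_continuous (fun h _ => @ex_derive _ _ _ _ _ _ _ (D h))).
have /andP[h0 h1] := soft'_itv ((c - k) / dl).
by rewrite normrM (ger0_norm h0) ler_piMl.
Qed.

Lemma truncation_ge dl k r : 0 < dl -> k + dl <= r -> dl * expR (- 1) <= truncation dl k r.
Proof.
move=> dl0 h; have s1 : 1 <= (r - k) / dl by rewrite ler_pdivlMr// mul1r lerBrDl.
set s := (r - k) / dl in s1 *; have s0 : 0 < s by exact: lt_le_trans s1.
rewrite /truncation -/s ler_wpM2l ?(ltW dl0)// /soft /flat_exp s0 hornerC mul1r.
rewrite -[leLHS]mul1r ler_pM ?expR_ge0// ler_expR lerN2 invf_le1//.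
Qed.

Lemma truncation_continuous dl k : 0 < dl -> continuous (truncation dl k).
Proof.
move=> dl0 r; apply: differentiable_continuous; apply/derivable1_diffP.
by have [] := @is_derive_truncation dl k r dl0.
Qed.

End soft_truncation.

Section sup_bound.
Context {R : realType} {d : nat} (Om : set 'rV[R]_d).
Hypotheses (oOm : open Om) (bOm : bounded_set Om) (neOm : Om !=set0)
  (cOm : convex_set (Om : set (convex_lmodType 'rV[R]_d))) (d3 : (d <= 3)%N).
Local Notation mu := (leb d : {sigma_finite_measure set 'rV[R]_d -> \bar R}).
Implicit Types (v w u : 'rV[R]_d -> R) (sigma : 'rV[R]_d -> 'rV[R]_d) (x : 'rV[R]_d) (k dl r : R).
Variable bc : boundary_case.

Let mOm : measurable Om. Proof. exact: open_measurable_rV. Qed.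
Let Omy : (mu Om < +oo)%E. Proof. exact: leb_bounded_lty. Qed.

(** The last condition says that [w] is the divergence of [sigma], and that
    [sigma . n = 0] on the boundary when the test functions need not vanish
    there. *)
Definition weak_laplacian u sigma w := [/\ mixed_gradient Om bc u sigma, L2 Om w &
  forall v, strongly_smooth v -> (bc = SimplySupported -> test_function Om v) ->
    \sum_i ip Om (coordf sigma i) (pd i v) = - ip Om w v].

Lemma weak_laplacian_div u sigma : mixed_gradient Om bc u sigma -> spaceM Om bc sigma ->
  weak_laplacian u sigma (div Om sigma).
Proof.
move=> hg hM; have hd := spaceM_Hdiv hM; have [ls _] := hd.
split=> //; first exact: L2_div hd.
move=> v sv tv; have Cv := strongly_smooth_C1 sv.
move: tv hM; rewrite /spaceM; case: bc => [/(_ erefl) tv _|_ [_ h0]].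
  by have [_ /(_ _ tv)] := divP hd; rewrite ipv_grad_test.
have := h0 v (C1_Hsob1 oOm bOm Cv); rewrite ipv_grad_C1// => /eqP.
by rewrite addr_eq0 => /eqP.
Qed.

Lemma ipNN v : L2 Om v -> ip Om (fun x => - v x) (fun x => - v x) = ip Om v v.
Proof. by move=> lv; apply: eq_Rintegral => x _; rewrite mulrNN. Qed.

Lemma weak_laplacianN u sigma w : weak_laplacian u sigma w ->
  weak_laplacian (fun x => - u x) (fun x => - sigma x) (fun x => - w x).
Proof.
move=> [[lu ls hg] lw hw].
have cE i : coordf (fun x => - sigma x) i = fun x => - coordf sigma i x.
  by apply/funext => x; rewrite /coordf mxE.
have lsN : L2v Om (fun x => - sigma x) by move=> i; rewrite cE; exact: L2N.
split; [split => //; first exact: L2N| exact: L2N|].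
  move=> psi hpsi; have hd := spaceM_Hdiv hpsi; have [lp _] := hd.
  rewrite ipNl ?(L2_div hd)// -[X in _ = X]oppr0 -(hg _ hpsi) opprD; congr (_ + _).
  rewrite !ipvE// -sumrN; by apply: eq_bigr => i _; rewrite cE ipNl.
move=> v sv tv; have lv : L2 Om v.
  by apply: L2_continuous_fun => //; have [] := strongly_smooth_full sv.
rewrite ipNl// -(hw v sv tv) -sumrN; apply: eq_bigr => i _.
by rewrite cE ipNl//; exact: L2_pd.
Qed.

Lemma pd_truncation u dl k : 0 < dl -> strongly_smooth u ->
  (forall i, pd i (truncation dl k \o u) = fun x => soft' ((u x - k) / dl) * pd i u x) /\
  strongly_smooth (truncation dl k \o u).
Proof.
move=> dl0 su; split.
  by have [] := full_derivative_comp (fun r => is_derive_truncation k r dl0) (strongly_smooth_full su).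
have sa : smooth_expr (fun x => dl^-1 * u x + - (k / dl)).
  by apply: SmoothAdd; [apply: SmoothMul; [exact: SmoothCst|exact: SmoothBase]|exact: SmoothCst].
rewrite (_ : _ \o _ = (fun x => dl * ((dl^-1 * u x + - (k / dl)) * (flat_exp 1 \o (fun x => dl^-1 * u x + - (k / dl))) x))).
  apply: smooth_expr_strongly_smooth; apply: SmoothMul; first exact: SmoothCst.
  by apply: SmoothMul => //; exact: SmoothFlat.
apply/funext => x /=; rewrite /truncation /soft.
by have -> : (u x - k) / dl = dl^-1 * u x + - (k / dl) by ring.
Qed.

(** The equation is tested with the truncation of a smooth approximation [v] of
    [u], as the truncation of [u] itself is not an admissible test function;
    since the derivative of [soft] is at most 1, the energy of the truncation is
    at most its product with [v]. *)
Lemma energy_truncation u sigma w v k dl : weak_laplacian u sigma w -> strongly_smooth v ->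
  (bc = SimplySupported -> test_function Om v) -> 0 <= k -> 0 < dl ->
  energy Om (truncation dl k \o v) <= - 2 * ip Om w (truncation dl k \o v) +
    \sum_i ip Om (fun x => pd i v x - coordf sigma i x) (fun x => pd i v x - coordf sigma i x).
Proof.
move=> [[lu ls _] lw hw] sv tv k0 dl0.
have [pE sV] := pd_truncation k dl0 sv; set V := _ \o _ in pE sV *.
have tV : bc = SimplySupported -> test_function Om V.
  move=> /tv [_ [K cK [KO hK]]]; split; first exact: strongly_smooth_smooth.
  by exists K => //; split => // x /hK; rewrite /V /= => ->; exact: truncation_le0.
have lp i : L2 Om (pd i v) by exact: L2_pd.
have lP i : L2 Om (pd i V) by exact: L2_pd.
have h1 : energy Om V <= \sum_i ip Om (pd i v) (pd i V).
  apply: ler_sum => i _; apply: le_Rintegral => //.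
  - exact: L2_integrableM.
  - exact: L2_integrableM.
  - move=> x _; rewrite pE; have /andP[s0 s1] := soft'_itv ((v x - k) / dl).
    rewrite mulrACA -expr2 [leRHS]mulrCA -expr2 ler_wpM2r ?sqr_ge0//.
    by rewrite expr2 ler_piMl.
have h2 i : ip Om (pd i v) (pd i V) <= ip Om (coordf sigma i) (pd i V) +
    2^-1 * ip Om (fun x => pd i v x - coordf sigma i x) (fun x => pd i v x - coordf sigma i x) +
    2^-1 * ip Om (pd i V) (pd i V).
  have lD : L2 Om (fun x => pd i v x - coordf sigma i x) by apply: L2B => //; exact: ls.
  have := @ip_young _ _ _ mOm 1 _ _ ltr01 lD (lP i).
  rewrite invr1 !mul1r [X in 2 * X]ipBl//.
  move: (ip _ _ _) (ip _ _ _) (ip _ _ _) (ip _ _ _) => a1 a2 a3 a4; lra.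
have : energy Om V <= \sum_i (ip Om (coordf sigma i) (pd i V) +
    2^-1 * ip Om (fun x => pd i v x - coordf sigma i x) (fun x => pd i v x - coordf sigma i x) +
    2^-1 * ip Om (pd i V) (pd i V)).
  by apply: le_trans h1 _; apply: ler_sum.
rewrite !big_split/= hw// -!mulr_sumr -/(energy Om V).
by move: (energy _ _) (ip _ _ _) (\sum_i _) => a1 a2 a3; lra.
Qed.

End sup_bound.

Lemma decay_arith (R : realFieldType) (mO p1 p2 p3 p4 S e c X Y Z : R) :
  2 * p1 <= mO -> p1 + p2 = mO -> 0 <= p1 -> 0 <= p2 -> 0 <= S -> 0 < e ->
  S <= 2 * p3 + 2 * e -> p4 <= e -> p2 * p3 <= 2 * p1 * p4 + Y -> Y <= Z ->
  Z <= X + mO / 16 * (2 * S + 2 * e) + c * e ->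
  mO / 4 * S <= 2 * X + (7 * mO + 2 * c) * e.
Proof.
move=> A2 mAB a0 b0 S0 e0 hS hB hFK hC haN.
have h5 : p2 * S <= p2 * (2 * p3 + 2 * e) by rewrite ler_wpM2l.
have h6 : p1 * p4 <= p1 * e by rewrite ler_wpM2l.
have h7 : p1 * e <= mO * e by rewrite ler_wpM2r ?(ltW e0)//; lra.
have h8 : p2 * e <= mO * e by rewrite ler_wpM2r ?(ltW e0)//; lra.
have h9 : mO / 2 * S <= p2 * S by rewrite ler_wpM2r//; lra.
have h10 : 0 <= mO * e by rewrite mulr_ge0 ?(ltW e0)//; lra.
lra.
Qed.

Section level_sets.
Context {R : realType} {d : nat} (Om : set 'rV[R]_d).
Hypotheses (oOm : open Om) (bOm : bounded_set Om) (neOm : Om !=set0)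
  (cOm : convex_set (Om : set (convex_lmodType 'rV[R]_d))) (d3 : (d <= 3)%N).
Local Notation mu := (leb d : {sigma_finite_measure set 'rV[R]_d -> \bar R}).
Implicit Types (v w u : 'rV[R]_d -> R) (sigma : 'rV[R]_d -> 'rV[R]_d) (x : 'rV[R]_d) (k dl r : R).
Variable bc : boundary_case.

Let mOm : measurable Om. Proof. exact: open_measurable_rV. Qed.
Let Omy : (mu Om < +oo)%E. Proof. exact: leb_bounded_lty. Qed.

Lemma leb_domain_gt0 : 0 < fine (mu Om).
Proof.
have [x0 Ox0] := neOm; have [rho rho0 hrho] := interior_ball oOm Ox0.
pose a : 'rV[R]_d := \row_i (x0 ord0 i - rho); pose b : 'rV[R]_d := \row_i (x0 ord0 i + rho).
have BO : box a b `<=` Om.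
  move=> x Bx; rewrite -(subrK x0 x) addrC; apply: hrho; apply: norm_le_coord; first exact: ltW.
  move=> i; have := Bx i; rewrite in_itv/= !mxE ler_norml => /andP[h1 h2].
  by apply/andP; split; lra.
have ab i : a ord0 i <= b ord0 i by rewrite !mxE; lra.
rewrite -lte_fin fineK ?ge0_fin_numE//.
apply: (@lt_le_trans _ _ (mu (box a b))).
  by rewrite leb_boxE// lte_fin prodr_gt0// => i _; rewrite !mxE; lra.
by apply: le_measure => //; rewrite inE//; exact: measurable_box.
Qed.

Definition superlevel u k := Om `&` [set x | k < u x].

Lemma measurable_superlevel u k : L2 Om u -> measurable (superlevel u k).
Proof.
move=> lu; have mu' := L2_measurable mOm lu.
rewrite /superlevel (_ : [set x | _] = u @^-1` `]k, +oo[); first exact: mu'.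
by apply/seteqP; split => x /=; rewrite in_itv/= andbT.
Qed.

Lemma ip_subset A v : measurable A -> A `<=` Om -> L2 Om v -> ip A v v <= ip Om v v.
Proof.
move=> mA AO lv; have lA := L2_subset oOm mA AO lv.
rewrite -lee_fin -!ip_EFin//; apply: ge0_subset_integral => //.
  by apply/measurable_EFinP; apply: measurable_funM; exact: (L2_measurable mOm lv).
by move=> x _; rewrite lee_fin -expr2 sqr_ge0.
Qed.

Lemma ip_supported A v : measurable A -> A `<=` Om -> (forall x, Om x -> ~ A x -> v x = 0) ->
  ip A v v = ip Om v v.
Proof.
move=> mA AO h; rewrite /ip (Rintegral_mkcond _ A) (Rintegral_mkcond _ Om).
congr (fine (integral _ _ _)); apply/funext => x; rewrite /= /patch.
case: ifPn => [/set_mem/AO Ox|]; first by rewrite mem_set.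
rewrite notin_setE => nA; case: ifPn => // /set_mem Ox.
by rewrite h// mulr0.
Qed.

Lemma fine_leb_subset (A B : set 'rV[R]_d) : measurable A -> measurable B -> A `<=` B -> B `<=` Om ->
  fine (mu A) <= fine (mu B).
Proof.
move=> mA mB AB BO.
have h X : measurable X -> X `<=` Om -> mu X \is a fin_num.
  move=> mX XO; rewrite ge0_fin_numE//; apply: le_lt_trans Omy.
  by apply: le_measure => //; rewrite inE.
apply: fine_le; [exact: h (subset_trans AB BO)|exact: h|].
by apply: le_measure => //; rewrite inE.
Qed.

(** The truncation vanishes off [A = {u > k}], so [faber_krahn] applies with
    [r]; the two terms of its constant are both of order [r^4] because [A] has
    measure at most [r^7]. The energy is bounded by [energy_truncation], in
    which the truncation appears again and is absorbed. *)
Lemma truncation_decay : exists2 K : R, 0 < K & forall u sigma w k dl r,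
  weak_laplacian Om bc u sigma w -> 0 <= k -> 0 < dl -> 0 < r <= 2^-1 ->
  fine (mu (superlevel u k)) <= r ^+ 7 -> 2 * fine (mu (superlevel u k)) <= fine (mu Om) ->
  ip Om (truncation dl k \o u) (truncation dl k \o u) <= K * r ^+ 8 * ip Om w w.
Proof.
have mO0 := leb_domain_gt0; set mO := fine (mu Om) in mO0 *.
have [C C0 FK] := faber_krahn oOm bOm cOm d3.
exists (2 * (16 * C / mO) ^+ 2).
  by apply: mulr_gt0 => //; apply: exprn_gt0; apply: divr_gt0 => //; apply: mulr_gt0.
move=> u sigma w k dl r hL k0 dl0 r012 Ar A2; have [hg lw hw] := hL; have [lu ls _] := hg.
have /andP[r0 r12] := r012.
set A := superlevel u k in Ar A2 *.
have mA : measurable A by exact: measurable_superlevel.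
have AO : A `<=` Om by move=> x [].
pose B := Om `\` A; have mB : measurable B by exact: measurableD.
have BO : B `<=` Om by move=> x [].
have mAB : fine (mu A) + fine (mu B) = mO.
  have fA : mu A \is a fin_num by rewrite ge0_fin_numE// (le_lt_trans _ Omy)// le_measure ?inE.
  have fB : mu B \is a fin_num by rewrite ge0_fin_numE// (le_lt_trans _ Omy)// le_measure ?inE.
  have -> : mO = fine (mu A + mu B)%E.
    by rewrite /mO -{1}(setDUK AO) measureU// setDIK.
  by rewrite fineD.
have a0 : 0 <= fine (mu A) by exact: fine_ge0.
have b0 : 0 <= fine (mu B) by exact: fine_ge0.
pose V := truncation dl k \o u.
have cT := @truncation_continuous _ dl k dl0.
have mV : measurable_fun Om V.
  apply: (@measurable_comp _ _ _ _ _ _ setT) => //; last exact: (L2_measurable mOm lu).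
  exact: continuous_measurable_fun.
have lV : L2 Om V.
  apply: (L2_le mOm mV _ (L2B mOm lu (L2_bounded mOm Omy (measurable_cst k) (fun x _ => lexx `|k|)))) => x _.
  by have := @truncation_lipschitz _ dl k (u x) k dl0; rewrite [X in _ - X]truncation_le0 ?subr0.
set W := ip Om w w; set S := ip Om V V.
have W0 : 0 <= W by exact: ip_ge0. have S0 : 0 <= S by exact: ip_ge0.
pose a := 2 * C * r ^+ 4.
have r40 : 0 < r ^+ 4 by rewrite exprn_gt0.
have a_gt0 : 0 < a by rewrite mulr_gt0// mulr_gt0.
have hr : r ^+ 4 + fine (mu A) * r^-1 ^+ 3 <= 2 * r ^+ 4.
  have : fine (mu A) * r^-1 ^+ 3 <= r ^+ 7 * r^-1 ^+ 3.
    by rewrite ler_wpM2r// exprn_ge0// invr_ge0 ltW.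
  have -> : r ^+ 7 * r^-1 ^+ 3 = r ^+ 4 by field; rewrite gt_eqF.
  by move=> h; rewrite mulr_natl mulr2n lerD2l.
have VB x : Om x -> ~ A x -> V x = 0.
  move=> Ox nA; apply: truncation_le0 => //; rewrite leNgt; apply/negP => h.
  by apply: nA; split.
have main e : 0 < e -> mO / 4 * S <= 32 * a ^+ 2 / mO * W + (7 * mO + 2 * (a * d%:R)) * e.
  move=> e0; have [v [sv tv hv hgv]] := smooth_approximation oOm bOm neOm cOm hg e0.
  pose Vn := truncation dl k \o v.
  have [_ sVn] := pd_truncation k dl0 sv.
  have lv : L2 Om v by apply: L2_continuous_fun => //; have [] := strongly_smooth_full sv.
  have lVn : L2 Om Vn by apply: L2_continuous_fun => //; have [] := strongly_smooth_full sVn.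
  have lD : L2 Om (fun x => Vn x - V x) by exact: L2B.
  have hD : ip Om (fun x => Vn x - V x) (fun x => Vn x - V x) <= e.
    apply: le_trans hv; apply: le_Rintegral => //; try exact: L2_integrableM.
      by apply: L2_integrableM => //; exact: L2B.
    move=> x _; rewrite -!expr2 -[leLHS]real_normK ?num_real// -[leRHS]real_normK ?num_real//.
    by rewrite lerXn2r ?nnegrE//; exact: truncation_lipschitz dl0.
  have hN := energy_truncation oOm bOm hL sv tv k0 dl0; rewrite -/Vn in hN.
  have hE : \sum_i ip Om (fun x => pd i v x - coordf sigma i x) (fun x => pd i v x - coordf sigma i x) <= d%:R * e.
    apply: (@le_trans _ _ (\sum_(i < d) e)); first by apply: ler_sum.
    by rewrite sumr_const card_ord mulr_natl.
  have hFK := FK Vn A B r sVn mA mB AO BO r012.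
  have hP : ip Om Vn Vn <= 2 * S + 2 * e.
    have -> : Vn = (fun x => V x + (Vn x - V x)) by apply/funext => x; rewrite addrC subrK.
    apply: le_trans (ipDD_le oOm lV lD) _; by rewrite lerD2l ler_wpM2l.
  have hB : ip B Vn Vn <= e.
    apply: le_trans hD.
    have -> : ip B Vn Vn = ip B (fun x => Vn x - V x) (fun x => Vn x - V x).
      by apply: eq_Rintegral => x /set_mem[Ox nA]; rewrite VB// subr0.
    exact: ip_subset.
  have hS : S <= 2 * ip A Vn Vn + 2 * e.
    rewrite /S -(ip_supported mA AO VB).
    have lVnA := L2_subset oOm mA AO lVn; have lDA := L2_subset oOm mA AO lD.
    have lDA' : L2 A (fun x => V x - Vn x) by apply: (L2B mA) => //; exact: (L2_subset oOm mA AO lV).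
    have -> : V = (fun x => Vn x + (V x - Vn x)) by apply/funext => x; rewrite addrC subrK.
    rewrite (ipDD mA lVnA lDA').
    have h1 : ip A (fun x => V x - Vn x) (fun x => V x - Vn x) <= e.
      apply: le_trans hD; apply: le_trans (ip_subset mA AO lD).
      by rewrite le_eqVlt; apply/orP; left; apply/eqP; apply: eq_Rintegral => x _; ring.
    have := @ip_young _ _ _ mA 1 _ _ ltr01 lVnA lDA'; rewrite invr1 !mul1r.
    by move: h1; move: (ip _ _ _) (ip _ _ _) (ip _ _ _) => p q s; lra.
  (* With this weight in Young's inequality the product of [w] with the
     truncation is absorbed by the left-hand side. *)
  pose eta := mO / (16 * a).
  have eta0 : 0 < eta by rewrite divr_gt0// mulr_gt0.
  have hw2 : - 2 * ip Om w Vn <= eta^-1 * W + eta * ip Om Vn Vn.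
    have := ip_young mOm (_ : 0 < eta^-1) (L2N mOm lw) lVn; rewrite invr_gt0 => /(_ eta0).
    by rewrite invrK ipNN// ipNl// mulrN mulNr.
  have ae : a * eta = mO / 16 by rewrite /eta; field; rewrite !gt_eqF.
  have aeV : a * eta^-1 = 16 * a ^+ 2 / mO by rewrite /eta; field; rewrite !gt_eqF.
  have hN2 : energy Om Vn <= eta^-1 * W + eta * (2 * S + 2 * e) + d%:R * e.
    apply: le_trans hN _; apply: lerD => //; apply: le_trans hw2 _.
    by rewrite lerD2l; apply: (ler_wpM2l (ltW eta0)); exact: hP.
  have hC : C * (r ^+ 4 + fine (mu A) * r^-1 ^+ 3) * energy Om Vn <= a * energy Om Vn.
    rewrite ler_wpM2r ?energy_ge0// /a -mulrA [2 * _]mulrCA ler_wpM2l// ltW//.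
  have haN : a * energy Om Vn <= a * (eta^-1 * W + eta * (2 * S + 2 * e) + d%:R * e).
    by rewrite ler_wpM2l// ltW.
  have EaN : a * (eta^-1 * W + eta * (2 * S + 2 * e) + d%:R * e) =
      16 * a ^+ 2 / mO * W + mO / 16 * (2 * S + 2 * e) + a * d%:R * e.
    by rewrite -aeV -ae; ring.
  rewrite EaN in haN.
  have -> : 32 * a ^+ 2 / mO * W = 2 * (16 * a ^+ 2 / mO * W) by ring.
  apply: (decay_arith A2 mAB a0 b0 S0 e0 hS hB hFK hC haN).
have {}main : mO / 4 * S <= 32 * a ^+ 2 / mO * W.
  apply/ler_addgt0Pr => e e0; set c := 7 * mO + 2 * (a * d%:R) in main.
  have c0 : 0 < c by rewrite /c ltr_pwDl ?mulr_gt0//; do 2!apply: mulr_ge0 => //; exact: ltW.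
  have := main (e / c) (divr_gt0 e0 c0); rewrite [c * _]mulrC divfK// gt_eqF//.
have -> : S = 4 / mO * (mO / 4 * S) by field; rewrite gt_eqF.
have -> : 2 * (16 * C / mO) ^+ 2 * r ^+ 8 * W = 4 / mO * (32 * a ^+ 2 / mO * W).
  by rewrite /a; field; rewrite gt_eqF.
by rewrite ler_wpM2l// divr_ge0// ltW.
Qed.

(** Chebyshev's inequality for the truncation, which is at least [dl * exp (- 1)] above
    the level [k + dl]. *)
Lemma level_decay : exists2 K : R, 0 < K & forall u sigma w k dl r,
  weak_laplacian Om bc u sigma w -> 0 <= k -> 0 < dl -> 0 < r <= 2^-1 ->
  fine (mu (superlevel u k)) <= r ^+ 7 -> 2 * fine (mu (superlevel u k)) <= fine (mu Om) ->
  fine (mu (superlevel u (k + dl))) * dl ^+ 2 <= K * r ^+ 8 * ip Om w w.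
Proof.
have [K K0 hK] := truncation_decay.
have q0 : 0 < expR (- 1) ^+ 2 :> R by rewrite exprn_gt0// expR_gt0.
exists (K / expR (- 1) ^+ 2); first exact: divr_gt0.
move=> u sigma w k dl r hL k0 dl0 r012 Ar A2; have [[lu _ _] lw _] := hL.
have := hK u sigma w k dl r hL k0 dl0 r012 Ar A2.
pose V := truncation dl k \o u; rewrite -/V => hV.
have cT := @truncation_continuous _ dl k dl0.
have mV : measurable_fun Om V.
  apply: (@measurable_comp _ _ _ _ _ _ setT) => //; last exact: (L2_measurable mOm lu).
  exact: continuous_measurable_fun.
have lV : L2 Om V.
  apply: (L2_le mOm mV _ (L2B mOm lu (L2_bounded mOm Omy (measurable_cst k) (fun x _ => lexx `|k|)))) => x _.
  by have := @truncation_lipschitz _ dl k (u x) k dl0; rewrite [X in _ - X]truncation_le0 ?subr0.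
set A := superlevel u (k + dl).
have mA : measurable A by exact: measurable_superlevel.
have AO : A `<=` Om by move=> x [].
have fA : mu A \is a fin_num by rewrite ge0_fin_numE// (le_lt_trans _ Omy)// le_measure ?inE.
have lVA := L2_subset oOm mA AO lV.
suff h : fine (mu A) * (dl * expR (- 1)) ^+ 2 <= ip Om V V.
  rewrite -(ler_pM2r q0); apply: le_trans (le_trans _ (le_trans h hV)) _.
    by rewrite le_eqVlt; apply/orP; left; apply/eqP; ring.
  by rewrite le_eqVlt; apply/orP; left; apply/eqP; field; rewrite gt_eqF ?expR_gt0.
apply: le_trans (ip_subset mA AO lV).
rewrite mulrC -lee_fin EFinM fineK// -integral_cst// -ip_EFin//.
apply: ge0_le_integral => //.
- by move=> x _; rewrite lee_fin sqr_ge0.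
- by apply/measurable_EFinP; apply: measurable_funM; exact: (L2_measurable mA lVA).
- move=> x [_ /= /ltW hx]; rewrite lee_fin expr2; have h0 : 0 <= dl * expR (- 1) by rewrite mulr_ge0 ?expR_ge0// ltW.
  by rewrite ler_pM// truncation_ge.
Qed.

End level_sets.

(** De Giorgi's iteration: each step of the levels [k j], which increase to
    [k0 + 2 D], halves the increment and divides the radius by 4. One of the
    eight factors [r] compensates the square of the increment, and the others
    make the measures tend to 0. *)
Lemma level_iteration (R : realType) (m : R -> R) (L b K k0 D W : R) :
  (forall k, 0 <= m k) -> {homo m : k l / k <= l >-> l <= k} ->
  0 < b <= 2^-1 -> 2 * b ^+ 7 <= L -> 0 <= k0 -> m k0 <= b ^+ 7 ->
  0 < D -> 0 <= K * W -> 4 ^+ 7 * (K * W) <= D ^+ 2 ->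
  (forall k dl r, 0 <= k -> 0 < dl -> 0 < r <= 2^-1 -> m k <= r ^+ 7 -> 2 * m k <= L ->
    m (k + dl) * dl ^+ 2 <= K * r ^+ 8 * W) ->
  m (k0 + 2 * D) = 0.
Proof.
move=> m0 mono /andP[b0 b12] bL k00 mk0 D0 KW0 DK step.
pose k j := k0 + 2 * D * (1 - 2^-1 ^+ j).
pose r (j : nat) : R := b * 4^-1 ^+ j.
have r0 j : 0 < r j by rewrite mulr_gt0// exprn_gt0.
have q1 j : 4^-1 ^+ j <= 1 :> R by rewrite exprn_ile1//; lra.
have rb j : r j <= b by rewrite ler_piMr// ltW.
have h1 j : 2^-1 ^+ j <= 1 :> R by rewrite exprn_ile1//; lra.
have h0 j : 0 < 2^-1 ^+ j :> R by rewrite exprn_gt0.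
have P j : m (k j) <= r j ^+ 7.
  elim: j => [|j IH]; first by rewrite /k /r !expr0 subrr mulr0 addr0 mulr1.
  pose dl := D * 2^-1 ^+ j.
  have dl0 : 0 < dl by rewrite mulr_gt0.
  have kE : k j.+1 = k j + dl by rewrite /k /dl exprS; field.
  have kj0 : 0 <= k j by rewrite addr_ge0// mulr_ge0 ?subr_ge0// mulr_ge0// ltW.
  have L2 : 2 * m (k j) <= L.
    apply: le_trans bL; rewrite ler_wpM2l//; apply: le_trans IH _.
    by rewrite lerXn2r ?nnegrE// ltW.
  have := step (k j) dl (r j) kj0 dl0 _ IH L2; rewrite -kE r0 (le_trans (rb j))// => /(_ isT) H.
  have E : dl ^+ 2 = D ^+ 2 * 4^-1 ^+ j.
    rewrite /dl exprMn -exprM mulnC exprM; congr (_ * _ ^+ _).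
    by rewrite exprVn -natrX.
  have rj4 : r j <= 4^-1 ^+ j by rewrite /r ler_piMl ?exprn_ge0//; lra.
  have D20 : 0 < D ^+ 2 by rewrite exprn_gt0.
  have Dr : D ^+ 2 * r j <= dl ^+ 2 by rewrite E ler_wpM2l// ltW.
  have H2 : m (k j.+1) * (D ^+ 2 * r j) <= K * r j ^+ 8 * W.
    by apply: le_trans H; rewrite ler_wpM2l.
  have rS : r j.+1 = r j * 4^-1 by rewrite /r exprSr mulrA.
  rewrite rS exprMn; have Dr0 : 0 < D ^+ 2 * r j by rewrite mulr_gt0.
  rewrite -(ler_pM2r Dr0); apply: le_trans H2 _.
  have -> : K * r j ^+ 8 * W = (4^-1 ^+ 7 * r j ^+ 8) * (4 ^+ 7 * (K * W)) by field.
  have -> : r j ^+ 7 * 4^-1 ^+ 7 * (D ^+ 2 * r j) = (4^-1 ^+ 7 * r j ^+ 8) * D ^+ 2 by ring.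
  by rewrite ler_wpM2l// mulr_ge0 ?exprn_ge0// ltW.
apply/le_anti; rewrite m0 andbT; apply/ler_addgt0Pr => e e0; rewrite add0r.
have : (4^-1 : R) ^+ n @[n --> \oo] --> (0 : R) by apply: cvg_expr; rewrite ger0_norm; lra.
move=> /cvgr0_norm_lt/(_ e e0)[n _ /(_ n (leqnn n))/ltW hn].
rewrite ger0_norm ?exprn_ge0// in hn.
apply: le_trans (mono (k n) _ _) _.
  by rewrite /k lerD2l ler_piMr ?mulr_ge0 ?(ltW D0)// lerBlDr lerDl ltW.
apply: le_trans (P n) _; apply: le_trans hn.
apply: (@le_trans _ _ (r n)); last by rewrite /r ler_piMl ?exprn_ge0//; lra.
have rn1 : r n <= 1 by have := rb n; lra.
by rewrite exprSr ler_piMl ?(ltW (r0 n))// exprn_ile1// ltW.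
Qed.

Section bounded.
Context {R : realType} {d : nat} (Om : set 'rV[R]_d).
Hypotheses (oOm : open Om) (bOm : bounded_set Om) (neOm : Om !=set0)
  (cOm : convex_set (Om : set (convex_lmodType 'rV[R]_d))) (d3 : (d <= 3)%N).
Local Notation mu := (leb d : {sigma_finite_measure set 'rV[R]_d -> \bar R}).
Implicit Types (v w u : 'rV[R]_d -> R) (sigma : 'rV[R]_d -> 'rV[R]_d) (x : 'rV[R]_d) (k dl r : R).
Variable bc : boundary_case.

Let mOm : measurable Om. Proof. exact: open_measurable_rV. Qed.
Let Omy : (mu Om < +oo)%E. Proof. exact: leb_bounded_lty. Qed.


(** The iteration starts at a level [k0] above which [u] has a small set by
    Chebyshev's inequality, and [D] is proportional to the norm of [w]. *)
Lemma solution_le : exists2 C : R, 0 < C & forall u sigma w,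
  weak_laplacian Om bc u sigma w ->
  {ae mu, forall x, Om x -> u x <= C * (1 + Num.sqrt (ip Om w w) + Num.sqrt (ip Om u u))}.
Proof.
have [K K0 hK] := level_decay oOm bOm neOm cOm d3 bc.
have mO0 := leb_domain_gt0 oOm bOm neOm; set mO := fine (mu Om) in mO0.
pose b := Num.min 2^-1 (mO / 2).
have b0 : 0 < b by rewrite lt_min invr_gt0 ltr0n/= divr_gt0.
have b12 : b <= 2^-1 by rewrite ge_min lexx.
have bO : b <= mO / 2 by rewrite ge_min lexx orbT.
have b1 : b <= 1 by lra.
have b7 : 2 * b ^+ 7 <= mO.
  have : b ^+ 7 <= b by rewrite -[leRHS]expr1 ler_wiXn2l// ltW.
  by move=> h; apply: le_trans (_ : 2 * b <= _); [rewrite ler_wpM2l|lra].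
pose c1 := Num.sqrt (4 ^+ 7 * K); have c10 : 0 <= c1 by exact: sqrtr_ge0.
have bV0 : 0 <= b^-1 ^+ 4 by rewrite exprn_ge0// invr_ge0 ltW.
exists (3 + b^-1 ^+ 4 + 2 * c1); first by lra.
move=> u sigma w hL; have [[lu _ _] lw _] := hL.
set W := ip Om w w; set U := ip Om u u.
have W0 : 0 <= W by exact: ip_ge0. have U0 : 0 <= U by exact: ip_ge0.
have sW := sqrtr_ge0 W; have sU := sqrtr_ge0 U.
pose m k := fine (mu (superlevel Om u k)).
pose k0 := 1 + b^-1 ^+ 4 * Num.sqrt U.
have k00 : 0 < k0 by rewrite ltr_pwDl// mulr_ge0.
pose D := 1 + c1 * Num.sqrt W.
have D0 : 0 < D by rewrite ltr_pwDl// mulr_ge0.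
have mA k : measurable (superlevel Om u k) by exact: measurable_superlevel.
have AO k : superlevel Om u k `<=` Om by move=> x [].
have fA k : mu (superlevel Om u k) \is a fin_num.
  by rewrite ge0_fin_numE//; apply: le_lt_trans Omy; apply: le_measure; rewrite ?inE.
have cheb : m k0 * k0 ^+ 2 <= U.
  apply: le_trans (ip_subset oOm (mA k0) (AO k0) lu).
  have luA := L2_subset oOm (mA k0) (AO k0) lu.
  rewrite mulrC -lee_fin EFinM /m fineK// -integral_cst// -ip_EFin//.
  apply: ge0_le_integral => //.
  - by move=> x _; rewrite lee_fin sqr_ge0.
  - by apply/measurable_EFinP; apply: measurable_funM; exact: (L2_measurable (mA k0) luA).
  - by move=> x [_ /= /ltW hx]; rewrite lee_fin expr2 ler_pM// ltW.
have mk0 : m k0 <= b ^+ 7.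
  have hk : U <= b ^+ 8 * k0 ^+ 2.
    have h1 : b^-1 ^+ 4 * Num.sqrt U <= k0 by rewrite lerDr.
    have h2 : (b^-1 ^+ 4 * Num.sqrt U) ^+ 2 <= k0 ^+ 2.
      by rewrite lerXn2r ?nnegrE ?(ltW k00)// mulr_ge0.
    rewrite exprMn sqr_sqrtr// in h2.
    rewrite -[leLHS]mul1r -[X in X * U](_ : b ^+ 8 * (b^-1 ^+ 4) ^+ 2 = 1); last by field; rewrite gt_eqF.
    by rewrite -mulrA ler_wpM2l// exprn_ge0// ltW.
  have h3 : m k0 <= b ^+ 8.
    by have := le_trans cheb hk; rewrite ler_pM2r// exprn_gt0.
  apply: le_trans h3 _; by rewrite exprS ler_piMl// exprn_ge0// ltW.
have mono : {homo m : k l / k <= l >-> l <= k}.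
  move=> k l kl; apply: (fine_leb_subset oOm bOm) => // x [Ox /= h]; split => //=.
  exact: le_lt_trans kl h.
have m0 k : 0 <= m k by exact: fine_ge0.
have KW0 : 0 <= K * W by rewrite mulr_ge0// ltW.
have DK : 4 ^+ 7 * (K * W) <= D ^+ 2.
  have E : 4 ^+ 7 * (K * W) = (c1 * Num.sqrt W) ^+ 2.
    by rewrite exprMn !sqr_sqrtr ?mulrA// mulr_ge0 ?exprn_ge0// ltW.
  rewrite E; rewrite lerXn2r ?nnegrE ?(ltW D0)//; first by rewrite mulr_ge0.
  by rewrite lerDr.
have step k dl r := hK u sigma w k dl r hL.
have b012 : 0 < b <= 2^-1 by rewrite b0.
have := level_iteration m0 mono b012 b7 (ltW k00) mk0 D0 KW0 DK step.
set M := k0 + 2 * D => mM.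
have muM : mu (superlevel Om u M) = 0%E by rewrite -[LHS]fineK// -/(m M) mM.
exists (superlevel Om u M); split => // x /= /not_implyP[Ox /negP]; rewrite -ltNge => h.
split => //=; apply: le_lt_trans h.
rewrite /M /k0 /D.
set c4 := b^-1 ^+ 4 in bV0 *; have := mulr_ge0 bV0 sW; have := mulr_ge0 c10 sU.
move: (Num.sqrt W) (Num.sqrt U) sW sU => sw su sw0 su0.
have := mulr_ge0 bV0 su0; have := mulr_ge0 c10 sw0.
by rewrite !mulrDl !mulrDr; lra.
Qed.

(** The embedding of [H^2] in the bounded functions, which holds for either
    boundary condition because the domain is convex, of dimension at most 3. *)
Lemma solution_bounded : exists2 C : R, 0 < C & forall u sigma w,
  weak_laplacian Om bc u sigma w ->
  {ae mu, forall x, Om x -> `|u x| <= C * (1 + Num.sqrt (ip Om w w) + Num.sqrt (ip Om u u))}.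
Proof.
have [C C0 hC] := solution_le; exists C => // u sigma w hL.
have [[lu _ _] lw _] := hL.
have := hC _ _ _ (weak_laplacianN oOm bOm hL); rewrite (ipNN lu) (ipNN lw).
apply: filterS2 (hC _ _ _ hL) => x h1 h2 Ox.
by rewrite ler_norml h1// lerNl h2.
Qed.

End bounded.

(** * Polynomials of several variables *)

Section polynomials.
Context {R : realType} {d : nat}.
Implicit Types (v w : 'rV[R]_d -> R) (x y z : 'rV[R]_d) (i j : 'I_d) (n : nat).

(** The polynomials of degree at most [n], generated in a way that suits
    inductions better than the explicit sums over multi-indices. *)
Inductive polyd : nat -> ('rV[R]_d -> R) -> Prop :=
| PolyCst n c : polyd n (fun=> c)
| PolyAdd n v w : polyd n v -> polyd n w -> polyd n (fun x => v x + w x)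
| PolyX n i v : polyd n v -> polyd n.+1 (fun x => x ord0 i * v x).

Lemma polydW n m v : (n <= m)%N -> polyd n v -> polyd m v.
Proof.
move=> nm h; elim: h m nm => {n v} [n c|n v w _ hv _ hw|n i v _ hv] m nm.
- exact: PolyCst.
- by apply: PolyAdd; [exact: hv|exact: hw].
- by case: m nm => // m nm; apply: PolyX; exact: hv.
Qed.

Lemma polydZ n (c : R) v : polyd n v -> polyd n (fun x => c * v x).
Proof.
elim=> {n v} [n c'|n v w _ hv _ hw|n i v _ hv].
- exact: PolyCst.
- by rewrite (_ : (fun _ => _) = fun x => c * v x + c * w x); [exact: PolyAdd|apply/funext => x; rewrite mulrDr].
- by rewrite (_ : (fun _ => _) = fun x => x ord0 i * (c * v x)); [exact: PolyX|apply/funext => x; rewrite mulrCA].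
Qed.

Lemma polyd_sum n (I : Type) (r : seq I) (P : pred I) (F : I -> 'rV[R]_d -> R) :
  (forall e, P e -> polyd n (F e)) -> polyd n (fun x => \sum_(i <- r | P i) F i x).
Proof.
move=> hF; elim: r => [|i r IH].
  by rewrite (_ : (fun _ => _) = fun=> 0); [exact: PolyCst|apply/funext => x; rewrite big_nil].
case Pi: (P i).
  rewrite (_ : (fun _ => _) = fun x => F i x + \sum_(j <- r | P j) F j x); last first.
    by apply/funext => x; rewrite big_cons Pi.
  by apply: PolyAdd => //; exact: hF.
by rewrite (_ : (fun _ => _) = fun x => \sum_(j <- r | P j) F j x)//; apply/funext => x; rewrite big_cons Pi.
Qed.

Lemma polyd_monomial (a : 'I_d -> nat) : polyd (\sum_i a i) (fun x => \prod_i x ord0 i ^+ a i).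
Proof.
suff h (s : seq 'I_d) : polyd (\sum_(i <- s) a i) (fun x => \prod_(i <- s) x ord0 i ^+ a i) by exact: h.
elim: s => [|i s IH].
  rewrite big_nil (_ : (fun _ => _) = fun=> 1); first exact: PolyCst.
  by apply/funext => x; rewrite big_nil.
rewrite big_cons (_ : (fun _ => _) = fun x => x ord0 i ^+ a i * \prod_(i <- s) x ord0 i ^+ a i); last first.
  by apply/funext => x; rewrite big_cons.
elim: (a i) => [|m IHm].
  rewrite add0n (_ : (fun _ => _) = fun x => \prod_(i <- s) x ord0 i ^+ a i)//.
  by apply/funext => x; rewrite expr0 mul1r.
rewrite addSn (_ : (fun _ => _) = fun x => x ord0 i * (x ord0 i ^+ m * \prod_(i <- s) x ord0 i ^+ a i)).
  exact: PolyX.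
by apply/funext => x; rewrite exprS mulrA.
Qed.

Lemma Pk_polyd k v : Pk k v -> polyd k v.
Proof.
move=> [c hc]; rewrite (_ : v = fun x => \sum_(alpha : {ffun 'I_d -> 'I_k.+1} |
  (\sum_i (alpha i : nat) <= k)%N) c alpha * \prod_i x ord0 i ^+ alpha i); last exact/funext.
by apply: polyd_sum => a ak; apply: polydZ; apply: polydW ak _; exact: polyd_monomial.
Qed.

Lemma PkD k v w : Pk k v -> Pk k w -> Pk k (fun x => v x + w x).
Proof.
move=> [c hc] [c' hc']; exists (fun a => c a + c' a) => x.
by rewrite hc hc' -big_split/=; apply: eq_bigr => a _; rewrite mulrDl.
Qed.

Lemma PkZ k (c : R) v : Pk k v -> Pk k (fun x => c * v x).
Proof.
by move=> [c' hc]; exists (fun a => c * c' a) => x; rewrite hc mulr_sumr; apply: eq_bigr => a _; rewrite mulrA.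
Qed.

Lemma Pk_monomial k (b : 'I_d -> nat) : (\sum_i b i <= k)%N -> Pk k (fun x => \prod_i x ord0 i ^+ b i).
Proof.
move=> hb; pose a : {ffun 'I_d -> 'I_k.+1} := [ffun i => inord (b i)].
have ab i : (a i : nat) = b i.
  rewrite ffunE inordK// ltnS; apply: leq_trans hb.
  by rewrite (bigD1 i)//= leq_addr.
exists (fun a' => (a' == a)%:R) => x.
rewrite (bigD1 a)/=; last by rewrite (eq_bigr b).
rewrite eqxx mul1r [X in _ + X]big1 => [|a' /andP[_ /negbTE ->]]; last exact: mul0r.
rewrite addr0.
by apply: eq_bigr => i _; rewrite ab.
Qed.

Lemma Pk_sum k (I : Type) (r : seq I) (P : pred I) (F : I -> 'rV[R]_d -> R) :
  (forall e, P e -> Pk k (F e)) -> Pk k (fun x => \sum_(i <- r | P i) F i x).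
Proof.
move=> hF; elim: r => [|i r IH].
  exists (fun=> 0) => x; rewrite big_nil big1// => a _; exact: mul0r.
case Pi: (P i).
  rewrite (_ : (fun _ => _) = fun x => F i x + \sum_(j <- r | P j) F j x); last first.
    by apply/funext => x; rewrite big_cons Pi.
  by apply: PkD => //; exact: hF.
by rewrite (_ : (fun _ => _) = fun x => \sum_(j <- r | P j) F j x)//; apply/funext => x; rewrite big_cons Pi.
Qed.

Lemma polyd_Pk k v : polyd k v -> Pk k v.
Proof.
elim=> {k v} [n c|n v w _ hv _ hw|n i v _ [c hc]].
- rewrite (_ : (fun=> c) = fun x => c * \prod_i x ord0 i ^+ (fun=> 0%N) i); last first.
    by apply/funext => x; rewrite big1 ?mulr1// => i _; rewrite expr0.
  by apply: PkZ; apply: Pk_monomial; rewrite big1.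
- exact: PkD.
rewrite (_ : (fun _ => _) = fun x => \sum_(a : {ffun 'I_d -> 'I_n.+1} |
    (\sum_i (a i : nat) <= n)%N) c a * \prod_j x ord0 j ^+ (a j + (j == i))).
  apply: Pk_sum => a an; apply: PkZ; apply: Pk_monomial.
  have E1 : (\sum_(j < d) (j == i) = 1)%N by rewrite (bigD1 i)//= eqxx big1// => j /negbTE ->.
  by rewrite big_split/= E1 addn1 ltnS.
apply/funext => x; rewrite hc mulr_sumr; apply: eq_bigr => a _.
rewrite mulrCA; congr (_ * _); rewrite (bigD1 i)//= [RHS](bigD1 i)//= mulrA; congr (_ * _).
  by rewrite eqxx addn1 exprS.
by apply: eq_bigr => j /negbTE ->; rewrite addn0.
Qed.

Lemma PkB k v w : Pk k v -> Pk k w -> Pk k (fun x => v x - w x).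
Proof.
move=> hv hw; rewrite (_ : (fun _ => _) = fun x => v x + (-1) * w x).
  by apply: PkD => //; exact: PkZ.
by apply/funext => x; rewrite mulN1r.
Qed.

Lemma polyd_smooth n v : polyd n v -> strongly_smooth v.
Proof.
move=> h; apply: smooth_expr_strongly_smooth; elim: h => {n v}.
- by move=> *; exact: SmoothCst.
- by move=> *; exact: SmoothAdd.
- by move=> *; apply: SmoothMul => //; exact: SmoothCoord.
Qed.

(** Multiplication by a coordinate compensates the degree lost by derivation;
    this is what keeps the divergence of [x * r x] in the same degree as [r]. *)
Lemma polyd_pd n v : polyd n v ->
  (forall i, polyd n (pd i v)) /\ (forall i j, polyd n (fun x => x ord0 j * pd i v x)).
Proof.
elim=> {n v} [n c|n v w pv [hv1 hv2] pw [hw1 hw2]|n l v pv [hv1 hv2]].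
- have [E _] := @full_derivative_cst R d c; split=> i; first by rewrite E; exact: PolyCst.
  by move=> j; rewrite E; under eq_fun do rewrite mulr0; exact: PolyCst.
- have [E _] := full_derivativeD (strongly_smooth_full (polyd_smooth pv)) (strongly_smooth_full (polyd_smooth pw)).
  split=> i; first by rewrite E; exact: PolyAdd.
  by move=> j; rewrite E; under eq_fun do rewrite mulrDr; exact: PolyAdd.
have [E1 fc] := @full_derivative_coord R d l.
have [E _] := full_derivativeM fc (strongly_smooth_full (polyd_smooth pv)).
have nn : (n <= n.+1)%N by exact: leqnSn.
split=> i.
  rewrite E E1; apply: PolyAdd; first exact: polydW (hv2 i l).
  by under eq_fun do rewrite mulrC; apply: polydZ; exact: polydW pv.
move=> j; rewrite E E1; under eq_fun do rewrite mulrDr.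
apply: PolyAdd; first exact: PolyX (hv2 i l).
by apply: PolyX; under eq_fun do rewrite mulrC; exact: polydZ.
Qed.

Lemma polyd_segment n v x z : polyd n v ->
  exists2 P : {poly R}, (size P <= n.+1)%N & forall s : R, v (s *: z + x) = P.[s].
Proof.
elim=> {n v} [n c|n v w _ [P sP hP] _ [Q sQ hQ]|n i v _ [P sP hP]].
- exists c%:P => [|s]; last by rewrite hornerC.
  by rewrite size_polyC; case: (c != 0).
- exists (P + Q) => [|s]; last by rewrite hornerD hP hQ.
  by rewrite (leq_trans (size_polyD _ _))// geq_max sP.
- exists (('X * (z ord0 i)%:P + (x ord0 i)%:P) * P) => [|s]; last first.
    by rewrite !hornerE hP !mxE mulrC [s * _]mulrC.
  apply: leq_trans (size_polyMleq _ _) _.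
  have : (size ('X * (z ord0 i)%:P + (x ord0 i)%:P)%R <= 2)%N.
    rewrite (leq_trans (size_polyD _ _))// geq_max.
    rewrite (leq_trans (size_polyMleq _ _)) ?size_polyX ?size_polyC//=; last by case: (_ != 0).
    by case: (_ != 0).
  by move: (size _) (size P) sP => [|[|[|s1]]] s2 //=; rewrite ?addSn ?add0n //= => h _; rewrite ?(leq_trans (leq_pred _)) ?(leq_trans h)// ?ltnS ?ltnW.
Qed.

End polynomials.

Section one_variable.
Context {R : realType}.

(** Newton interpolation: the division of [P - P.[a]] by [X - a] reduces the
    number of nodes by one. *)
Lemma node_bound (s : seq R) : uniq s -> (forall a, a \in s -> 0 <= a <= 1) ->
  exists2 C : R, 0 <= C & forall (P : {poly R}) (S : R), (size P <= size s)%N -> 0 <= S ->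
    (forall a, a \in s -> `|P.[a]| <= S) -> forall t, 0 <= t <= 1 -> `|P.[t]| <= C * S.
Proof.
elim: s => [_ _|a s IH /= /andP[as_ us] h01].
  exists 0 => // P S; rewrite leqn0 size_poly_eq0 => /eqP -> S0 _ t _.
  by rewrite horner0 normr0 mul0r.
have [|C C0 hC] := IH us; first by move=> b bs; apply: h01; rewrite inE bs orbT.
pose dl := \sum_(b <- s) `|b - a|^-1.
have dl0 : 0 <= dl by apply: sumr_ge0 => b _; rewrite invr_ge0.
exists (1 + C * (2 * dl)); first by rewrite addr_ge0// mulr_ge0// mulr_ge0.
move=> P S sP S0 hP t t01.
have : root (P - P.[a]%:P) a by rewrite rootE !hornerE subrr.
move=> /factor_theorem[Q EQ].
have PE x : P.[x] = P.[a] + Q.[x] * (x - a).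
  have := congr1 (horner^~ x) EQ; rewrite !hornerE => <-.
  by rewrite addrC subrK.
have sQ : (size Q <= size s)%N.
  have [->|Q0] := eqVneq Q 0; first by rewrite size_poly0.
  have : (size (Q * ('X - a%:P))%R <= (size s).+1)%N.
    rewrite -EQ (leq_trans (size_polyD _ _))// geq_max sP size_polyN size_polyC.
    by case: (_ != 0).
  by rewrite size_Mmonic ?monicXsubC// size_XsubC addn2.
have hQ b : b \in s -> `|Q.[b]| <= 2 * dl * S.
  move=> bs; have ba : 0 < `|b - a|.
    by rewrite normr_gt0 subr_eq0; apply: contraNneq as_ => <-.
  have E : `|Q.[b]| * `|b - a| <= 2 * S.
    rewrite -normrM (_ : Q.[b] * (b - a) = P.[b] - P.[a]); last by rewrite (PE b) addrAC subrr add0r.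
    have h1 := hP a (mem_head _ _).
    have h2 : `|P.[b]| <= S by apply: hP; rewrite inE bs orbT.
    by apply: le_trans (ler_normB _ _) _; lra.
  have hd : `|b - a|^-1 <= dl.
    by rewrite /dl (big_rem b)//= lerDl sumr_ge0// => c _; rewrite invr_ge0.
  rewrite -ler_pdivlMr// in E; apply: le_trans E _.
  by rewrite [leRHS]mulrAC ler_wpM2l// mulr_ge0.
have := hC Q (2 * dl * S) sQ _ hQ t t01.
move=> /(_ (mulr_ge0 (mulr_ge0 (ler0n _ 2) dl0) S0)) hQt.
rewrite PE; apply: le_trans (ler_normD _ _) _.
rewrite mulrDl mul1r lerD//; first exact: hP (mem_head _ _).
rewrite normrM -mulrA; apply: (@le_trans _ _ `|Q.[t]|); last by rewrite -!mulrA in hQt *.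
rewrite ler_piMr//.
have := h01 a (mem_head _ _); rewrite ler_norml; move: t01 => /andP[? ?] /andP[? ?].
by apply/andP; split; lra.
Qed.

(** The quotient of [P - P.[0]] by the variable is interpolated at nodes away
    from 0. *)
Lemma poly_increment_bound (k : nat) : exists2 C : R, 0 <= C & forall (P : {poly R}) (S : R),
  (size P <= k.+1)%N -> (forall t, 0 <= t <= 1 -> `|P.[t]| <= S) ->
  forall t, 0 <= t <= 1 -> `|P.[t] - P.[0]| <= C * S * t.
Proof.
pose s : seq R := [seq i.+1%:R / k.+1%:R | i <- iota 0 k.+1].
have k0 : (0 : R) < k.+1%:R by rewrite ltr0n.
have us : uniq s.
  rewrite map_inj_uniq ?iota_uniq// => i j /(mulIf _); rewrite invr_eq0 gt_eqF// => /(_ isT)/eqP.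
  by rewrite eqr_nat => /eqP[].
have h01 a : a \in s -> 0 < a <= 1 /\ k.+1%:R^-1 <= a.
  move=> /mapP[i]; rewrite mem_iota add0n => /andP[_ ik] ->; split.
    by rewrite divr_gt0 ?ltr0n//= ler_pdivrMr// mul1r ler_nat.
  by rewrite ler_peMl ?invr_ge0 ?(ltW k0)// ler1n.
have [|C C0 hC] := node_bound us; first by move=> a /h01[/andP[/ltW -> ->]].
exists (C * (2 * k.+1%:R)); first by rewrite mulr_ge0// mulr_ge0// ltW.
move=> P S sP hP t t01.
have S0 : 0 <= S by apply: le_trans (normr_ge0 _) (hP 0 _); rewrite lexx ler01.
have : root (P - P.[0]%:P) 0 by rewrite rootE !hornerE subrr.
move=> /factor_theorem[Q EQ].
have PE x : P.[x] - P.[0] = Q.[x] * x.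
  have -> : P.[x] - P.[0] = (P - P.[0]%:P).[x] by rewrite !hornerE.
  by rewrite EQ hornerM hornerXsubC subr0.
have sQ : (size Q <= size s)%N.
  rewrite size_map size_iota.
  have [->|Q0] := eqVneq Q 0; first by rewrite size_poly0.
  have : (size (Q * ('X - 0%:P))%R <= k.+1)%N.
    rewrite -EQ (leq_trans (size_polyD _ _))// geq_max sP size_polyN size_polyC.
    by case: (_ != 0).
  by rewrite size_Mmonic ?monicXsubC// size_XsubC addn2 => /ltnW.
have hQ b : b \in s -> `|Q.[b]| <= 2 * k.+1%:R * S.
  move=> /h01[/andP[b0 b1] bk].
  have E : `|Q.[b]| * b <= 2 * S.
    rewrite -{2}(gtr0_norm b0) -normrM -PE; apply: le_trans (ler_normB _ _) _.
    have h1 : `|P.[b]| <= S by apply: hP; rewrite (ltW b0).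
    have h2 : `|P.[0]| <= S by apply: hP; rewrite lexx ler01.
    lra.
  rewrite -ler_pdivlMr// in E; apply: le_trans E _.
  rewrite [leRHS]mulrAC ler_wpM2l ?mulr_ge0//.
  by rewrite -[leRHS]invrK lef_pV2// posrE invr_gt0.
have hQt := hC Q (2 * k.+1%:R * S) sQ (mulr_ge0 (mulr_ge0 (ler0n _ 2) (ltW k0)) S0) hQ t t01.
have /andP[t0 t1] := t01.
rewrite PE normrM (ger0_norm t0) ler_wpM2r//.
by rewrite -!mulrA in hQt *.
Qed.

End one_variable.

(** * Geometry of the elements *)

Section geometry.
Context {R : realType} {d : nat}.
Local Notation mu := (leb d : {sigma_finite_measure set 'rV[R]_d -> \bar R}).
Implicit Types (x y z q : 'rV[R]_d) (A B K : set 'rV[R]_d).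

Lemma bernoulli_ineq (t : R) n : 0 <= t <= 1 -> 1 - n%:R * t <= (1 - t) ^+ n.
Proof.
move=> /andP[t0 t1]; elim: n => [|n IH]; first by rewrite mul0r subr0 expr0.
rewrite exprS; have h0 : 0 <= 1 - t by lra.
apply: le_trans (ler_wpM2l h0 IH); rewrite -natr1.
have : 0 <= n%:R * t * t by rewrite !mulr_ge0.
by move: n%:R => m; lra.
Qed.

(** A set that contains the dilates, by all factors less than 1, of a larger
    one has the same measure. *)
Lemma homothety_null A B z : measurable A -> measurable B -> (mu B < +oo)%E -> A `<=` B ->
  (forall l x, 0 < l < 1 -> B x -> A (l *: x + (1 - l) *: z)) ->
  {ae mu, forall x, B x -> A x}.
Proof.
move=> mA mB By AB h.
have fB : mu B \is a fin_num by rewrite ge0_fin_numE.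
have Ay : (mu A < +oo)%E by apply: le_lt_trans By; apply: le_measure; rewrite ?inE.
have fA : mu A \is a fin_num by rewrite ge0_fin_numE.
have hl l : 0 < l < 1 -> l ^+ d * fine (mu B) <= fine (mu A).
  move=> l01; have /andP[l0 l1] := l01.
  rewrite -lee_fin EFinM !fineK//.
  have lV : 0 < l^-1 by rewrite invr_gt0.
  have := leb_aff (- (l^-1 * (1 - l)) *: z) lV mB; rewrite invrK => <-.
  apply: le_measure; rewrite ?inE//; first exact: measurable_preimage_aff.
  move=> y /= By'; have := h l _ l01 By'.
  rewrite (_ : _ + _ = y)//; apply/rowP => i; rewrite /aff !mxE; field.
  by rewrite gt_eqF.
have leBA : fine (mu B) <= fine (mu A).
  have B0 : 0 <= fine (mu B) by exact: fine_ge0.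
  apply/ler_addgt0Pr => e e0.
  pose c := d%:R * fine (mu B) / e + 2.
  have c0 : 0 <= d%:R * fine (mu B) / e by rewrite divr_ge0 ?(ltW e0)// mulr_ge0.
  have c2 : 0 < c by rewrite /c; lra.
  pose t := c^-1.
  have t0 : 0 < t by rewrite invr_gt0.
  have tc : t * c = 1 by rewrite /t mulVf// gt_eqF.
  have t1 : t < 1 by rewrite /t invf_lt1// /c; lra.
  have l01 : 0 < 1 - t < 1 by apply/andP; split; lra.
  have := hl _ l01; have t01 : 0 <= t <= 1 by rewrite !ltW.
  have := bernoulli_ineq d t01; move=> h1 h2.
  have : (1 - d%:R * t) * fine (mu B) <= fine (mu A) by apply: le_trans h2; rewrite ler_wpM2r.
  have : d%:R * t * fine (mu B) <= e.
    have Ee : e = t * (d%:R * fine (mu B)) + 2 * (t * e).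
      transitivity (e * (t * c)); first by rewrite tc mulr1.
      by rewrite /c; field; rewrite gt_eqF.
    rewrite [leRHS]Ee mulrAC [leLHS]mulrC lerDl; apply: mulr_ge0 => //; apply: mulr_ge0; exact: ltW.
  by move: (fine (mu A)) (fine (mu B)) d%:R => a b dd; rewrite mulrBl mul1r; lra.
have D0 : mu (B `\` A) = 0%E.
  apply/eqP; rewrite -measure_le0.
  rewrite measureD//= (setIidr AB) -(fineK fB) -(fineK fA) -EFinB lee_fin; lra.
exists (B `\` A); split => //; first exact: measurableD.
by move=> x /= /not_implyP[].
Qed.

Definition has_ball K z := exists2 rho : R, 0 < rho & forall q, `|q| <= rho -> K (z + q).

Lemma has_ball_interior K z : has_ball K z -> interior K z.
Proof.
move=> [rho rho0 h]; apply: (@filterS _ _ (nbhs_filter z) (ball z rho)); last exact: nbhsx_ballx.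
move=> x; rewrite -ball_normE/= distrC => /ltW hx.
by rewrite -(subrK z x) addrC; exact: h.
Qed.

Definition convex K := forall x y (t : R), K x -> K y -> 0 <= t <= 1 -> K (t *: x + (1 - t) *: y).

Lemma interior_homothety K z l x : convex K -> has_ball K z -> 0 < l < 1 -> K x ->
  interior K (l *: x + (1 - l) *: z).
Proof.
move=> cK [rho rho0 h] /andP[l0 l1] Kx; apply: has_ball_interior.
have l1' : 0 < 1 - l by lra.
exists ((1 - l) * rho) => [|q hq]; first exact: mulr_gt0.
rewrite (_ : _ + q = l *: x + (1 - l) *: (z + (1 - l)^-1 *: q)); last first.
  by rewrite scalerDr scalerA mulfV ?gt_eqF// scale1r addrA.
apply: cK => //; last by rewrite !ltW.
by apply: h; rewrite normrZ gtr0_norm ?invr_gt0// ler_pdivrMl.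
Qed.

Lemma ae_interior K z : measurable K -> (mu K < +oo)%E -> convex K -> has_ball K z ->
  {ae mu, forall x, K x -> interior K x}.
Proof.
move=> mK Ky cK hz; apply: (@homothety_null _ _ z) => //.
- by apply: open_measurable_rV; exact: open_interior.
- exact: interior_subset.
- by move=> l x l01 Kx; exact: interior_homothety.
Qed.

Lemma has_ball_leb_gt0 K z : measurable K -> has_ball K z -> (0 < mu K)%E.
Proof.
move=> mK [rho rho0 h].
pose a : 'rV[R]_d := \row_i (z ord0 i - rho); pose b : 'rV[R]_d := \row_i (z ord0 i + rho).
have BK : box a b `<=` K.
  move=> x Bx; rewrite -(subrK z x) addrC; apply: h; apply: norm_le_coord; first exact: ltW.
  move=> i; have := Bx i; rewrite in_itv/= !mxE ler_norml => /andP[h1 h2].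
  by apply/andP; split; lra.
have ab i : a ord0 i <= b ord0 i by rewrite !mxE; lra.
apply: (@lt_le_trans _ _ (mu (box a b))).
  by rewrite leb_boxE// lte_fin prodr_gt0// => i _; rewrite !mxE; lra.
by apply: le_measure => //; rewrite inE//; exact: measurable_box.
Qed.

(** * Barycentric coordinates *)

Variable V : 'M[R]_(d.+1, d).
Hypothesis nV : nondegenerate V.

Definition edges : 'M[R]_d := \matrix_(i < d) (row (lift ord0 i) V - row ord0 V).

Definition bary x : 'rV[R]_d := (x - row ord0 V) *m invmx edges.

Lemma edges_unit : edges \in unitmx. Proof. exact: nV. Qed.

Lemma baryK x : row ord0 V + bary x *m edges = x.
Proof. by rewrite /bary mulmxKV ?edges_unit// addrC subrK. Qed.

Lemma mul_simplex (w : 'rV[R]_d.+1) : \sum_i w ord0 i = 1 ->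
  w *m V = row ord0 V + (\row_i w ord0 (lift ord0 i)) *m edges.
Proof.
move=> w1; rewrite !mulmx_sum_row big_ord_recl.
have -> : w ord0 ord0 = 1 - \sum_i w ord0 (lift ord0 i).
  by rewrite -w1 big_ord_recl addrK.
rewrite scalerBl scale1r -addrA; congr (_ + _).
rewrite scaler_suml -sumrN -big_split/=; apply: eq_bigr => i _.
by rewrite !mxE rowK scalerBr addrC.
Qed.

Lemma simplexE : simplex V = [set x | (forall i, 0 <= bary x ord0 i) /\ \sum_i bary x ord0 i <= 1].
Proof.
apply/seteqP; split => x /=.
  move=> [w [w0 w1] <-].
  have E : bary (w *m V) = \row_i w ord0 (lift ord0 i).
    by rewrite mul_simplex// /bary addrAC subrr add0r mulmxK// edges_unit.
  rewrite E; split; first by move=> i; rewrite mxE.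
  under eq_bigr do rewrite mxE.
  by rewrite -w1 big_ord_recl lerDr.
move=> [b0 b1].
pose w : 'rV[R]_d.+1 := \row_i (if unlift ord0 i is Some j then bary x ord0 j else 1 - \sum_j bary x ord0 j).
have wl i : w ord0 (lift ord0 i) = bary x ord0 i by rewrite mxE liftK.
have w1 : \sum_i w ord0 i = 1.
  rewrite big_ord_recl mxE unlift_none.
  by rewrite [X in _ + X = _](eq_bigr (fun i => bary x ord0 i)) ?subrK// => i _; exact: wl.
exists w; last first.
  rewrite mul_simplex// -[RHS]baryK; congr (_ + _ *m _); apply/rowP => i.
  by rewrite mxE wl.
split => // i; case: (unliftP ord0 i) => [j|] ->; first by rewrite wl.
by rewrite mxE unlift_none subr_ge0.
Qed.

Lemma bary_convex x y (t : R) : bary (t *: x + (1 - t) *: y) = t *: bary x + (1 - t) *: bary y.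
Proof.
rewrite /bary !scalemxAl -mulmxDl; congr (_ *m _).
by apply/rowP => i; rewrite !mxE; ring.
Qed.

Lemma bary_convex_coord x y (t : R) j :
  bary (t *: x + (1 - t) *: y) ord0 j = t * bary x ord0 j + (1 - t) * bary y ord0 j.
Proof. by rewrite bary_convex mxE [X in X + _]mxE [X in _ + X]mxE. Qed.

Lemma simplex_convex : convex (simplex V).
Proof.
move=> x y t; rewrite simplexE/= => -[x0 x1] [y0 y1] /andP[t0 t1].
have t1' : 0 <= 1 - t by lra.
split=> [i|]; first by rewrite bary_convex_coord addr_ge0// mulr_ge0.
under eq_bigr do rewrite bary_convex_coord.
rewrite big_split/= -!mulr_sumr; apply: (@le_trans _ _ (t * 1 + (1 - t) * 1)); last by lra.
by rewrite lerD// ler_wpM2l.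
Qed.

Lemma bary_coord x j : bary x ord0 j = \sum_i (x ord0 i - V ord0 i) * invmx edges i j.
Proof. by rewrite /bary mxE; apply: eq_bigr => i _; rewrite !mxE. Qed.

Lemma measurable_bary j : measurable_fun setT (fun x => bary x ord0 j).
Proof.
under eq_fun do rewrite bary_coord.
apply: measurable_sum => i; apply: measurable_funM => //; apply: measurable_funB => //.
exact: measurable_coord.
Qed.

Lemma simplex_measurable : measurable (simplex V).
Proof.
have mge (f : 'rV[R]_d -> R) (c : R) : measurable_fun setT f -> measurable [set x | c <= f x].
  move=> mf; rewrite (_ : [set x | _] = setT `&` f @^-1` `[c, +oo[); first exact: mf.
  by apply/seteqP; split => x /=; rewrite in_itv/= andbT => // -[].
rewrite simplexE (_ : [set x | _] = (\bigcap_(i in [set: 'I_d]) [set x | 0 <= bary x ord0 i]) `&`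
   [set x | -1 <= - \sum_i bary x ord0 i]).
  apply: measurableI; last first.
    by apply: mge; apply: measurable_funN; apply: measurable_sum => i; exact: measurable_bary.
  by apply: fin_bigcap_measurable => // i _; apply: mge; exact: measurable_bary.
apply/seteqP; split => x /= -[h1 h2].
  by split; [move=> i _; exact: h1|rewrite lerN2].
by split; [move=> i; exact: (h1 i)|rewrite -lerN2].
Qed.

Lemma simplex_has_ball : exists z, has_ball (simplex V) z.
Proof.
pose e : R := d.+1%:R^-1.
have e0 : 0 < e by rewrite invr_gt0 ltr0n.
pose z : 'rV[R]_d := row ord0 V + (const_mx e) *m edges.
pose N := \sum_j \sum_i `|invmx edges i j|.
have N0 : 0 <= N by apply: sumr_ge0 => j _; exact: sumr_ge0.
exists z, (e / (N + 1)); first by rewrite divr_gt0// ltr_wpDl.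
move=> q hq.
have bE j : bary (z + q) ord0 j = e + (q *m invmx edges) ord0 j.
  have -> : bary (z + q) = (const_mx e *m edges + q) *m invmx edges.
    by congr (_ *m _); rewrite /z addrC !addrA addNr add0r.
  rewrite mulmxDl mulmxK ?edges_unit//.
  by rewrite mxE [const_mx _ _ _]mxE.
have hS : \sum_j `|(q *m invmx edges) ord0 j| <= e.
  apply: (@le_trans _ _ (`|q| * N)).
    rewrite mulr_sumr; apply: ler_sum => j _; rewrite mxE; apply: le_trans (ler_norm_sum _ _ _) _.
    rewrite mulr_sumr; apply: ler_sum => i _; rewrite normrM ler_wpM2r//; exact: norm_coord_le.
  apply: (@le_trans _ _ (e / (N + 1) * (N + 1))); last by rewrite divfK// gt_eqF// ltr_wpDl.
  by rewrite ler_pM// lerDl.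
rewrite simplexE/=; split=> [j|].
  have : `|(q *m invmx edges) ord0 j| <= e.
    by apply: le_trans hS; rewrite (bigD1 j)//= lerDl sumr_ge0.
  by rewrite bE ler_norml => /andP[h _]; rewrite -lerBlDl sub0r.
under eq_bigr do rewrite bE.
rewrite big_split/= sumr_const card_ord.
have h1 : \sum_j (q *m invmx edges) ord0 j <= e.
  by apply: le_trans hS; apply: ler_sum => j _; exact: ler_norm.
apply: (@le_trans _ _ (e *+ d + e)); first by rewrite lerD2l.
by rewrite -mulrSr -mulr_natr /e mulVf// pnatr_eq0.
Qed.

End geometry.

(** * Discrete spaces *)

Section norm_equivalence.
Context {R : realType} {d : nat}.
Local Notation mu := (leb d : {sigma_finite_measure set 'rV[R]_d -> \bar R}).
Implicit Types (x y z : 'rV[R]_d) (K : set 'rV[R]_d).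

(** Near a point where a polynomial almost attains its supremum over a convex
    set it stays large, on a dilate of the set by a factor that depends on the
    degree only; hence the constant does not depend on the set. *)
Lemma polynomial_sup_le k : exists2 C : R, 0 < C & forall K (p : 'rV[R]_d -> R) (M : R),
  polyd k p -> measurable K -> bounded_set K -> convex K -> (0 < mu K)%E -> 0 <= M ->
  ip K p p <= M ^+ 2 * fine (mu K) -> forall x, K x -> `|p x| <= C * M.
Proof.
have [C1 C10 hC1] := @poly_increment_bound R k.
(* Along a ray from a point where half of the supremum [S] is attained, the
   polynomial varies by at most [C1 * S * l <= S / 4] up to the parameter [l].
   *)
pose l : R := (4 * (C1 + 1))^-1.
have h4 : 0 < 4 * (C1 + 1) by lra.
have l0 : 0 < l by rewrite invr_gt0.
have l1 : l <= 1 by rewrite /l invf_le1//; lra.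
have lC : C1 * l <= 4^-1.
  have : (4 * (C1 + 1)) * l = 1 by rewrite /l mulfV// gt_eqF.
  by move: l0; move: (l) => t t0; lra.
have lV1 : 1 <= l^-1 by rewrite invf_ge1.
exists (4 * l^-1 ^+ d); first by rewrite mulr_gt0// exprn_gt0// invr_gt0.
move=> K p M pk mK bK cK K0 M0 hM.
have cp : continuous p by have [] := strongly_smooth_full (polyd_smooth pk).
have [B B0 hB] := continuous_bounded_on bK cp.
have Ky : (mu K < +oo)%E by exact: leb_bounded_lty.
have fK : mu K \is a fin_num by rewrite ge0_fin_numE.
have fK0 : 0 < fine (mu K) by rewrite fine_gt0// K0.
pose E := [set `|p x| | x in K].
have [x0 Kx0] : K !=set0.
  by apply/set0P; apply: contraTneq K0 => ->; rewrite measure0 ltxx.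
have hE : has_sup E.
  split; first by exists `|p x0|, x0.
  by exists B => _ [x Kx <-]; exact: hB.
set S := sup E.
have hS x : K x -> `|p x| <= S by move=> Kx; apply: ub_le_sup; [case: hE|exists x].
suff SM : S <= 4 * l^-1 ^+ d * M by move=> x /hS /le_trans; exact.
have cM0 : 0 <= 4 * l^-1 ^+ d * M by rewrite mulr_ge0// mulr_ge0// exprn_ge0// invr_ge0 ltW.
have [S0|S0] := leP S 0; first exact: le_trans S0 cM0.
have [|_ [z Kz <-] hz] := @sup_adherent _ E (S / 2) _ hE; first by rewrite divr_gt0.
have {}hz : S / 2 < `|p z| by apply: le_lt_trans hz; rewrite -/S; lra.
have large x : K x -> S / 4 <= `|p (l *: (x - z) + z)|.
  move=> Kx; have [P sP hP] := polyd_segment z (x - z) pk.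
  have P0 : P.[0] = p z by rewrite -hP scale0r add0r.
  have hPS t : 0 <= t <= 1 -> `|P.[t]| <= S.
    move=> t01; rewrite -hP; apply: hS.
    rewrite (_ : _ + _ = t *: x + (1 - t) *: z); first exact: cK.
    by apply/rowP => i; rewrite !mxE; ring.
  have l01 : 0 <= l <= 1 by rewrite (ltW l0).
  have := hC1 P S sP hPS l l01; rewrite P0 -hP => h.
  have : `|p z| <= `|p (l *: (x - z) + z)| + `|p (l *: (x - z) + z) - p z|.
    by rewrite -[X in `|X| <= _](subrK (p (l *: (x - z) + z))) addrC distrC ler_normD.
  have : C1 * S * l <= S / 4 by rewrite mulrAC [leRHS]mulrC ler_wpM2r// ltW.
  move: h hz; move: `|_ - _| `|p z| `|p _| (C1 * S * l) => a1 a2 a3 a4; lra.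
have lp : L2 K p.
  by apply: (@L2_bounded _ _ _ mK p B) => //; apply: measurable_funTS; exact: continuous_measurable_rV.
pose K' := aff l^-1 (z - l^-1 *: z) @^-1` K.
have mK' : measurable K' by exact: measurable_preimage_aff.
have K'E y : K' y -> K (aff l^-1 (z - l^-1 *: z) y) /\ y = l *: (aff l^-1 (z - l^-1 *: z) y - z) + z.
  move=> Ky'; split => //; apply/rowP => i; rewrite /aff !mxE; field.
  by rewrite gt_eqF.
have K'K : K' `<=` K.
  move=> y /K'E[Ky' ->].
  rewrite (_ : _ + _ = l *: aff l^-1 (z - l^-1 *: z) y + (1 - l) *: z).
    by apply: cK => //; rewrite (ltW l0).
  by apply/rowP => i; rewrite !mxE; ring.
have muK' : (mu K' = (l ^+ d * fine (mu K))%:E)%E.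
  by rewrite /K' leb_aff// ?invr_gt0// invrK EFinM fineK.
have h1 : (S / 4) ^+ 2 * (l ^+ d * fine (mu K)) <= ip K p p.
  rewrite -lee_fin EFinM -muK' -ip_EFin// -integral_cst//.
  apply: (@le_trans _ _ (\int[mu]_(x in K') (p x * p x)%:E)%E).
    apply: ge0_le_integral => //.
    - by move=> x _; rewrite lee_fin sqr_ge0.
    - by apply/measurable_EFinP; apply: measurable_funTS; apply: measurable_funM; exact: continuous_measurable_rV.
    - move=> y /K'E[Ky' ->]; rewrite lee_fin -expr2 -[leRHS]real_normK ?num_real//.
      by rewrite lerXn2r ?nnegrE// ?large// divr_ge0// ltW.
  apply: ge0_subset_integral => //; last by move=> x _; rewrite lee_fin -expr2 sqr_ge0.
  by apply/measurable_EFinP; apply: measurable_funTS; apply: measurable_funM; exact: continuous_measurable_rV.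
have h2 : (S / 4) ^+ 2 * l ^+ d <= M ^+ 2.
  by rewrite -(ler_pM2r fK0) -mulrA; apply: le_trans h1 hM.
have ld : 0 < l ^+ d by rewrite exprn_gt0.
have lV : 1 <= l^-1 ^+ d by rewrite exprn_ege1.
have h3 : (S / 4) ^+ 2 <= (l^-1 ^+ d * M) ^+ 2.
  rewrite [leRHS]exprMn; apply: (@le_trans _ _ (l^-1 ^+ d * M ^+ 2)).
    by rewrite [leRHS]mulrC exprVn ler_pdivlMr.
  by rewrite ler_wpM2r ?sqr_ge0// expr2 ler_peMl// (le_trans ler01).
have h4' : S / 4 <= l^-1 ^+ d * M.
  rewrite -(@ler_pXn2r _ 2)// nnegrE; first by rewrite divr_ge0// ltW.
  by rewrite mulr_ge0// (le_trans ler01).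
by rewrite -mulrA mulrC -ler_pdivrMr.
Qed.

End norm_equivalence.

Section discrete_spaces.
Context {R : realType} {d : nat} (Om : set 'rV[R]_d).
Hypotheses (oOm : open Om) (bOm : bounded_set Om) (neOm : Om !=set0)
  (cOm : convex_set (Om : set (convex_lmodType 'rV[R]_d))).
Local Notation mu := (leb d : {sigma_finite_measure set 'rV[R]_d -> \bar R}).
Implicit Types (u v w : 'rV[R]_d -> R) (tau psi : 'rV[R]_d -> 'rV[R]_d) (x y z : 'rV[R]_d).

Let mOm : measurable Om. Proof. exact: open_measurable_rV. Qed.
Let Omy : (mu Om < +oo)%E. Proof. exact: leb_bounded_lty. Qed.

Lemma closure_sub_box : exists a b : 'rV[R]_d, closure Om `<=` box a b.
Proof.
have [a [b Oab]] := bounded_sub_obox bOm; exists a, b.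
have /closure_id -> : closed (box a b).
  by apply: compact_closed; [exact: norm_hausdorff|exact: compact_box].
by apply: closureS => x /Oab /obox_sub_box.
Qed.

Lemma leb_sub_closure_lty (A : set 'rV[R]_d) : measurable A -> A `<=` closure Om -> (mu A < +oo)%E.
Proof.
move=> mA AO; have [a [b Oab]] := closure_sub_box.
apply: le_lt_trans (leb_box_lty a b); apply: le_measure; rewrite ?inE//; first exact: measurable_box.
exact: subset_trans Oab.
Qed.

Lemma ae_closure : {ae mu, forall x, closure Om x -> Om x}.
Proof.
have [z Oz] := neOm; have [rho rho0 hrho] := interior_ball oOm Oz.
have mC : measurable (closure Om) by apply: closed_measurable_rV; exact: closed_closure.
apply: (@homothety_null _ _ _ _ z) => //.
- exact: leb_sub_closure_lty.
- exact: subset_closure.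
move=> l x /andP[l0 l1] cx; have l1' : 0 < 1 - l by lra.
have r0 : 0 < (1 - l) * rho by exact: mulr_gt0.
have [y [Oy]] := cx _ (nbhsx_ballx x _ r0); rewrite -ball_normE/= => hxy.
rewrite (_ : _ + _ = l *: y + (1 - l) *: (z + (1 - l)^-1 *: (l *: (x - y)))); last first.
  by rewrite [in RHS]scalerDr [in RHS]scalerA mulfV ?gt_eqF// scale1r; apply/rowP => i; rewrite !mxE; ring.
apply: convex_comb => //; [exact: ltW|exact: ltW|].
apply: hrho; rewrite !normrZ gtr0_norm ?invr_gt0// ler_pdivrMl// (gtr0_norm l0).
by apply: le_trans (ltW hxy); rewrite ler_piMl// ltW.
Qed.

Variable bc : boundary_case.

Lemma spaceU_B u v : spaceU Om bc u -> spaceU Om bc v -> spaceU Om bc (fun x => u x - v x).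
Proof.
move=> [lu hu] [lv hv]; split; first exact: L2B.
case: bc hu hv => // hu hv.
by rewrite RintegralB//; [rewrite hu hv subrr|exact: L2_integrable|exact: L2_integrable].
Qed.

Variables (k : nat) (Th : mesh R d).
Hypothesis hTh : is_partition Om Th.

Lemma UhB u v : Uh Om bc k Th u -> Uh Om bc k Th v -> Uh Om bc k Th (fun x => u x - v x).
Proof.
move=> [su hu] [sv hv]; split; first exact: spaceU_B.
move=> i; have [p pk hp] := hu i; have [q qk hq] := hv i.
exists (fun x => p x - q x); first exact: PkB.
by apply: filterS2 hp hq => x h1 h2 Tx; rewrite h1// h2.
Qed.

Lemma MhB tau psi : Mh Om bc k Th tau -> Mh Om bc k Th psi -> Mh Om bc k Th (fun x => tau x - psi x).
Proof.
move=> [st ht] [sp hp]; split; first exact: spaceM_B.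
move=> i; have [q [r [qk rk h]]] := ht i; have [q' [r' [qk' rk' h']]] := hp i.
exists (fun j x => q j x - q' j x), (fun x => r x - r' x); split => [j||].
- exact: PkB.
- exact: PkB.
apply: filterS2 h h' => x h1 h2 Tx; rewrite h1// h2//.
by apply/rowP => j; rewrite !mxE; ring.
Qed.

Lemma elt_measurable i : measurable (elt Th i).
Proof. by have [nd _ _] := hTh; exact: simplex_measurable (nd i). Qed.

Lemma elt_convex i : convex (elt Th i).
Proof. by have [nd _ _] := hTh; exact: simplex_convex (nd i). Qed.

Lemma elt_has_ball i : exists z, has_ball (elt Th i) z.
Proof. by have [nd _ _] := hTh; exact: simplex_has_ball (nd i). Qed.

Lemma elt_sub i : elt Th i `<=` closure Om.
Proof. by have [_ <- _] := hTh; move=> x Tx; exists i. Qed.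

Lemma elt_cover x : Om x -> exists i, elt Th i x.
Proof.
move=> Ox; have [_ E _] := hTh.
have : closure Om x by exact: subset_closure.
by rewrite -E => -[i _ Tx]; exists i.
Qed.

Lemma ae_elt_interior i : {ae mu, forall x, elt Th i x -> (interior (elt Th i) `&` Om) x}.
Proof.
have [z hz] := elt_has_ball i; have mT := elt_measurable i.
have Ty : (mu (elt Th i) < +oo)%E by apply: leb_sub_closure_lty => //; exact: elt_sub.
have h1 := ae_interior mT Ty (@elt_convex i) hz.
apply: filterS2 h1 ae_closure => x h1 h2 Tx; split; first exact: h1.
by apply: h2; exact: elt_sub Tx.
Qed.

Lemma ae_elt_disjoint i j : i != j -> {ae mu, forall x, elt Th i x -> ~ elt Th j x}.
Proof.
move=> ij; have [_ _ D] := hTh.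
apply: filterS2 (ae_elt_interior i) (ae_elt_interior j) => x h1 h2 Ti Tj.
have [Ii _] := h1 Ti; have [Ij _] := h2 Tj.
have : (interior (elt Th i) `&` interior (elt Th j)) x by [].
by rewrite D.
Qed.

Lemma ae_elt_all (P : 'rV[R]_d -> Prop) :
  (forall i, {ae mu, forall x, elt Th i x -> Om x -> P x}) -> {ae mu, forall x, Om x -> P x}.
Proof.
move=> h.
have H : {ae mu, forall x, forall i, elt Th i x -> Om x -> P x}.
  have H' : {ae mu, forall x, forall (n : nat) i, val i = n -> elt Th i x -> Om x -> P x}.
    apply: ae_foralln => n; case: (ltnP n (mesh_card Th)) => hn.
      apply: filterS (h (Ordinal hn)) => x hx i ni Ti Ox; apply: hx => //.
      by rewrite (_ : Ordinal hn = i)//; apply: val_inj.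
    by apply: aeW => x i ni; have := ltn_ord i; rewrite ltnNge -ni in hn *; rewrite hn.
  by apply: filterS H' => x hx i; exact: hx erefl.
by apply: filterS H => x hx Ox; have [i Ti] := elt_cover Ox; exact: hx Ti Ox.
Qed.

(** * The divergence maps the Raviart-Thomas space into the piecewise polynomials *)

Lemma eq_ip_ae_on (G : set 'rV[R]_d) v v' w : measurable G -> L2 G v -> L2 G v' -> L2 G w ->
  {ae mu, forall x, G x -> v x = v' x} -> ip G v w = ip G v' w.
Proof. by move=> mG lv lv' lw h; apply: ip_ae => //; exact: L2_measurable. Qed.

(** On an element, the divergence of [q + r x] is a polynomial of degree [k],
    since [x_j] times a partial derivative of [r] is one; in the interior of the
    element it is the distributional divergence. Its mean value vanishes with
    the normal trace, tested with the constant 1. *)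
Lemma div_Mh tau : Mh Om bc k Th tau -> Uh Om bc k Th (div Om tau).
Proof.
move=> [hM hT]; have hd := spaceM_Hdiv hM; have [lt _] := hd; have ld := L2_div hd.
split.
  split => //; move: hM; rewrite /spaceM; case: bc => // -[_ h0].
  have C1c : @C1 R d (fun=> 1).
    by apply: strongly_smooth_C1; apply: smooth_expr_strongly_smooth; exact: SmoothCst.
  have := h0 _ (C1_Hsob1 oOm bOm C1c); rewrite ipv_grad_C1//.
  have [E _] := @full_derivative_cst R d 1.
  rewrite big1 ?add0r => [|i _]; last by rewrite E ipC ip0l.
  by move=> <-; apply: eq_Rintegral => x _; rewrite mulr1.
move=> i; have [q [r [qk rk h]]] := hT i.
pose g j x := q j x + x ord0 j * r x.
have gk j : polyd k.+1 (g j).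
  by apply: PolyAdd; [apply: polydW (Pk_polyd (qk j))|apply: PolyX; exact: Pk_polyd].
have pgk j : polyd k (pd j (g j)).
  have pq := Pk_polyd (qk j); have pr := Pk_polyd rk.
  have fr := strongly_smooth_full (polyd_smooth pr).
  have [E1 fc] := @full_derivative_coord R d j.
  have [E2 fm] := full_derivativeM fc fr.
  have [E3 _] := full_derivativeD (strongly_smooth_full (polyd_smooth pq)) fm.
  rewrite E3 E2 E1 eqxx; have [hq _] := polyd_pd pq; have [_ hr] := polyd_pd pr.
  apply: PolyAdd; first exact: hq.
  apply: PolyAdd; first exact: hr.
  by under eq_fun do rewrite mulr1.
pose D x := \sum_j pd j (g j) x.
have Dk : polyd k D by apply: polyd_sum.
exists D; first exact: polyd_Pk.
pose G := interior (elt Th i) `&` Om.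
have oG : open G by apply: openI => //; exact: open_interior.
have GO : G `<=` Om by move=> x [].
have GT : G `<=` elt Th i by move=> x [/interior_subset].
have bG : bounded_set G.
  have [M [Mr hMb]] := bOm; exists M; split => // N MN x /GO; exact: hMb.
have mG : measurable G by exact: open_measurable_rV.
have Cg j : C1 (g j) by apply: strongly_smooth_C1; exact: polyd_smooth (gk j).
have lgG j : L2 G (g j) by apply: (L2_continuous_fun oG bG); case: (Cg j).
have ltG j : L2 G (coordf tau j) by exact: (L2_subset oOm mG GO (lt j)).
have lpg j : L2 G (pd j (g j)).
  apply: (L2_continuous_fun oG bG).
  by have [] := strongly_smooth_full (polyd_smooth (pgk j)).
have tg j : {ae mu, forall x, G x -> coordf tau j x = g j x}.
  apply: filterS h => x hx /GT Tx; rewrite /coordf hx// !mxE /g; ring.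
suff H : div Om tau = D %[ae mu in G].
  apply: filterS2 (ae_elt_interior i) H => x h1 h2 Tx; apply: h2; exact: h1.
apply: (L2_eq_ae oG bG).
- exact: (L2_subset oOm mG GO ld).
- apply: (L2_continuous_fun oG bG).
  by have [] := strongly_smooth_full (polyd_smooth Dk).
move=> phi tphi.
have tO : test_function Om phi.
  by have [sp [K cK [KG hK]]] := tphi; split => //; exists K => //; split => //; exact: subset_trans GO.
have z1 := test_function_zero tphi.
have z2 := test_function_zero tO.
have eqip v f : (forall x, ~ G x -> f x = 0) -> ip G v f = ip Om v f.
  by move=> hf; rewrite (ip_test_T v hf) ip_test_T// => x nOx; apply: hf => /GO.
have [_ hdiv] := divP hd.
rewrite eqip//; have := hdiv phi tO; rewrite ipv_grad_test// => /eqP; rewrite -eqr_oppLR => /eqP <-.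
rewrite -sumrN ip_suml//; last exact: (L2_test oG bG).
apply: eq_bigr => j _.
have tpd := test_function_pd j tphi.
rewrite -eqip; last exact: test_function_zero.
rewrite (eq_ip_ae_on mG (ltG j) (lgG j) _ (tg j)); last exact: (L2_test oG bG).
by rewrite ip_by_parts// opprK.
Qed.

(** * The projection onto the piecewise polynomials is stable in the maximum norm *)

Lemma ip_restrict (A : set 'rV[R]_d) v w : ip Om v (fun x => \1_A x * w x) = ip (A `&` Om) v w.
Proof.
rewrite /ip (Rintegral_mkcond _ Om) (Rintegral_mkcond _ (A `&` Om)).
congr (fine (integral _ _ _)); apply/funext => x; rewrite /= /patch indicE.
have [Ox|nOx] := pselect (Om x); last first.
  by rewrite [x \in Om]memNset// memNset// => -[].
rewrite [x \in Om]mem_set//; have [Ax|nAx] := pselect (A x).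
  by rewrite !mem_set// mul1r.
by rewrite memNset// [x \in A `&` Om]memNset ?mul0r ?mulr0// => -[].
Qed.

(** Polynomials on a single element belong to the discrete space up to the
    subtraction of their mean value. *)
Lemma Uh_local i p : polyd k p ->
  exists2 v, Uh Om bc k Th v & exists m : R, (bc = SimplySupported -> m = 0) /\
    v = (fun x => \1_(elt Th i) x * p x - m).
Proof.
move=> pk; have cp : continuous p by have [] := strongly_smooth_full (polyd_smooth pk).
have [B B0 hB] := continuous_bounded_on bOm cp.
pose g x : R := \1_(elt Th i) x * p x.
have mg : measurable_fun setT g.
  by apply: measurable_funM; [exact: measurable_indic (elt_measurable i)|exact: continuous_measurable_rV].
have lg : L2 Om g.
  apply: (@L2_bounded _ _ _ mOm g B) => //; first exact: measurable_funTS.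
  move=> x /hB h; rewrite /g indicE; case: (x \in _); rewrite ?mul1r ?mul0r ?normr0//.
have lc (c : R) : L2 Om (fun=> c).
  by apply: (@L2_bounded _ _ _ mOm _ `|c|).
have mO0 : 0 < fine (mu Om) by exact: leb_domain_gt0.
pose m : R := if bc is SimplySupported then 0 else (\int[mu]_(x in Om) g x) / fine (mu Om).
exists (fun x => g x - m); last by exists m; split => //; rewrite /m => ->.
split.
  split; first by apply: L2B => //; exact: lc.
  rewrite /m; case: bc => //.
  rewrite RintegralB//; [|exact: (L2_integrable mOm Omy lg)|exact: (L2_integrable mOm Omy (lc _))].
  by rewrite Rintegral_cst// divfK ?subrr// gt_eqF.
have Pkm : @Pk R d k (fun=> m) by apply: polyd_Pk; exact: PolyCst.
move=> j; have [->|ji] := eqVneq j i.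
  exists (fun x => p x - m); first by apply: PkB => //; exact: polyd_Pk.
  by apply: aeW => x Tx; rewrite /g indicE mem_set// mul1r.
exists (fun=> 0 - m); first by apply: polyd_Pk; exact: PolyCst.
apply: filterS (ae_elt_disjoint ji) => x h Tx.
by rewrite /g indicE memNset ?mul0r//; exact: h.
Qed.

End discrete_spaces.

Section projection_stability.
Context {R : realType} {d : nat} (Om : set 'rV[R]_d).
Hypotheses (oOm : open Om) (bOm : bounded_set Om) (neOm : Om !=set0)
  (cOm : convex_set (Om : set (convex_lmodType 'rV[R]_d))).
Local Notation mu := (leb d : {sigma_finite_measure set 'rV[R]_d -> \bar R}).
Implicit Types (u v w : 'rV[R]_d -> R).

Let mOm : measurable Om. Proof. exact: open_measurable_rV. Qed.
Let Omy : (mu Om < +oo)%E. Proof. exact: leb_bounded_lty. Qed.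

(** The orthogonality to the functions of [Uh_local] makes the projection local,
    the constants being harmless as [u] and its projection have the same mean
    value; [polynomial_sup_le] then applies on each element. *)
Lemma projection_bounded k : exists2 C : R, 0 < C & forall bc (Th : mesh R d) P u (M : R),
  is_partition Om Th -> is_projU Om bc k Th P -> spaceU Om bc u -> 0 <= M ->
  {ae mu, forall x, Om x -> `|u x| <= M} -> {ae mu, forall x, Om x -> `|P u x| <= C * M}.
Proof.
have [C C0 hC] := @polynomial_sup_le R d k; exists C => // bc Th P u M hTh hP su M0 uM.
have [lu mean_u] := su; have [UP orth] := hP u lu; have [[lP mean_P] loc] := UP.
apply: (ae_elt_all hTh) => i; have [p pk hp] := loc i.
have {}pk := Pk_polyd pk.
pose K := elt Th i `&` Om.
have mT := elt_measurable hTh i.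
have mK : measurable K by exact: measurableI.
have KO : K `<=` Om by move=> x [].
have cp : continuous p by have [] := strongly_smooth_full (polyd_smooth pk).
have bK : bounded_set K by have [B [Br hB]] := bOm; exists B; split => // N BN x /KO; exact: hB.
have Ky : (mu K < +oo)%E by exact: leb_bounded_lty.
have lpK : L2 K p.
  have [B B0 hB] := continuous_bounded_on bK cp.
  by apply: (@L2_bounded _ _ _ mK p B) => //; apply: measurable_funTS; exact: continuous_measurable_rV.
have luK := L2_subset oOm mK KO lu; have lPK := L2_subset oOm mK KO lP.
have K0 : (0 < mu K)%E.
  have [z hz] := elt_has_ball hTh i.
  apply: (@lt_le_trans _ _ (mu (elt Th i))); first exact: has_ball_leb_gt0 hz.
  have [N [mN N0 hN]] := ae_elt_interior oOm bOm neOm cOm hTh i.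
  apply: (@le_trans _ _ (mu (K `|` N))).
    apply: le_measure; rewrite ?inE//; first exact: measurableU.
    move=> x Tx; have [Ox|nOx] := pselect (Om x); first by left.
    by right; apply: hN => /(_ Tx)[].
  by rewrite -[leRHS]adde0 -N0; exact: measureU2.
have key : ip K p p <= M ^+ 2 * fine (mu K).
  have [v hv [m [m0 vE]]] := Uh_local oOm bOm neOm cOm bc hTh i pk.
  have := orth v hv; have [[lv _] _] := hv.
  have lc (c : R) : L2 Om (fun=> c) by apply: (@L2_bounded _ _ _ mOm _ `|c|).
  have lg : L2 Om (fun x => \1_(elt Th i) x * p x).
    have := L2D mOm lv (lc m); rewrite vE; under eq_fun do rewrite subrK; by [].
  have lD : L2 Om (u \- P u) by exact: L2B.
  rewrite vE (ipBr mOm)//.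
  have -> : ip Om (u \- P u) (fun=> m) = 0.
    case: bc m0 mean_u mean_P {hP su orth UP hv} => [/(_ erefl) -> _ _|_ h1 h2]; first by rewrite ipC ip0l.
    rewrite (ipBl mOm)// /ip.
    rewrite !RintegralZr//; [|exact: L2_integrable|exact: L2_integrable].
    by rewrite h1 h2 mul0r subrr.
  rewrite subr0 ip_restrict -/K ipBl// => /eqP; rewrite subr_eq0 => /eqP E.
  have E2 : ip K (P u) p = ip K p p.
    apply: (eq_ip_ae_on mK lPK lpK lpK); apply: filterS hp => x hx [Tx _]; exact: hx.
  have hu : ip K u u <= M ^+ 2 * fine (mu K).
    have fK : mu K \is a fin_num by rewrite ge0_fin_numE.
    rewrite -lee_fin (EFinM (M ^+ 2)) (fineK fK) -(ip_EFin mK luK luK) -integral_cst//.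
    have H : {ae mu, forall x, K x -> ((u x * u x)%:E <= (M ^+ 2)%:E)%E}.
      apply: filterS uM => x hx /KO Ox; rewrite lee_fin -expr2 -real_normK ?num_real//.
      by rewrite lerXn2r ?nnegrE//; exact: hx.
    apply: ae_ge0_le_integral H => //.
    - by move=> x _; rewrite lee_fin -expr2 sqr_ge0.
    - by apply/measurable_EFinP; apply: measurable_funM; exact: (L2_measurable mK luK).
    - by move=> x _; rewrite lee_fin sqr_ge0.
  have := @ip_young _ _ _ mK 1 u p ltr01 luK lpK; rewrite invr1 !mul1r E E2.
  by move: hu; move: (ip _ _ _) (ip _ _ _) (M ^+ 2 * _) => a b c; lra.
have cK : convex K.
  move=> x y t [Tx Ox] [Ty Oy] t01; split; first exact: (elt_convex hTh Tx Ty).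
  by have /andP[t0 t1] := t01; apply: convex_comb.
apply: filterS hp => x hx Tx Ox; rewrite hx//.
by apply: (hC K p M pk mK bK cK K0 M0 key); split.
Qed.

End projection_stability.

(** * Functions of time with values in L2 *)

Section time.
Context {R : realType} {d : nat} (Om : set 'rV[R]_d) (T : R).
Hypotheses (mOm : measurable Om) (T0 : 0 < T).
Local Notation mu := (leb d : {sigma_finite_measure set 'rV[R]_d -> \bar R}).
Implicit Types (w : R -> 'rV[R]_d -> R) (v z : 'rV[R]_d -> R) (t s : R).

Local Notation sq v := (ip Om v v).

Lemma cvg_normL2_near (I : Type) (F : set_system I) {FF : Filter F} (w : I -> 'rV[R]_d -> R) (e : R) :
  normL2 Om (w s) @[s --> F] --> 0%E -> 0 < e ->
  \forall s \near F, L2 Om (w s) -> sq (w s) <= e.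
Proof.
move=> /fine_cvgP[_ h] e0.
have se0 : 0 < Num.sqrt e by rewrite sqrtr_gt0.
have := cvgr_lt _ h _ se0; move=> /(_ FF).
apply: filterS => s hs ls; move: hs; rewrite /= normL2E//= => hs.
rewrite -[leRHS]sqr_sqrtr ?(ltW e0)// -[leLHS]sqr_sqrtr ?ip_ge0//.
by rewrite lerXn2r ?nnegrE ?sqrtr_ge0// ltW.
Qed.

Lemma sqD_le v z : L2 Om v -> L2 Om z ->
  sq (fun x => v x + z x) <= 2 * sq v + 2 * sq z.
Proof.
move=> lv lw; rewrite (ipDD mOm lv lw).
have := @ip_young _ _ _ mOm 1 v z ltr01 lv lw.
by rewrite invr1 !mul1r; move: (sq _) (ip _ _ _) (sq _) => p q r; lra.
Qed.

Lemma ip_small v z (e : R) : L2 Om v -> L2 Om z -> 0 < e ->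
  sq v <= e ^+ 2 / (sq z + 1) -> `|ip Om v z| <= e.
Proof.
move=> lv lz e0; have z0 : 0 <= sq z by exact: ip_ge0.
have z1 : 0 < sq z + 1 by rewrite ltr_wpDl.
rewrite ler_pdivlMr// => h.
rewrite -(@ler_pXn2r _ 2) ?nnegrE ?(ltW e0)// real_normK ?num_real//.
apply: le_trans (ip_cauchy_schwarz mOm lv lz) _; apply: le_trans h.
by rewrite ler_wpM2l ?ip_ge0// lerDl.
Qed.

Lemma sq_diff v z : L2 Om v -> L2 Om z ->
  sq v - sq z = 2 * ip Om (fun x => v x - z x) z + sq (fun x => v x - z x).
Proof.
move=> lv lz; have lD := L2B mOm lv lz.
rewrite (ipBB mOm lv lz) (ipBl mOm lv lz lz).
by move: (ip _ _ _) (ip _ _ _) (ip _ _ _) => p q r; ring.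
Qed.

Lemma sq_diff_small v z (e : R) : L2 Om v -> L2 Om z -> 0 < e ->
  sq (fun x => v x - z x) <= Num.min (e / 2) ((e / 4) ^+ 2 / (sq z + 1)) ->
  `|sq v - sq z| <= e.
Proof.
move=> lv lz e0; rewrite le_min => /andP[h1 h2]; have lD := L2B mOm lv lz.
have e4 : 0 < e / 4 by rewrite divr_gt0.
have := ip_small lD lz e4 h2; have := ip_ge0 Om (fun x => v x - z x).
rewrite sq_diff//; move: h1; move: (sq (fun x => v x - z x)) (ip _ _ _) => a b h1 a0 h.
apply: le_trans (ler_normD _ _) _; rewrite normrM ger0_norm// (ger0_norm a0).
lra.
Qed.

Lemma L2_continuous_sq w : (forall t, 0 <= t <= T -> L2 Om (w t)) -> L2_continuous Om T w ->
  {within `[0, T], continuous (fun t => sq (w t))}.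
Proof.
move=> lw cw; apply/subspace_continuousP => t /=; rewrite in_itv/= => t0T.
apply/(@cvgrPdist_le _ _ _ (within `[0, T] (nbhs t))) => e e0.
have z1 : 0 < sq (w t) + 1 by rewrite ltr_wpDl// ip_ge0.
have d0 : 0 < Num.min (e / 2) ((e / 4) ^+ 2 / (sq (w t) + 1)).
  by rewrite lt_min divr_gt0//= divr_gt0// exprn_gt0// divr_gt0.
have h := @cvg_normL2_near _ _ (within_filter `[0, T] (nbhs_filter t)) _ _ (cw t t0T) d0.
near=> s.
have /= sT : `[0, T]%classic s by near: s; exact: withinT.
rewrite in_itv/= in sT.
rewrite distrC; apply: sq_diff_small => //; [exact: lw|exact: lw|].
have hs : L2 Om (w s \- w t) -> sq (w s \- w t) <= Num.min (e / 2) ((e / 4) ^+ 2 / (sq (w t) + 1)).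
  by near: s.
by apply: hs; apply: L2B => //; exact: lw.
Unshelve. all: by end_near. Qed.

Lemma dnbhs_shift t (P : set R) : (\forall s \near dnbhs t, P s) -> \forall h \near 0^', P (h + t).
Proof.
move=> [r /= r0 hr]; exists r => // h /=; rewrite sub0r normrN => hr' h0.
apply: hr; first by rewrite /= opprD addrCA subrr addr0 normrN.
by apply: contra_neq h0 => e; apply: (@addIr _ t); rewrite e add0r.
Qed.

Lemma dnbhs_within t : 0 < t < T -> forall P : set R,
  (\forall s \near within `[0, T] (dnbhs t), P s) -> \forall s \near dnbhs t, P s.
Proof.
move=> t0T P hP.
have : \forall s \near dnbhs t, `[0, T]%classic s.
  apply: (@nbhs_dnbhs _ t); apply: (@filterS _ _ _ `]0, T[%classic); first exact: subset_itvW.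
  by apply: open_nbhs_nbhs; split; [exact: interval_open|rewrite /= in_itv].
by move=> hT; apply: filterS2 hT hP => s h; exact.
Qed.

Lemma is_derive_sq w t z : (forall t, 0 <= t <= T -> L2 Om (w t)) -> 0 < t < T ->
  is_dt Om T w t z -> is_derive t 1 (fun t => sq (w t)) (2 * ip Om z (w t)).
Proof.
move=> lw t0T [lz hz]; have t0T' : 0 <= t <= T by have /andP[? ?] := t0T; rewrite !ltW.
have lt := lw t t0T'.
apply: is_derive_of_cvg; apply/cvgrPdist_le => e e0.
suff h : \forall s \near dnbhs t, `|2 * ip Om z (w t) - (s - t)^-1 * (sq (w s) - sq (w t))| <= e.
  by have := dnbhs_shift h; apply: filterS => h' /=; rewrite addrK.
pose q s x := (s - t)^-1 * (w s x - w t x) - z x.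
have z1 : 0 < sq (w t) + 1 by rewrite ltr_wpDl// ip_ge0.
have e8 : 0 < e / 8 by rewrite divr_gt0.
pose dl := Num.min 1 ((e / 8) ^+ 2 / (sq (w t) + 1)).
have d0 : 0 < dl by rewrite lt_min ltr01/= divr_gt0// exprn_gt0.
pose eta := e / (2 * (2 * sq z + 2)).
have zz0 : 0 <= sq z by exact: ip_ge0.
have eta0 : 0 < eta by rewrite divr_gt0//; lra.
have hq := dnbhs_within t0T (@cvg_normL2_near _ _ (within_filter `[0, T] (dnbhs_filter t)) _ _ hz d0).
have hT : \forall s \near dnbhs t, `[0, T]%classic s.
  by apply: (dnbhs_within t0T); exact: withinT.
have hE : \forall s \near dnbhs t, `|s - t| < eta.
  apply: (@nbhs_dnbhs _ t); have := @nbhsx_ballx _ R^o t eta eta0.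
  by apply: filterS => s; rewrite /= -ball_normE/= distrC.
have hne : \forall s \near dnbhs t, s != t by exact: nbhs_dnbhs_neq.
near=> s.
have sT : 0 <= s <= T.
  have /= : `[0, T]%classic s by near: s.
  by rewrite in_itv.
have st : s - t != 0 by rewrite subr_eq0; near: s.
have ls := lw s sT.
have lq : L2 Om (q s) by apply: (L2B mOm) => //; apply: (L2Z mOm); exact: L2B.
have qs : sq (q s) <= dl.
  by have hh : L2 Om (q s) -> sq (q s) <= dl; [near: s|exact: hh].
have sE : `|s - t| < eta by near: s.
have wE : (fun x => w s x - w t x) = (fun x => (s - t) * (z x + q s x)).
  by apply/funext => x; rewrite /q (addrC (z x)) subrK mulrA mulfV// mul1r.
have lzq : L2 Om (fun x => z x + q s x) by exact: L2D.
have E : sq (w s) - sq (w t) = (s - t) * (2 * ip Om z (w t) + 2 * ip Om (q s) (w t) + (s - t) * sq (fun x => z x + q s x)).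
  rewrite sq_diff// wE (ipZl mOm)// (ipZl mOm)//; last exact: L2Z.
  by rewrite (ipZr mOm)// (ipDl mOm)//; move: (ip _ _ _) (ip _ _ _) (ip _ _ _) => a b c; ring.
rewrite E mulrA mulVf// mul1r.
move: qs; rewrite le_min => /andP[q1 q2].
have h1 := ip_small lq lt e8 q2.
have h2 : sq (fun x => z x + q s x) <= 2 * sq z + 2.
  by apply: le_trans (sqD_le lz lq) _; rewrite lerD2l; lra.
have h3 : `|(s - t) * sq (fun x => z x + q s x)| <= e / 2.
  rewrite normrM (ger0_norm (ip_ge0 _ _)).
  apply: (@le_trans _ _ (eta * (2 * sq z + 2))).
    by apply: ler_pM => //; [exact: ip_ge0|exact: ltW].
  rewrite le_eqVlt; apply/orP; left; apply/eqP; rewrite /eta; field.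
  by rewrite gt_eqF//; lra.
rewrite -addrA opprD addrA subrr add0r normrN.
apply: le_trans (ler_normD _ _) _; rewrite normrM ger0_norm//; lra.
Unshelve. all: by end_near. Qed.

Lemma right_dini_of_derive (F : R -> R) (l k t e : R) : is_derive t 1 F l -> l <= k -> 0 < e ->
  \forall s \near t^'+, F s - F t <= (s - t) * (k + e).
Proof.
move=> [h1 h2] lk e0.
have : (fun h => h^-1 *: ((F \o shift t) (h *: (1:R)) - F t)) h @[h --> 0^'] --> l.
  by rewrite -h2; exact: h1.
move=> /cvgrPdist_le/(_ e e0) [r /= r0 hr].
exists r => //= s ts ts'.
have st : 0 < s - t by rewrite subr_gt0.
have := hr (s - t); rewrite /= sub0r normrN -[X in X < r]distrC => /(_ ts); rewrite gt_eqF// => /(_ isT).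
rewrite [(s - t) *: 1]mulr1 subrK [_ *: _]mulrC -(ler_pM2r st).
rewrite -{2}(gtr0_norm st) -normrM mulrBl divfK ?gt_eqF// => h.
move: h; rewrite ler_norml => /andP[h _].
have : l * (s - t) <= k * (s - t) by rewrite ler_wpM2r// (ltW st).
by move: h; rewrite [(s - t) * _]mulrC mulrDl; move: (l * _) (k * _) (e * _) => p1 p2 p3; lra.
Qed.

(** * Strong measurability *)

Lemma strongly_measurable_ip w v : strongly_measurable Om T w -> L2 Om v ->
  measurable_fun `]0, T] (fun t => ip Om (w t) v) /\ measurable_fun `]0, T] (fun t => sq (w t)).
Proof.
move=> [lw [N [A [f [hA hc]]]]] lv.
pose s n t x := \sum_(i < N n) \1_(A n i) t * f n i x.
have ls n t : L2 Om (s n t) by apply: (L2_sum mOm) => i _; apply: (L2Z mOm); have [_] := hA n i.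
have m1 n i : measurable_fun `]0, T] (\1_(A n i) : R -> R).
  by apply: measurable_funTS; apply: measurable_indic; have [] := hA n i.
have ipE n t g : L2 Om g -> ip Om (s n t) g = \sum_(i < N n) \1_(A n i) t * ip Om (f n i) g.
  move=> lg; rewrite /s (ip_suml mOm)//; last by move=> i _; apply: (L2Z mOm); have [_] := hA n i.
  by apply: eq_bigr => i _; rewrite (ipZl mOm)//; have [_] := hA n i.
have mip n g : L2 Om g -> measurable_fun `]0, T] (fun t => ip Om (s n t) g).
  move=> lg; rewrite (_ : (fun _ => _) = fun t => \sum_(i < N n) \1_(A n i) t * ip Om (f n i) g); last by apply/funext => t; exact: ipE.
  by apply: measurable_sum => i; apply: measurable_funM.
have msq n : measurable_fun `]0, T] (fun t => sq (s n t)).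
  rewrite (_ : (fun _ => _) = fun t => \sum_(i < N n) \1_(A n i) t * ip Om (s n t) (f n i)).
    by apply: measurable_sum => i; apply: measurable_funM => //; apply: mip; have [_] := hA n i.
  apply/funext => t; rewrite {1}/s (ip_suml mOm)//; last by move=> i _; apply: (L2Z mOm); have [_] := hA n i.
  by apply: eq_bigr => i _; rewrite (ipZl mOm)//; [rewrite ipC|have [_] := hA n i].
have mI : measurable (`]0, T]%classic : set (measurableTypeR R)) by exact: measurable_itv.
have hn t (e : R) : 0 < t <= T -> 0 < e -> \forall n \near \oo, sq (fun x => s n t x - w t x) <= e.
  move=> t0T e0; have h := @cvg_normL2_near _ _ eventually_filter _ _ (hc t t0T) e0.
  apply: filterS h => n h.
  have lD : L2 Om (fun x => w t x - s n t x) by apply: (L2B mOm) => //; exact: lw.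
  have -> : sq (fun x => s n t x - w t x) = sq (fun x => w t x - s n t x).
    by apply: eq_Rintegral => x _; ring.
  exact: h.
split.
  apply: (measurable_fun_cvg (h := fun n t => ip Om (s n t) v)).
  - by move=> n; exact: mip.
  move=> t /=; rewrite in_itv/= => t0T; apply/cvgrPdist_le => e e0.
  have z1 : 0 < sq v + 1 by rewrite ltr_wpDl// ip_ge0.
  have d0 : 0 < e ^+ 2 / (sq v + 1) by rewrite divr_gt0// exprn_gt0.
  apply: filterS (hn t _ t0T d0) => n h.
  rewrite distrC -(ipBl mOm)//; last exact: lw.
  by apply: ip_small => //; apply: (L2B mOm) => //; exact: lw.
apply: (measurable_fun_cvg (h := fun n t => sq (s n t))).
- by move=> n; exact: msq.
move=> t /=; rewrite in_itv/= => t0T; apply/cvgrPdist_le => e e0.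
have z1 : 0 < sq (w t) + 1 by rewrite ltr_wpDl// ip_ge0.
have d0 : 0 < Num.min (e / 2) ((e / 4) ^+ 2 / (sq (w t) + 1)).
  by rewrite lt_min divr_gt0//= divr_gt0// exprn_gt0// divr_gt0.
apply: filterS (hn t _ t0T d0) => n h.
by rewrite distrC; apply: sq_diff_small => //; exact: lw.
Qed.

End time.

(** * Differential inequalities without measurability *)

Section lower_integrals.
Import HBNNSimple.
Context {R : realType}.
Local Notation mu := (@lebesgue_measure R).
Local Open Scope ereal_scope.

(** The integral of a nonnegative function is a supremum over simple functions
    below it; monotonicity and homogeneity hold without any measurability. *)
Lemma lower_integral_le (D1 D2 : set R) (F G : R -> \bar R) :
  (forall x, D1 x -> 0 <= F x) -> (forall x, D2 x -> 0 <= G x) ->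
  (forall x, D1 x -> D2 x /\ F x <= G x) ->
  \int[mu]_(x in D1) F x <= \int[mu]_(x in D2) G x.
Proof.
move=> F0 G0 FG; rewrite ge0_integralE// ge0_integralE//.
apply: ereal_sup_le => _ [h /= hF <-]; exists h => // x; apply: le_trans (hF x) _.
rewrite !patchE; case: ifPn => [/set_mem D1x|_].
  by have [D2x] := FG _ D1x; rewrite mem_set.
by case: ifPn => // /set_mem; exact: G0.
Qed.

Lemma lower_integralZ (D : set R) (F : R -> \bar R) (c : R) : (0 < c)%R ->
  (forall x, D x -> 0 <= F x) ->
  \int[mu]_(x in D) (c%:E * F x) = c%:E * \int[mu]_(x in D) F x.
Proof.
move=> c0 F0.
have H (a : R) (G : R -> \bar R) : (0 < a)%R -> (forall x, D x -> 0 <= G x) ->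
    a%:E * \int[mu]_(x in D) G x <= \int[mu]_(x in D) (a%:E * G x).
  move=> a0 G0; rewrite -lee_pdivlMl// [leLHS]ge0_integralE//.
  apply: ge_ereal_sup => _ [h /= hF <-].
  rewrite lee_pdivlMl// -sintegralrM ge0_integralE; last first.
    by move=> x Dx; rewrite mule_ge0 ?G0// lee_fin ltW.
  apply: ereal_sup_ubound; exists (scale_nnsfun h (ltW a0)) => //= x.
  rewrite patchE EFinM; have := hF x; rewrite patchE; case: ifPn => _ hx.
    by rewrite lee_pmul2l.
  by rewrite -[leRHS](mule0 a%:E) lee_pmul2l.
apply/le_anti/andP; split; last exact: H.
rewrite -(@lee_pdivrMl _ c)//; apply: le_trans (H c^-1%R _ _ _) _; rewrite ?invr_gt0//.
  by move=> x Dx; rewrite mule_ge0 ?F0// lee_fin ltW.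
rewrite le_eqVlt; apply/orP; left; apply/eqP; apply: eq_integral => x _.
by rewrite muleA -EFinM mulVf ?mul1e// gt_eqF.
Qed.

Close Scope ereal_scope.
Local Open Scope ring_scope.

(** The derivative [D] is measurable, being a limit of difference quotients; the
    integrals of [K] and [L] therefore only enter through simple functions, and
    neither of them has to be measurable. *)
Lemma growth_by_derivative (a b : R) (f D K m L : R -> R) : a < b ->
  {within `[a, b], continuous f} -> (forall t, a < t < b -> is_derive t 1 f (D t)) ->
  measurable_fun `]a, b] m ->
  (forall t, a < t <= b -> [/\ 0 <= m t, 0 <= K t & 0 <= L t]) ->
  (forall t, a < t < b -> D t + L t <= K t + m t) ->
  ((f b - f a)%:E + \int[mu]_(t in `]a, b]) (L t)%:E <=
   \int[mu]_(t in `]a, b]) (K t)%:E + \int[mu]_(t in `]a, b]) (m t)%:E)%E.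
Proof.
move=> ab cf fD mm pos hD; set I := `]a, b]%classic in mm *.
have mI : measurable (I : set (measurableTypeR R)) by exact: measurable_itv.
have pI t : I t -> [/\ 0 <= m t, 0 <= K t & 0 <= L t] by rewrite /I/= in_itv; exact: pos.
have mf : measurable_fun `[a, b] f by apply: subspace_continuous_measurable_fun.
pose E t := if t < b then D t else 0.
have mE : measurable_fun I E.
  pose q (n : nat) t := n.+1%:R * (f (Num.min (t + n.+1%:R^-1) b) - f t).
  apply: (measurable_fun_cvg (h := q)).
    move=> n; apply: measurable_funM => //; apply: measurable_funB.
      have mg : measurable_fun I (fun t => Num.min (t + n.+1%:R^-1) b).
        by apply: measurable_minr => //; apply: measurable_funD.
      have gI : [set Num.min (t + n.+1%:R^-1) b | t in I] `<=` `[a, b]%classic.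
        move=> _ [t + <-]; rewrite /I/= !in_itv/= => /andP[at_ tb].
        rewrite ge_min lexx orbT andbT le_min (ltW ab) andbT.
        by apply: le_trans (ltW at_) _; rewrite lerDl.
      exact: (measurable_comp (measurable_itv _) gI mf mg).
    by apply: measurable_funS mf => //; exact: subset_itv_oc_cc.
  move=> t; rewrite /I/= in_itv/= => /andP[at_ tb]; rewrite /E; case: ifPn => [tb'|].
    have [h1 h2] := fD t (introT andP (conj at_ tb')).
    have : (fun h => h^-1 *: ((f \o shift t) (h *: (1:R)) - f t)) h @[h --> 0^'] --> D t.
      by rewrite -h2; exact: h1.
    move=> /cvgrPdist_le hc; apply/cvgrPdist_le => e e0.
    have [r /= r0 hr] := hc e e0.
    have r'0 : 0 < Num.min r (b - t) by rewrite lt_min r0 subr_gt0.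
    near=> n.
    have nr : n.+1%:R^-1 < Num.min r (b - t) by near: n; exact: near_infty_natSinv_lt (PosNum r'0).
    move: nr; rewrite lt_min => /andP[nr nb].
    have n0 : 0 < n.+1%:R^-1 :> R by rewrite invr_gt0.
    have := hr n.+1%:R^-1; rewrite /= sub0r normrN gtr0_norm// => /(_ nr); rewrite gt_eqF// => /(_ isT).
    by rewrite /q min_l ?invrK ?[_ *: 1]mulr1 ?[_ *: _]mulrC 1?(addrC t) 1?[X in `|_ - X|]mulrC//; rewrite addrC -lerBrDl ltW.
  rewrite -leNgt => bt; have -> : t = b by apply/le_anti; rewrite tb.
  apply/cvgrPdist_le => e e0; apply: nearW => n.
  by rewrite /q min_r ?lerDl// subrr mulr0 subrr normr0 ltW.
rewrite [leLHS]addeC -leeBrDr//.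
rewrite ge0_integralE; last by move=> t /pI[_ _ l0]; rewrite lee_fin.
apply: ge_ereal_sup => _ [h /= hL <-].
have h0 t : 0 <= h t by exact: fun_ge0.
have mh : measurable_fun I h.
  by move=> _ Y mY; apply: measurableI => //; rewrite -[X in measurable X]setTI; have := measurable_funP h; apply.
have hD' t : ~ I t -> h t = 0.
  move=> nD; apply/le_anti; rewrite h0 andbT -lee_fin; apply: le_trans (hL t) _.
  by rewrite patchN// ?notin_setE.
have hLt t : I t -> h t <= L t.
  by move=> It; rewrite -lee_fin; apply: le_trans (hL t) _; rewrite patchE mem_set.
pose G t := if t < b then Num.max 0 (E t - m t + h t) else 0.
have mG : measurable_fun I G.
  apply: measurable_fun_if => //; first exact: measurable_fun_ltr.
  apply: (measurable_funS mI) => //.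
  by apply: measurable_maxr => //; apply: measurable_funD => //; exact: measurable_funB.
have G0 t : 0 <= G t by rewrite /G; case: ifP => // _; rewrite le_max lexx.
have GK t : I t -> G t <= K t.
  move=> It; have [m0 K0 L0] := pI _ It; rewrite /G /E; case: ifP => // tb; rewrite ge_max K0/=.
  have := hD t; rewrite tb andbT; move: (It); rewrite /I/= in_itv/= => /andP[-> _] /(_ isT).
  by have := hLt _ It; move: (D t) (L t) (K t) (m t) (h t) => d1 d2 d3 d4 d5; lra.
have [ci ca cb] := (continuous_within_itvP f ab).1 cf.
have [c hc] : exists c : R, forall t, 0 <= h t <= c.
  have [c [_ hc]] := simple_bounded h.
  by exists (c + 1) => t; rewrite h0/=; apply: le_trans (ler_norm _) (hc (c + 1) _ t _) => //; rewrite ltrDl.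
have := @growth_dissipation R a b c f (fun t => G t + m t) h ab.
rewrite -/I (_ : (\int[mu]_(t in I) (G t + m t)%:E = \int[mu]_(t in I) (G t)%:E + \int[mu]_(t in I) (m t)%:E)%E); last first.
  under eq_integral do rewrite EFinD.
  by rewrite ge0_integralD//; [move=> t _; rewrite lee_fin|exact/measurable_EFinP|move=> t /pI[m0 _ _]; rewrite lee_fin|exact/measurable_EFinP].
move=> H; rewrite EFinN leeBrDr// [leLHS]addeC.
rewrite -integralT_nnsfun (_ : (\int[mu]_x (h x)%:E = \int[mu]_(x in I) (h x)%:E)%E); last first.
  rewrite [RHS]integral_mkcond; apply: eq_integral => x _; rewrite /patch; case: ifPn => //.
  by rewrite notin_setE => /hD' ->.
apply: le_trans (H _ _ mh hc _ _ _) _.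
- exact: measurable_funD.
- by move=> t /pI[m0 _ _]; rewrite addr_ge0.
- move=> t /andP[at_]; rewrite le_eqVlt => /predU1P[->//|tb].
  by apply: cvg_within_filter; apply: ci; rewrite in_itv/= at_.
- exact: ca.
- move=> t e tab e0; apply: (right_dini_of_derive (fD t tab)) => //.
  have /andP[_ tb] := tab; rewrite /G /E tb.
  by rewrite lerBrDr -lerBlDr addrAC le_max lexx orbT.
- rewrite leeD2r//; apply: lower_integral_le.
  + by move=> x _; rewrite lee_fin.
  + by move=> x /pI[_ K0 _]; rewrite lee_fin.
  + by move=> x Ix; split => //; rewrite lee_fin GK.
Unshelve. all: by end_near. Qed.

End lower_integrals.

(** * Calculus of functions with values in L2 *)

Section time_derivatives.
Context {R : realType} {d : nat} (Om : set 'rV[R]_d) (T : R).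
Hypotheses (mOm : measurable Om) (T0 : 0 < T).
Local Notation sq v := (ip Om v v).
Local Notation leb1 := (@lebesgue_measure R).
Implicit Types (w : R -> 'rV[R]_d -> R) (v z : 'rV[R]_d -> R) (t s : R).

Lemma cvg_normL2_0 (I : Type) (F : set_system I) {FF : Filter F} (w : I -> 'rV[R]_d -> R) :
  (forall e : R, 0 < e -> \forall s \near F, L2 Om (w s) /\ sq (w s) <= e) ->
  normL2 Om (w s) @[s --> F] --> 0%E.
Proof.
move=> h; apply/fine_cvgP; split.
  by apply: filterS (h 1 ltr01) => s [ls _]; rewrite (normL2E mOm ls).
apply/cvgrPdist_le => e e0; apply: filterS (h (e ^+ 2) (exprn_gt0 2 e0)) => s [ls hs].
rewrite sub0r normrN /= (normL2E mOm ls) ger0_norm ?sqrtr_ge0//=.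
by rewrite -[leRHS]ger0_norm ?(ltW e0)// -sqrtr_sqr ler_wsqrtr.
Qed.

Lemma L2_continuousB w1 w2 :
  (forall t, 0 <= t <= T -> L2 Om (w1 t)) -> (forall t, 0 <= t <= T -> L2 Om (w2 t)) ->
  L2_continuous Om T w1 -> L2_continuous Om T w2 -> L2_continuous Om T (fun t => w1 t \- w2 t).
Proof.
move=> l1 l2 c1 c2 t t0T; have FF := within_filter `[0, T] (nbhs_filter t).
apply: cvg_normL2_0 => e e0.
have e4 : 0 < e / 4 by rewrite divr_gt0.
have h1 := @cvg_normL2_near _ _ _ mOm _ _ FF _ _ (c1 t t0T) e4.
have h2 := @cvg_normL2_near _ _ _ mOm _ _ FF _ _ (c2 t t0T) e4.
near=> s.
have sT : 0 <= s <= T.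
  have /= : `[0, T]%classic s by near: s; exact: withinT.
  by rewrite in_itv.
have ld1 := L2B mOm (l1 s sT) (l1 t t0T); have ld2 := L2B mOm (l2 s sT) (l2 t t0T).
have q1 : sq (w1 s \- w1 t) <= e / 4.
  by suff: L2 Om (w1 s \- w1 t) -> sq (w1 s \- w1 t) <= e / 4; [exact|near: s].
have q2 : sq (w2 s \- w2 t) <= e / 4.
  by suff: L2 Om (w2 s \- w2 t) -> sq (w2 s \- w2 t) <= e / 4; [exact|near: s].
have -> : ((w1 s \- w2 s) \- (w1 t \- w2 t)) = (fun x => (w1 s \- w1 t) x + - (w2 s \- w2 t) x).
  by apply/funext => x /=; ring.
have ln := L2N mOm ld2.
split; first exact: L2D.
apply: le_trans (sqD_le mOm ld1 ln) _.
have -> : sq (fun x => - (w2 s \- w2 t) x) = sq (w2 s \- w2 t).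
  by apply: eq_Rintegral => x _; rewrite mulrNN.
by move: q1 q2; move: (sq _) (sq _) => a b; lra.
Unshelve. all: by end_near. Qed.

Lemma is_dtB w1 w2 t z1 z2 :
  (forall t, 0 <= t <= T -> L2 Om (w1 t)) -> (forall t, 0 <= t <= T -> L2 Om (w2 t)) ->
  0 <= t <= T -> is_dt Om T w1 t z1 -> is_dt Om T w2 t z2 ->
  is_dt Om T (fun t => w1 t \- w2 t) t (fun x => z1 x - z2 x).
Proof.
move=> l1 l2 t0T [lz1 c1] [lz2 c2]; split; first exact: L2B.
have FF := within_filter `[0, T] (dnbhs_filter t).
apply: cvg_normL2_0 => e e0.
have e4 : 0 < e / 4 by rewrite divr_gt0.
have h1 := @cvg_normL2_near _ _ _ mOm _ _ FF _ _ c1 e4.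
have h2 := @cvg_normL2_near _ _ _ mOm _ _ FF _ _ c2 e4.
pose D1 s x := (s - t)^-1 * (w1 s x - w1 t x) - z1 x.
pose D2 s x := (s - t)^-1 * (w2 s x - w2 t x) - z2 x.
near=> s.
have sT : 0 <= s <= T.
  have /= : `[0, T]%classic s by near: s; exact: withinT.
  by rewrite in_itv.
have ld1 : L2 Om (D1 s) by apply: (L2B mOm) => //; apply: (L2Z mOm); apply: (L2B mOm); [exact: l1|exact: l1].
have ld2 : L2 Om (D2 s) by apply: (L2B mOm) => //; apply: (L2Z mOm); apply: (L2B mOm); [exact: l2|exact: l2].
have q1 : sq (D1 s) <= e / 4 by suff: L2 Om (D1 s) -> sq (D1 s) <= e / 4; [exact|near: s].
have q2 : sq (D2 s) <= e / 4 by suff: L2 Om (D2 s) -> sq (D2 s) <= e / 4; [exact|near: s].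
have -> : (fun x => (s - t)^-1 * ((w1 s \- w2 s) x - (w1 t \- w2 t) x) - (z1 x - z2 x)) = (fun x => D1 s x + - D2 s x).
  by apply/funext => x; rewrite /D1 /D2 /=; ring.
have ln := L2N mOm ld2.
split; first exact: L2D.
apply: le_trans (sqD_le mOm ld1 ln) _.
have -> : sq (fun x => - D2 s x) = sq (D2 s) by apply: eq_Rintegral => x _; rewrite mulrNN.
by move: q1 q2; move: (sq _) (sq _) => a b; lra.
Unshelve. all: by end_near. Qed.

(** * Orthogonal projections *)

Section projection.
Variable P : ('rV[R]_d -> R) -> ('rV[R]_d -> R).
Hypothesis LP : forall v, L2 Om v -> L2 Om (P v).
Hypothesis orthP : forall v z, L2 Om v -> L2 Om z -> ip Om (v \- P v) (P z) = 0.

Lemma pythagoras_le v z : L2 Om v -> L2 Om z -> ip Om v z = 0 -> sq z <= sq (fun x => v x + z x).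
Proof.
by move=> lv lz h; rewrite (ipDD mOm lv lz) h mulr0 addr0 lerDr ip_ge0.
Qed.

Lemma projection_contraction v z : L2 Om v -> L2 Om z -> sq (P v \- P z) <= sq (v \- z).
Proof.
move=> lv lz; have lPv := LP lv; have lPz := LP lz.
have le1 := L2B mOm lv lPv; have le2 := L2B mOm lz lPz.
have lD := L2B mOm le1 le2; have lDP := L2B mOm lPv lPz.
have -> : v \- z = (fun x => ((v \- P v) x - (z \- P z) x) + (P v \- P z) x).
  by apply/funext => x /=; ring.
apply: pythagoras_le => //.
by rewrite (ipBr mOm)// !(ipBl mOm le1 le2)// !orthP// !subrr.
Qed.

Lemma projection_contraction3 (c : R) v v' z : L2 Om v -> L2 Om v' -> L2 Om z ->
  sq (fun x => c * (P v x - P v' x) - P z x) <= sq (fun x => c * (v x - v' x) - z x).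
Proof.
move=> lv lv' lz; have lPv := LP lv; have lPw := LP lv'; have lPz := LP lz.
have e1 := L2B mOm lv lPv; have e2 := L2B mOm lv' lPw; have e3 := L2B mOm lz lPz.
have e12 := L2B mOm e1 e2; have e12c := L2Z mOm c e12.
have lE := L2B mOm e12c e3.
have P12 := L2B mOm lPv lPw; have P12c := L2Z mOm c P12; have lN := L2B mOm P12c lPz.
have -> : (fun x => c * (v x - v' x) - z x) =
    (fun x => (c * ((v \- P v) x - (v' \- P v') x) - (z \- P z) x) + (c * (P v x - P v' x) - P z x)).
  by apply/funext => x /=; ring.
apply: pythagoras_le => //.
have H g : L2 Om g -> ip Om (fun x => c * ((v \- P v) x - (v' \- P v') x) - (z \- P z) x) (P g) = 0.
  move=> lg; have lPg := LP lg.
  by rewrite (ipBl mOm e12c e3)// (ipZl mOm _ e12)// (ipBl mOm e1 e2)// !orthP// subrr mulr0 subrr.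
by rewrite (ipBr mOm P12c lPz lE) (ipZr mOm _ P12 lE) (ipBr mOm lPv lPw lE) !H// subrr mulr0 subrr.
Qed.

Lemma L2_continuous_projection w : (forall t, 0 <= t <= T -> L2 Om (w t)) ->
  L2_continuous Om T w -> L2_continuous Om T (fun t => P (w t)).
Proof.
move=> lw cw t t0T; have FF := within_filter `[0, T] (nbhs_filter t).
apply: cvg_normL2_0 => e e0.
have h1 := @cvg_normL2_near _ _ _ mOm _ _ FF _ _ (cw t t0T) e0.
near=> s.
have sT : 0 <= s <= T.
  have /= : `[0, T]%classic s by near: s; exact: withinT.
  by rewrite in_itv.
have ls := lw s sT; have lt := lw t t0T; have ld := L2B mOm ls lt.
split; first by apply: (L2B mOm); exact: LP.
apply: le_trans (projection_contraction ls lt) _.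
by suff: L2 Om (w s \- w t) -> sq (w s \- w t) <= e; [exact|near: s].
Unshelve. all: by end_near. Qed.

Lemma is_dt_projection w t z : (forall t, 0 <= t <= T -> L2 Om (w t)) -> 0 <= t <= T ->
  is_dt Om T w t z -> is_dt Om T (fun t => P (w t)) t (P z).
Proof.
move=> lw t0T [lz cz]; split; first exact: LP.
have FF := within_filter `[0, T] (dnbhs_filter t).
apply: cvg_normL2_0 => e e0.
have h1 := @cvg_normL2_near _ _ _ mOm _ _ FF _ _ cz e0.
near=> s.
have sT : 0 <= s <= T.
  have /= : `[0, T]%classic s by near: s; exact: withinT.
  by rewrite in_itv.
have ls := lw s sT; have lt := lw t t0T.
have lD : L2 Om (fun x => (s - t)^-1 * (w s x - w t x) - z x).
  by apply: (L2B mOm) => //; apply: (L2Z mOm); exact: L2B.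
split.
  by apply: (L2B mOm); [apply: (L2Z mOm); apply: (L2B mOm); exact: LP|exact: LP].
apply: le_trans (projection_contraction3 _ ls lt lz) _.
by suff: L2 Om (fun x => (s - t)^-1 * (w s x - w t x) - z x) -> sq (fun x => (s - t)^-1 * (w s x - w t x) - z x) <= e; [exact|near: s].
Unshelve. all: by end_near. Qed.

End projection.

(** * The maximum in time *)

(** [s |-> (s - c) * (w s, w s)] vanishes at [c]; taking for [c] the end of the
    time interval that is farther from [t] bounds the value at [t]. *)
Lemma sup_le_time w (z : R -> 'rV[R]_d -> R) : (forall t, 0 <= t <= T -> L2 Om (w t)) ->
  L2_continuous Om T w -> (forall t, 0 < t < T -> is_dt Om T w t (z t)) ->
  forall t, 0 <= t <= T -> ((sq (w t))%:E <= ((T / 2)^-1 * (1 + T))%:E *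
    (\int[leb1]_(s in `]0%R, T]) (sq (w s))%:E + \int[leb1]_(s in `]0%R, T]) (sq (z s))%:E))%E.
Proof.
move=> lw cw dw.
set S := (_ + _)%E.
have T1 : 0 < 1 + T by rewrite addr_gt0.
have cr := L2_continuous_sq mOm lw cw.
have H a b c : 0 <= a -> a < b -> b <= T -> 0 <= c <= T ->
    (((b - c) * sq (w b) - (a - c) * sq (w a))%:E <= (1 + T)%:E * S)%E.
  move=> a0 ab bT /andP[c0 cT].
  have ab0T : [set` `[a, b]] `<=` [set` `[0, T]].
    by move=> s; rewrite /= !in_itv/= => /andP[h1 h2]; rewrite (le_trans a0 h1) (le_trans h2 bT).
  have aboc : [set` `]a, b]] `<=` [set` `]0, T]].
    by move=> s; rewrite /= !in_itv/= => /andP[h1 h2]; rewrite (le_lt_trans a0 h1) (le_trans h2 bT).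
  have crab := continuous_subspaceW ab0T cr.
  pose D s := sq (w s) + (s - c) * (2 * ip Om (z s) (w s)).
  have := @growth_by_derivative R a b (fun s => (s - c) * sq (w s)) D
    (fun s => T * sq (z s)) (fun s => (1 + T) * sq (w s)) (fun=> 0) ab.
  rewrite integral0 adde0 => G.
  apply: le_trans (G _ _ _ _ _) _.
  - move=> s; apply: cvgM; last exact: crab s.
    have cid : continuous (fun s : R => s - c).
      by move=> x; apply: cvgB; [exact: cvg_id|exact: cvg_cst].
    exact: (continuous_subspaceT cid) s.
  - move=> s /andP[as_ sb]; have s0T : 0 < s < T by rewrite (le_lt_trans a0 as_) (lt_le_trans sb bT).
    have h1 := is_derive_sq mOm lw s0T (dw s s0T).
    have h2 : is_derive s 1 (fun s : R => s - c) 1.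
      have := is_deriveB (is_derive_id s (1 : R)) (is_derive_cst c s (1 : R)).
      by move=> h; apply: (is_derive_eq h); rewrite subr0.
    have h3 := is_deriveM h2 h1; apply: (is_derive_eq h3).
    by rewrite /D addrC [sq (w s) *: 1]mulr1.
  - apply: measurable_funM => //; apply: (@measurable_funS _ _ _ _ `[a, b]) => //.
      exact: subset_itv_oc_cc.
    exact: subspace_continuous_measurable_fun.
  - by move=> s _; split => //; apply: mulr_ge0; rewrite ?ip_ge0 ?(ltW T1) ?(ltW T0).
  - move=> s /andP[as_ sb]; have s0T : 0 < s < T by rewrite (le_lt_trans a0 as_) (lt_le_trans sb bT).
    have [lz _] := dw s s0T; have ls : L2 Om (w s) by apply: lw; case/andP: s0T => *; rewrite !ltW.
    have y1 := @ip_young _ _ _ mOm 1 (z s) (w s) ltr01 lz ls.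
    have y2 := ip_ge0 Om (fun x => z s x + w s x); rewrite (ipDD mOm lz ls) in y2.
    have z0 := ip_ge0 Om (z s); have w0 := ip_ge0 Om (w s).
    rewrite invr1 !mul1r in y1.
    rewrite addr0 /D; move: s0T => /andP[s0 sT].
    move: y1 y2 z0 w0; move: (ip Om (z s) (w s)) (sq (z s)) (sq (w s)) => i1 i2 i3 y1 y2 z0 w0.
    have : (s - c) * (2 * i1) <= T * (i2 + i3).
      have [sc|sc] := leP 0 (s - c).
        apply: (@le_trans _ _ ((s - c) * (i2 + i3))); first exact: ler_wpM2l.
        by apply: ler_wpM2r; lra.
      apply: (@le_trans _ _ ((c - s) * (i2 + i3))).
        by rewrite -(opprB s c) mulNr -mulrN ler_wnM2l ?(ltW sc)//; lra.
      by apply: ler_wpM2r; lra.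
    rewrite (mulrDl 1 T) mul1r (mulrDr T i2).
    by move: (_ * (2 * i1)) (T * i2) (T * i3) => *; lra.
  rewrite /S addeC ge0_muleDr ?integral_ge0//; [|by move=> *; rewrite lee_fin ip_ge0..].
  have hm : (\int[leb1]_(s in `]a, b]) ((1 + T) * sq (w s))%:E <= (1 + T)%:E * \int[leb1]_(s in `]0%R, T]) (sq (w s))%:E)%E.
    rewrite -lower_integralZ//; last by move=> *; rewrite lee_fin ip_ge0.
    apply: lower_integral_le => s; [by rewrite lee_fin mulr_ge0 ?ip_ge0 ?(ltW T1)|by rewrite lee_fin mulr_ge0 ?ip_ge0 ?(ltW T1)|].
    by move=> /aboc sI; split => //; rewrite EFinM.
  have hk : (\int[leb1]_(s in `]a, b]) (T * sq (z s))%:E <= (1 + T)%:E * \int[leb1]_(s in `]0%R, T]) (sq (z s))%:E)%E.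
    rewrite -lower_integralZ//; last by move=> *; rewrite lee_fin ip_ge0.
    apply: lower_integral_le => s; [by rewrite lee_fin mulr_ge0 ?ip_ge0 ?(ltW T0)|by rewrite lee_fin mulr_ge0 ?ip_ge0 ?(ltW T1)|].
    by move=> /aboc sI; split => //; rewrite -EFinM lee_fin ler_wpM2r ?ip_ge0// lerDr.
  exact: leeD hm hk.
move=> t /andP[t0 tT].
have T2 : 0 < T / 2 by rewrite divr_gt0.
rewrite EFinM -muleA lee_pdivlMl//.
have r0 := ip_ge0 Om (w t).
have [tT2|tT2] := leP (T / 2) t.
  have t0' : 0 < t by exact: lt_le_trans tT2.
  have := H 0 t 0 (lexx _) t0' tT; rewrite lexx (ltW T0) => /(_ isT).
  by apply: le_trans; rewrite -EFinM lee_fin !subr0 mul0r subr0 ler_wpM2r.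
have tT' : t < T by apply: (lt_trans tT2); rewrite ltr_pdivrMr// mulr2n mulrDr mulr1 ltrDl.
have := H t T T t0 tT' (lexx _); rewrite lexx (ltW T0) => /(_ isT).
apply: le_trans; rewrite -EFinM lee_fin subrr mul0r sub0r -mulNr opprB ler_wpM2r//.
by move: tT2; move: (T) => T'; lra.
Qed.

End time_derivatives.

(** * The energy estimate at a fixed time *)

Section energy_estimate.
Context {R : realType} {d : nat} (Om : set 'rV[R]_d).
Hypotheses (oOm : open Om) (bOm : bounded_set Om) (neOm : Om !=set0)
  (cOm : convex_set (Om : set (convex_lmodType 'rV[R]_d))).
Local Notation mu := (leb d : {sigma_finite_measure set 'rV[R]_d -> \bar R}).
Local Notation sq v := (ip Om v v).
Local Notation sqv tau := (ipv Om tau tau).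
Implicit Types (u v w : 'rV[R]_d -> R) (tau psi : 'rV[R]_d -> 'rV[R]_d).

Let mOm : measurable Om. Proof. exact: open_measurable_rV. Qed.

Lemma ip_youngN v w : L2 Om v -> L2 Om w -> - (2 * ip Om v w) <= sq v + sq w.
Proof.
move=> lv lw; have := ip_ge0 Om (fun x => v x + w x); rewrite (ipDD mOm lv lw).
by move: (ip _ _ _) (ip _ _ _) (ip _ _ _) => a b c; lra.
Qed.

Lemma ipv_youngN (e : R) tau psi : 0 < e -> L2v Om tau -> L2v Om psi ->
  - (2 * ipv Om tau psi) <= e * sqv tau + e^-1 * sqv psi.
Proof.
move=> e0 lt lp; have ln := L2vZ mOm (-1) lt.
have := @ipv_young _ _ _ mOm e _ _ e0 ln lp.
rewrite (ipvZl mOm)// (ipvZl mOm)// [ipv Om tau (fun x => -1 *: tau x)]ipvC (ipvZl mOm)//.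
by move: (ipv _ _ _) (ipv _ _ _) (ipv _ _ _) => a b c; rewrite !mulN1r opprK mulrN.
Qed.

Lemma energy_arith (g zt zht a1 a1h b1 b1h c1 c1h s1 s1h r1 r1h ft al D2 be e ta2 rs2 rf2 : R) :
  0 < g -> zt + g * (a1 + (b1 + c1)) + s1 + r1 = ft ->
  zht + g * (a1h + (b1h + c1h)) + s1h + r1h = ft ->
  a1 - a1h = al + D2 -> b1 - b1h = be + e -> c1 - c1h = - e -> s1 - s1h = ta2 ->
  - (2 * al) <= rs2 + D2 -> - (2 * be) <= g^-1 * ta2 + g * rf2 ->
  2 * (zt - zht) + (g * D2 + ta2) <= g * rs2 + g ^+ 2 * rf2 - 2 * (r1 - r1h).
Proof.
move=> g0 E1 E2 A1 A2 A3 A4 Y1 Y2.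
have g0' : g != 0 by rewrite gt_eqF.
have {}Y1 : g * - (2 * al) <= g * (rs2 + D2) by rewrite ler_wpM2l// ltW.
have {}Y2 : g * - (2 * be) <= g * (g^-1 * ta2 + g * rf2) by rewrite ler_wpM2l// ltW.
rewrite mulrDr mulVKf// mulrA -expr2 in Y2.
have E : zt - zht = - (g * (al + D2 + be)) - ta2 - (r1 - r1h).
  have -> : al + D2 + be = (a1 - a1h) + (b1 - b1h) + (c1 - c1h) by rewrite A1 A2 A3; ring.
  by rewrite -A4; move: E1; rewrite -E2 => E1; apply/eqP; rewrite -subr_eq0; apply/eqP; move/eqP: E1; rewrite -subr_eq0 => /eqP <-; ring.
by rewrite E; move: Y1 Y2; rewrite !mulrDr !mulrN; lra.
Qed.

Lemma telescope_arith (s q sh a D : R) : a = s - q -> D = q - sh -> s - sh = a + D.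
Proof. by move=> -> ->; ring. Qed.

Lemma coupling_arith (s sq sh u p uh : R) :
  s + u = 0 -> sh + uh = 0 -> u - p = 0 -> s - sq = 0 -> p - uh = - (sq - sh).
Proof. by move=> *; lra. Qed.

Variables (bc : boundary_case) (k : nat) (Th : mesh R d).
Hypothesis hTh : is_partition Om Th.
Local Notation Uh := (Uh Om bc k Th).
Local Notation Mh := (Mh Om bc k Th).

(** The discrete errors are admissible test functions in both problems. In the
    difference of the first equations, tested with [(p - uh, q - sigmah)], the
    discrete part of the coupling term cancels against the difference of the
    second equations, tested with [F - phih]. *)
Lemma energy_estimate (gamma : R) f u z sigma phi uh zh sigmah phih p q F :
  0 < gamma -> L2 Om z -> L2 Om zh -> L2 Om (reaction u) -> L2 Om (reaction uh) ->
  spaceU Om bc u -> spaceM Om bc sigma -> spaceM Om bc phi ->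
  Uh uh -> Mh sigmah -> Mh phih -> Uh p -> Mh q -> Mh F ->
  (forall v tau, spaceU Om bc v -> spaceM Om bc tau ->
    ip Om z v + gamma * (form_a Om (u, sigma) (v, tau) + form_b Om (v, tau) phi) +
    form_c Om sigma tau + ip Om (reaction u) v = ip Om f v) ->
  (forall psi, spaceM Om bc psi -> form_b Om (u, sigma) psi = 0) ->
  (forall v tau, Uh v -> Mh tau ->
    ip Om zh v + gamma * (form_a Om (uh, sigmah) (v, tau) + form_b Om (v, tau) phih) +
    form_c Om sigmah tau + ip Om (reaction uh) v = ip Om f v) ->
  (forall psi, Mh psi -> form_b Om (uh, sigmah) psi = 0) ->
  (forall v, Uh v -> ip Om (u \- p) v = 0) ->
  (forall tau, Mh tau -> ipv Om (sigma \- q) tau = 0) ->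
  (forall v, Uh v -> ip Om (div Om F) v = ip Om (div Om phi) v) ->
  2 * ip Om (z \- zh) (p \- uh) + (gamma * sq (div Om (q \- sigmah)) + sqv (q \- sigmah)) <=
  gamma * sq (div Om (sigma \- q)) + gamma ^+ 2 * sqv (phi \- F)
  - 2 * ip Om (reaction u \- reaction uh) (p \- uh).
Proof.
move=> g0 lz lzh lr lrh su ss sp suh ssh sph hp hq hF eq1 eq2 eq1h eq2h ou os oF; set th := p \- uh; set ths := q \- sigmah.
have hth : Uh th by exact: UhB.
have hths : Mh ths by exact: MhB.
pose thf := F \- phih.
have hthf : Mh thf by exact: MhB.
have [lu _] := su; have [[luh _] _] := suh; have [[lp _] _] := hp; have [lth _] := hth.1.
have H t : Mh t -> Hdiv Om t by move=> [/spaceM_Hdiv].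
have Hs := spaceM_Hdiv ss; have Hp := spaceM_Hdiv sp.
have Hsh := H _ ssh; have Hph := H _ sph; have Hq := H _ hq; have HF := H _ hF.
have Hths := H _ hths; have Hthf := H _ hthf.
have L t : Hdiv Om t -> L2v Om t by case.
have LD := L2_div Hths; have LDf := L2_div Hthf.
have [HrS _] := HdivB oOm bOm Hs Hq.
have E1 := eq1 th ths hth.1 hths.1.
have E1h := eq1h th ths hth hths.
have E2 := eq2 thf hthf.1.
have E2h := eq2h thf hthf.
rewrite (form_bE oOm (L _ Hths) lth Hp) -[form_a _ _ _]/(ip Om (div Om sigma) (div Om ths))
  -[form_c _ _ _]/(ipv Om sigma ths) in E1.
rewrite (form_bE oOm (L _ Hths) lth Hph) -[form_a _ _ _]/(ip Om (div Om sigmah) (div Om ths))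
  -[form_c _ _ _]/(ipv Om sigmah ths) in E1h.
rewrite (form_bE oOm (L _ Hs) lu Hthf) in E2.
rewrite (form_bE oOm (L _ Hsh) luh Hthf) in E2h.
rewrite (ipBl mOm lz lzh lth) (ipBl mOm lr lrh lth).
pose e := ipv Om ths thf.
apply: (energy_arith (al := ip Om (div Om (sigma \- q)) (div Om ths))
  (be := ipv Om ths (phi \- F)) (e := e) g0 E1 E1h).
- exact: (telescope_arith (ip_divB oOm bOm Hs Hq LD) (ip_divB oOm bOm Hq Hsh LD)).
- rewrite /e (ipvBr mOm (L _ Hp) (L _ HF) (L _ Hths)) (ipvBr mOm (L _ HF) (L _ Hph) (L _ Hths)).
  by move: (ipv _ _ _) (ipv _ _ _) (ipv _ _ _) => *; ring.
- have oth := oF th hth.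
  rewrite (ipC Om th) (ipC Om th) -oth -(ip_divB oOm bOm HF Hph lth).
  have := os thf hthf; rewrite (ipvBl mOm (L _ Hs) (L _ Hq) (L _ Hthf)).
  have := ou _ (div_Mh oOm bOm neOm cOm hTh hthf); rewrite (ipBl mOm lu lp LDf).
  rewrite /e (ipvBl mOm (L _ Hq) (L _ Hsh) (L _ Hthf)) [ip Om (div _ _) th]ipC.
  rewrite (ipBl mOm lp luh LDf); move: E2 E2h.
  rewrite -/thf; 
  exact: coupling_arith.
- have := os ths hths; rewrite (ipvBl mOm (L _ Hs) (L _ Hq) (L _ Hths)).
  have -> : ipv Om ths ths = ipv Om q ths - ipv Om sigmah ths by exact: (ipvBl mOm (L _ Hq) (L _ Hsh) (L _ Hths)).
  by move/eqP; rewrite subr_eq0 => /eqP ->.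
- exact: (ip_youngN (L2_div HrS) LD).
- have g0V : 0 < gamma^-1 by rewrite invr_gt0.
  have := ipv_youngN g0V (L _ Hths) (L2vB mOm (L _ Hp) (L _ HF)).
  by rewrite invrK; exact.
Qed.

(** Up to the monotone part [(p^3 - uh^3) * (p - uh)], which controls all products
    with [th ^+ 2], the cubic term only leaves a quadratic term in [r]. *)
Lemma cubic_lower (p r th : R) :
  0 <= ((p + r) ^+ 3 - (p - th) ^+ 3) * th + 100 * (p ^+ 2 + r ^+ 2) * r ^+ 2.
Proof.
have -> : ((p + r) ^+ 3 - (p - th) ^+ 3) * th + 100 * (p ^+ 2 + r ^+ 2) * r ^+ 2 =
  th ^+ 2 * ((23 / 8) * p ^+ 2 - 3 * (p * th) + (7 / 8) * th ^+ 2)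
  + (p * (th / 4 + 6 * r)) ^+ 2 + (p * th / 4 + 6 * r ^+ 2) ^+ 2
  + (2^-1 * (th ^+ 2 / 2 - r ^+ 2) ^+ 2 + 2^-1 * (r * (r + th)) ^+ 2)
  + (64 * (p * r) ^+ 2 + 63 * (r ^+ 2) ^+ 2) by field.
have h : 0 <= (23 / 8) * p ^+ 2 - 3 * (p * th) + (7 / 8) * th ^+ 2.
  have -> : (23 / 8) * p ^+ 2 - 3 * (p * th) + (7 / 8) * th ^+ 2 =
    (23 / 8) * (p - (12 / 23) * th) ^+ 2 + (17 / 184) * th ^+ 2 by field.
  by apply: addr_ge0; apply: mulr_ge0 => //; exact: sqr_ge0.
have h1 : 0 <= th ^+ 2 * ((23 / 8) * p ^+ 2 - 3 * (p * th) + (7 / 8) * th ^+ 2).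
  by apply: mulr_ge0 => //; exact: sqr_ge0.
have m0 (c a : R) : 0 <= c -> 0 <= c * a ^+ 2 by move=> c0; apply: mulr_ge0 => //; exact: sqr_ge0.
by rewrite !(addr_ge0, h1, sqr_ge0, m0).
Qed.

Lemma ip_ae_ge0 (c : R) w v r : L2 Om w -> L2 Om v -> L2 Om r ->
  {ae mu, forall x, Om x -> 0 <= w x * v x + c * (r x * r x)} -> 0 <= ip Om w v + c * sq r.
Proof.
move=> lw lv lr h.
have i1 := L2_integrableM mOm lw lv.
have i2 : mu.-integrable Om (EFin \o (fun x => c * (r x * r x))).
  have := integrableZl mOm c (L2_integrableM mOm lr lr).
  by apply: eq_integrable => // x _ /=; rewrite EFinM.
rewrite /ip -RintegralZl//; last exact: (L2_integrableM mOm lr lr).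
rewrite -RintegralD// /Rintegral.
have mf : measurable_fun Om (fun x => (w x * v x + c * (r x * r x))%:E).
  apply/measurable_EFinP; apply: measurable_funD.
    by apply: measurable_funM; exact: L2_measurable.
  by apply: measurable_funM => //; apply: measurable_funM; exact: L2_measurable.
have -> : (\int[mu]_(x in Om) (w x * v x + c * (r x * r x))%:E =
    \int[mu]_(x in Om) `|(w x * v x + c * (r x * r x))%:E|)%E.
  apply: ae_eq_integral => //; first exact: measurableT_comp.
  by apply: filterS h => x hx Ox; rewrite gee0_abs// lee_fin hx.
by apply: fine_ge0; exact: integral_ge0.
Qed.

Lemma reaction_lower (C M : R) u p uh : 0 <= M -> 0 <= C -> L2 Om u -> L2 Om p -> L2 Om uh ->
  L2 Om (reaction u) -> L2 Om (reaction uh) ->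
  {ae mu, forall x, Om x -> `|u x| <= M} -> {ae mu, forall x, Om x -> `|p x| <= C * M} ->
  ip Om (u \- p) (p \- uh) = 0 ->
  - (2 * ip Om (reaction u \- reaction uh) (p \- uh)) <=
  200 * (C ^+ 2 + (1 + C) ^+ 2) * M ^+ 2 * sq (u \- p) + 2 * sq (p \- uh).
Proof.
move=> M0 C0 lu lp luh lr lrh uM pM; set th := p \- uh; set rho := u \- p => o.
have lth : L2 Om th by exact: L2B.
have lrho : L2 Om rho by exact: L2B.
have lR := L2B mOm lr lrh.
have lS : L2 Om (fun x => rho x + th x) by exact: L2D.
have lw : L2 Om (fun x => (reaction u x - reaction uh x) + (rho x + th x)) by exact: L2D.
have := @ip_ae_ge0 (100 * (C ^+ 2 + (1 + C) ^+ 2) * M ^+ 2) _ _ _ lw lth lrho.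
rewrite (ipDl mOm lR lS lth) (ipDl mOm lrho lth lth) o add0r => h.
have {h} := h _; move=> h.
suff : 0 <= ip Om (fun x => reaction u x - reaction uh x) th + sq th + 100 * (C ^+ 2 + (1 + C) ^+ 2) * M ^+ 2 * sq rho.
  rewrite -!mulrA; move: (_ * (_ * sq rho)); move: (ip _ _ _) (ip _ _ _) => a b c; lra.
apply: h; apply: filterS2 uM pM => x hu hp Ox; have {}hu := hu Ox; have {}hp := hp Ox.
have hr : `|rho x| <= (1 + C) * M.
  by rewrite mulrDl mul1r; apply: le_trans (ler_normB _ _) _; exact: lerD.
have s a b : `|a| <= b -> a ^+ 2 <= b ^+ 2 :> R.
  by move=> ab; rewrite -real_normK ?num_real// lerXn2r ?nnegrE// (le_trans _ ab).
have := cubic_lower (p x) (rho x) (th x).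
have -> : p x + rho x = u x by rewrite /rho /=; ring.
have -> : p x - th x = uh x by rewrite /th /=; ring.
have -> : u x ^+ 3 - uh x ^+ 3 = reaction u x - reaction uh x + (rho x + th x).
  by rewrite /reaction /rho /th /=; ring.
move/le_trans; apply; rewrite lerD2l -expr2.
apply: ler_wpM2r; first exact: sqr_ge0.
rewrite -!mulrA; apply: ler_wpM2l; first by [].
by rewrite mulrDl -!exprMn lerD// s.
Qed.

End energy_estimate.

(** * A Gronwall inequality with dissipation *)

Section gronwall.
Context {R : realType}.
Local Notation mu := (@lebesgue_measure R).

(** Multiplying [X] by [exp (- 2 * t)] removes the last term of the inequality. *)
Lemma gronwall_dissipation (T : R) (X D K m L : R -> R) : 0 < T ->
  {within `[0, T], continuous X} -> (forall t, 0 < t < T -> is_derive t 1 X (D t)) ->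
  X 0 = 0 -> (forall t, 0 <= X t) -> measurable_fun `]0, T] m ->
  (forall t, 0 < t <= T -> [/\ 0 <= m t, 0 <= K t & 0 <= L t]) ->
  (forall t, 0 < t < T -> D t + L t <= K t + m t + 2 * X t) ->
  let B := (\int[mu]_(t in `]0%R, T]) (K t)%:E + \int[mu]_(t in `]0%R, T]) (m t)%:E)%E in
  (forall t, 0 <= t <= T -> ((X t)%:E <= (expR (2 * T))%:E * B)%E) /\
  (\int[mu]_(t in `]0%R, T]) (L t)%:E <= (expR (2 * T))%:E * B)%E.
Proof.
move=> T0 cX dX X0 Xge0 mm pos hD B.
have posI t : [set` `]0, T]] t -> [/\ 0 <= m t, 0 <= K t & 0 <= L t] by rewrite /= in_itv; exact: pos.
have B0 : (0 <= B)%E by rewrite adde_ge0//; apply: integral_ge0 => t /posI[? ? ?]; rewrite lee_fin.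
have eT0 := expR_gt0 (2 * T).
pose f t := expR (- (2 * t)) * X t.
have G b : 0 < b <= T -> ((f b)%:E + (expR (- (2 * T)))%:E * \int[mu]_(t in `]0%R, b]) (L t)%:E <= B)%E.
  move=> /andP[b0 bT].
  have sub0 : [set` `[0, b]] `<=` [set` `[0, T]].
    by move=> s; rewrite /= !in_itv/= => /andP[-> /le_trans->].
  have sub1 : [set` `]0, b]] `<=` [set` `]0, T]].
    by move=> s; rewrite /= !in_itv/= => /andP[-> /le_trans->].
  pose D' t := expR (- (2 * t)) * (D t - 2 * X t).
  have := @growth_by_derivative R 0 b f D' K m (fun t => expR (- (2 * T)) * L t) b0.
  have f0 : f 0 = 0 by rewrite /f X0 mulr0.
  rewrite f0 subr0 => H.
  have posb t : [set` `]0, b]] t -> [/\ 0 <= m t, 0 <= K t & 0 <= L t] by move/sub1/posI.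
  rewrite -lower_integralZ ?expR_gt0//; last by move=> t /posb[_ _ l0]; rewrite lee_fin.
  apply: le_trans (H _ _ _ _ _) _.
  - have cXb := continuous_subspaceW sub0 cX.
    rewrite /f => s; apply: cvgM; last exact: cXb s.
    have ce : continuous (fun s : R => expR (- (2 * s))).
      move=> x; apply: continuous_comp; last exact: continuous_expR.
      by apply: cvgN; apply: cvgM; [exact: cvg_cst|exact: cvg_id].
    exact: (continuous_subspaceT ce) s.
  - move=> t /andP[t0 tb]; have t0T : 0 < t < T by rewrite t0 (lt_le_trans tb).
    have h1 : is_derive t 1 (fun s : R => - (2 * s)) (- 2).
      have h := is_deriveN (is_deriveZ 2 (is_derive_id t (1 : R))).
      by apply: (is_derive_eq h); rewrite [2 *: 1]mulr1.
    have h2 : is_derive t 1 (fun s : R => expR (- (2 * s))) (expR (- (2 * t)) * - 2).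
      exact: (@is_derive1_comp _ expR (fun s : R => - (2 * s)) t _ _ (is_derive_expR _) h1).
    have h3 := is_deriveM h2 (dX t t0T); apply: (is_derive_eq h3).
    by rewrite /D' /GRing.scale/=; ring.
  - by apply: measurable_funS mm.
  - move=> t tI; have [m0 K0 L0] : [/\ 0 <= m t, 0 <= K t & 0 <= L t] by apply: posb; rewrite /= in_itv.
    by split => //; rewrite mulr_ge0 ?expR_ge0.
  - move=> t /andP[t0 tb]; have t0T : 0 < t < T by rewrite t0 (lt_le_trans tb).
    have [m0 K0 L0] : [/\ 0 <= m t, 0 <= K t & 0 <= L t] by apply: pos; have /andP[-> /ltW] := t0T.
    have e1 : expR (- (2 * t)) <= 1.
      by rewrite -[leRHS]expR0 ler_expR oppr_le0 mulr_ge0// ltW.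
    have eTt : expR (- (2 * T)) <= expR (- (2 * t)).
      by rewrite ler_expR lerN2 ler_pM2l//; have /andP[_ /ltW] := t0T.
    have h1 := hD t t0T.
    have h2 : expR (- (2 * T)) * L t <= expR (- (2 * t)) * L t by rewrite ler_wpM2r.
    have h3 : D' t + expR (- (2 * t)) * L t <= expR (- (2 * t)) * (K t + m t).
      by rewrite -mulrDr ler_wpM2l ?expR_ge0//; move: h1; move: (D t) (L t) (K t) (m t) (X t) => *; lra.
    have h4 : expR (- (2 * t)) * (K t + m t) <= K t + m t by rewrite ler_piMl// addr_ge0.
    by apply: le_trans h4; apply: le_trans h3; rewrite lerD2l.
  by apply: leeD; apply: lower_integral_le => t => [/posb[? ? ?]|/posI[? ? ?]|tI]; rewrite ?lee_fin//; split => //; exact: sub1.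
split.
  move=> t /andP[t0 tT].
  have [->|tn0] := eqVneq t 0; first by rewrite X0 mule_ge0// lee_fin expR_ge0.
  have tp : 0 < t by rewrite lt_neqAle eq_sym tn0.
  have h : ((f t)%:E <= B)%E.
    apply: le_trans (G t _); last by rewrite tp.
    rewrite leeDl// mule_ge0 ?lee_fin ?expR_ge0// integral_ge0// => s.
    rewrite /= in_itv/= => /andP[s0 st]; rewrite lee_fin.
    by have [] : [/\ 0 <= m s, 0 <= K s & 0 <= L s] by apply: pos; rewrite s0 (le_trans st).
  apply: (@le_trans _ _ ((expR (2 * T))%:E * (f t)%:E)%E).
    rewrite -EFinM lee_fin /f mulrA -expRD ler_peMl//.
    by rewrite -[leLHS]expR0 ler_expR subr_ge0 ler_pM2l.
  by rewrite lee_pmul2l.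
have := G T; rewrite T0 lexx => /(_ isT) h.
have {}h : ((expR (- (2 * T)))%:E * \int[mu]_(t in `]0%R, T]) (L t)%:E <= B)%E.
  by apply: le_trans h; rewrite leeDr// lee_fin mulr_ge0// expR_ge0.
apply: (@le_trans _ _ ((expR (2 * T))%:E * ((expR (- (2 * T)))%:E * \int[mu]_(t in `]0%R, T]) (L t)%:E))%E).
  by rewrite muleA -EFinM -expRD subrr expR0 mul1e.
by rewrite lee_pmul2l.
Qed.

End gronwall.

(** * The error estimate *)

Lemma sqr_add3_le (R : realType) (a b : R) : (1 + a + b) ^+ 2 <= 3 * (1 + a ^+ 2 + b ^+ 2).
Proof.
have h1 := sqr_ge0 (1 - a); have h2 := sqr_ge0 (1 - b); have h3 := sqr_ge0 (a - b).
by move: h1 h2 h3; rewrite !expr2; lra.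
Qed.

Lemma absorb_arith (R : realType) (x r f y c c' th : R) :
  x <= r + f - y -> - y <= c + th -> c <= c' -> x <= r + (f + c') + th.
Proof. by move=> *; lra. Qed.

Lemma slack_arith (R : realType) (x l l' r f c c' th : R) :
  l <= l' -> x + l' <= r + (f + c) + th -> c <= c' -> x + l <= r + (f + c') + th.
Proof. by move=> *; lra. Qed.

Section semidiscrete_error.
Context {R : realType} {d : nat} (Om : set 'rV[R]_d).
Hypotheses (oOm : open Om) (bOm : bounded_set Om) (neOm : Om !=set0)
  (cOm : convex_set (Om : set (convex_lmodType 'rV[R]_d))).
Local Notation mu := (leb d : {sigma_finite_measure set 'rV[R]_d -> \bar R}).
Local Notation leb1 := (@lebesgue_measure R).
Local Notation sq v := (ip Om v v).
Local Notation sqv tau := (ipv Om tau tau).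

Let mOm : measurable Om. Proof. exact: open_measurable_rV. Qed.

Variables (bc : boundary_case) (k : nat) (T gamma : R) (T0 : 0 < T) (g0 : 0 < gamma).
Local Notation J := [set` `]0, T]].

Lemma sqnormJE (w : R -> 'rV[R]_d -> R) : (forall t, 0 < t <= T -> L2 Om (w t)) ->
  sqnormJ T (fun t => normL2 Om (w t)) = (\int[leb1]_(t in `]0%R, T]) (sq (w t))%:E)%E.
Proof.
move=> lw; apply: eq_integral => t tJ; have tT : 0 < t <= T by move: tJ; rewrite inE/= in_itv.
exact: (normL2_sqr mOm (lw t tT)).
Qed.

Lemma sqnormJvE (tau : R -> 'rV[R]_d -> 'rV[R]_d) : (forall t, 0 < t <= T -> L2v Om (tau t)) ->
  sqnormJ T (fun t => normL2v Om (tau t)) = (\int[leb1]_(t in `]0%R, T]) (sqv (tau t))%:E)%E.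
Proof.
move=> lw; apply: eq_integral => t tJ; have tT : 0 < t <= T by move: tJ; rewrite inE/= in_itv.
exact: (normL2v_sqr mOm (lw t tT)).
Qed.

Lemma supnormJ_sqr_le (w : R -> 'rV[R]_d -> R) (c : R) :
  (forall t, 0 <= t <= T -> L2 Om (w t) /\ sq (w t) <= c) ->
  (supnormJ T (fun t => normL2 Om (w t)) ^+ 2 <= c%:E)%E.
Proof.
move=> h; have T0' : 0 <= T by exact: ltW.
have [l0 h0] := h 0 (introT andP (conj (lexx _) T0')).
have c0 : 0 <= c by apply: le_trans h0; exact: ip_ge0.
have s0 : (0 <= supnormJ T (fun t => normL2 Om (w t)))%E.
  apply: (@le_trans _ _ (normL2 Om (w 0))); first exact: Lnorm_ge0.
  by apply: ereal_sup_ubound; exists 0 => //=; rewrite in_itv/= lexx.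
have sc : (supnormJ T (fun t => normL2 Om (w t)) <= (Num.sqrt c)%:E)%E.
  apply: ge_ereal_sup => _ [t /= + <-]; rewrite in_itv/= => tT.
  by have [lt ht] := h t tT; rewrite (normL2E mOm lt) lee_fin ler_wsqrtr.
rewrite expe2 -[leRHS](_ : ((Num.sqrt c)%:E * (Num.sqrt c)%:E)%E = _); last first.
  by rewrite -EFinM -expr2 sqr_sqrtr.
exact: lee_pmul.
Qed.

Variables (f : R -> 'rV[R]_d -> R) (u0 : 'rV[R]_d -> R) (hu0 : spaceU Om bc u0)
  (u : R -> 'rV[R]_d -> R) (sigma phi : R -> 'rV[R]_d -> 'rV[R]_d)
  (hsol : is_solution Om T gamma f (spaceU Om bc) (spaceM Om bc) u0 u sigma phi).

Local Notation W t := (sq (div Om (sigma t))).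
Local Notation U t := (sq (u t)).

Lemma sol_L2 t : 0 <= t <= T -> L2 Om (u t).
Proof. by move=> tT; have [] := sol_U hsol tT. Qed.

Lemma sol_weak_laplacian t : 0 < t <= T -> weak_laplacian Om bc (u t) (sigma t) (div Om (sigma t)).
Proof.
move=> tT; have [hs _] := sol_M hsol tT; have Hs := spaceM_Hdiv hs; have [ls _] := Hs.
have lu : L2 Om (u t) by apply: sol_L2; have /andP[/ltW -> ->] := tT.
apply: (weak_laplacian_div oOm bOm) => //; split => // psi hpsi.
by rewrite -(form_bE oOm ls lu (spaceM_Hdiv hpsi)); exact: (sol_eq2 hsol tT hpsi).
Qed.

Lemma sol_coefficient : measurable_fun `]0, T] (fun t => 1 + W t + U t) /\
  (\int[leb1]_(t in `]0%R, T]) (1 + W t + U t)%:E < +oo)%E.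
Proof.
have [_ [_ [smW fW]] _] := sol_L2J hsol.
have L0 : L2 Om (fun=> 0) by exact: L20.
have [_ mW] := strongly_measurable_ip mOm smW L0.
have cU := L2_continuous_sq mOm sol_L2 (sol_cont hsol).
have mU : measurable_fun `]0, T] (fun t => U t).
  apply: (@measurable_funS _ _ _ _ `[0, T]) => //; first exact: subset_itv_oc_cc.
  exact: subspace_continuous_measurable_fun.
have m1W : measurable_fun `]0, T] (fun t => 1 + W t) by exact: measurable_funD.
split; first exact: measurable_funD.
have W0 t : J t -> (0 <= (W t)%:E)%E by rewrite lee_fin ip_ge0.
have U0 t : J t -> (0 <= (U t)%:E)%E by rewrite lee_fin ip_ge0.
under eq_integral do rewrite EFinD EFinD.
rewrite ge0_integralD//; last 3 first.
- by move=> t tJ; rewrite adde_ge0// W0.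
- by rewrite (_ : (fun _ => _) = EFin \o (fun t => 1 + W t))//; exact/measurable_EFinP.
- exact/measurable_EFinP.
rewrite ge0_integralD//; last exact/measurable_EFinP.
apply: lte_add_pinfty; first apply: lte_add_pinfty.
- by rewrite integral_cst//= mul1e lebesgue_measure_itv/= lte_fin T0 -EFinD ltry.
- rewrite -sqnormJE// => t tT; apply: L2_div; apply: (@spaceM_Hdiv _ _ _ bc).
  by have [] := sol_M hsol tT.
- have /integrableP[_] : leb1.-integrable `[0, T] (EFin \o (fun t => U t)).
    by apply: continuous_compact_integrable => //; exact: segment_compact.
  apply: le_lt_trans; apply: lower_integral_le => t; [exact: U0|by []|].
  by rewrite /= !in_itv/= => /andP[/ltW -> ->]; split => //; rewrite lee_fin ler_norm.
Qed.

Variables (Cs Cp : R) (Cs0 : 0 < Cs) (Cp0 : 0 < Cp).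
Hypothesis hCs : forall u sigma w, weak_laplacian Om bc u sigma w ->
  {ae mu, forall x, Om x -> `|u x| <= Cs * (1 + Num.sqrt (ip Om w w) + Num.sqrt (ip Om u u))}.
Hypothesis hCp : forall bc (Th : mesh R d) P u (M : R),
  is_partition Om Th -> is_projU Om bc k Th P -> spaceU Om bc u -> 0 <= M ->
  {ae mu, forall x, Om x -> `|u x| <= M} -> {ae mu, forall x, Om x -> `|P u x| <= Cp * M}.

Let A := 200 * (Cp ^+ 2 + (1 + Cp) ^+ 2) * (3 * Cs ^+ 2).

Let A0 : 0 <= A.
Proof.
apply: mulr_ge0; last by apply: mulr_ge0; [exact: ler0n|exact: sqr_ge0].
by apply: mulr_ge0; [exact: ler0n|apply: addr_ge0; exact: sqr_ge0].
Qed.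

Variables (Th : mesh R d) (hTh : is_partition Om Th)
  (P : ('rV[R]_d -> R) -> ('rV[R]_d -> R))
  (Q F : ('rV[R]_d -> 'rV[R]_d) -> ('rV[R]_d -> 'rV[R]_d))
  (hP : is_projU Om bc k Th P) (hQ : is_projM Om bc k Th Q).
Hypotheses (hF : forall psi, spaceM Om bc psi -> Mh Om bc k Th (F psi))
  (hdF : forall psi, spaceM Om bc psi -> div Om (F psi) = P (div Om psi) %[ae mu in Om]).
Variables (uh : R -> 'rV[R]_d -> R) (sigmah phih : R -> 'rV[R]_d -> 'rV[R]_d)
  (hsolh : is_solution Om T gamma f (Uh Om bc k Th) (Mh Om bc k Th) (P u0) uh sigmah phih).

Local Notation rho := (fun t => u t \- P (u t)).
Local Notation theta := (fun t => P (u t) \- uh t).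
Local Notation rhos := (fun t => sigma t \- Q (sigma t)).
Local Notation thetas := (fun t => Q (sigma t) \- sigmah t).
Local Notation rhof := (fun t => phi t \- F (phi t)).

Let LP v : L2 Om v -> L2 Om (P v). Proof. by move=> /hP[[[]]]. Qed.

Let orthP v z : L2 Om v -> L2 Om z -> ip Om (v \- P v) (P z) = 0.
Proof. by move=> /hP[_ h] /hP[hz _]; exact: h. Qed.

Let JT t : 0 < t <= T -> 0 <= t <= T. Proof. by move=> /andP[/ltW -> ->]. Qed.

Let lPu t : 0 <= t <= T -> L2 Om (P (u t)). Proof. by move=> tT; apply/LP/sol_L2. Qed.

Let luh t : 0 <= t <= T -> L2 Om (uh t).
Proof. by move=> tT; have [[]] := sol_U hsolh tT. Qed.

Let is_dt_u t : 0 < t <= T -> is_dt Om T u t (dt Om T u t).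
Proof. by move=> /(sol_dt hsol) hz; exact: (getPex hz). Qed.

Let is_dt_uh t : 0 < t <= T -> is_dt Om T uh t (dt Om T uh t).
Proof. by move=> /(sol_dt hsolh) hz; exact: (getPex hz). Qed.

Let lrho t : 0 <= t <= T -> L2 Om (rho t).
Proof. by move=> tT; apply: (L2B mOm); [exact: sol_L2|exact: lPu]. Qed.

Let ltheta t : 0 <= t <= T -> L2 Om (theta t).
Proof. by move=> tT; apply: (L2B mOm); [exact: lPu|exact: luh]. Qed.

Let is_dt_Pu t : 0 < t <= T -> is_dt Om T (fun t => P (u t)) t (P (dt Om T u t)).
Proof. by move=> tT; apply: (is_dt_projection mOm LP orthP sol_L2 (JT tT)); exact: is_dt_u. Qed.

Lemma is_dt_rho t : 0 < t <= T -> is_dt Om T rho t (dt Om T rho t).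
Proof.
move=> tT; have h := is_dtB mOm sol_L2 lPu (JT tT) (is_dt_u tT) (is_dt_Pu tT).
by apply: getPex; eexists; exact: h.
Qed.

Let is_dt_theta t : 0 < t <= T ->
  is_dt Om T theta t (fun x => P (dt Om T u t) x - dt Om T uh t x).
Proof.
by move=> tT; exact: (is_dtB mOm lPu luh (JT tT) (is_dt_Pu tT) (is_dt_uh tT)).
Qed.

Let cPu : L2_continuous Om T (fun t => P (u t)).
Proof. exact: (L2_continuous_projection mOm LP orthP sol_L2 (sol_cont hsol)). Qed.

Let ctheta : L2_continuous Om T theta.
Proof. exact: (L2_continuousB mOm lPu luh cPu (sol_cont hsolh)). Qed.

Let crho : L2_continuous Om T rho.
Proof. exact: (L2_continuousB mOm sol_L2 lPu (sol_cont hsol) cPu). Qed.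

Lemma theta_initial : sq (theta 0) = 0.
Proof.
have T00 : 0 <= (0 : R) <= T by rewrite lexx ltW.
have [lu0 _] := hu0; have lu := sol_L2 T00; have lPu0 := LP lu0; have lPuu := lPu T00.
have lD := L2B mOm lPuu lPu0.
have h1 : sq (P (u 0) \- P u0) <= sq (u 0 \- u0) by exact: (projection_contraction mOm LP orthP).
have h2 : sq (u 0 \- u0) = 0.
  have lB := L2B mOm lu lu0.
  rewrite (ip_ae_L2 oOm lB (L20 mOm) lB) ?ip0l//.
  by apply: filterS (sol_init hsol) => x hx Ox /=; rewrite hx// subrr.
have {h1 h2} h : sq (P (u 0) \- P u0) = 0 by apply/le_anti/andP; split; [rewrite -[leRHS]h2|exact: ip_ge0].
have lt := ltheta T00.
have e : theta 0 = (P (u 0) \- P u0) %[ae mu in Om].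
  by apply: filterS (sol_init hsolh) => x hx Ox /=; rewrite hx.
by rewrite (ip_ae_L2 oOm lt lD lt e) ipC (ip_ae_L2 oOm lt lD lD e).
Qed.

(** The maximum norm of [u t], hence of its projection, is controlled by the two
    norms in [1 + W t + U t], which is integrable in time and does not depend on
    the mesh. *)
Lemma error_inequality t : 0 < t <= T ->
  2 * ip Om (fun x => P (dt Om T u t) x - dt Om T uh t x) (theta t) +
    (gamma * sq (div Om (thetas t)) + sqv (thetas t)) <=
  gamma * sq (div Om (rhos t)) + (gamma ^+ 2 * sqv (rhof t) +
    A * (1 + W t + U t) * sq (rho t)) + 2 * sq (theta t).
Proof.
move=> tT; have tT' := JT tT.
have su := sol_U hsol tT'; have suh := sol_U hsolh tT'.
have [ss sp] := sol_M hsol tT; have [ssh sph] := sol_M hsolh tT.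
have lu := sol_L2 tT'; have lr := sol_g hsol tT; have lrh := sol_g hsolh tT.
have [lz _] := is_dt_u tT; have [lzh _] := is_dt_uh tT.
have [hp op] := hP lu; have [hq oq] := hQ ss.
have hth : Uh Om bc k Th (theta t) by exact: UhB.
have lth := ltheta tT'.
have oF v : Uh Om bc k Th v -> ip Om (div Om (F (phi t))) v = ip Om (div Om (phi t)) v.
  move=> hv; have [[lv _] _] := hv; have ldp := L2_div (spaceM_Hdiv sp).
  have ldF := L2_div (spaceM_Hdiv (hF sp).1).
  rewrite (ip_ae_L2 oOm ldF (LP ldp) lv (hdF sp)).
  have [_ /(_ v hv)] := hP ldp; rewrite (ipBl mOm ldp (LP ldp) lv).
  by move/eqP; rewrite subr_eq0 => /eqP.
have E := @energy_estimate _ _ _ oOm bOm neOm cOm bc k Th hTh gamma (f t) (u t) (dt Om T u t)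
  (sigma t) (phi t) (uh t) (dt Om T uh t) (sigmah t) (phih t) (P (u t)) (Q (sigma t)) (F (phi t))
  g0 lz lzh lr lrh su ss sp suh ssh sph hp hq (hF sp) (sol_eq1 hsol tT) (sol_eq2 hsol tT)
  (sol_eq1 hsolh tT) (sol_eq2 hsolh tT) op oq oF.
have dE : ip Om (fun x => P (dt Om T u t) x - dt Om T uh t x) (theta t) =
    ip Om (dt Om T u t \- dt Om T uh t) (theta t).
  have lPz := LP lz; have [_ /(_ _ hth)] := hP lz.
  rewrite (ipBl mOm lz lPz lth) (ipBl mOm lPz lzh lth) (ipBl mOm lz lzh lth).
  by move/eqP; rewrite subr_eq0 => /eqP ->.
pose M := Cs * (1 + Num.sqrt (W t) + Num.sqrt (U t)).
have M0 : 0 <= M by rewrite mulr_ge0 ?(ltW Cs0)// !addr_ge0 ?sqrtr_ge0.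
have uM := hCs (sol_weak_laplacian tT); have pM := hCp hTh hP su M0 uM.
have B := reaction_lower oOm M0 (ltW Cp0) lu (lPu tT') (luh tT') lr lrh uM pM (op _ hth).
have MA : 200 * (Cp ^+ 2 + (1 + Cp) ^+ 2) * M ^+ 2 * sq (rho t) <= A * (1 + W t + U t) * sq (rho t).
  apply: ler_wpM2r; first exact: ip_ge0.
  rewrite /A -[leRHS]mulrA; apply: ler_wpM2l.
    by apply: mulr_ge0; [exact: ler0n|apply: addr_ge0; exact: sqr_ge0].
  rewrite /M exprMn -[leRHS]mulrA [leRHS]mulrCA; apply: ler_wpM2l; first exact: sqr_ge0.
  have := sqr_add3_le (Num.sqrt (W t)) (Num.sqrt (U t)).
  by rewrite (sqr_sqrtr (ip_ge0 Om (div Om (sigma t)))) (sqr_sqrtr (ip_ge0 Om (u t))).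
rewrite dE; exact: (absorb_arith E B MA).
Qed.

Lemma rho_sup t : 0 <= t <= T -> ((sq (rho t))%:E <= ((T / 2)^-1 * (1 + T))%:E *
    (\int[leb1]_(s in `]0%R, T]) (sq (rho s))%:E +
     \int[leb1]_(s in `]0%R, T]) (sq (dt Om T rho s))%:E))%E.
Proof.
apply: (@sup_le_time _ _ _ _ mOm T0 rho (dt Om T rho)); [exact: lrho|exact: crho|].
by move=> s /andP[s0 sT]; apply: is_dt_rho; rewrite s0 ltW.
Qed.

Hypothesis smf : forall i, strongly_measurable Om T (fun t => coordf (rhof t) i).

Let lrhof t : 0 < t <= T -> L2v Om (rhof t).
Proof. by move=> tT i; have [h _] := smf i; exact: h. Qed.

Lemma measurable_rhof : measurable_fun `]0, T] (fun t => sqv (rhof t)).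
Proof.
apply: (eq_measurable_fun (fun t => \sum_i sq (coordf (rhof t) i))).
  by move=> t /set_mem/=; rewrite in_itv/= => tT; rewrite ipvE//; exact: lrhof.
apply: measurable_sum => i.
by have [] := strongly_measurable_ip mOm (smf i) (L20 mOm).
Qed.

Let kappa (I : R) := 1 + gamma ^+ 2 + A * (2 * ((T / 2)^-1 * (1 + T))) * I.

Lemma error_bound (I s : R) :
  (\int[leb1]_(t in `]0%R, T]) (1 + W t + U t)%:E = I%:E)%E ->
  (\int[leb1]_(t in `]0%R, T]) (sq (dt Om T rho t))%:E <= s%:E)%E ->
  (\int[leb1]_(t in `]0%R, T]) (sq (rho t))%:E <= s%:E)%E ->
  (gamma%:E * \int[leb1]_(t in `]0%R, T]) (sq (div Om (rhos t)))%:E <= s%:E)%E ->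
  (\int[leb1]_(t in `]0%R, T]) (sqv (rhof t))%:E <= s%:E)%E ->
  [/\ forall t, 0 <= t <= T -> sq (theta t) <= expR (2 * T) * (kappa I * s),
      (gamma%:E * \int[leb1]_(t in `]0%R, T]) (sq (div Om (thetas t)))%:E <= (expR (2 * T) * (kappa I * s))%:E)%E &
      (\int[leb1]_(t in `]0%R, T]) (sqv (thetas t))%:E <= (expR (2 * T) * (kappa I * s))%:E)%E].
Proof.
move=> hI hdt hrho hdiv hrf.
have T1 : 0 < (T / 2)^-1 * (1 + T) by rewrite mulr_gt0 ?invr_gt0 ?divr_gt0 ?addr_gt0.
pose Z := 2 * ((T / 2)^-1 * (1 + T)) * s.
have rZ t : 0 <= t <= T -> sq (rho t) <= Z.
  move=> tT; rewrite -lee_fin; apply: le_trans (rho_sup tT) _.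
  have -> : Z = (T / 2)^-1 * (1 + T) * (s + s) by rewrite /Z; ring.
  rewrite (EFinM ((T / 2)^-1 * (1 + T)) (s + s)) (EFinD s s).
  by apply: lee_wpmul2l; [rewrite lee_fin; exact: (ltW T1)|exact: (leeD hrho hdt)].
have Z0 : 0 <= Z by apply: le_trans (rZ T _); rewrite ?ip_ge0// lexx ltW.
have [mc _] := sol_coefficient.
pose K t := gamma * sq (div Om (rhos t)).
pose m t := gamma ^+ 2 * sqv (rhof t) + A * (1 + W t + U t) * Z.
have c0 t : 0 <= 1 + W t + U t by rewrite !addr_ge0 ?ip_ge0.
have mm1 : measurable_fun `]0, T] (fun t => gamma ^+ 2 * sqv (rhof t)).
  by apply: measurable_funM => //; exact: measurable_rhof.
have mm2 : measurable_fun `]0, T] (fun t => A * (1 + W t + U t) * Z).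
  by apply: measurable_funM => //; exact: measurable_funM.
have mm : measurable_fun `]0, T] m by exact: measurable_funD.
have K0 t : 0 <= K t by rewrite mulr_ge0 ?ip_ge0 ?(ltW g0).
have m10 t : 0 <= gamma ^+ 2 * sqv (rhof t) by apply: mulr_ge0; [exact: sqr_ge0|exact: ipv_ge0].
have m20 t : 0 <= A * (1 + W t + U t) * Z by apply: mulr_ge0 => //; exact: mulr_ge0.
have m0 t : 0 <= m t by exact: addr_ge0.
have hB : (\int[leb1]_(t in `]0%R, T]) (K t)%:E + \int[leb1]_(t in `]0%R, T]) (m t)%:E <= (kappa I * s)%:E)%E.
  have -> : kappa I * s = s + (gamma ^+ 2 * s + A * I * Z) by rewrite /kappa /Z; ring.
  rewrite EFinD; apply: leeD.
    apply: le_trans hdiv; rewrite -lower_integralZ//; last by move=> t _; rewrite lee_fin ip_ge0.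
  under eq_integral do rewrite EFinD.
  rewrite ge0_integralD//; last 4 first.
  - by move=> t _; rewrite lee_fin.
  - exact/measurable_EFinP.
  - by move=> t _; rewrite lee_fin.
  - exact/measurable_EFinP.
  rewrite EFinD; apply: leeD.
    under eq_integral do rewrite EFinM.
    rewrite lower_integralZ ?exprn_gt0//; last by move=> t _; rewrite lee_fin ipv_ge0.
    by rewrite (EFinM (gamma ^+ 2) s); apply: lee_wpmul2l => //; rewrite lee_fin; exact: sqr_ge0.
  under eq_integral do rewrite mulrAC EFinM.
  rewrite ge0_integralZl_EFin//; last 3 first.
  - by move=> t _; rewrite lee_fin.
  - exact/measurable_EFinP.
  - exact: mulr_ge0.
  by rewrite hI -EFinM lee_fin mulrAC.
have main (L : R -> R) : (forall t, 0 < t <= T -> 0 <= L t <= gamma * sq (div Om (thetas t)) + sqv (thetas t)) ->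
    (forall t, 0 <= t <= T -> ((sq (theta t))%:E <= (expR (2 * T) * (kappa I * s))%:E)%E) /\
    (\int[leb1]_(t in `]0%R, T]) (L t)%:E <= (expR (2 * T) * (kappa I * s))%:E)%E.
  move=> hL.
  have cX := L2_continuous_sq mOm ltheta ctheta.
  have := @gronwall_dissipation R T (fun t => sq (theta t))
    (fun t => 2 * ip Om (fun x => P (dt Om T u t) x - dt Om T uh t x) (theta t)) K m L T0 cX.
  move=> G.
  have G1 t : 0 < t < T -> is_derive t 1 (fun t => sq (theta t))
      (2 * ip Om (fun x => P (dt Om T u t) x - dt Om T uh t x) (theta t)).
    move=> tT; apply: (is_derive_sq mOm ltheta tT); apply: is_dt_theta.
    by have /andP[-> /ltW] := tT.
  have G2 t : 0 <= sq (theta t) by exact: ip_ge0.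
  have G3 t : 0 < t <= T -> [/\ 0 <= m t, 0 <= K t & 0 <= L t].
    by move=> tT; have /andP[L0 _] := hL t tT.
  have G4 t : 0 < t < T -> 2 * ip Om (fun x => P (dt Om T u t) x - dt Om T uh t x) (theta t) + L t <=
      K t + m t + 2 * sq (theta t).
    move=> /andP[t0 tT]; have tT' : 0 < t <= T by rewrite t0 ltW.
    have /andP[_ L1] := hL t tT'.
    have hA : A * (1 + W t + U t) * sq (rho t) <= A * (1 + W t + U t) * Z.
      by apply: ler_wpM2l; [exact: mulr_ge0|exact/rZ/JT].
    exact: (slack_arith L1 (error_inequality tT') hA).
  have [h1 h2] := G G1 theta_initial G2 mm G3 G4.
  have eT0 := expR_gt0 (2 * T).
  split; last by apply: le_trans h2 _; rewrite EFinM lee_pmul2l.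
  by move=> t tT; apply: le_trans (h1 t tT) _; rewrite EFinM lee_pmul2l.
have n0 t : 0 <= gamma * sq (div Om (thetas t)) by rewrite mulr_ge0 ?ip_ge0 ?(ltW g0).
have v0 t : 0 <= sqv (thetas t) by exact: ipv_ge0.
have [|h1 h2] := main (fun t => gamma * sq (div Om (thetas t))).
  by move=> t _; rewrite n0 lerDl v0.
have [|_ h3] := main (fun t => sqv (thetas t)).
  by move=> t _; rewrite v0 lerDr n0.
split.
- by move=> t tT; rewrite -lee_fin h1.
- rewrite -lower_integralZ => [|//|t _]; [exact: h2|by rewrite lee_fin ip_ge0].
- exact: h3.
Qed.

End semidiscrete_error.

Lemma summands_le (R : realType) (a b c e g : \bar R) (s : R) :
  (0 <= a -> 0 <= b -> 0 <= c -> 0 <= e -> 0 <= g -> a + b + c + e + g = s%:E ->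
   [/\ a <= s%:E, b <= s%:E, c <= s%:E & g <= s%:E])%E.
Proof.
move=> a0 b0 c0 e0 g0 <-; split.
- by rewrite -!addeA leeDl// !adde_ge0.
- by rewrite (addeC a) -!addeA leeDl// !adde_ge0.
- by rewrite (addeC (a + b)%E) -!addeA leeDl// !adde_ge0.
- by rewrite leeDr// !adde_ge0.
Qed.

Theorem theorem2 (R : realType) (d : nat) (hd : d = 2%N \/ d = 3%N)
    (Om : set 'rV[R]_d) (hOm : polyhedral_domain Om) (bc : boundary_case)
    (k : nat) (T gamma : R) (hT : 0 < T) (hgamma : 0 < gamma)
    (f : R -> 'rV[R]_d -> R) (hf : L2J Om T f)
    (u0 : 'rV[R]_d -> R) (hu0 : spaceU Om bc u0)
    (u : R -> 'rV[R]_d -> R) (sigma phi : R -> 'rV[R]_d -> 'rV[R]_d)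
    (hsol : is_solution Om T gamma f (spaceU Om bc) (spaceM Om bc)
              u0 u sigma phi)
    (kappa CF : R) :
  exists2 C : R, 0 < C &
  forall (Th : mesh R d),
    is_partition Om Th -> shape_regular kappa Th ->
  forall (Ph : ('rV[R]_d -> R) -> ('rV[R]_d -> R))
         (Pvh Fh : ('rV[R]_d -> 'rV[R]_d) -> ('rV[R]_d -> 'rV[R]_d)),
    is_projU Om bc k Th Ph -> is_projM Om bc k Th Pvh ->
    is_fortin Om bc k Th Ph CF Fh ->
  forall (uh : R -> 'rV[R]_d -> R) (sigmah phih : R -> 'rV[R]_d -> 'rV[R]_d),
    is_solution Om T gamma f (Uh Om bc k Th) (Mh Om bc k Th)
      (Ph u0) uh sigmah phih ->
  let rho_u := fun t => u t \- Ph (u t) in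
  let theta_u := fun t => Ph (u t) \- uh t in
  let rho_sigma : R -> 'rV[R]_d -> 'rV[R]_d :=
    fun t => sigma t \- Pvh (sigma t) in
  let theta_sigma : R -> 'rV[R]_d -> 'rV[R]_d :=
    fun t => Pvh (sigma t) \- sigmah t in
  let rho_phi : R -> 'rV[R]_d -> 'rV[R]_d :=
    fun t => phi t \- Fh (phi t) in
    (forall i, strongly_measurable Om T (fun t => coordf (rho_phi t) i)) ->
    (supnormJ T (fun t => normL2 Om (theta_u t)) ^+ 2
     + gamma%:E * sqnormJ T (fun t => normL2 Om (div Om (theta_sigma t)))
     + sqnormJ T (fun t => normL2v Om (theta_sigma t))
     <= C%:E *
        (sqnormJ T (fun t => normL2 Om (dt Om T rho_u t))
         + sqnormJ T (fun t => normL2 Om (rho_u t))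
         + gamma%:E * sqnormJ T (fun t => normL2 Om (div Om (rho_sigma t)))
         + sqnormJ T (fun t => normL2v Om (rho_sigma t))
         + sqnormJ T (fun t => normL2v Om (rho_phi t))))%E.
Proof.
have [oOm neOm bOm cOm _] := hOm.
have mOm : measurable Om by exact: open_measurable_rV.
have d3 : (d <= 3)%N by case: hd => ->.
have [Cs Cs0 hCs] := solution_bounded oOm bOm neOm cOm d3 bc.
have [Cp Cp0 hCp] := projection_bounded oOm bOm neOm cOm k.
have [_ fI] := sol_coefficient oOm hT hsol.
set I := (\int[_]_(t in _) _)%E in fI.
have I0 : (0 <= I)%E by apply: integral_ge0 => t _; rewrite lee_fin !addr_ge0 ?ip_ge0.
have hI : I = (fine I)%:E by rewrite fineK// ge0_fin_numE.
pose kap := 1 + gamma ^+ 2 + 200 * (Cp ^+ 2 + (1 + Cp) ^+ 2) * (3 * Cs ^+ 2) *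
  (2 * ((T / 2)^-1 * (1 + T))) * fine I.
have kap0 : 0 < kap.
  have c0 : 0 <= 200 * (Cp ^+ 2 + (1 + Cp) ^+ 2) * (3 * Cs ^+ 2) * (2 * ((T / 2)^-1 * (1 + T))) * fine I.
    have n0 (n : nat) : 0 <= n%:R :> R by exact: ler0n.
    apply: mulr_ge0; last exact: fine_ge0.
    apply: mulr_ge0; last first.
      apply: mulr_ge0; first exact: (n0 2).
      apply: mulr_ge0; last exact: (addr_ge0 ler01 (ltW hT)).
      by rewrite invr_ge0; exact: (divr_ge0 (ltW hT) (n0 2)).
    apply: mulr_ge0; last by apply: mulr_ge0; [exact: (n0 3)|exact: sqr_ge0].
    by apply: mulr_ge0; [exact: (n0 200)|apply: addr_ge0; exact: sqr_ge0].
  by rewrite /kap ltr_wpDr// ltr_wpDr ?sqr_ge0.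
exists (3 * (expR (2 * T) * kap)); first by rewrite !mulr_gt0 ?expR_gt0.
move=> Th hTh _ Ph Pvh Fh hP hQ [hF hdF _] uh sigmah phih hsolh rho_u theta_u rho_sigma theta_sigma rho_phi smf.
have ldr t : 0 < t <= T -> L2 Om (dt Om T rho_u t).
  by move=> tT; have [] := is_dt_rho oOm hsol hP tT.
have lr t : 0 < t <= T -> L2 Om (rho_u t).
  move=> /andP[/ltW t0 tT]; have lu : L2 Om (u t) by apply: (sol_L2 hsol); rewrite t0.
  by have [[[lp _] _] _] := hP _ lu; apply: L2B.
have Ms t : 0 < t <= T -> Hdiv Om (sigma t) /\ Hdiv Om (Pvh (sigma t)).
  move=> tT; have [hs _] := sol_M hsol tT; split; first exact: spaceM_Hdiv hs.
  by have [[/spaceM_Hdiv]] := hQ _ hs.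
have Hrs t : 0 < t <= T -> Hdiv Om (rho_sigma t).
  by move=> /Ms[h1 h2]; have [] := HdivB oOm bOm h1 h2.
have Hts t : 0 < t <= T -> Hdiv Om (theta_sigma t).
  move=> tT; have [_ h1] := Ms t tT; have [[/spaceM_Hdiv h2 _] _] := sol_M hsolh tT.
  by have [] := HdivB oOm bOm h1 h2.
have lrf t : 0 < t <= T -> L2v Om (rho_phi t) by move=> tT j; have [h _] := smf j; exact: h.
have lth t : 0 <= t <= T -> L2 Om (theta_u t).
  move=> tT; have lu : L2 Om (u t) by exact: (sol_L2 hsol).
  have [[[lp _] _] _] := hP _ lu; have [[lh _] _] := sol_U hsolh tT; exact: L2B.
set X0 := (X in (X ^+ 2 + _ + _ <= _)%E); set X1 := (X in (_ + _ * X + _ <= _)%E).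
set X2 := (X in (_ + X <= _)%E).
set Y1 := (X in (_ <= _ * (X + _ + _ + _ + _))%E).
set Y2 := (X in (_ <= _ * (_ + X + _ + _ + _))%E).
set Y3 := (X in (_ <= _ * (_ + _ * X + _ + _))%E).
set Y4 := (X in (_ <= _ * (_ + X + _))%E).
set Y5 := (X in (_ <= _ * (_ + X))%E).
have E1 : Y1 = _ := sqnormJE oOm ldr.
have E2 : Y2 = _ := sqnormJE oOm lr.
have E3 : Y3 = _ := sqnormJE oOm (fun t tT => L2_div (Hrs t tT)).
have E5 : Y5 = _ := sqnormJvE oOm lrf.
have EX1 : X1 = _ := sqnormJE oOm (fun t tT => L2_div (Hts t tT)).
have EX2 : X2 = _ := sqnormJvE oOm (fun t tT => (Hts t tT).1).
set S := (Y1 + Y2 + gamma%:E * Y3 + Y4 + Y5)%E.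
have J0 (w : R -> \bar R) : (forall t, 0 <= w t)%E -> (0 <= sqnormJ T w)%E.
  by move=> w0; apply: integral_ge0 => t _; exact: expe_ge0.
have S10 : (0 <= Y1)%E by apply: J0 => t; exact: Lnorm_ge0.
have S20 : (0 <= Y2)%E by apply: J0 => t; exact: Lnorm_ge0.
have S30 : (0 <= gamma%:E * Y3)%E.
  by apply: mule_ge0; [rewrite lee_fin ltW|apply: J0 => t; exact: Lnorm_ge0].
have S40 : (0 <= Y4)%E by apply: J0 => t; exact: Lnorm_ge0.
have S50 : (0 <= Y5)%E by apply: J0 => t; exact: Lnorm_ge0.
have C0 : 0 < 3 * (expR (2 * T) * kap) by rewrite !mulr_gt0 ?expR_gt0.
have S0 : (0 <= S)%E := adde_ge0 (adde_ge0 (adde_ge0 (adde_ge0 S10 S20) S30) S40) S50.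
have [SE|Sfin] := eqVneq S +oo%E; first by rewrite SE gt0_muley ?lte_fin// leey.
have {Sfin} SE : S = (fine S)%:E by rewrite fineK// ge0_fin_numE// ltey.
have [S1S S2S S3S S5S] := summands_le S10 S20 S30 S40 S50 SE.
rewrite E1 in S1S; rewrite E2 in S2S; rewrite E3 in S3S; rewrite E5 in S5S.
have [B1 B2 B3] := error_bound oOm bOm neOm cOm hT hgamma hu0 hsol Cs0 Cp0 hCs hCp hTh hP hQ
  hF hdF hsolh smf hI S1S S2S S3S S5S.
rewrite -/kap in B1 B2 B3.
rewrite -EX1 in B2; rewrite -EX2 in B3.
have {}B1 : (X0 ^+ 2 <= (expR (2 * T) * (kap * fine S))%:E)%E.
  by apply: (supnormJ_sqr_le oOm hT) => t tT; split; [exact: lth|exact: B1].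
have -> : ((3 * (expR (2 * T) * kap))%:E * S = (expR (2 * T) * (kap * fine S))%:E +
    (expR (2 * T) * (kap * fine S))%:E + (expR (2 * T) * (kap * fine S))%:E)%E.
  by rewrite SE -EFinM -!EFinD /=; congr EFin; ring.
by apply: leeD => //; exact: leeD.
Qed.
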